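(* Let $d,N\ge1$ be integers and $p\ge1$. There exist a constant $c(d,p)$ depending only on $d$ and $p$ and, when $p>1$, a constant $c_p$ depending only on $p$, such that the following holds for every $\varepsilon>0$. Let $\mu$ be a Borel probability measure on $(\mathbb{R}^d)^N$ such that $\mu_j\in\mathcal{P}^{1,p}(\mathbb{R}^d)$ for every $j=1,\dots,N$. Then $$\mathcal{E}^{1,p}(\Theta^\varepsilon[\mu])\le\sum_{j=1}^N\left(\mathcal{E}^{1,p}(\mu_j)^{\frac1p}+\frac{c(d,p)}{\sqrt\varepsilon}\right)^p.$$ If in addition $\mu\in\mathcal{P}^{1,p}((\mathbb{R}^d)^N)$ and $p>1$, then $$\mathcal{E}^{1,p}(\Theta^\varepsilon[\mu])\le\sum_{j=1}^N\left(\left\|\nabla_{x_j}\Lambda^\varepsilon[\mu]^{\frac1p}\right\|_p+c_p\,\Delta_j(\varepsilon,p,\mu)\right)^p,$$ where $$\Delta_j(\varepsilon,p,\mu)=\begin{cases}\left[\left(\mathcal{E}^{1,p}(\mu_j)+\mathcal{E}^{1,p}(\mu_j*\eta^\varepsilon)\right)^{\frac1{p-1}}-2\,\mathcal{E}^{1,p}(\mu_j*\eta^\varepsilon)^{\frac1{p-1}}\right]^{\frac{p-1}{p}} & 1<p<2,\\[1ex] \left(\mathcal{E}^{1,p}(\mu_j)-\mathcal{E}^{1,p}(\mu_j*\eta^\varepsilon)\right)^{\frac1p} & p\ge2.\end{cases}$$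
   Context: $\mathcal{P}(\mathbb{R}^m)$ is the set of Borel probability measures on $\mathbb{R}^m$. $\mathcal{P}^{1,p}(\mathbb{R}^m)$ is the set of $\mu\in\mathcal{P}(\mathbb{R}^m)$ that are absolutely continuous with respect to Lebesgue measure, with density (also denoted $\mu$) satisfying $\mu^{1/p}\in W^{1,p}(\mathbb{R}^m)$. Norms of gradients are always $\ell^p$ norms: $|\nabla f|=(\sum_i|\partial_i f|^p)^{1/p}$ (also for partial gradients $\nabla_{x_j}$), and $\|\nabla_{x_j} f\|_p$ is the $L^p$ norm of $|\nabla_{x_j} f|$. The energy of $\mu\in\mathcal{P}^{1,p}(\mathbb{R}^m)$ is $\mathcal{E}^{1,p}(\mu)=\int_{\mathbb{R}^m}|\nabla\mu^{1/p}|^p\,dx$. The space $(\mathbb{R}^d)^N$ is identified with $\mathbb{R}^{dN}$. $\mu_j=\pi^j_\#\mu$ is the $j$-th marginal of $\mu\in\mathcal{P}((\mathbb{R}^d)^N)$, $\pi^j(x_1,\dots,x_N)=x_j$. $\nabla_{x_j}$ is the (weak) gradient with respect to the $j$-th $\mathbb{R}^d$-variable. Smoothing operator: for $\varepsilon>0$ let $\eta^\varepsilon(z)=(2\pi\varepsilon)^{-d/2}\exp(-|z|^2/(2\varepsilon))$ for $z\in\mathbb{R}^d$ (Euclidean norm of $z$). For $\mu\in\mathcal{P}((\mathbb{R}^d)^N)$ let $\Lambda^\varepsilon[\mu]$ be the probability measure with Lebesgue density $\Lambda^\varepsilon[\mu](Y)=\int\prod_{k=1}^N\eta^\varepsilon(y_k-x_k)\,d\mu(X)$.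 Let $\mu_k*\eta^\varepsilon$ be the probability measure with density $(\mu_k*\eta^\varepsilon)(y)=\int\eta^\varepsilon(y-x)\,d\mu_k(x)$. Then $\Theta^\varepsilon[\mu]\in\mathcal{P}((\mathbb{R}^d)^N)$ is defined by $$\int\psi\,d\Theta^\varepsilon[\mu]=\iint\psi(X)\prod_{k=1}^N\left(\frac{\eta^\varepsilon(y_k-x_k)}{(\mu_k*\eta^\varepsilon)(y_k)}\,d\mu_k(x_k)\right)d\Lambda^\varepsilon[\mu](Y)\quad\text{for all }\psi\in C_b((\mathbb{R}^d)^N).$$ (It is a fact that $\Theta^\varepsilon[\mu]\in\mathcal{P}^{1,p}((\mathbb{R}^d)^N)$ when all marginals are in $\mathcal{P}^{1,p}(\mathbb{R}^d)$, and that $\mathcal{E}^{1,p}(\mu_j*\eta^\varepsilon)\le\mathcal{E}^{1,p}(\mu_j)$.) *)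

(* Defs.v *)
From HB Require Import structures.
From mathcomp Require Import all_boot all_order all_algebra.
From mathcomp Require Import all_classical all_reals all_analysis.
From mathcomp Require Import measurable_realfun.

Set Implicit Arguments.
Unset Strict Implicit.
Unset Printing Implicit Defensive.

Import Order.TTheory GRing.Theory Num.Theory.
Import numFieldNormedType.Exports.

Local Open Scope classical_set_scope.
Local Open Scope ring_scope.

(* The space R^n is 'rV[R]_n = 'M[R]_(1, n), and (R^d)^N is 'M[R]_(N, d), the
   k-th row of a matrix X being the point x_k of R^d. Everything is defined once
   on 'M[R]_(m, n), that is on R^(m n), with one coordinate per matrix entry. *)

Section borel_matrix.
Variables (R : realType) (m n : nat).

Let B : set (set 'M[R]_(m, n)) := <<s @open 'M[R]_(m, n) >>.

Let borel0 : B set0. Proof. exact: sigma_algebra0. Qed.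

Let borelC A : B A -> B (~` A). Proof. exact: sigma_algebraC. Qed.

Let borelU (F : (set 'M[R]_(m, n))^nat) : (forall i, B (F i)) -> B (\bigcup_i F i).
Proof. exact: sigma_algebra_bigcup. Qed.

HB.instance Definition _ := @isMeasurable.Build
  (sigma_display (@open 'M[R]_(m, n))) 'M[R]_(m, n) B borel0 borelC borelU.

End borel_matrix.

Section borel_matrix_theory.
Variable R : realType.

Lemma open_measurable_mx m n (U : set 'M[R]_(m, n)) : open U -> measurable U.
Proof. exact: sub_sigma_algebra. Qed.

Lemma measurable_coord m n (i : 'I_m) (j : 'I_n) :
  measurable_fun setT (fun M : 'M[R]_(m, n) => M i j : measurableTypeR R).
Proof.
apply: (measurability _ (RGenOpens.measurableE R)).
move=> _ [_ [a [b ->] <-]]; rewrite setTI.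
apply: open_measurable_mx; apply: open_comp; last exact: interval_open.
by move=> M _; exact: coord_continuous.
Qed.

Lemma measurable_fun_mx d (T : measurableType d) m n (f : T -> 'M[R]_(m, n)) :
  (forall i j, measurable_fun setT (fun x => f x i j : measurableTypeR R)) ->
  measurable_fun setT f.
Proof.
move=> mf; apply: (@measurability _ _ _ _ setT f (@open 'M[R]_(m, n))) => //.
move=> _ [U oU <-]; rewrite setTI.
pose b (q : 'M[rat]_(m, n)) (k : nat) : set 'M[R]_(m, n) :=
  ball (map_mx ratr q : 'M[R]_(m, n)) k.+1%:R^-1.
have mb q k : measurable (f @^-1` b q k).
  rewrite (_ : f @^-1` _ = \bigcap_(i in [set: 'I_m]) \bigcap_(j in [set: 'I_n])
    ((fun x => f x i j) @^-1` ball (ratr (q i j) : R) k.+1%:R^-1)); last first.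
    apply/seteqP; split=> [x [_ bx] i _ j _|x bx]; first by have := bx i j; rewrite mxE.
    by split=> // i j; rewrite mxE; exact: bx.
  apply: fin_bigcap_measurable => // i _; apply: fin_bigcap_measurable => // j _.
  rewrite -[X in measurable X]setTI; apply: mf => //.
  exact: measurable_ball.
pose G (c : nat) : set T := if unpickle c is Some (q, k) then
  (if `[< b q k `<=` U >] then f @^-1` b q k else set0) else set0.
rewrite (_ : _ @^-1` _ = \bigcup_c G c); last first.
  apply/seteqP; split=> [x Ufx|x [c _]]; last first.
    rewrite /G; case: unpickle => [[q k]|//]; case: asboolP => // bU.
    exact: bU.
  have /nbhs_ballP[e /= e0 eU] := open_nbhs_nbhs (conj oU Ufx).
  have [k ke] : exists k, k.+1%:R^-1 < e / 2 :> R.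
    have [k _ /(_ _ (leqnn k))] := near_infty_natSinv_lt (PosNum (divr_gt0 e0 (ltr0Sn R 1))).
    by exists k.
  have k0 : 0 < k.+1%:R^-1 :> R by rewrite invr_gt0.
  have q_ (i : 'I_m) (j : 'I_n) : {q : rat | `|ratr q - f x i j| < k.+1%:R^-1}.
    apply: cid; have : f x i j - k.+1%:R^-1 < f x i j + k.+1%:R^-1
      by rewrite ltrD2l (lt_trans _ k0)// oppr_lt0.
    by move=> /rat_in_itvoo[q]; rewrite in_itv/= => qf; exists q; rewrite distrC ltr_distlC.
  pose q : 'M[rat]_(m, n) := \matrix_(i, j) sval (q_ i j).
  exists (pickle (q, k)) => //; rewrite /G pickleK; case: asboolP => [_|].
    by split=> // i j; rewrite !mxE; case: (q_ i j).
  case=> M [_ Mb]; apply: eU; split=> // i j.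
  have := Mb i j; rewrite !mxE; case: (q_ i j) => /= r rf rM.
  rewrite -[e](subrKC k.+1%:R^-1).
  apply: (@ball_triangle R R (ratr r)); first exact: ball_sym.
  by apply: le_ball rM; rewrite lerBrDr ltW// [ltRHS]splitr ltrD.
apply: bigcup_measurable => c _; rewrite /G.
by case: unpickle => [[q k]|//]; case: asboolP.
Qed.

End borel_matrix_theory.

Section image_measure.
Context d1 d2 (T1 : measurableType d1) (T2 : measurableType d2) (R : realType).
Variables (m : {sigma_finite_measure set T1 -> \bar R}).
Variables (f : T1 -> T2) (g : T2 -> T1).
Hypotheses (mf : measurable_fun setT f) (mg : measurable_fun setT g).
Hypothesis fK : cancel f g.

(* The image of m by f; g only serves to transport sigma-finiteness. *)
Definition image_measure of measurable_fun setT f & measurable_fun setT g &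
  cancel f g := pushforward m f.

Let image0 : image_measure mf mg fK set0 = 0%E.
Proof. by rewrite /image_measure /pushforward preimage_set0 measure0. Qed.

Let image_ge0 A : (0 <= image_measure mf mg fK A)%E.
Proof. exact: measure_ge0. Qed.

Let image_sigma_additive : semi_sigma_additive (image_measure mf mg fK).
Proof.
exact: (@measure_semi_sigma_additive _ _ _ (measure_function_pushforward__canonical__measure_function_Measure m mf)).
Qed.

HB.instance Definition _ := isMeasure.Build _ _ _ (image_measure mf mg fK)
  image0 image_ge0 image_sigma_additive.

Let image_sigma_finite : sigma_finite setT (image_measure mf mg fK).
Proof.
have [F TF mF] := @sigma_finiteT _ _ _ m.
exists (fun i => g @^-1` F i).
  by rewrite -preimage_bigcup -TF preimage_setT.
move=> i; have [mFi Fioo] := mF i; split.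
  by rewrite -[X in measurable X]setTI; exact: mg.
rewrite /image_measure /pushforward -comp_preimage.
by rewrite (_ : g \o f = id) //; apply/funext => x; exact: fK.
Qed.

HB.instance Definition _ := Measure_isSigmaFinite.Build _ _ _
  (image_measure mf mg fK) image_sigma_finite.

End image_measure.

Section product_sigma_finite.
Local Open Scope ereal_scope.
Context d1 d2 (T1 : measurableType d1) (T2 : measurableType d2) (R : realType).
Variable m1 : {sigma_finite_measure set T1 -> \bar R}.
Variable m2 : {sigma_finite_measure set T2 -> \bar R}.

(* An alias of m1 \x m2: the library's sigma-finiteness instance for \x is
   shadowed by the one for products of subprobabilities. *)
Definition sfprod := m1 \x m2.

HB.instance Definition _ := Measure.on sfprod.

Let sfprod_sigma_finite : sigma_finite setT sfprod.
Proof.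
have /sigma_finiteP[F [TF ndF Foo]] := sigma_finiteT m1.
have /sigma_finiteP[G [TG ndG Goo]] := sigma_finiteT m2.
exists (fun n => F n `*` G n).
  rewrite -setXTT TF TG predeqE => -[x y]; split; last first.
    by move=> [n _ []/= ? ?]; split; exists n.
  move=> [/= [n _ Fnx] [k _ Gky]]; exists (maxn n k) => //; split.
  - by move: x Fnx; exact/subsetPset/ndF/leq_maxl.
  - by move: y Gky; exact/subsetPset/ndG/leq_maxr.
move=> k; have [? ?] := Foo k; have [? ?] := Goo k.
split; first exact: measurableX.
by rewrite /sfprod product_measure1E// lte_mul_pinfty// ge0_fin_numE.
Qed.

HB.instance Definition _ :=
  Measure_isSigmaFinite.Build _ _ _ sfprod sfprod_sigma_finite.

End product_sigma_finite.

Section tuple_measure.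
Context d (T : measurableType d) (R : realType).

Definition tuple_cons n (x : T * n.-tuple T) : n.+1.-tuple T :=
  [tuple of x.1 :: x.2].

Definition tuple_uncons n (t : n.+1.-tuple T) : T * n.-tuple T :=
  (thead t, [tuple of behead t]).

Lemma tuple_consK n : cancel (@tuple_cons n) (@tuple_uncons n).
Proof.
by move=> [x t]; rewrite /tuple_uncons /tuple_cons theadE; congr pair; apply/val_inj.
Qed.

Lemma measurable_tuple_cons n : measurable_fun setT (@tuple_cons n).
Proof. exact: measurable_cons. Qed.

Lemma measurable_tuple_uncons n : measurable_fun setT (@tuple_uncons n).
Proof.
apply/measurable_fun_pairP; split; first exact: measurable_tnth.
exact: measurable_behead.
Qed.

(* the product measure mu 0 \x ... \x mu n.-1 *)
Fixpoint tuple_measure n : ('I_n -> {sigma_finite_measure set T -> \bar R}) ->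
    {sigma_finite_measure set (n.-tuple T) -> \bar R} :=
  match n with
  | 0 => fun=> \d_[tuple]
  | n'.+1 => fun mu => image_measure
      (sfprod (mu ord0) (tuple_measure (fun i : 'I_n' => mu (lift ord0 i))))
      (@measurable_tuple_cons n') (@measurable_tuple_uncons n')
      (@tuple_consK n')
  end.

End tuple_measure.

Section matrix_measure.
Variable R : realType.

Definition row_of_tuple n (t : n.-tuple (measurableTypeR R)) : 'rV[R]_n :=
  \row_i tnth t i.

Definition tuple_of_row n (v : 'rV[R]_n) : n.-tuple (measurableTypeR R) :=
  [tuple v ord0 i | i < n].

Lemma row_of_tupleK n : cancel (@row_of_tuple n) (@tuple_of_row n).
Proof. by move=> t; apply: eq_from_tnth => i; rewrite tnth_mktuple mxE. Qed.

Lemma measurable_row_of_tuple n : measurable_fun setT (@row_of_tuple n).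
Proof.
apply: measurable_fun_mx => i j.
by under eq_fun do rewrite mxE; exact: measurable_tnth.
Qed.

Lemma measurable_tuple_of_row n : measurable_fun setT (@tuple_of_row n).
Proof.
apply/measurable_fun_tnthP => i.
rewrite (_ : _ \o _ = fun v : 'rV[R]_n => v ord0 i); first exact: measurable_coord.
by apply/funext => v; rewrite /= tnth_mktuple.
Qed.

Definition lebesgue_row n : {sigma_finite_measure set 'rV[R]_n -> \bar R} :=
  image_measure (tuple_measure (fun _ : 'I_n => @lebesgue_measure R))
    (@measurable_row_of_tuple n) (@measurable_tuple_of_row n)
    (@row_of_tupleK n).

Definition matrix_of_tuple m n (t : m.-tuple 'rV[R]_n) : 'M[R]_(m, n) :=
  \matrix_(i, j) tnth t i ord0 j.

Definition tuple_of_matrix m n (M : 'M[R]_(m, n)) : m.-tuple 'rV[R]_n :=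
  [tuple row i M | i < m].

Lemma matrix_of_tupleK m n : cancel (@matrix_of_tuple m n) (@tuple_of_matrix m n).
Proof.
move=> t; apply: eq_from_tnth => i; rewrite tnth_mktuple.
by apply/rowP => j; rewrite !mxE.
Qed.

Lemma measurable_row m n (i : 'I_m) : measurable_fun setT (@row R m n i).
Proof.
apply: measurable_fun_mx => k j.
by under eq_fun do rewrite mxE; exact: measurable_coord.
Qed.

HB.instance Definition _ m n (i : 'I_m) :=
  isMeasurableFun.Build _ _ _ _ (@row R m n i) (@measurable_row m n i).

Lemma measurable_matrix_of_tuple m n : measurable_fun setT (@matrix_of_tuple m n).
Proof.
apply: measurable_fun_mx => i j; under eq_fun do rewrite mxE.
by apply: (measurableT_comp (measurable_coord ord0 j)); exact: measurable_tnth.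
Qed.

Lemma measurable_tuple_of_matrix m n : measurable_fun setT (@tuple_of_matrix m n).
Proof.
apply/measurable_fun_tnthP => i.
rewrite (_ : _ \o _ = row i); first exact: measurable_row.
by apply/funext => v; rewrite /= tnth_mktuple.
Qed.

(* the product mu 0 \x ... \x mu m.-1, as a measure on (R^n)^m *)
Definition rows_measure m n
    (mu : 'I_m -> {sigma_finite_measure set 'rV[R]_n -> \bar R}) :
    {sigma_finite_measure set 'M[R]_(m, n) -> \bar R} :=
  image_measure (tuple_measure mu)
    (@measurable_matrix_of_tuple m n) (@measurable_tuple_of_matrix m n)
    (@matrix_of_tupleK m n).

Definition lebesgue_mx m n : {sigma_finite_measure set 'M[R]_(m, n) -> \bar R} :=
  rows_measure (fun _ : 'I_m => lebesgue_row n).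

End matrix_measure.

Section sobolev.
Local Open Scope charge_scope.
Variables (R : realType) (m n : nat).
Let T := 'M[R]_(m, n).
Let leb := lebesgue_mx R m n.
Implicit Types (ij : 'I_m * 'I_n) (p : R) (f g phi : T -> R).

Definition partial ij phi : T -> R := fun x => 'D_(delta_mx ij.1 ij.2) phi x.

Definition smooth phi := forall s : seq ('I_m * 'I_n),
  let psi := foldr partial phi s in
  continuous psi /\ forall ij x, derivable psi x (delta_mx ij.1 ij.2).

Definition test_function phi :=
  smooth phi /\ compact (closure [set x | phi x != 0]).

Definition loc_integrable f :=
  forall K : set T, compact K -> leb.-integrable K (EFin \o f).

Definition is_weak_partial ij f g :=
  [/\ loc_integrable f, loc_integrable g &
    forall phi, test_function phi ->
      \int[leb]_x (f x * partial ij phi x) = - \int[leb]_x (g x * phi x)].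

(* a representative, unique up to a null set; meaningful only if f has a weak
   partial derivative *)
Definition weak_partial ij f : T -> R :=
  xget (cst 0) [set g | is_weak_partial ij f g].

Definition sobolev p f :=
  f \in Lfun leb p%:E /\
  forall ij, exists2 g, is_weak_partial ij f g & g \in Lfun leb p%:E.

(* l^p norm of the gradient with respect to all the variables *)
Definition grad_norm p f (x : T) : R :=
  (\sum_(i < m) \sum_(j < n) `|weak_partial (i, j) f x| `^ p) `^ p^-1.

(* l^p norm of the gradient with respect to the entries of the i-th row *)
Definition row_grad_norm p (i : 'I_m) f (x : T) : R :=
  (\sum_(j < n) `|weak_partial (i, j) f x| `^ p) `^ p^-1.

(* Lebesgue density, for mu absolutely continuous *)
Definition density (mu : probability T R) (x : T) : R :=
  fine (('d (charge_of_finite_measure mu) '/d leb) x).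

Definition root_density p (mu : probability T R) (x : T) : R :=
  density mu x `^ p^-1.

Definition P1p p (mu : probability T R) :=
  mu `<< leb /\ sobolev p (root_density p mu).

(* +oo outside of the space P1p *)
Definition energy p (mu : probability T R) : \bar R :=
  if `[< P1p p mu >]
  then (\int[leb]_x (grad_norm p (root_density p mu) x `^ p)%:E)%E
  else +oo%E.

(* the probability measure with Lebesgue density f; meaningful only if f is a
   probability density *)
Definition prob_of_density f : probability T R :=
  get [set P : probability T R |
    forall A, measurable A -> P A = (\int[leb]_(x in A) (f x)%:E)%E].

End sobolev.

Section smoothing.
Variables (R : realType) (N d : nat).
Implicit Types (eps p : R) (mu : probability 'M[R]_(N, d) R).
Implicit Types (nu : probability 'rV[R]_d R).

Definition marginal mu (j : 'I_N) : probability 'rV[R]_d R :=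
  distribution mu (row j).

Definition eta eps (z : 'rV[R]_d) : R :=
  (2 * pi * eps) `^ (- (d%:R / 2)) *
  expR (- (\sum_(i < d) z ord0 i ^+ 2) / (2 * eps)).

Definition conv_density eps nu (y : 'rV[R]_d) : R :=
  \int[nu]_x eta eps (y - x).

Definition gauss_conv eps nu : probability 'rV[R]_d R :=
  prob_of_density (conv_density eps nu).

Definition Lambda_density eps mu (Y : 'M[R]_(N, d)) : R :=
  \int[mu]_X \prod_(k < N) eta eps (row k Y - row k X).

Definition Lambda eps mu : probability 'M[R]_(N, d) R :=
  prob_of_density (Lambda_density eps mu).

Definition is_Theta eps mu (P : probability 'M[R]_(N, d) R) :=
  forall psi : 'M[R]_(N, d) -> R,
    continuous psi -> (exists M : R, forall X, `|psi X| <= M) ->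
    \int[P]_X psi X =
    \int[Lambda eps mu]_Y \int[rows_measure (marginal mu)]_X
      (psi X * \prod_(k < N) (eta eps (row k Y - row k X) /
                              conv_density eps (marginal mu k) (row k Y))).

(* is_Theta eps mu determines P: a Borel probability measure is determined by the
   integrals of bounded continuous functions *)
Definition Theta eps mu : probability 'M[R]_(N, d) R :=
  get [set P | is_Theta eps mu P].

Local Open Scope ereal_scope.

Definition Delta eps p mu (j : 'I_N) : \bar R :=
  let E := energy p (marginal mu j) in
  let Eeps := energy p (gauss_conv eps (marginal mu j)) in
  if (p < 2)%R then
    ((E + Eeps) `^ (p - 1)^-1 - 2%:E * Eeps `^ (p - 1)^-1) `^ ((p - 1) / p)
  else (E - Eeps) `^ p^-1.

End smoothing.

(* Main.v *)
Require Import Defs.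
From HB Require Import structures.
From mathcomp Require Import all_boot all_order all_algebra.
From mathcomp Require Import all_classical all_reals all_analysis.
From mathcomp Require Import measurable_realfun ring lra.

Set Implicit Arguments.
Unset Strict Implicit.
Unset Printing Implicit Defensive.

Import Order.TTheory GRing.Theory Num.Theory.
Import numFieldNormedType.Exports.

Local Open Scope classical_set_scope.
Local Open Scope ring_scope.

Local Notation eta := Defs.eta.

Section almost_everywhere.
Context d (T : measurableType d) (R : realType) (mu : {measure set T -> \bar R}).

Lemma ae_imp (P Q : T -> Prop) : (forall x, P x -> Q x) ->
  {ae mu, forall x, P x} -> {ae mu, forall x, Q x}.
Proof. by move=> PQ; apply: (@negligibleS _ _ _ mu) => x /= nQ /PQ. Qed.

Lemma ae_and (P Q : T -> Prop) : {ae mu, forall x, P x} ->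
  {ae mu, forall x, Q x} -> {ae mu, forall x, P x /\ Q x}.
Proof.
move=> aP aQ; apply: negligibleS (negligibleU aP aQ) => x /=.
by case: (pselect (P x)) => [Px|nPx] nPQ; [right => Qx; apply: nPQ|left].
Qed.

Lemma ae_imp2 (P Q S : T -> Prop) : (forall x, P x -> Q x -> S x) ->
  {ae mu, forall x, P x} -> {ae mu, forall x, Q x} -> {ae mu, forall x, S x}.
Proof. by move=> PQS aP aQ; apply: ae_imp (ae_and aP aQ) => x [/PQS]; exact. Qed.

Lemma ae_all (P : T -> Prop) : (forall x, P x) -> {ae mu, forall x, P x}.
Proof. by move=> aP; apply: (negligibleS _ (negligible_set0 mu)) => x /=; apply. Qed.

End almost_everywhere.

Section tuple_integrals.
Local Open Scope ereal_scope.
Context d (T : measurableType d) (R : realType).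

Lemma integral_tuple0 (mu : 'I_0 -> {sigma_finite_measure set T -> \bar R})
    (f : 0.-tuple T -> \bar R) : measurable_fun setT f ->
  \int[tuple_measure mu]_t f t = f [tuple].
Proof. by move=> mf; rewrite /= integral_dirac// diracT mul1e. Qed.

Lemma integral_tupleS n (mu : 'I_n.+1 -> {sigma_finite_measure set T -> \bar R})
    (f : n.+1.-tuple T -> \bar R) : measurable_fun setT f ->
    (forall t, 0 <= f t) ->
  \int[tuple_measure mu]_t f t =
  \int[mu ord0]_x \int[tuple_measure (fun i => mu (lift ord0 i))]_t
     f (tuple_cons (x, t)).
Proof.
move=> mf f0.
transitivity (\int[sfprod (mu ord0) (tuple_measure (fun i : 'I_n => mu (lift ord0 i)))]_z
  (f \o @tuple_cons d T n) z).
  rewrite -[RHS](@ge0_integral_pushforward _ _ _ _ R (@tuple_cons d T n)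
    (@measurable_tuple_cons d T n) _ setT)//.
rewrite /sfprod (fubini_tonelli1 (f \o @tuple_cons d T n))//.
  by apply: measurableT_comp => //; exact: measurable_tuple_cons.
by move=> x; exact: f0.
Qed.

End tuple_integrals.


Section tuple_integrals2.
Local Open Scope ereal_scope.

Lemma emeasurable_prod d (T : measurableType d) (R : realType) (I : Type)
    (r : seq I) (P : pred I) (g : I -> T -> \bar R) :
  (forall i, P i -> measurable_fun setT (g i)) ->
  measurable_fun setT (fun x => \prod_(i <- r | P i) g i x).
Proof.
move=> mg; elim: r => [|i r IH].
  by under eq_fun do rewrite big_nil; exact: measurable_cst.
under eq_fun do rewrite big_cons.
by case Pi: (P i) => //; apply: emeasurable_funM => //; exact: mg.
Qed.

Context d (T : measurableType d) (R : realType).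

Lemma measurable_tuple_prod n (g : 'I_n -> T -> \bar R) :
  (forall i, measurable_fun setT (g i)) ->
  measurable_fun setT (fun t : n.-tuple T => \prod_(i < n) g i (tnth t i)).
Proof.
move=> mg; apply: emeasurable_prod => i _.
by apply: measurableT_comp => //; exact: measurable_tnth.
Qed.

Lemma integral_tuple_prod n (mu : 'I_n -> {sigma_finite_measure set T -> \bar R})
    (g : 'I_n -> T -> \bar R) :
    (forall i, measurable_fun setT (g i)) -> (forall i x, 0 <= g i x) ->
  \int[tuple_measure mu]_t \prod_(i < n) g i (tnth t i) =
  \prod_(i < n) \int[mu i]_x g i x.
Proof.
elim: n mu g => [|n IH] mu g mg g0.
  by rewrite integral_tuple0 ?big_ord0//; exact: measurable_tuple_prod.
rewrite integral_tupleS; last 2 first.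
- exact: measurable_tuple_prod.
- by move=> t; apply: prode_ge0 => i _.
rewrite big_ord_recl -IH// -ge0_integralZr//; last first.
  by apply: integral_ge0 => t _; apply: prode_ge0 => i _.
apply: eq_integral => x _; rewrite -ge0_integralZl//; last 2 first.
- by apply: (measurable_tuple_prod (g := fun i => g (lift ord0 i))).
- by move=> t _; apply: prode_ge0 => i _.
apply: eq_integral => t _; rewrite big_ord_recl; congr *%E.
by apply: eq_bigr => i _; rewrite /tuple_cons tnthS.
Qed.

(* density factors go through product measures *)
Lemma integral_tuple_density n (mu nu : 'I_n -> {sigma_finite_measure set T -> \bar R})
    (h : 'I_n -> T -> \bar R) :
    (forall i, measurable_fun setT (h i)) -> (forall i x, 0 <= h i x) ->
    (forall i f, measurable_fun setT f -> (forall x, 0 <= f x) ->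
      \int[mu i]_x f x = \int[nu i]_x (f x * h i x)) ->
  forall f, measurable_fun setT f -> (forall t, 0 <= f t) ->
  \int[tuple_measure mu]_t f t =
  \int[tuple_measure nu]_t (f t * \prod_(i < n) h i (tnth t i)).
Proof.
elim: n mu nu h => [|n IH] mu nu h mh h0 munu f mf f0.
  rewrite !integral_tuple0//; first by rewrite big_ord0 mule1.
  by apply: emeasurable_funM => //; exact: measurable_tuple_prod.
rewrite !integral_tupleS//; last 2 first.
- by apply: emeasurable_funM => //; exact: measurable_tuple_prod.
- by move=> t; apply: mule_ge0 => //; apply: prode_ge0 => i _.
have mfc : measurable_fun setT (f \o @tuple_cons d T n).
  by apply: measurableT_comp => //; exact: measurable_tuple_cons.
have mfx x : measurable_fun setT (fun t => f (tuple_cons (x, t))).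
  by apply: (measurableT_comp mfc); exact: measurable_fun_pair.
have mp : measurable_fun setT (fun t : n.-tuple T => \prod_(i < n) h (lift ord0 i) (tnth t i)).
  by apply: (measurable_tuple_prod (g := fun i => h (lift ord0 i))).
rewrite munu; last 2 first.
- have := @measurable_fun_fubini_tonelli_F _ _ _ _ R
    (tuple_measure (fun i : 'I_n => mu (lift ord0 i))) (f \o @tuple_cons d T n) mfc.
  by apply => x; exact: f0.
- by move=> x; apply: integral_ge0.
apply: eq_integral => x _.
rewrite (IH _ (fun i => nu (lift ord0 i)) (fun i => h (lift ord0 i)))//.
  rewrite -ge0_integralZr//; last 2 first.
  - by apply: emeasurable_funM.
  - by move=> t _; apply: mule_ge0 => //; apply: prode_ge0.
  apply: eq_integral => t _; rewrite big_ord_recl -muleA; congr *%E.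
  rewrite muleC; congr *%E.
  by apply: eq_bigr => i _; rewrite /tuple_cons tnthS.
by move=> i g mg g0; exact: munu.
Qed.

End tuple_integrals2.

Section matrix_integrals.
Local Open Scope ereal_scope.
Variable R : realType.

Lemma integral_rowsE m n (mu : 'I_m -> {sigma_finite_measure set 'rV[R]_n -> \bar R})
    (f : 'M[R]_(m, n) -> \bar R) :
  measurable_fun setT f -> (forall x, 0 <= f x) ->
  \int[rows_measure mu]_X f X = \int[tuple_measure mu]_t f (matrix_of_tuple t).
Proof.
move=> mf f0.
by rewrite -[RHS](@ge0_integral_pushforward _ _ _ _ R (@matrix_of_tuple R m n)
  (@measurable_matrix_of_tuple R m n) _ setT).
Qed.

Lemma integral_lebesgue_rowE n (f : 'rV[R]_n -> \bar R) :
  measurable_fun setT f -> (forall x, 0 <= f x) ->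
  \int[lebesgue_row R n]_x f x =
  \int[tuple_measure (fun _ : 'I_n => @lebesgue_measure R)]_t f (row_of_tuple t).
Proof.
move=> mf f0.
by rewrite -[RHS](@ge0_integral_pushforward _ _ _ _ R (@row_of_tuple R n)
  (@measurable_row_of_tuple R n) _ setT).
Qed.

Lemma measurable_rows_prod m n (g : 'I_m -> 'rV[R]_n -> \bar R) :
  (forall i, measurable_fun setT (g i)) ->
  measurable_fun setT (fun X : 'M[R]_(m, n) => \prod_(i < m) g i (row i X)).
Proof.
move=> mg; apply: emeasurable_prod => i _.
by apply: measurableT_comp => //; exact: measurable_row.
Qed.

Lemma row_matrix_of_tuple m n (t : m.-tuple 'rV[R]_n) i :
  row i (matrix_of_tuple t) = tnth t i.
Proof. by apply/rowP => j; rewrite !mxE. Qed.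

Lemma integral_rows_prod m n (mu : 'I_m -> {sigma_finite_measure set 'rV[R]_n -> \bar R})
    (g : 'I_m -> 'rV[R]_n -> \bar R) :
    (forall i, measurable_fun setT (g i)) -> (forall i x, 0 <= g i x) ->
  \int[rows_measure mu]_X \prod_(i < m) g i (row i X) =
  \prod_(i < m) \int[mu i]_x g i x.
Proof.
move=> mg g0; rewrite integral_rowsE; last 2 first.
- exact: measurable_rows_prod.
- by move=> X; apply: prode_ge0.
rewrite -integral_tuple_prod//; apply: eq_integral => t _.
by apply: eq_bigr => i _; rewrite row_matrix_of_tuple.
Qed.

Lemma integral_rows_density m n
    (mu nu : 'I_m -> {sigma_finite_measure set 'rV[R]_n -> \bar R})
    (h : 'I_m -> 'rV[R]_n -> \bar R) :
    (forall i, measurable_fun setT (h i)) -> (forall i x, 0 <= h i x) ->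
    (forall i f, measurable_fun setT f -> (forall x, 0 <= f x) ->
      \int[mu i]_x f x = \int[nu i]_x (f x * h i x)) ->
  forall f, measurable_fun setT f -> (forall t, 0 <= f t) ->
  \int[rows_measure mu]_X f X =
  \int[rows_measure nu]_X (f X * \prod_(i < m) h i (row i X)).
Proof.
move=> mh h0 munu f mf f0; rewrite !integral_rowsE//; last 2 first.
- by apply: emeasurable_funM => //; exact: measurable_rows_prod.
- by move=> X; apply: mule_ge0 => //; apply: prode_ge0.
rewrite (integral_tuple_density mh h0 munu)//.
  by apply: eq_integral => t _; congr *%E; apply: eq_bigr => i _; rewrite row_matrix_of_tuple.
by apply: measurableT_comp => //; exact: measurable_matrix_of_tuple.
Qed.

Lemma integral_lebesgue_row_prod n (g : 'I_n -> R -> \bar R) :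
    (forall i, measurable_fun setT (g i)) -> (forall i x, 0 <= g i x) ->
  \int[lebesgue_row R n]_x \prod_(i < n) g i (x ord0 i) =
  \prod_(i < n) \int[lebesgue_measure]_x g i x.
Proof.
move=> mg g0; rewrite integral_lebesgue_rowE; last 2 first.
- apply: emeasurable_prod => i _; apply: measurableT_comp => //.
  exact: measurable_coord.
- by move=> X; apply: prode_ge0.
rewrite -(@integral_tuple_prod _ (measurableTypeR R))//; apply: eq_integral => t _.
by apply: eq_bigr => i _; rewrite mxE.
Qed.

Lemma integral_lebesgue_mx1 n (f : 'rV[R]_n -> \bar R) :
    measurable_fun setT f -> (forall x, 0 <= f x) ->
  \int[lebesgue_mx R 1 n]_x f x = \int[lebesgue_row R n]_x f x.
Proof.
move=> mf f0.
transitivity (\int[lebesgue_mx R 1 n]_X \prod_(i < 1) f (row i X)).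
  apply: eq_integral => x _; rewrite big_ord1.
  by congr f; apply/rowP => j; rewrite mxE.
by rewrite (@integral_rows_prod 1 n _ (fun=> f))// big_ord1.
Qed.

End matrix_integrals.

Section translation.
Local Open Scope ereal_scope.
Variable R : realType.

Lemma lebesgue_measure_shift (c : R) (A : set R) : measurable A ->
  lebesgue_measure ((fun x => x + c)%R @^-1` A) = lebesgue_measure A.
Proof.
move=> mA; apply/esym.
have mc : measurable_fun setT (fun x : measurableTypeR R => (x + c)%R : measurableTypeR R).
  exact: measurable_funD.
pose m := measure_function_pushforward__canonical__measure_function_Measure
  (@lebesgue_measure R) mc.
rewrite -[RHS]/(m A); apply: lebesgue_measure_unique => // _ [[a b] _ <-].
rewrite /m /= /pushforward.
rewrite (_ : _ @^-1` _ = `]a - c, b - c]%classic)%R; last first.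
  by apply/seteqP; split => x /=; rewrite !in_itv/= ltrBlDr lerBrDr.
rewrite !lebesgue_measure_itv/= !lte_fin.
by rewrite ltrD2r; case: ifP => // ab; rewrite -!EFinB; congr EFin; rewrite opprB addrA subrK.
Qed.

Lemma ge0_integral_lebesgue_shift (c : R) (f : R -> \bar R) :
    measurable_fun setT f -> (forall x, 0 <= f x) ->
  \int[lebesgue_measure]_x f (x + c)%R = \int[lebesgue_measure]_x f x.
Proof.
move=> mf f0.
have mc : measurable_fun setT (fun x : measurableTypeR R => (x + c)%R : measurableTypeR R).
  exact: measurable_funD.
rewrite -[LHS](@ge0_integral_pushforward _ _ _ _ R _ mc _ setT)//.
apply: eq_measure_integral => A mA _.
exact: lebesgue_measure_shift.
Qed.

Lemma tuple_measure_comp d (T : measurableType d) n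
    (mu : 'I_n -> {sigma_finite_measure set T -> \bar R}) (g : 'I_n -> T -> T) :
    (forall i, measurable_fun setT (g i)) ->
    (forall i f, measurable_fun setT f -> (forall x, 0 <= f x) ->
      \int[mu i]_x f (g i x) = \int[mu i]_x f x) ->
  forall f, measurable_fun setT f -> (forall t, 0 <= f t) ->
  \int[tuple_measure mu]_t f [tuple g i (tnth t i) | i < n] =
  \int[tuple_measure mu]_t f t.
Proof.
elim: n mu g => [|n IH] mu g mg gmu f mf f0.
  rewrite !integral_tuple0//.
    by congr f; apply: eq_from_tnth => -[].
  rewrite (_ : (fun _ => _) = cst (f [tuple]))//; apply/funext => t.
  by congr f; apply: eq_from_tnth => -[].
have mfc : measurable_fun setT (f \o @tuple_cons d T n).
  by apply: measurableT_comp => //; exact: measurable_tuple_cons.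
have mG n' (g' : 'I_n' -> T -> T) : (forall i, measurable_fun setT (g' i)) ->
    measurable_fun setT (fun t : n'.-tuple T => [tuple g' i (tnth t i) | i < n']).
  move=> mg'; apply/measurable_fun_tnthP => i.
  rewrite (_ : _ \o _ = fun t => g' i (tnth t i)).
    by apply: measurableT_comp => //; exact: measurable_tnth.
  by apply/funext => t; rewrite /= tnth_mktuple.
rewrite !integral_tupleS//; last first.
  by apply: measurableT_comp => //; exact: mG.
rewrite -[RHS]gmu//; last 2 first.
- have := @measurable_fun_fubini_tonelli_F _ _ _ _ R
    (tuple_measure (fun i : 'I_n => mu (lift ord0 i))) (f \o @tuple_cons d T n) mfc.
  by apply => x; exact: f0.
- by move=> x; apply: integral_ge0.
apply: eq_integral => x _.
rewrite -[RHS](IH (fun i => mu (lift ord0 i)) (fun i => g (lift ord0 i)))//.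
- apply: eq_integral => t _; congr f; apply: eq_from_tnth => i.
  rewrite tnth_mktuple /tuple_cons; case: (unliftP ord0 i) => [j|] ->.
    by rewrite !tnthS tnth_mktuple.
  by rewrite !tnth0.
- by move=> i h mh h0; exact: gmu.
- by apply: (measurableT_comp mfc); exact: measurable_fun_pair.
Qed.

Lemma ge0_integral_row_shift n (c : 'rV[R]_n) (f : 'rV[R]_n -> \bar R) :
    measurable_fun setT f -> (forall x, 0 <= f x) ->
  \int[lebesgue_row R n]_x f (x + c)%R = \int[lebesgue_row R n]_x f x.
Proof.
move=> mf f0.
have mc : measurable_fun setT (fun x : 'rV[R]_n => (x + c)%R).
  apply: measurable_fun_mx => i j; under eq_fun do rewrite mxE.
  by apply: measurable_funD => //; exact: measurable_coord.
rewrite !integral_lebesgue_rowE//; last exact: measurableT_comp.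
rewrite -[RHS](@tuple_measure_comp _ (measurableTypeR R) n _ (fun i x => x + c ord0 i)%R)//.
- by apply: eq_integral => t _; congr f; apply/rowP => i; rewrite !mxE tnth_mktuple.
- by move=> i; exact: measurable_funD.
- by move=> i g mg g0; exact: ge0_integral_lebesgue_shift.
- by apply: measurableT_comp => //; exact: measurable_row_of_tuple.
Qed.

Lemma measurable_shift m n (c : 'M[R]_(m, n)) :
  measurable_fun setT (fun x : 'M[R]_(m, n) => (x + c)%R).
Proof.
apply: measurable_fun_mx => i j; under eq_fun do rewrite mxE.
by apply: measurable_funD => //; exact: measurable_coord.
Qed.

Lemma ge0_integral_shift m n (c : 'M[R]_(m, n)) (f : 'M[R]_(m, n) -> \bar R) :
    measurable_fun setT f -> (forall x, 0 <= f x) ->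
  \int[lebesgue_mx R m n]_x f (x + c)%R = \int[lebesgue_mx R m n]_x f x.
Proof.
move=> mf f0.
rewrite !integral_rowsE//; last first.
  by apply: measurableT_comp => //; exact: measurable_shift.
rewrite -[RHS](@tuple_measure_comp _ 'rV[R]_n m _ (fun i x => x + row i c)%R)//.
- apply: eq_integral => t _; congr f; apply/matrixP => i j.
  by rewrite !mxE tnth_mktuple !mxE.
- by move=> i; exact: measurable_shift.
- by move=> i g mg g0; exact: ge0_integral_row_shift.
- by apply: measurableT_comp => //; exact: measurable_matrix_of_tuple.
Qed.

End translation.

Section heine.
Variable R : realType.

Lemma heine (f : R -> R) (a b : R) : {within `[a, b], continuous f} ->
  forall e, 0 < e -> exists2 d, 0 < d &
    forall x y, x \in `[a, b] -> y \in `[a, b] -> `|x - y| < d -> `|f x - f y| < e.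
Proof.
move=> cf e e0.
have /compact_near_coveringP/near_covering_withinP := @segment_compact R a b.
move=> /(_ R (0^'+) (fun d x => forall y, y \in `[a, b] -> `|x - y| < d -> `|f x - f y| < e)).
have Ff : Filter (0^'+ : set_system R) by exact: filter_filter.
case/(_ Ff) => [x xab|d /= d0 H].
  have e20 : 0 < e / 2 by rewrite divr_gt0.
  have /(_ x) := (@subspace_continuousP _ _ _ _).1 cf.
  move=> /(_ xab) /cvgr_dist_lt /(_ _ e20) /nbhs_ballP[r /= r0 Hr].
  have r20 : 0 < r / 2 by rewrite divr_gt0.
  exists (ball x (r / 2), [set d | d <= r / 2]) => /=.
    split; first exact: nbhsx_ballx.
    exact: nbhs_right_le.
  move=> [x' d] /= [xx' dr] x'ab y yab x'y.
  rewrite -(subrKA (f x)) (le_lt_trans (ler_normD _ _))// [e]splitr ltrD//.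
    rewrite distrC; apply: Hr => //=.
    by apply: le_ball xx'; rewrite ler_pdivrMr// ler_pMr// ler1n.
  apply: Hr => //.
  rewrite /ball/= -(subrKA x') (le_lt_trans (ler_normD _ _))// [r]splitr ltrD//.
  exact: lt_le_trans x'y _.
exists (d / 2); first by rewrite divr_gt0.
move=> x y xab yab xy; apply: (H (d/2)) => //=.
  by rewrite sub0r normrN gtr0_norm ?divr_gt0// ltr_pdivrMr// ltr_pMr// ltr1n.
  by rewrite divr_gt0.
Qed.

End heine.

Section primitive01.
Variable R : realType.
Notation mu := (@lebesgue_measure R).
Implicit Types U V g h : R -> R.

Definition primitive01 U g := mu.-integrable `[0, 1] (EFin \o g) /\
  forall t, 0 <= t <= 1 -> U t = U 0 + \int[mu]_(s in `[0, t]) g s.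

Lemma integrable01_sub g s t : mu.-integrable `[0, 1] (EFin \o g) ->
  0 <= s -> t <= 1 -> mu.-integrable `[s, t] (EFin \o g).
Proof.
move=> ig s0 t1; apply: integrableS ig => //.
by apply: subset_itv; rewrite bnd_simp.
Qed.

Lemma Rintegral_cc_split g s t : mu.-integrable `[0, 1] (EFin \o g) ->
  0 <= s -> s <= t -> t <= 1 ->
  \int[mu]_(x in `[0, t]) g x = \int[mu]_(x in `[0, s]) g x + \int[mu]_(x in `[s, t]) g x.
Proof.
move=> ig s0 st t1.
have it := integrable01_sub ig (lexx 0) t1.
have := @Rintegral_itvB R g (BLeft 0) (BRight t) s it.
rewrite !bnd_simp => /(_ s0 st) H.
rewrite -(Rintegral_itv_obnd_cbnd (r := s)) -?H; first by rewrite addrC subrK.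
apply: integrableS (integrable01_sub ig s0 t1) => //.
by apply: subset_itvr; rewrite bnd_simp.
Qed.

Lemma primitive01B U g s t : primitive01 U g -> 0 <= s -> s <= t -> t <= 1 ->
  U t - U s = \int[mu]_(x in `[s, t]) g x.
Proof.
move=> [ig Ug] s0 st t1.
rewrite (Ug t) ?(le_trans s0 st)// (Ug s) ?s0 ?(le_trans st t1)//.
by rewrite (Rintegral_cc_split ig s0 st t1); ring.
Qed.

Lemma primitive01_cont U g : primitive01 U g -> {within `[0, 1], continuous U}.
Proof.
move=> [ig Ug].
have H := @parameterized_integral_continuous R 0 1 g ler01 ig.
apply: (@subspace_eq_continuous _ _ _ (fun x => U 0 + parameterized_integral mu 0 x g)).
  by move=> x; rewrite inE/= in_itv/= => x01; rewrite /from_subspace/= -Ug.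
move=> x; apply: cvgD; [exact: cvg_cst|exact: H].
Qed.

Lemma integrable01_cont h : {within `[0, 1], continuous h} ->
  mu.-integrable `[0, 1] (EFin \o h).
Proof. by apply: continuous_compact_integrable; exact: segment_compact. Qed.

Lemma integrable01_bounded g h (C : R) : mu.-integrable `[0, 1] (EFin \o g) ->
  measurable_fun (`[0, 1]%classic : set R) h -> (forall t, t \in `[0, 1] -> `|h t| <= C) ->
  mu.-integrable `[0, 1] (EFin \o (fun t => h t * g t)).
Proof.
move=> ig mh hC.
have mg : measurable_fun (`[0, 1]%classic : set R) g by apply/measurable_EFinP; exact: measurable_int ig.
apply: (@le_integrable _ _ R mu `[0, 1]%classic _ _ (EFin \o (fun t => C * g t))) => //.
- by apply/measurable_EFinP; apply: measurable_funM.
- move=> t t01; rewrite /= lee_fin !normrM ler_wpM2r//.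
  by rewrite (le_trans (hC _ _))// ler_norm.
- exact: (@integrableZl _ _ _ mu `[0, 1] _ C _ ig).
Qed.

(* Summing local estimates over a fine subdivision *)
Lemma local_to_global (F M : R -> R) (d : R) : 0 < d ->
  (forall s t, 0 <= s -> s <= t -> t <= 1 -> t - s < d -> `|F t - F s| <= M t - M s) ->
  forall t, 0 <= t <= 1 -> `|F t - F 0| <= M t - M 0.
Proof.
move=> d0 H t /andP[t0 t1].
have [n nd] : exists n : nat, t / n.+1%:R < d.
  have [n _ /(_ _ (leqnn n))] := near_infty_natSinv_lt (PosNum d0).
  move=> /= nd; exists n; apply: le_lt_trans nd.
  by rewrite ler_piMl// invr_ge0.
have K k : (k <= n.+1)%N ->
    `|F (t * k%:R / n.+1%:R) - F 0| <= M (t * k%:R / n.+1%:R) - M 0.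
  elim: k => [_|k IH kn]; first by rewrite mulr0 mul0r !subrr normr0.
  rewrite -(subrKA (F (t * k%:R / n.+1%:R))) (le_trans (ler_normD _ _))//.
  rewrite -(subrKA (M (t * k%:R / n.+1%:R)) (M (t * k.+1%:R / n.+1%:R))) lerD//.
    apply: H.
    - by rewrite !mulr_ge0// invr_ge0.
    - by rewrite ler_pM2r ?invr_gt0// ler_wpM2l// ler_nat.
    - rewrite (le_trans _ t1)// -mulrA ler_piMr// ler_pdivrMr// mul1r ler_nat//.
    - by rewrite -mulrBl -mulrBr -natrB// subSnn mulr1.
  by apply: IH; exact: ltnW.
by have := K n.+1 (leqnn _); rewrite mulfK.
Qed.

Lemma primitive01_chain U g (P Q : R -> R) (a b : R) :
  primitive01 U g -> (forall t, 0 <= t <= 1 -> a <= U t <= b) ->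
  {within `[a, b], continuous Q} ->
  (forall x y, a <= x -> x <= y -> y <= b ->
    exists2 z, x <= z <= y & P y - P x = Q z * (y - x)) ->
  primitive01 (P \o U) (fun t => Q (U t) * g t).
Proof.
move=> pU Uab cQ HP.
have [ig Ug] := pU.
have cU := primitive01_cont pU.
have QUe e : 0 < e -> exists2 d, 0 < d & forall s t, 0 <= s -> s <= t -> t <= 1 ->
    t - s < d -> forall z, Num.min (U s) (U t) <= z <= Num.max (U s) (U t) ->
    forall r, s <= r <= t -> `|Q z - Q (U r)| < e.
  move=> e0; have [c c0 Hc] := heine cQ e0.
  have c20 : 0 < c / 2 by rewrite divr_gt0.
  have [d d0 Hd] := heine cU c20.
  exists d => // s t s0 st t1 tsd z zst r /andP[sr rt].
  have rab : U r \in `[a, b].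
    by rewrite in_itv/= Uab// (le_trans s0 sr) (le_trans rt t1).
  have /andP[sa sb] : a <= U s <= b by rewrite Uab// s0 (le_trans st t1).
  have /andP[ta tb] : a <= U t <= b by rewrite Uab// t1 (le_trans s0 st).
  have rs : `|U r - U s| < c / 2.
    apply: Hd; rewrite ?in_itv/= ?s0 ?(le_trans s0 sr) ?(le_trans rt t1) ?(le_trans st t1)//.
    by rewrite ger0_norm ?subr_ge0// (le_lt_trans _ tsd)// lerB.
  have rt' : `|U r - U t| < c / 2.
    apply: Hd; rewrite ?in_itv/= ?t1 ?(le_trans s0 sr) ?(le_trans rt t1) ?(le_trans s0 st)//.
    by rewrite ler0_norm ?subr_le0// opprB (le_lt_trans _ tsd)// lerB.
  have c2c : c / 2 < c by rewrite ltr_pdivrMr// ltr_pMr// ltr1n.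
  move: zst rs rt'; rewrite ge_min le_max !ltr_norml => zst rs rt'.
  rewrite -ltr_norml; apply: Hc => //; last by rewrite ltr_norml; lra.
  by rewrite in_itv/=; lra.
have mQU : measurable_fun (`[0, 1]%classic : set R) (Q \o U).
  apply: subspace_continuous_measurable_fun => //.
  apply/subspace_continuousP => x x01; apply/cvgrPdist_lt => e e0.
  have [c c0 Hc] := heine cQ e0.
  have [d d0 Hd] := heine cU c0.
  apply/nbhs_ballP; exists d => //= y xy y01.
  apply: Hc; [rewrite in_itv/=; exact: Uab|rewrite in_itv/=; exact: Uab|exact: Hd].
have [C QUC] : exists C, forall t, t \in `[0, 1] -> `|Q (U t)| <= C.
  have [d d0 Hd] := QUe 1 ltr01.
  have [||c _ Hc] := @EVT_max R (fun x => `|Q x|) a b.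
  - by have /andP[? ?] := Uab 0 (@andb_true_intro _ _ (conj (lexx 0) ler01)); lra.
  - move=> x; apply: continuous_comp; [exact: cQ|exact: norm_continuous].
  by exists `|Q c| => t; rewrite in_itv/= => /Uab t01; apply: Hc; rewrite in_itv.
have iQ := integrable01_bounded ig mQU QUC.
split=> //.
move=> t t01; apply/eqP; rewrite -subr_eq0 -normr_le0.
apply/ler_addgt0Pl => e e0; rewrite addr0.
pose I := \int[mu]_(s in `[0, 1]) `|g s|.
have I0 : 0 <= I by apply: Rintegral_ge0 => x _; exact: normr_ge0.
have e'0 : 0 < e / (I + 1) by rewrite divr_gt0// ltr_wpDl.
set e' := e / (I + 1) in e'0.
have [d d0 Hd] := QUe _ e'0.
pose F s := P (U s) - \int[mu]_(x in `[0, s]) (Q (U x) * g x).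
pose M s := e' * \int[mu]_(x in `[0, s]) `|g x|.
have iag : mu.-integrable `[0, 1] (EFin \o (fun x => `|g x|)).
  exact: (@integrable_norm _ _ _ mu `[0,1] g ig).
have loc : forall s t, 0 <= s -> s <= t -> t <= 1 -> t - s < d -> `|F t - F s| <= M t - M s.
  move=> {t01}{}s {}t s0 st t1 tsd.
  rewrite /F /M (Rintegral_cc_split iQ s0 st t1) (Rintegral_cc_split iag s0 st t1).
  rewrite [leRHS](_ : _ = e' * \int[mu]_(x in `[s, t]) `|g x|); last by ring.
  rewrite [X in `|X|](_ : _ = P (U t) - P (U s) - \int[mu]_(x in `[s, t]) (Q (U x) * g x)); last by ring.
  have /andP[sa sb] : a <= U s <= b by rewrite Uab// s0 (le_trans st t1).
  have /andP[ta tb] : a <= U t <= b by rewrite Uab// t1 (le_trans s0 st).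
  have [z zst ->] : exists2 z, Num.min (U s) (U t) <= z <= Num.max (U s) (U t) &
      P (U t) - P (U s) = Q z * (U t - U s).
    have [ust|uts] := leP (U s) (U t).
      exact: HP.
    have [z zz H] := HP _ _ ta (ltW uts) sb.
    by exists z => //; lra.
  rewrite (primitive01B pU)//.
  have ist := integrable01_sub ig s0 t1.
  rewrite -RintegralZl// -RintegralB//; last 2 first.
  - exact: (@integrableZl _ _ _ mu `[s, t] _ (Q z) _ ist).
  - exact: (integrable01_sub (g := fun x => Q (U x) * g x) iQ s0 t1).
  have izg : mu.-integrable `[s, t] (EFin \o (fun x => Q z * g x - Q (U x) * g x)).
    apply: (@integrableB _ _ _ mu `[s,t] _ (EFin \o (fun x => Q z * g x)) (EFin \o (fun x => Q (U x) * g x))) => //.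
    - exact: (@integrableZl _ _ _ mu `[s, t] _ (Q z) _ ist).
    - exact: (integrable01_sub (g := fun x => Q (U x) * g x) iQ s0 t1).
  have iagst := integrable01_sub iag s0 t1.
  rewrite (le_trans (le_normr_Rintegral _ izg))// -RintegralZl//.
  apply: le_Rintegral => //.
  - exact: (@integrable_norm _ _ _ mu `[s,t] _ izg).
  - exact: (@integrableZl _ _ _ mu `[s, t] _ e' _ iagst).
  move=> x; rewrite /= in_itv/= => xst.
  by rewrite -mulrBl normrM ler_wpM2r// ltW// (Hd s t).
have := local_to_global d0 loc t01.
have /andP[t0 t1] := t01.
rewrite /F /M set_itv1 !Rintegral_set1 mulr0 !subr0.
rewrite [X in `|X|](_ : _ = (P \o U) t - ((P \o U) 0 + \int[mu]_(s in `[0, t]) (Q (U s) * g s))); last by rewrite /=; ring.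
move=> /le_trans; apply.
have It : \int[mu]_(x in `[0, t]) `|g x| <= I.
  rewrite /I (Rintegral_cc_split iag t0 t1 (lexx _)) lerDl.
  by apply: Rintegral_ge0 => x _; exact: normr_ge0.
rewrite (le_trans (ler_wpM2l (ltW e'0) It))//.
by rewrite /e' mulrAC ler_pdivrMr ?ltr_wpDl// ler_wpM2l ?(ltW e0)// lerDl.
Qed.

End primitive01.

Section primitive01_calculus.
Variable R : realType.
Notation mu := (@lebesgue_measure R).
Implicit Types U V g h : R -> R.

Lemma primitive01_integrable U g : primitive01 U g -> mu.-integrable `[0, 1] (EFin \o g).
Proof. by case. Qed.

Lemma primitive01_cst c : primitive01 (fun=> c : R) (fun=> 0).
Proof.
split; first by apply: integrable01_cont; apply: continuous_subspaceT => x; exact: cvg_cst.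
by move=> t _; rewrite Rintegral_cst// mul0r addr0.
Qed.

Lemma primitive01D U V g h : primitive01 U g -> primitive01 V h ->
  primitive01 (fun t => U t + V t) (fun t => g t + h t).
Proof.
move=> [ig Ug] [ih Vh]; split.
  exact: (@integrableD _ _ _ mu `[0, 1] _ _ _ ig ih).
move=> t t01; rewrite Ug// Vh// RintegralD//; last 2 first.
- by apply: integrable01_sub => //; case/andP: t01.
- by apply: integrable01_sub => //; case/andP: t01.
by ring.
Qed.

Lemma primitive01Z c U g : primitive01 U g ->
  primitive01 (fun t => c * U t) (fun t => c * g t).
Proof.
move=> [ig Ug]; split.
  exact: (@integrableZl _ _ _ mu `[0, 1] _ c _ ig).
move=> t t01; rewrite Ug// RintegralZl//; last first.
  by apply: integrable01_sub => //; case/andP: t01.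
by ring.
Qed.

Lemma primitive01_bounded U g : primitive01 U g ->
  exists C, forall t, 0 <= t <= 1 -> `|U t| <= C.
Proof.
move=> pU; have cU := primitive01_cont pU.
have [|c _ Hc] := @EVT_max R (fun x => `|U x|) 0 1 ler01.
  by move=> x; apply: continuous_comp; [exact: cU|exact: norm_continuous].
by exists `|U c| => t t01; apply: Hc; rewrite in_itv.
Qed.

Lemma eq_primitive01 U V g h : primitive01 U g ->
  (forall t, 0 <= t <= 1 -> V t = U t) ->
  (forall t, 0 <= t <= 1 -> h t = g t) -> primitive01 V h.
Proof.
move=> [ig Ug] VU hg; split.
  by apply: eq_integrable ig => // t; rewrite inE/= in_itv/= => t01; rewrite hg.
move=> t t01; rewrite !VU ?lexx ?ler01// Ug//; congr +%R.
apply: eq_Rintegral => s; rewrite inE/= in_itv/= => /andP[s0 st]; rewrite hg//.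
by rewrite s0 (le_trans st)//; case/andP: t01.
Qed.

Lemma primitive01_sqr U g : primitive01 U g ->
  primitive01 (fun t => U t ^+ 2) (fun t => 2 * U t * g t).
Proof.
move=> pU; have [C UC] := primitive01_bounded pU.
apply: (@primitive01_chain R U g (fun x => x ^+ 2) (fun x => 2 * x) (- C) C) => //.
- by move=> t /UC; rewrite ler_norml.
- by apply: continuous_subspaceT => x; apply: mulrl_continuous.
- move=> x y _ xy _; exists ((x + y) / 2); last by field.
  by apply/andP; split; lra.
Qed.

Lemma primitive01M U V g h : primitive01 U g -> primitive01 V h ->
  primitive01 (fun t => U t * V t) (fun t => U t * h t + V t * g t).
Proof.
move=> pU pV.
have pN : primitive01 (fun t => - V t) (fun t => - h t).
  by apply: eq_primitive01 (primitive01Z (- 1) pV) _ _ => t _; rewrite mulN1r.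
have p1 := primitive01Z 4^-1 (primitive01_sqr (primitive01D pU pV)).
have p2 := primitive01Z (- 4^-1) (primitive01_sqr (primitive01D pU pN)).
by apply: eq_primitive01 (primitive01D p1 p2) _ _ => t _ /=; field.
Qed.

Lemma primitive01_FTC U g : (forall s : R, is_derive s (1 : R) U (g s)) -> continuous g ->
  primitive01 U g.
Proof.
move=> dU cg; have ig : mu.-integrable `[0, 1] (EFin \o g).
  by apply: integrable01_cont; exact: continuous_subspaceT.
have cU : continuous U.
  by move=> x; apply: differentiable_continuous; apply/derivable1_diffP; case: (dU x).
split => // t /andP[t0 t1].
move: t0; rewrite le_eqVlt => /predU1P[<-|t0].
  by rewrite set_itv1 Rintegral_set1 addr0.
have := @continuous_FTC2 R g U 0 t t0.
rewrite /Rintegral => ->.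
- by rewrite -EFinB/= addrC subrK.
- exact: continuous_subspaceT.
- split; first by move=> x _; case: (dU x).
  + exact: cvg_at_right_filter (cU 0).
  + exact: cvg_at_left_filter (cU t).
- by move=> x _; rewrite derive1E; apply: derive_val.
Qed.

Lemma powR_continuous_within (a b s : R) : 0 < a \/ (0 <= a /\ 0 < s) ->
  {within `[a, b], continuous (fun x => x `^ s)}.
Proof.
move=> as0; apply/subspace_continuousP => x; rewrite /= in_itv/= => /andP[ax xb].
have a0 : 0 <= a by case: as0 => [/ltW//|[]//].
have [x0|x0] := leP x 0; last first.
  apply: cvg_within_filter; apply: differentiable_continuous.
  by apply/derivable1_diffP; apply: derivable_powR; rewrite in_itv/= x0.
have -> : x = 0 by apply/eqP; rewrite eq_le x0 (le_trans a0).
case: as0 => [a0'|[_ s0]]; first by have := lt_le_trans a0' ax; rewrite ltNge x0.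
apply/cvgrPdist_lt => e e0.
apply/nbhs_ballP; exists (e `^ s^-1) => /=; first exact: powR_gt0.
move=> y; rewrite /ball/= sub0r normrN => ye /=; rewrite in_itv/= => /andP[ay _].
rewrite /from_subspace powR0 ?gt_eqF// sub0r normrN ger0_norm ?powR_ge0//.
have y0 : 0 <= y by exact: le_trans ay.
move: ye; rewrite ger0_norm// => ye.
rewrite -[e](@powRr1 R) ?(ltW e0)// -[X in e `^ X](@mulVf _ s) ?gt_eqF// powRrM.
by apply: gt0_ltr_powR => //; rewrite ?nnegrE ?powR_ge0.
Qed.

Lemma powR_MVT (r x y : R) : 0 < x \/ (0 <= x /\ 0 < r) -> x <= y ->
  exists2 z, x <= z <= y & y `^ r - x `^ r = (r * z `^ (r - 1)) * (y - x).
Proof.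
move=> xr; rewrite le_eqVlt => /predU1P[<-|xy].
  by exists x; rewrite ?lexx// !subrr mulr0.
have x0 : 0 <= x by case: xr => [/ltW//|[]//].
have [z zxy H] : exists2 z, z \in `]x, y[ & y `^ r - x `^ r = (r * z `^ (r - 1)) * (y - x).
  apply: (@MVT R (fun t => t `^ r) (fun z => r * z `^ (r - 1))) => //.
    move=> z; rewrite in_itv/= => /andP[xz zy].
    have z0 : z \in `]0, +oo[ by rewrite in_itv/= andbT (le_lt_trans x0).
    split; first exact: derivable_powR.
    by rewrite -derive1E powR_derive1.
  exact: powR_continuous_within.
by exists z => //; move: zxy; rewrite in_itv/= => /andP[/ltW -> /ltW ->].
Qed.

(* either U stays positive, or the exponent is larger than one *)
Lemma primitive01_powR (r : R) U g : primitive01 U g ->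
  (forall t, 0 <= t <= 1 -> 0 < U t) \/
  (1 < r /\ forall t, 0 <= t <= 1 -> 0 <= U t) ->
  primitive01 (fun t => U t `^ r) (fun t => r * U t `^ (r - 1) * g t).
Proof.
move=> pU H; have [C UC] := primitive01_bounded pU.
have cU := primitive01_cont pU.
have [c c01 Hc] := @EVT_min R U 0 1 ler01 cU.
have Hc0 : 0 < U c \/ (0 <= U c /\ 1 < r).
  by case: H => [H|[r1 H]]; [left|right; split => //]; apply: H; move: c01; rewrite in_itv.
apply: (@primitive01_chain R U g (fun x => x `^ r) (fun x => r * x `^ (r - 1)) (U c) C) => //.
- by move=> t t01; rewrite Hc ?in_itv// (le_trans (ler_norm _) (UC _ t01)).
- move=> x; apply: cvgM; first exact: cvg_cst.
  apply: powR_continuous_within.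
  by case: Hc0 => [|[? ?]]; [left|right; rewrite subr_gt0].
- move=> x y cx xy _; apply: powR_MVT => //.
  case: Hc0 => [c0|[c0 r1]]; [left; exact: lt_le_trans cx|right].
  by split; [exact: le_trans cx|exact: lt_trans r1].
Qed.

Lemma primitive01_lim (U_ g_ : nat -> R -> R) (g W : R -> R) (c : R) :
  (forall n, primitive01 (U_ n) (g_ n)) ->
  measurable_fun (`[0, 1]%classic : set R) g ->
  {ae mu, forall s, s \in `[0, 1] -> g_ ^~ s @ \oo --> g s} ->
  {ae mu, forall s, s \in `[0, 1] -> forall n, `|g_ n s| <= W s} ->
  mu.-integrable `[0, 1] (EFin \o W) ->
  U_ ^~ 0 @ \oo --> c ->
  primitive01 (fun t => c + \int[mu]_(s in `[0, t]) g s) g /\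
  forall t, 0 <= t <= 1 -> U_ ^~ t @ \oo --> c + \int[mu]_(s in `[0, t]) g s.
Proof.
move=> pU mg g_g g_W iW Uc.
have dct t : 0 <= t <= 1 -> mu.-integrable `[0, t] (EFin \o g) /\
    \int[mu]_(s in `[0, t]) g_ n s @[n --> \oo] --> \int[mu]_(s in `[0, t]) g s.
  move=> /andP[t0 t1].
  have sub : `[0, t] `<=` `[0, 1]%classic by apply: subset_itv; rewrite bnd_simp.
  have [| | | | |ig _ H] := @dominated_convergence _ _ R mu `[0, t]%classic
    (measurable_itv _)
    (fun n => EFin \o g_ n) (EFin \o g) (EFin \o W).
  - move=> n; have := primitive01_integrable (pU n).
    by move=> /(integrable01_sub)/(_ (lexx 0) t1) /measurable_int.
  - by apply/measurable_EFinP; exact: measurable_funS mg.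
  - apply: ae_imp g_g => s H /sub s01 /=.
    by apply: cvg_EFin; [exact: nearW|exact: H].
  - exact: integrable01_sub.
  - by apply: ae_imp g_W => s H n s0t /=; rewrite lee_fin; apply: H; exact: sub.
  split=> //.
  apply: fine_cvg; rewrite /Rintegral fineK//.
  exact: integrable_fin_num.
split.
  have [ig _] := dct 1 (@andb_true_intro _ _ (conj ler01 (lexx 1))).
  split=> // t t01.
  by rewrite set_itv1 Rintegral_set1 addr0.
move=> t t01; have [ig H] := dct t t01.
under eq_fun do rewrite (proj2 (pU _))//.
exact: cvgD.
Qed.

End primitive01_calculus.

Lemma le_abse_fine_integral d (T : measurableType d) (R : realType)
    (mu : {measure set T -> \bar R}) (f : T -> \bar R) : measurable_fun setT f ->
  (`|(fine (\int[mu]_x f x))%:E| <= \int[mu]_x `|f x|)%E.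
Proof.
move=> mf; apply: le_trans (le_abse_integral mu measurableT mf).
by case: (\int[mu]_x f x)%E => [r| |]//=; rewrite normr0 leey.
Qed.

Section fubini_ae.
Local Open Scope ereal_scope.
Context d1 d2 (T1 : measurableType d1) (T2 : measurableType d2) (R : realType).
Variables (m1 : {sigma_finite_measure set T1 -> \bar R})
  (m2 : {sigma_finite_measure set T2 -> \bar R}).

Lemma ae_sections (A : set (T1 * T2)) : measurable A ->
  (forall y, m1 [set x | A (x, y)] = 0) ->
  {ae m1, forall x, {ae m2, forall y, ~ A (x, y)}}.
Proof.
move=> mA A0.
pose f : T1 * T2 -> \bar R := fun z => (\1_A z)%:E.
have mf : measurable_fun setT f by apply/measurable_EFinP; exact: measurable_indic.
have f0 z : 0 <= f z by rewrite lee_fin.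
have mfy y : measurable_fun setT (fun x => f (x, y)).
  by apply: (measurableT_comp mf); exact: measurable_fun_pair.
have mfx x : measurable_fun setT (fun y => f (x, y)).
  by apply: (measurableT_comp mf); exact: measurable_fun_pair.
have : \int[m1]_x \int[m2]_y f (x, y) = 0.
  rewrite (fubini_tonelli f)//; apply: integral0_eq => y _ /=.
  have mAy : measurable [set x | A (x, y)].
    have := @measurable_ysection _ _ T1 T2 A y mA.
    by congr measurable; apply/seteqP; split=> x; rewrite /ysection/= inE.
  rewrite (eq_integral (fun x => (\1_[set x | A (x, y)] x)%:E)).
    by rewrite integral_indic// setIT; exact: A0.
  by move=> x _; rewrite /f !indicE.
have mF : measurable_fun setT (fun x => \int[m2]_y f (x, y)).
  exact: measurable_fun_fubini_tonelli_F.
have F0 x : 0 <= \int[m2]_y f (x, y) by exact: integral_ge0.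
move=> H0.
have : ae_eq m1 setT (fun x => \int[m2]_y f (x, y)) (cst 0).
  apply/ae_eq_integral_abs => //.
  by rewrite -[RHS]H0; apply: eq_integral => x _; rewrite gee0_abs.
apply: ae_imp => x /(_ I) fx0.
have : ae_eq m2 setT (fun y => f (x, y)) (cst 0).
  apply/ae_eq_integral_abs => //.
  by rewrite -[RHS]fx0; apply: eq_integral => y _; rewrite gee0_abs.
apply: ae_imp => y /(_ I); rewrite /f indicE => fxy0 Axy.
by move: fxy0; rewrite mem_set// => /eqP; rewrite /= eqe oner_eq0.
Qed.

Lemma measurable_param_integral (f : T1 * T2 -> \bar R) : measurable_fun setT f ->
  (forall z, 0 <= f z) -> measurable_fun setT (fun x => \int[m2]_y f (x, y)).
Proof. by move=> mf f0; exact: measurable_fun_fubini_tonelli_F. Qed.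

Lemma measurable_param_Rintegral (f : T1 * T2 -> R) : measurable_fun setT f ->
  measurable_fun setT (fun x => (\int[m2]_y f (x, y))%R).
Proof.
move=> mf.
have mef : measurable_fun setT (EFin \o f) by apply/measurable_EFinP.
apply: measurableT_comp => //.
rewrite (_ : (fun x => _) =
  (fun x => \int[m2]_y (EFin \o f)^\+ (x, y)) \- (fun x => \int[m2]_y (EFin \o f)^\- (x, y))).
  apply: emeasurable_funB.
  - by apply: (measurable_fun_fubini_tonelli_F (EFin \o f)^\+) => //; exact: measurable_funepos.
  - by apply: (measurable_fun_fubini_tonelli_F (EFin \o f)^\-) => //; exact: measurable_funeneg.
apply/funext => x; rewrite integralE; congr (_ - _); by apply: eq_integral => y _; rewrite ?funeposE ?funenegE.
Qed.

End fubini_ae.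

Section primitive_param.
Context d (S : measurableType d) (R : realType).
Variable m : {sigma_finite_measure set S -> \bar R}.
Notation mu := (@lebesgue_measure R).

Lemma primitive01_param (k k' : S -> R -> R) :
  measurable_fun setT (fun z : S * R => k' z.1 z.2) ->
  (forall a, primitive01 (k a) (k' a)) ->
  m.-integrable setT (fun a => (k a 0)%:E) ->
  (\int[m]_a \int[mu]_(s in `[0%R, 1%R]) `|(k' a s)%:E| < +oo)%E ->
  primitive01 (fun s => \int[m]_a k a s) (fun s => \int[m]_a k' a s).
Proof.
move=> mk' pk ik0 ik'.
pose f t : S * R -> \bar R := fun z => ((k' z.1 z.2) * \1_(`[0, t]%classic) z.2)%:E.
have mf t : measurable_fun setT (f t).
  apply/measurable_EFinP; apply: measurable_funM => //.
  by apply: measurableT_comp => //; exact: measurable_indic.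
have fE t a : (\int[mu]_s f t (a, s) = \int[mu]_(s in `[0%R, t]) (k' a s)%:E)%E.
  rewrite [RHS]integral_mkcond; apply: eq_integral => s _.
  by rewrite /f /= patchE/= indicE; case: ifPn => _; rewrite ?mulr1 ?mulr0.
have fE' t a : (\int[mu]_s `|f t (a, s)| = \int[mu]_(s in `[0%R, t]) `|(k' a s)%:E|)%E.
  rewrite [RHS]integral_mkcond; apply: eq_integral => s _.
  by rewrite /f /= patchE/= indicE; case: ifPn => _; rewrite ?mulr1 ?mulr0 ?normr0.
have If t : 0 <= t <= 1 -> (m \x mu)%E.-integrable setT (f t).
  move=> /andP[t0 t1]; apply/integrable12ltyP; first exact: mf.
  apply: le_lt_trans ik'; apply: ge0_le_integral => //.
  - by move=> a _; apply: integral_ge0.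
  - by apply: (@measurable_param_integral _ _ _ _ R mu (abse \o f t)); [exact: measurableT_comp (mf _)|move=> z; exact: abse_ge0].
  - rewrite (_ : (fun a => _) = fun a => \int[mu]_s `|f 1%R (a, s)|)%E.
      by apply: (@measurable_param_integral _ _ _ _ R mu (abse \o f 1)); [exact: measurableT_comp (mf _)|move=> z; exact: abse_ge0].
    by apply/funext => a; rewrite fE'.
  - move=> a _; rewrite fE'; apply: ge0_subset_integral => //.
    + apply: measurableT_comp => //; apply/measurable_EFinP.
      by have := primitive01_integrable (pk a) => /measurable_int /measurable_EFinP.
    + by apply: subset_itv; rewrite bnd_simp.
have ikt t : 0 <= t <= 1 -> m.-integrable setT (fun a => \int[mu]_s f t (a, s))%E.
  by move=> t01; exact: integrable_fubini_F (If t t01).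
have ifin t a : 0 <= t <= 1 -> (\int[mu]_s f t (a, s))%E \is a fin_num.
  move=> /andP[t0 t1]; rewrite fE; apply: integrable_fin_num => //.
  by apply: integrable01_sub => //; exact: primitive01_integrable (pk a).
have H s : 0 <= s <= 1 -> \int[m]_a k a s = \int[m]_a k a 0 + fine (\int[m]_a \int[mu]_s' f s (a, s'))%E.
  move=> s01.
  have -> : \int[m]_a k a s = \int[m]_a (k a 0 + fine (\int[mu]_r f s (a, r))%E).
    by apply: eq_Rintegral => a _; rewrite fE; have [_ ->] := pk a.
  rewrite RintegralD//.
    congr +%R; rewrite /Rintegral; congr fine; apply: eq_integral => a _.
    by rewrite fineK// ifin.
  apply: eq_integrable (ikt s s01) => // a _ /=.
  by rewrite fineK// ifin.
have J t : 0 <= t <= 1 -> {ae mu, forall s, s \in `[0, t]%classic ->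
    m.-integrable setT (fun a => (k' a s)%:E)}.
  move=> t01; have := ae_integrable2 (If t t01).
  apply: ae_imp => s; rewrite /f /= => + st; rewrite indicE st.
  by under eq_fun do rewrite mulr1.
have K t : 0 <= t <= 1 ->
  mu.-integrable `[0, t] (fun s => (\int[m]_a k' a s)%:E) /\
  (\int[mu]_(s in `[0%R, t]) (\int[m]_a k' a s)%:E = \int[m]_a \int[mu]_s f t (a, s))%E.
  move=> t01; rewrite (Fubini (If t t01)).
  have e : {ae mu, forall s, setT s -> (\int[m]_a f t (a, s))%E =
     ((fun s => (\int[m]_a k' a s)%:E) \_ `[0, t]) s}.
    apply: ae_imp (J t t01) => s Js _; rewrite patchE /f/= indicE.
    case: ifPn => st.
      under eq_integral do rewrite mulr1.
      rewrite /Rintegral fineK//; apply: integrable_fin_num => //; exact: Js.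
    by under eq_integral do rewrite mulr0; rewrite integral0.
  have mG : measurable_fun setT ((fun s => (\int[m]_a k' a s)%:E) \_ `[0, t]).
    apply/(measurable_restrictT _ _).1 => //; apply: measurable_funTS.
    apply/measurable_EFinP; apply: (@measurable_param_Rintegral _ _ _ _ R m (fun z => k' z.2 z.1)).
    have ms : measurable_fun setT (fun z : R * S => (z.2, z.1)) by exact: measurable_fun_pair.
    exact: (measurableT_comp mk' ms).
  have mft s : measurable_fun setT (fun a => f t (a, s)).
    by apply: (measurableT_comp (mf t)); exact: measurable_fun_pair.
  split.
    rewrite integrable_mkcond//; apply/integrableP; split => //.
    have ift := (integrable21ltyP m mu (mf t)).1 (If t t01).
    apply: (le_lt_trans _ ift).
    apply: ge0_le_integral => //.
    - exact: measurableT_comp.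
    - apply: (@measurable_param_integral _ _ _ _ R m (fun z => `|f t (z.2, z.1)|%E)).
        have ms : measurable_fun setT (fun z : R * S => (z.2, z.1)) by exact: measurable_fun_pair.
        by apply: measurableT_comp => //; exact: (measurableT_comp (mf t) ms).
      by move=> z; exact: abse_ge0.
    move=> s _; rewrite patchE; case: ifPn => st; last by rewrite abse0; exact: integral_ge0.
    apply: (le_trans _ (@le_abse_fine_integral _ _ _ m _ (mft s))).
    rewrite /f /= indicE st; under [in leRHS]eq_integral do rewrite mulr1.
    by [].
  rewrite integral_mkcond; apply: ae_eq_integral => //.
  - exact: measurable_fubini_G (If t t01).
  - by apply: ae_imp e => s es _; rewrite es.
split.
  by have [] := K 1 (@andb_true_intro _ _ (conj ler01 (lexx 1))).
move=> t t01; rewrite H//; congr +%R; rewrite /Rintegral; congr fine.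
by have [_ <-] := K t t01.
Qed.

End primitive_param.

Section shifts.
Variables (R : realType) (m n : nat).
Local Notation T := 'M[R]_(m, n).
Local Notation leb := (lebesgue_mx R m n).
Local Notation mu := (@lebesgue_measure R).

Lemma integral_shift (c : T) (f : T -> \bar R) : measurable_fun setT f ->
  (\int[leb]_x f (x + c)%R = \int[leb]_x f x)%E.
Proof.
move=> mf; rewrite [LHS]integralE [RHS]integralE; congr (_ - _)%E.
- rewrite -[RHS](ge0_integral_shift c)//; last exact: measurable_funepos.
  by apply: eq_integral => x _; rewrite !funeposE.
- rewrite -[RHS](ge0_integral_shift c)//; last exact: measurable_funeneg.
  by apply: eq_integral => x _; rewrite !funenegE.
Qed.

Lemma negligible_shift (c : T) (A : set T) : leb.-negligible A ->
  leb.-negligible [set x | A (x + c)].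
Proof.
move=> [B [mB B0 AB]]; exists [set x | B (x + c)].
have mBc : measurable [set x | B (x + c)].
  by rewrite -[X in measurable X]setTI; exact: measurable_shift.
split => //; last by move=> x; exact: AB.
transitivity (\int[leb]_x (\1_B (x + c))%:E)%E.
  rewrite (eq_integral (fun x => (\1_[set x | B (x + c)] x)%:E)).
    by rewrite integral_indic// setIT.
  by move=> x _; rewrite !indicE.
rewrite (@integral_shift c (fun x => (\1_B x)%:E)).
  by rewrite integral_indic// setIT.
by apply/measurable_EFinP; exact: measurable_indic.
Qed.

Lemma ae_shift (c : T) (P : T -> Prop) : {ae leb, forall x, P x} ->
  {ae leb, forall x, P (x + c)}.
Proof. exact: negligible_shift. Qed.

Lemma measurable_line (e : T) :
  measurable_fun setT (fun z : T * R => z.1 + z.2 *: e).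
Proof.
apply: measurable_fun_mx => i j; under eq_fun do rewrite !mxE.
apply: measurable_funD; last exact: measurable_funM.
exact: (measurableT_comp (measurable_coord i j) measurable_fst).
Qed.

Lemma measurable_line1 (e x : T) : measurable_fun setT (fun s : R => x + s *: e).
Proof.
apply: measurable_fun_mx => i j; under eq_fun do rewrite !mxE.
exact: (@measurable_funD _ _ R setT (fun=> x i j) (fun s : R => s * e i j)
  (measurable_cst _) (measurable_funM (@measurable_id _ _ _) (measurable_cst _))).
Qed.

Lemma ae_line (e : T) (P : T -> Prop) : {ae leb, forall x, P x} ->
  {ae leb, forall x, {ae mu, forall s, P (x + s *: e)}}.
Proof.
move=> [B [mB B0 AB]].
have mA : measurable [set z : T * R | B (z.1 + z.2 *: e)].
  by rewrite -[X in measurable X]setTI; exact: measurable_line.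
have A0 y : leb [set x | B (x + y *: e)] = 0%E.
  have : leb.-negligible [set x | B (x + y *: e)].
    by apply: negligible_shift; exists B; split.
  by apply: measure_negligible; rewrite -[X in measurable X]setTI; exact: measurable_shift.
apply: ae_imp (@ae_sections _ _ _ _ R leb mu _ mA A0) => x.
by apply: ae_imp => s /= nB; apply: contrapT => nP; apply: nB; exact: AB.
Qed.

End shifts.

Section ac_lines.
Variables (R : realType) (m n : nat).
Local Notation T := 'M[R]_(m, n).
Local Notation leb := (lebesgue_mx R m n).
Local Notation mu := (@lebesgue_measure R).
Implicit Types (e : T) (f g : T -> R).

Lemma integral_indic01 : (\int[mu]_s (\1_(`[0%R, 1%R]%classic : set R) s)%:E = 1)%E.
Proof. by rewrite integral_indic//= setIT lebesgue_measure_itv/= lte01 oppr0 adde0. Qed.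

Definition ac_line e f g (x : T) := exists U : R -> R,
  [/\ primitive01 U (fun s => g (x + s *: e)), U 0 = f x, U 1 = f (x + e) &
      {ae mu, forall s, s \in `[0, 1] -> U s = f (x + s *: e)}].

Definition ac_lines e f g := {ae leb, forall x, ac_line e f g x}.

Definition ac_everywhere e f g := forall x,
  primitive01 (fun s => f (x + s *: e)) (fun s => g (x + s *: e)).

Lemma ac_everywhere_line e f g x : ac_everywhere e f g -> ac_line e f g x.
Proof.
move=> H; exists (fun s => f (x + s *: e)); split => //.
- by rewrite scale0r addr0.
- by rewrite scale1r.
- exact: ae_all.
Qed.

Lemma ac_everywhere_lines e f g : ac_everywhere e f g -> ac_lines e f g.
Proof. by move=> H; apply: ae_all => x; exact: ac_everywhere_line. Qed.

Lemma measurable_fun_line e f x (D : set R) : measurable_fun setT f ->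
  measurable_fun D (fun s : R => f (x + s *: e)).
Proof.
by move=> mf; apply: measurable_funTS; apply: (measurableT_comp mf); exact: measurable_line1.
Qed.

Lemma ae_eq_primitive01 (U g h : R -> R) : primitive01 U g ->
  measurable_fun (`[0, 1]%classic : set R) h ->
  {ae mu, forall s, s \in `[0, 1] -> h s = g s} -> primitive01 U h.
Proof.
move=> [ig Ug] mh hg.
have mg : measurable_fun (`[0, 1]%classic : set R) (EFin \o g) by exact: measurable_int ig.
have mhe : measurable_fun (`[0, 1]%classic : set R) (EFin \o h) by apply/measurable_EFinP.
split.
  apply/integrableP; split => //.
  have /integrableP[_] := ig.
  apply: le_lt_trans; rewrite le_eqVlt; apply/orP; left; apply/eqP.
  apply: ge0_ae_eq_integral => //; [exact: measurableT_comp|exact: measurableT_comp|].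
  by apply: ae_imp hg => s H s01 /=; rewrite H.
move=> t t01; rewrite Ug//; congr +%R; rewrite /Rintegral; congr fine.
have sub : `[0, t] `<=` `[0, 1]%classic.
  by apply: subset_itv; rewrite bnd_simp//; case/andP: t01.
apply: ae_eq_integral => //.
- exact: measurable_funS mg.
- exact: measurable_funS mhe.
- by apply: ae_imp hg => s H /sub s01 /=; rewrite H.
Qed.

(* A continuous function which is nonnegative almost everywhere is so everywhere. *)
Lemma within_ae_ge0 (U : R -> R) : {within `[0, 1], continuous U} ->
  {ae mu, forall s, s \in `[0, 1] -> 0 <= U s} ->
  forall t, 0 <= t <= 1 -> 0 <= U t.
Proof.
move=> cU [B [mB B0 UB]] t t01; rewrite leNgt; apply/negP => Ut.
have Ut0 : 0 < - U t by rewrite oppr_gt0.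
have [d d0 Hd] := heine cU Ut0.
pose a := Num.max 0 (t - d / 2); pose b := Num.min 1 (t + d / 2).
have d20 : 0 < d / 2 by rewrite divr_gt0.
have dd : d / 2 < d by rewrite ltr_pdivrMr// ltr_pMr// ltr1n.
have ab : a < b.
  case/andP: t01 => t0 t1.
  rewrite /a /b gt_max !lt_min; apply/andP; split; apply/andP; split; lra.
have : (mu `[a, b] <= mu B)%E.
  apply: le_measure; rewrite ?inE// => s /=; rewrite in_itv/= => /andP[as_ sb].
  apply: UB => /=.
  move: as_ sb; rewrite /a /b ge_max le_min => /andP[s0 s1] /andP[s2 s3].
  have s01 : s \in `[0, 1] by rewrite in_itv/=; apply/andP.
  move=> /(_ s01); apply/negP; rewrite -ltNge.
  have := Hd t s; rewrite s01 in_itv/= t01 => /(_ erefl erefl) H.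
  have : `|t - s| < d by rewrite ltr_norml; lra.
  by move=> /H; rewrite ltr_norml; lra.
rewrite [in X in (_ <= X)%E -> _]B0 lebesgue_measure_itv/= lte_fin ab -EFinB lee_fin.
by rewrite leNgt subr_gt0 ab.
Qed.

Lemma ac_lineM e f1 g1 f2 g2 x :
  measurable_fun setT f1 -> measurable_fun setT f2 ->
  measurable_fun setT g1 -> measurable_fun setT g2 ->
  ac_line e f1 g1 x -> ac_line e f2 g2 x ->
  ac_line e (fun x => f1 x * f2 x) (fun x => f1 x * g2 x + f2 x * g1 x) x.
Proof.
move=> mf1 mf2 mg1 mg2 [U [pU U0 U1 Uf]] [V [pV V0 V1 Vf]].
exists (fun s => U s * V s); split; [|by rewrite U0 V0|by rewrite U1 V1|].
- apply: ae_eq_primitive01 (primitive01M pU pV) _ _.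
    by apply: measurable_funD; apply: measurable_funM; exact: measurable_fun_line.
  by apply: ae_imp2 Uf Vf => s Us Vs s01; rewrite Us// Vs.
- by apply: ae_imp2 Uf Vf => s Us Vs s01; rewrite Us// Vs.
Qed.

Lemma ac_linesM e f1 g1 f2 g2 :
  measurable_fun setT f1 -> measurable_fun setT f2 ->
  measurable_fun setT g1 -> measurable_fun setT g2 ->
  ac_lines e f1 g1 -> ac_lines e f2 g2 ->
  ac_lines e (fun x => f1 x * f2 x) (fun x => f1 x * g2 x + f2 x * g1 x).
Proof. by move=> *; apply: (@ae_imp2 _ _ _ leb (ac_line e f1 g1) (ac_line e f2 g2)) => // x; exact: ac_lineM. Qed.

Lemma ac_lines_powR e f g (p : R) : 1 < p -> (forall x, 0 <= f x) ->
  measurable_fun setT f -> measurable_fun setT g ->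
  ac_lines e f g ->
  ac_lines e (fun x => f x `^ p) (fun x => p * f x `^ (p - 1) * g x).
Proof.
move=> p1 f0 mf mg; apply: ae_imp => x [U [pU U0 U1 Uf]].
exists (fun s => U s `^ p); split; [|by rewrite U0|by rewrite U1|].
- have pU' : primitive01 (fun s => U s `^ p) (fun s => p * U s `^ (p - 1) * g (x + s *: e)).
    apply: primitive01_powR => //; right; split => //.
    apply: within_ae_ge0; first exact: primitive01_cont pU.
    by apply: ae_imp Uf => s H /H ->.
  apply: ae_eq_primitive01 pU' _ _.
    apply: (@measurable_fun_line e (fun x => p * f x `^ (p - 1) * g x)).
    apply: measurable_funM => //; apply: measurable_funM => //.
    exact: (measurableT_comp (measurable_powR _)).
  by apply: ae_imp Uf => s H /H ->.
- by apply: ae_imp Uf => s H /H ->.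
Qed.

Lemma eq_ac_lines e f g f' g' : measurable_fun setT g' ->
  {ae leb, forall x, f' x = f x} -> {ae leb, forall x, g' x = g x} ->
  ac_lines e f g -> ac_lines e f' g'.
Proof.
move=> mg' ff gg ac.
apply: ae_imp2 (ae_and ac (ae_and ff (ae_shift e ff))) (ae_and (ae_line e ff) (ae_line e gg)).
move=> x [[U [pU U0 U1 Uf]] [fx fxe]] [fs gs].
exists U; split; [|by rewrite U0|by rewrite U1|].
- apply: ae_eq_primitive01 pU _ _; first exact: measurable_fun_line.
  by apply: ae_imp gs => s ->.
- by apply: ae_imp2 Uf fs => s Us -> /Us.
Qed.

Lemma integrable_line e g : leb.-integrable setT (EFin \o g) ->
  (leb \x mu)%E.-integrable setT
    (fun z => (g (z.1 + z.2 *: e) * \1_(`[0, 1]%classic : set R) z.2)%:E).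
Proof.
move=> ig.
have mg : measurable_fun setT (EFin \o g) by exact: measurable_int ig.
have mgr : measurable_fun setT g by apply/measurable_EFinP.
pose h (z : T * R) : \bar R := (g (z.1 + z.2 *: e) * \1_(`[0, 1]%classic : set R) z.2)%:E.
have mh : measurable_fun setT h.
  apply/measurable_EFinP; apply: measurable_funM.
    exact: (measurableT_comp mgr (measurable_line e)).
  by apply: measurableT_comp => //; exact: measurable_indic.
have habs s : (\int[leb]_x `|h (x, s)| = \int[leb]_x `|(g x)%:E| * (\1_(`[0%R, 1%R]%classic : set R) s)%:E)%E.
  rewrite -ge0_integralZr//; last exact: measurableT_comp.
  rewrite -[RHS](integral_shift (s *: e)).
    apply: eq_integral => x _; rewrite /h /= normrM [`|\1_ _ _|]ger0_norm//.
  by apply: emeasurable_funM => //; exact: measurableT_comp.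
apply/(integrable21ltyP leb mu mh).
under eq_integral do rewrite habs.
  rewrite ge0_integralZl//; last 2 first.
    by apply/measurable_EFinP; exact: measurable_indic.
    by apply: integral_ge0.
  rewrite integral_indic01 mule1.
  by have /integrableP[] := ig.
Qed.

Lemma ac_lines_integral0 e f g : ac_lines e f g ->
  leb.-integrable setT (EFin \o f) -> leb.-integrable setT (EFin \o g) ->
  (\int[leb]_x (g x)%:E = 0)%E.
Proof.
move=> ac if_ ig.
have mf : measurable_fun setT (EFin \o f) by exact: measurable_int if_.
have mg : measurable_fun setT (EFin \o g) by exact: measurable_int ig.
have mfr : measurable_fun setT f by apply/measurable_EFinP.
have mgr : measurable_fun setT g by apply/measurable_EFinP.
have ih := integrable_line e ig.
set h : T * R -> \bar R := (fun z => _) in ih.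
have := Fubini ih.
have -> : (\int[leb]_x \int[mu]_y h (x, y) = \int[leb]_x ((f (x + e))%:E - (f x)%:E))%E.
  apply: ae_eq_integral => //.
  - exact: measurable_fubini_F ih.
  - apply: emeasurable_funB => //.
    exact: (measurableT_comp mf (@measurable_shift R m n e)).
  apply: ae_imp ac => x [U [pU U0 U1 _]] _.
  have [ig' Ug] := pU.
  rewrite -U1 -U0 Ug ?ler01 ?lexx// -EFinB addrC addKr /Rintegral fineK; last first.
    exact: integrable_fin_num.
  rewrite [RHS]integral_mkcond; apply: eq_integral => s _.
  by rewrite /h/= patchE indicE; case: ifPn; rewrite ?mulr1 ?mulr0.
have ishift : leb.-integrable setT (fun x => (f (x + e))%:E).
  apply/integrableP; split.
    exact: (measurableT_comp mf (@measurable_shift R m n e)).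
  rewrite (@integral_shift _ _ _ e (fun x => `|(f x)%:E|%E)).
    by have /integrableP[] := if_.
  exact: measurableT_comp.
rewrite integralB//.
rewrite (@integral_shift _ _ _ e (fun x => (f x)%:E))// subee; last exact: integrable_fin_num.
have -> : (\int[mu]_y \int[leb]_x h (x, y) = \int[leb]_x (g x)%:E)%E.
  transitivity (\int[mu]_s ((\int[leb]_x (g x)%:E) * (\1_(`[0%R, 1%R]%classic : set R) s)%:E))%E.
    apply: eq_integral => s _.
    have ig' : leb.-integrable setT (fun x => (g (x + s *: e))%:E).
      apply/integrableP; split.
        exact: (measurableT_comp mg (@measurable_shift R m n _)).
      rewrite (@integral_shift _ _ _ (s *: e) (fun x => `|(g x)%:E|%E)).
        by have /integrableP[] := ig.
      exact: measurableT_comp.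
    rewrite -[in RHS](@integral_shift _ _ _ (s *: e) (fun x => (g x)%:E))//.
    by rewrite -integralZr.
  have gfin : (\int[leb]_x (g x)%:E)%E \is a fin_num by exact: integrable_fin_num.
  rewrite -(fineK gfin) integralZl//; last first.
    apply/integrableP; split; first by apply/measurable_EFinP; exact: measurable_indic.
    under eq_integral do rewrite gee0_abs ?lee_fin//.
    by rewrite integral_indic01 ltry.
  by rewrite integral_indic01 mule1.
by move=> <-.
Qed.

End ac_lines.

Section ac_lines_limit.
Variables (R : realType) (m n : nat).
Local Notation T := 'M[R]_(m, n).
Local Notation leb := (lebesgue_mx R m n).
Local Notation mu := (@lebesgue_measure R).
Implicit Types (e : T) (f g : T -> R).

Lemma ae_integrable_line e (W : T -> R) : leb.-integrable setT (EFin \o W) ->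
  {ae leb, forall x, mu.-integrable `[0, 1] (EFin \o (fun s => W (x + s *: e)))}.
Proof.
move=> iW; apply: ae_imp (ae_integrable1 (integrable_line e iW)) => x H.
rewrite integrable_mkcond//.
apply: eq_integrable H => // s _; rewrite patchE/= indicE.
by case: ifPn => _; rewrite ?mulr1 ?mulr0.
Qed.

Lemma ac_lines_lim e (f_ g_ : nat -> T -> R) f g (W : T -> R) :
  (forall k, ac_lines e (f_ k) (g_ k)) -> measurable_fun setT g ->
  {ae leb, forall x, f_ ^~ x @ \oo --> f x} ->
  {ae leb, forall x, g_ ^~ x @ \oo --> g x} ->
  {ae leb, forall x, forall k, `|g_ k x| <= 1 + W x} ->
  leb.-integrable setT (EFin \o W) ->
  ac_lines e f g.
Proof.
move=> ac mg ff gg gW iW.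
have ac' : {ae leb, forall x, forall k, ac_line e (f_ k) (g_ k) x} by exact: ae_foralln.
have A1 := ae_and ff (ae_shift e ff).
have A2 := ae_and (ae_line e ff) (ae_and (ae_line e gg) (ae_line e gW)).
apply: ae_imp2 (ae_and ac' (ae_integrable_line e iW)) (ae_and A1 A2).
move=> x [/choice[U_ U_P] iWx] [[ffx ffxe] [fl [gl gWl]]].
have iW1 : mu.-integrable `[0, 1] (EFin \o (fun s => 1 + W (x + s *: e))).
  apply: (@integrableD _ _ _ mu `[0, 1]%classic _ (EFin \o cst 1) _ _ iWx) => //.
  by apply: integrable01_cont; apply: continuous_subspaceT => s; exact: cvg_cst.
have mgl : measurable_fun (`[0, 1]%classic : set R) (fun s : R => g (x + s *: e)).
  exact: measurable_fun_line.
have gl' : {ae mu, forall s, s \in `[0, 1] -> g_ ^~ (x + s *: e) @ \oo --> g (x + s *: e)}.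
  exact: ae_imp gl.
have gWl' : {ae mu, forall s, s \in `[0, 1] -> forall k, `|g_ k (x + s *: e)| <= 1 + W (x + s *: e)}.
  exact: ae_imp gWl.
have ffx' : U_ ^~ 0 @ \oo --> f x.
  by apply: cvg_trans ffx; apply: near_eq_cvg; apply: nearW => k; case: (U_P k).
have pU_ k : primitive01 (U_ k) (fun s => g_ k (x + s *: e)) by case: (U_P k).
have [pU UU] := primitive01_lim pU_ mgl gl' gWl' iW1 ffx'.
exists (fun t => f x + \int[mu]_(s in `[0, t]) g (x + s *: e)); split => //.
- by rewrite set_itv1 Rintegral_set1 addr0.
- have H1 : U_ ^~ 1 @ \oo --> f (x + e).
    by apply: cvg_trans ffxe; apply: near_eq_cvg; apply: nearW => k; case: (U_P k).
  by apply: cvg_unique H1 => //; apply: UU; rewrite ler01 lexx.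
- have H : {ae mu, forall s, forall k, s \in `[0, 1] -> U_ k s = f_ k (x + s *: e)}.
    by apply: ae_foralln => k; case: (U_P k).
  apply: ae_imp2 H fl => s Hs fs s01.
  have Hs' : U_ ^~ s @ \oo --> f (x + s *: e).
    by apply: cvg_trans fs; apply: near_eq_cvg; apply: nearW => k; rewrite Hs.
  by apply: cvg_unique Hs' => //; apply: UU; rewrite in_itv in s01.
Qed.

Lemma ac_everywhere_param e d (S : measurableType d)
    (mm : {sigma_finite_measure set S -> \bar R}) (k k' : S -> T -> R) :
  measurable_fun setT (fun z : S * T => k' z.1 z.2) ->
  (forall a, ac_everywhere e (k a) (k' a)) ->
  (forall x, mm.-integrable setT (fun a => (k a x)%:E)) ->
  (forall x, (\int[mm]_a \int[mu]_(s in `[0%R, 1%R]) `|(k' a (x + s *: e))%:E| < +oo)%E) ->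
  ac_everywhere e (fun x => \int[mm]_a k a x) (fun x => \int[mm]_a k' a x).
Proof.
move=> mk' ack ik ik' x.
apply: (@primitive01_param _ _ _ mm (fun a s => k a (x + s *: e)) (fun a s => k' a (x + s *: e))) => //.
- have ms : measurable_fun setT (fun z : S * R => (z.1, x + z.2 *: e)).
    by apply: measurable_fun_pair => //; exact: (measurableT_comp (measurable_line1 e x)).
  exact: (measurableT_comp mk' ms).
- by move=> a; exact: ack.
Qed.

Lemma ac_everywhereM e f1 g1 f2 g2 :
  ac_everywhere e f1 g1 -> ac_everywhere e f2 g2 ->
  ac_everywhere e (fun x => f1 x * f2 x) (fun x => f1 x * g2 x + f2 x * g1 x).
Proof. by move=> H1 H2 x; exact: primitive01M (H1 x) (H2 x). Qed.

Lemma ac_everywhere_powR e f g (r : R) : (forall x, 0 < f x) ->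
  ac_everywhere e f g ->
  ac_everywhere e (fun x => f x `^ r) (fun x => r * f x `^ (r - 1) * g x).
Proof. by move=> f0 H x; apply: (primitive01_powR (H x)); left. Qed.

Lemma eq_ac_everywhere e f g f' g' : f =1 f' -> g =1 g' ->
  ac_everywhere e f g -> ac_everywhere e f' g'.
Proof. by move=> /funext -> /funext ->. Qed.

Lemma ac_everywhere_invariant e f : (forall x s, f (x + s *: e) = f x) ->
  ac_everywhere e f (fun=> 0).
Proof.
move=> fe x; rewrite (_ : (fun s => _) = fun=> f x).
  exact: primitive01_cst.
by apply/funext => s.
Qed.

End ac_lines_limit.

Section rows.
Variables (R : realType) (N d : nat).
Local Notation T := 'M[R]_(N, d).
Local Notation V := 'rV[R]_d.

Lemma row_shift (j k : 'I_N) (i : 'I_d) (X : T) (s : R) :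
  row k (X + s *: delta_mx j i) = row k X + s *: (if k == j then delta_mx ord0 i else 0).
Proof.
apply/rowP => l; rewrite !mxE; congr (_ + s * _).
by case: ifPn => kj; rewrite !mxE.
Qed.

Lemma negligible_row (j : 'I_N) (A : set V) : (lebesgue_mx R 1 d).-negligible A ->
  (lebesgue_mx R N d).-negligible [set X | A (row j X)].
Proof.
move=> [B [mB B0 AB]]; exists [set X : T | B (row j X)]; split.
- by rewrite -[X in measurable X]setTI; exact: measurable_row.
- have mBj : measurable [set X : T | B (row j X)].
    by rewrite -[X in measurable X]setTI; exact: measurable_row.
  pose g (k : 'I_N) (x : V) : \bar R := if k == j then (\1_B x)%:E else 1%E.
  have mg k : measurable_fun setT (g k).
    rewrite /g; case: (k == j) => //.
    by apply/measurable_EFinP; exact: measurable_indic.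
  have g0 k x : (0 <= g k x)%E by rewrite /g; case: ifP => // _; rewrite lee_fin.
  transitivity (\int[lebesgue_mx R N d]_X \prod_(k < N) g k (row k X))%E.
    rewrite (eq_integral (fun X => (\1_[set X : T | B (row j X)] X)%:E)).
      by rewrite integral_indic// setIT.
    move=> X _; rewrite (bigD1 j)//= big1 ?mule1.
      by rewrite /g eqxx !indicE.
    by move=> k kj; rewrite /g (negbTE kj).
  rewrite integral_rows_prod// (bigD1 j)//=.
  have -> : (\int[lebesgue_row R d]_x g j x = 0)%E; last by rewrite mul0e.
  rewrite -integral_lebesgue_mx1//.
  rewrite (eq_integral (fun x => (\1_B x)%:E)); last by move=> x _; rewrite /g eqxx.
  by rewrite integral_indic// setIT.
- by move=> X; exact: AB.
Qed.

Lemma ae_row (j : 'I_N) (P : V -> Prop) : {ae lebesgue_mx R 1 d, forall x, P x} ->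
  {ae lebesgue_mx R N d, forall X, P (row j X)}.
Proof. exact: negligible_row. Qed.

Lemma ac_lines_row (j : 'I_N) (i : 'I_d) (f g : V -> R) :
  ac_lines (delta_mx ord0 i) f g ->
  ac_lines (delta_mx j i) (fun X : T => f (row j X)) (fun X => g (row j X)).
Proof.
move=> /(ae_row j); apply: ae_imp => X [U [pU U0 U1 Uf]].
have rE s : row j (X + s *: delta_mx j i) = row j X + s *: delta_mx ord0 i.
  by rewrite row_shift eqxx.
exists U; split => //.
- by under eq_fun do rewrite rE.
- by have := rE 1; rewrite !scale1r => ->.
- by apply: ae_imp Uf => s H /H; rewrite rE.
Qed.

Lemma ac_everywhere_row (j : 'I_N) (i : 'I_d) (f g : V -> R) :
  ac_everywhere (delta_mx ord0 i) f g ->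
  ac_everywhere (delta_mx j i) (fun X : T => f (row j X)) (fun X => g (row j X)).
Proof.
move=> H X.
have rE s : row j (X + s *: delta_mx j i) = row j X + s *: delta_mx ord0 i.
  by rewrite row_shift eqxx.
by under eq_fun do rewrite rE; under [X in primitive01 _ X]eq_fun do rewrite rE.
Qed.

Lemma ac_everywhere_other_row (j k : 'I_N) (i : 'I_d) (f : V -> R) : k != j ->
  ac_everywhere (delta_mx j i) (fun X : T => f (row k X)) (fun=> 0).
Proof.
move=> kj; apply: ac_everywhere_invariant => X s.
by rewrite row_shift (negbTE kj) scaler0 addr0.
Qed.

End rows.

Section smooth1.
Variable R : realType.

(* t^{-k} e^{-1/t} for t > 0, extended by 0 *)
Definition flat k (t : R) : R := if 0 < t then t ^- k * expR (- t^-1) else 0.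

Lemma flat_ge0 k t : 0 <= flat k t.
Proof. by rewrite /flat; case: ifP => // t0; rewrite mulr_ge0 ?expR_ge0// invr_ge0 exprn_ge0// ltW. Qed.

Lemma expRN_le k (y : R) : 0 < y -> y ^+ k * expR (- y) <= k.+1%:R ^+ k.
Proof.
move=> y0; rewrite expRN ler_pdivrMr ?expR_gt0//.
have k0 : 0 < k.+1%:R :> R by [].
have -> : y = k.+1%:R * (y / k.+1%:R) by rewrite mulrC divfK ?gt_eqF.
rewrite expRM_natl exprMn ler_wpM2l ?exprn_ge0//.
set z := y / _.
have z0 : 0 < z by rewrite divr_gt0.
have z1 : z <= expR z by rewrite (le_trans _ (expR_ge1Dx z))// lerDr.
rewrite (@le_trans _ _ (expR z ^+ k))//.
  by apply: lerXn2r => //; rewrite nnegrE ltW// expR_gt0.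
by apply: ler_weXn2l => //; rewrite (le_trans _ (expR_ge1Dx z))// lerDl ltW.
Qed.

Lemma flat_bound k (t : R) : 0 < t -> flat k t <= k.+3%:R ^+ k.+2 * t ^+ 2.
Proof.
move=> t0; rewrite /flat t0.
have := @expRN_le k.+2 t^-1; rewrite invr_gt0 => /(_ t0) H.
have -> : t ^- k * expR (- t^-1) = t^-1 ^+ k.+2 * expR (- t^-1) * t ^+ 2.
  rewrite -exprVn exprSr exprSr expr2.
  by field; rewrite gt_eqF.
by rewrite ler_wpM2r// exprn_ge0// ltW.
Qed.

Lemma is_derive_flat k (t : R) : is_derive t (1 : R) (flat k)
  (- k%:R * flat k.+1 t + flat k.+2 t).
Proof.
have [t0|t0|->] := ltgtP t 0.
- have H : \forall y \near t, cst 0 y = flat k y.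
    near=> y; rewrite /flat ltNge ltW//=.
    near: y; exact: lt_nbhsl.
  rewrite /flat !ltNge ltW//= mulr0 addr0.
  exact: near_eq_is_derive H (is_derive_cst _ _ _).
- have H : \forall y \near t, (fun y : R => y ^- k * expR (- y^-1)) y = flat k y.
    near=> y; rewrite /flat ifT//.
    near: y; exact: lt_nbhsr.
  have tn0 : t != 0 by rewrite gt_eqF.
  have dV : is_derive t (1 : R) (fun y : R => y^-1) (- t ^- 2).
    have := @is_deriveV R id t 1 1 tn0 (is_derive_id _ _).
    by move=> D0; apply: is_derive_eq D0 _; rewrite /GRing.scale/= mulr1.
  have D : is_derive t (1:R) (fun y : R => y ^- k * expR (- y^-1))
      (- k%:R * (t ^- k.+1 * expR (- t^-1)) + t ^- k.+2 * expR (- t^-1)).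
    rewrite (_ : (fun y : R => y ^- k * expR (- y^-1)) = (fun y => (y^-1) ^+ k * expR (- y^-1))); last first.
      by apply/funext => y; rewrite exprVn.
    have d1 : is_derive t (1:R) (fun y : R => - y^-1) (t ^- 2).
      by rewrite -[t ^- 2]opprK; exact: is_deriveN.
    have d2 := @is_derive1_comp R expR (fun y : R => - y^-1) t _ _ (is_derive_expR _) d1.
    have d3 := @is_deriveX R R (fun y : R => y^-1) k t 1 _ dV.
    have := @is_deriveM R R _ _ t 1 _ _ d3 d2.
    move=> D0.
    have fE : (fun y : R => y^-1 ^+ k * expR (- y^-1)) =
        (fun y : R => y^-1) ^+ k * (expR \o (fun y : R => - y^-1)).
      by apply/funext => y; rewrite mulrfctE exprfctE.
    rewrite fE; apply: is_derive_eq D0 _; rewrite exprfctE /GRing.scale /=.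
    case: k {H d3 fE} => [|k]; rewrite -!exprVn !exprS ?expr0; first by field.
    by rewrite /=; field.
  rewrite /flat t0.
  exact: near_eq_is_derive H D.
- rewrite {2 3}/flat ltxx mulr0 addr0.
  set C : R := k.+3%:R ^+ k.+2.
  have C0 : 0 < C by rewrite exprn_gt0.
  have H : (fun h : R => h^-1 *: ((flat k \o shift 0) (h *: 1) - flat k 0)) @ 0^' --> (0 : R).
    apply/cvgrPdist_le => e e0.
    near=> h.
    rewrite sub0r normrN /= addr0 {2}/flat ltxx subr0 /GRing.scale/= mulr1.
    have [h0|h0] := leP h 0; first by rewrite /flat ltNge h0/= mulr0 normr0 ltW.
    rewrite ger0_norm ?mulr_ge0 ?invr_ge0 ?flat_ge0 ?(ltW h0)//.
    rewrite mulrC ler_pdivrMr// (le_trans (flat_bound k h0))// -/C expr2 mulrA ler_wpM2r ?(ltW h0)//.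
    rewrite -ler_pdivlMl// mulrC.
    have : `|h| <= e / C.
      near: h; apply: dnbhs0_le; rewrite divr_gt0//.
    by rewrite gtr0_norm.
  split; first by apply/cvg_ex; exists 0.
  exact: cvg_lim H.
Unshelve. all: end_near. Qed.

End smooth1.

Section smooth_class.
Variable R : realType.

(* a class of smooth functions of one variable, closed under primitives *)
Inductive smooth1 : (R -> R) -> Prop :=
| smooth1_flat k a b : smooth1 (fun t => flat k (a * t + b))
| smooth1_cst c : smooth1 (fun=> c)
| smooth1_add f g : smooth1 f -> smooth1 g -> smooth1 (fun t => f t + g t)
| smooth1_mul f g : smooth1 f -> smooth1 g -> smooth1 (fun t => f t * g t)
| smooth1_shift c f : smooth1 f -> smooth1 (fun t => f (t + c))
| smooth1_prim f f' : (forall t : R, is_derive t (1 : R) f (f' t)) -> smooth1 f' -> smooth1 f.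

Lemma is_derive_affine (a b t : R) : is_derive t (1 : R) (fun t : R => a * t + b) a.
Proof.
have H1 : is_derive t (1 : R) (fun t : R => a * t) (a *: 1) by exact: is_deriveZ.
have H2 : is_derive t (1 : R) (fun t : R => b) 0 by exact: is_derive_cst.
have := is_deriveD H1 H2; rewrite addr0 /GRing.scale/= mulr1.
by [].
Qed.

Lemma smooth1_derive f : smooth1 f ->
  exists2 f', smooth1 f' & forall t : R, is_derive t (1 : R) f (f' t).
Proof.
elim=> {f} [k a b|c|f g _ [f' sf df] _ [g' sg dg]|f g sf0 [f' sf df] sg0 [g' sg dg]|
  c f _ [f' sf df]|f f' df sf _].
- exists (fun t => a * (- k%:R * flat k.+1 (a * t + b) + flat k.+2 (a * t + b))).
    apply: (smooth1_mul (smooth1_cst a)); apply: smooth1_add; last exact: smooth1_flat.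
    by apply: (smooth1_mul (smooth1_cst _)); exact: smooth1_flat.
  move=> t; have := @is_derive1_comp R (flat k) (fun t : R => a * t + b) t _ _
    (is_derive_flat k _) (is_derive_affine a b t).
  by move=> D; apply: is_derive_eq D _; rewrite mulrC.
- by exists (fun=> 0) => [|t]; [exact: smooth1_cst|exact: is_derive_cst].
- exists (fun t => f' t + g' t); first exact: smooth1_add.
  by move=> t; have := is_deriveD (df t) (dg t).
- exists (fun t => f t * g' t + g t * f' t).
    by apply: smooth1_add; apply: smooth1_mul.
  by move=> t; have := is_deriveM (df t) (dg t).
- exists (fun t => f' (t + c)); first exact: smooth1_shift.
  move=> t; have D1 : is_derive t (1 : R) (fun t : R => t + c) 1.
    by have := is_derive_affine 1 c t; under eq_fun do rewrite mul1r.
  by have := @is_derive1_comp R f (fun t => t + c) t _ _ (df (t + c)) D1; rewrite mulr1.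
- by exists f'.
Qed.

Lemma smooth1_continuous f : smooth1 f -> continuous f.
Proof.
move=> /smooth1_derive[f' _ df] t; apply: differentiable_continuous.
by apply/derivable1_diffP; case: (df t).
Qed.

Variables m n : nat.
Local Notation T := 'M[R]_(m, n).

Inductive smooth_poly : (T -> R) -> Prop :=
| smooth_poly_coord i j f : smooth1 f -> smooth_poly (fun x => f (x i j))
| smooth_poly_cst c : smooth_poly (fun=> c)
| smooth_poly_add f g : smooth_poly f -> smooth_poly g -> smooth_poly (fun x => f x + g x)
| smooth_poly_mul f g : smooth_poly f -> smooth_poly g -> smooth_poly (fun x => f x * g x).

Lemma smooth_poly_continuous f : smooth_poly f -> continuous f.
Proof.
elim=> {f} [i j f sf|c|f g _ cf _ cg|f g _ cf _ cg] x.
- apply: (@continuous_comp _ _ _ (fun x : T => x i j) f).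
    exact: coord_continuous.
  exact: smooth1_continuous.
- exact: cst_continuous.
- exact: (cvgD (cf x) (cg x)).
- exact: (cvgM (cf x) (cg x)).
Qed.

Lemma smooth_poly_derive (i0 : 'I_m) (j0 : 'I_n) f : smooth_poly f ->
  exists2 f', smooth_poly f' & forall x, is_derive x (delta_mx i0 j0 : T) f (f' x).
Proof.
elim=> {f} [i j f sf|c|f g sf0 [f' sf df] sg0 [g' sg dg]|f g sf0 [f' sf df] sg0 [g' sg dg]].
- have [f' sf' df] := smooth1_derive sf.
  exists (fun x => f' (x i j) * ((delta_mx i0 j0 : T) i j)).
    by apply: smooth_poly_mul; [exact: smooth_poly_coord|exact: smooth_poly_cst].
  move=> x.
  have [E|E] := eqVneq ((delta_mx i0 j0 : T) i j) 0.
    rewrite E mulr0.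
    have H h : f ((h *: (delta_mx i0 j0 : T) + x) i j) - f (x i j) = 0.
      by rewrite !mxE; move: E; rewrite mxE => ->; rewrite mulr0 add0r subrr.
    have H' : (fun h : R => h^-1 *: ((f \o (fun x : T => x i j) \o shift x) (h *: (delta_mx i0 j0 : T)) - f (x i j))) @ 0^' --> (0 : R).
      rewrite (_ : (fun h => _) = cst 0); first exact: cvg_cst.
      by apply/funext => h; rewrite /= H scaler0.
    split; first by apply/cvg_ex; exists 0.
    exact: cvg_lim H'.
  have E1 : (delta_mx i0 j0 : T) i j = 1.
    by move: E; rewrite mxE; case: (_ && _) => //=; rewrite eqxx.
  rewrite E1 mulr1.
  have [Dx Ex] := df (x i j).
  have H : (fun h : R => h^-1 *: ((f \o (fun x : T => x i j) \o shift x) (h *: (delta_mx i0 j0 : T)) - f (x i j)))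
    = (fun h : R => h^-1 *: ((f \o shift (x i j)) (h *: 1) - f (x i j))).
    apply/funext => h /=; congr (_ *: (f _ - _)).
    by rewrite !mxE; move: E1; rewrite mxE => ->.
  split; first by rewrite /derivable H.
  by rewrite /derive H.
- by exists (fun=> 0) => [|x]; [exact: smooth_poly_cst|exact: is_derive_cst].
- exists (fun t => f' t + g' t); first exact: smooth_poly_add.
  by move=> t; have := is_deriveD (df t) (dg t).
- exists (fun t => f t * g' t + g t * f' t).
    by apply: smooth_poly_add; apply: smooth_poly_mul.
  by move=> t; have := is_deriveM (df t) (dg t).
Qed.

Lemma smooth_poly_partial ij f : smooth_poly f -> smooth_poly (partial ij f).
Proof.
move=> /(smooth_poly_derive ij.1 ij.2)[f' sf' df].
suff -> : partial ij f = f' by [].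
by apply/funext => x; rewrite /partial; have [_ ->] := df x.
Qed.

Lemma smooth_poly_smooth f : smooth_poly f -> smooth f.
Proof.
move=> sf s.
have spsi : smooth_poly (foldr (@partial R m n) f s).
  by elim: s => //= ij s; exact: smooth_poly_partial.
split; first exact: smooth_poly_continuous.
move=> ij x; have [g _ dg] := smooth_poly_derive ij.1 ij.2 spsi.
by case: (dg x).
Qed.

Lemma smooth_poly_prod (I : Type) (r : seq I) (F : I -> T -> R) :
  (forall i, smooth_poly (F i)) -> smooth_poly (fun x => \prod_(i <- r) F i x).
Proof.
move=> sF; elim: r => [|i r IH].
  by under eq_fun do rewrite big_nil; exact: smooth_poly_cst.
by under eq_fun do rewrite big_cons; exact: smooth_poly_mul.
Qed.

End smooth_class.

Section density_measure.
Local Open Scope ereal_scope.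
Context d (T : measurableType d) (R : realType) (mu : {measure set T -> \bar R}).
Variable (f : T -> \bar R).

Definition density_measure of measurable_fun setT f & (forall x, 0 <= f x) :=
  fun A => \int[mu]_(x in A) f x.

Hypotheses (mf : measurable_fun setT f) (f0 : forall x, 0 <= f x).

Let density_measure0 : density_measure mf f0 set0 = 0.
Proof. exact: integral_set0. Qed.

Let density_measure_ge0 A : 0 <= density_measure mf f0 A.
Proof. exact: integral_ge0. Qed.

Let density_measure_sigma_additive : semi_sigma_additive (density_measure mf f0).
Proof.
move=> F mF tF mUF; rewrite /density_measure ge0_integral_bigcup//; last first.
  exact: measurable_funTS.
by apply: is_cvg_ereal_nneg_natsum_cond => n _ _; exact: integral_ge0.
Qed.

HB.instance Definition _ := isMeasure.Build _ _ _ (density_measure mf f0)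
  density_measure0 density_measure_ge0 density_measure_sigma_additive.

End density_measure.

Lemma cvg_prodr (R : realType) (I : Type) (r : seq I) (F : I -> nat -> R) (l : I -> R) :
  (forall i, F i @ \oo --> l i) ->
  \prod_(i <- r) F i k @[k --> \oo] --> \prod_(i <- r) l i.
Proof.
move=> Fl; elim: r => [|i r IH].
  by rewrite big_nil; under eq_cvg do rewrite big_nil; exact: cvg_cst.
by rewrite big_cons; under eq_cvg do rewrite big_cons; exact: cvgM.
Qed.

Section box_bump.
Variable R : realType.

Definition bump1 (a b : R) (k : nat) (t : R) : R :=
  flat 0 (k.+1%:R * t + - (k.+1%:R * a)) * flat 0 (- k.+1%:R * t + k.+1%:R * b).

Lemma smooth1_bump a b k : smooth1 (bump1 a b k).
Proof. by apply: smooth1_mul; exact: smooth1_flat. Qed.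

Lemma flat0_le1 (t : R) : flat 0 t <= 1.
Proof.
rewrite /flat; case: ifP => // t0; rewrite expr0 invr1 mul1r.
by rewrite -[leRHS]expR0 ler_expR oppr_le0 invr_ge0 ltW.
Qed.

Lemma bump1_ge0 a b k t : 0 <= bump1 a b k t.
Proof. by rewrite mulr_ge0 ?flat_ge0. Qed.

Lemma bump1_le1 a b k t : bump1 a b k t <= 1.
Proof. by rewrite /bump1 mulr_ile1 ?flat_ge0 ?flat0_le1. Qed.

Lemma bump1_out a b k t : ~~ (a < t < b) -> bump1 a b k t = 0.
Proof.
rewrite negb_and -!leNgt /bump1 /flat => /orP[ta|bt].
  rewrite ifF ?mul0r//; apply/negbTE; rewrite -leNgt -mulrBr.
  by rewrite mulr_ge0_le0// subr_le0.
rewrite [X in _ * X]ifF ?mulr0//; apply/negbTE; rewrite -leNgt mulNr addrC -mulrBr.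
by rewrite mulr_ge0_le0// subr_le0.
Qed.

Lemma flat0_cvg (c : R) : 0 < c -> flat 0 (k.+1%:R * c) @[k --> \oo] --> (1 : R).
Proof.
move=> c0; rewrite (_ : (fun k => _) = (fun k => expR (- (c^-1 * k.+1%:R^-1)))); last first.
  apply/funext => k; rewrite /flat mulr_gt0// expr0 invr1 mul1r; congr (expR (- _)).
  by rewrite invfM mulrC.
rewrite -[X in _ --> X]expR0; apply: continuous_cvg; first exact: continuous_expR.
rewrite -[X in _ --> X]oppr0; apply: cvgN; rewrite -[X in _ --> X](mulr0 c^-1).
by apply: cvgM; [exact: cvg_cst|exact: cvg_harmonic].
Qed.

Lemma bump1_cvg a b t : bump1 a b k t @[k --> \oo] --> ((a < t < b)%R%:R : R).
Proof.
have [/andP[at_ tb]|H] := boolP (a < t < b); last first.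
  rewrite (_ : (fun k => _) = fun=> 0); first exact: cvg_cst.
  by apply/funext => k; rewrite bump1_out.
rewrite /= -[X in _ --> X](mulr1 1); apply: cvgM.
  rewrite (_ : (fun k => _) = (fun k => flat 0 (k.+1%:R * (t - a)))).
    by apply: flat0_cvg; rewrite subr_gt0.
  by apply/funext => k; rewrite mulrBr.
rewrite (_ : (fun k => _) = (fun k => flat 0 (k.+1%:R * (b - t)))).
  by apply: flat0_cvg; rewrite subr_gt0.
by apply/funext => k; congr flat; ring.
Qed.

End box_bump.

Section cubes.
Variables (R : realType) (m n : nat).
Local Notation T := 'M[R]_(m, n).
Local Notation leb := (lebesgue_mx R m n).

Lemma continuous_measurable_mx (f : T -> R) : continuous f -> measurable_fun setT f.
Proof.
move=> /continuousP cf; apply: (measurability _ (RGenOpens.measurableE R)).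
move=> _ [_ [a [b ->] <-]]; rewrite setTI.
by apply: open_measurable_mx; apply: cf; exact: interval_open.
Qed.

Definition cube (M : R) := [set x : T | forall i j, `|x i j| <= M].

Lemma le_entry_norm (x : T) i j : `|x i j| <= `|x|.
Proof.
by rewrite [leRHS]/Num.norm /= mx_normrE; apply/bigmax_geP; right => /=; exists (i, j).
Qed.

Lemma vec_mx_continuous : continuous (@vec_mx R m n).
Proof.
move=> v A /nbhs_ballP[e /= e0 eA]; apply/nbhs_ballP; exists e => //= w [_ vw].
by apply: eA; split => // i j; rewrite !mxE; exact: vw.
Qed.

Lemma compact_cube M : compact (cube M).
Proof.
have H : compact [set v : 'rV[R]_(m * n) | forall i, `[- M, M]%classic (v ord0 i)].
  by apply: (@rV_compact _ _ (fun=> `[- M, M]%classic)) => _; exact: segment_compact.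
rewrite (_ : cube M = @vec_mx R m n @` [set v : 'rV[R]_(m * n) | forall i, `[- M, M]%classic (v ord0 i)]).
  apply: continuous_compact => //; apply: continuous_subspaceT; exact: vec_mx_continuous.
apply/seteqP; split => [x xM|_ [v vM <-] i j]; last first.
  by rewrite mxE ler_norml; have := vM (mxvec_index i j); rewrite /= in_itv.
exists (mxvec x); last exact: mxvecK.
by move=> k /=; case/mxvec_indexP: k => i j; rewrite mxvecE in_itv/= -ler_norml.
Qed.

Lemma measurable_cube M : measurable (cube M).
Proof.
rewrite (_ : cube M = \bigcap_(i in [set: 'I_m]) \bigcap_(j in [set: 'I_n])
    ((fun x : T => x i j) @^-1` `[- M, M]%classic)); last first.
  apply/seteqP; split => [x xM i _ j _/=|x xM i j]; first by rewrite in_itv/= -ler_norml.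
  by have := xM i I j I; rewrite /= in_itv/= -ler_norml.
apply: fin_bigcap_measurable => // i _; apply: fin_bigcap_measurable => // j _.
rewrite -[X in measurable X]setTI; exact: measurable_coord.
Qed.

Lemma compact_sub_cube K : compact K -> exists2 M, 0 <= M & K `<=` cube M.
Proof.
move=> /compact_bounded[M [_ HM]]; exists (`|M| + 1); first by rewrite addr_ge0.
move=> x Kx i j; rewrite (le_trans (le_entry_norm x i j))//.
by apply: HM => //; rewrite ltr_pwDr// ler_norm.
Qed.

Definition box (a b : T) := [set x : T | forall i j, a i j < x i j < b i j].

Lemma measurable_box a b : measurable (box a b).
Proof.
rewrite (_ : box a b = \bigcap_(i in [set: 'I_m]) \bigcap_(j in [set: 'I_n])
    ((fun x : T => x i j) @^-1` `]a i j, b i j[%classic)); last first.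
  apply/seteqP; split => [x xM i _ j _/=|x xM i j]; first by rewrite in_itv/=.
  by have := xM i I j I; rewrite /= in_itv/=.
apply: fin_bigcap_measurable => // i _; apply: fin_bigcap_measurable => // j _.
rewrite -[X in measurable X]setTI; exact: measurable_coord.
Qed.

Definition box_bump (a b : T) k (x : T) : R :=
  \prod_(i < m) \prod_(j < n) bump1 (a i j) (b i j) k (x i j).

Lemma smooth_poly_box_bump a b k : smooth_poly (box_bump a b k).
Proof.
apply: smooth_poly_prod => i; apply: smooth_poly_prod => j.
by apply: smooth_poly_coord; exact: smooth1_bump.
Qed.

Lemma box_bump_ge0 a b k x : 0 <= box_bump a b k x.
Proof. by apply: prodr_ge0 => i _; apply: prodr_ge0 => j _; exact: bump1_ge0. Qed.

Lemma box_bump_le1 a b k x : box_bump a b k x <= 1.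
Proof.
apply: prodr_ile1 => i _; apply/andP; split.
  by apply: prodr_ge0 => j _; exact: bump1_ge0.
by apply: prodr_ile1 => j _; rewrite bump1_ge0 bump1_le1.
Qed.

Lemma box_bump_out a b k x : ~ box a b x -> box_bump a b k x = 0.
Proof.
move=> /existsNP[i /existsNP[j /negP xij]].
by rewrite /box_bump (bigD1 i)//= (bigD1 j)//= bump1_out// !mul0r.
Qed.

Lemma box_bump_cvg a b x : box_bump a b k x @[k --> \oo] --> (\1_(box a b) x : R).
Proof.
have -> : (\1_(box a b) x : R) = \prod_(i < m) \prod_(j < n) ((a i j < x i j < b i j)%R%:R : R).
  rewrite indicE; have [xab|/negP xab] := boolP (x \in box a b).
    rewrite big1// => i _; rewrite big1// => j _.
    by move: xab; rewrite inE => /(_ i j) ->.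
  have /existsNP[i /existsNP[j /negP xij]] : ~ box a b x by move=> /mem_set.
  by rewrite (bigD1 i)//= (bigD1 j)//= (negbTE xij) !mul0r.
by apply: cvg_prodr => i; apply: cvg_prodr => j; exact: bump1_cvg.
Qed.

Lemma test_function_cube f M : smooth f -> (forall x, f x != 0 -> cube M x) ->
  test_function f.
Proof.
move=> sf fM; split => //; have cM : closed (cube M).
  by apply: compact_closed; [exact: norm_hausdorff|exact: compact_cube].
apply: (@subclosed_compact _ (closure [set x | f x != 0]) (cube M)).
- exact: closed_closure.
- exact: compact_cube.
by rewrite [X in _ `<=` X](closure_id _).1//; apply: closure_subset => x /= /fM.
Qed.

Definition boxes : set (set T) := [set B | exists a b, B = box a b].

Lemma boxesI : setI_closed boxes.
Proof.
move=> _ _ [a [b ->]] [a' [b' ->]].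
exists (\matrix_(i, j) Num.max (a i j) (a' i j)), (\matrix_(i, j) Num.min (b i j) (b' i j)).
apply/seteqP; split => [x [H H'] i j|x H].
  by rewrite !mxE gt_max lt_min; move: (H i j) (H' i j) => /andP[? ?] /andP[? ?]; apply/andP; split; apply/andP.
by split => i j; have := H i j; rewrite !mxE gt_max lt_min => /andP[/andP[? ?] /andP[? ?]]; apply/andP.
Qed.

Lemma box_cover : \bigcup_k (box (const_mx (- k%:R)) (const_mx k%:R)) = setT.
Proof.
rewrite -subTset => x _; exists (Num.truncn `|x|).+1 => // i j; rewrite !mxE -ltr_norml.
by rewrite (le_lt_trans (le_entry_norm x i j))// truncnS_gt.
Qed.

Lemma measurable_boxes : (measurable : set (set T)) = <<s boxes >>.
Proof.
apply/seteqP; split; last first.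
  apply: smallest_sub; first exact: sigma_algebra_measurable.
  by move=> _ [a [b ->]]; exact: measurable_box.
pose T' := g_sigma_algebraType boxes.
have mid : measurable_fun setT (id : T' -> T).
  apply: measurable_fun_mx => i j.
  apply: (measurability _ (RGenOInfty.measurableE R)).
  move=> _ [_ [c ->] <-]; rewrite setTI.
  rewrite (_ : _ @^-1` _ = \bigcup_k (box (\matrix_(i', j') (if (i' == i) && (j' == j) then c else - k%:R))
      (const_mx k%:R) : set T')); last first.
    apply/seteqP; split => x /=; rewrite in_itv/= ?andbT.
      move=> cx; exists (Num.truncn `|x : T|).+1 => // i' j'; rewrite !mxE.
      have : `|x i' j'| < (Num.truncn `|x : T|).+1%:R.
        by rewrite (le_lt_trans (le_entry_norm (x : T) i' j'))// truncnS_gt.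
      rewrite ltr_norml => /andP[H1 ->]; rewrite andbT.
      by case: ifP => // /andP[/eqP -> /eqP ->].
    by move=> [k _ /(_ i j)]; rewrite !mxE !eqxx/= => /andP[].
  apply: bigcupT_measurable => k; apply: sub_sigma_algebra.
  by exists (\matrix_(i', j') (if (i' == i) && (j' == j) then c else - k%:R)), (const_mx k%:R).
by move=> A mA; have := mid measurableT A mA; rewrite setTI preimage_id.
Qed.

End cubes.

Section fundamental_lemma.
Variables (R : realType) (m n : nat).
Local Notation T := 'M[R]_(m, n).
Local Notation leb := (lebesgue_mx R m n).
Local Notation mu := (@lebesgue_measure R).

Lemma leb_cube_lty M : (leb (@cube R m n M) < +oo)%E.
Proof.
have mI : measurable_fun setT (fun t : R => (\1_(`[- M, M]%classic : set R) t : R)%:E).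
  by apply/measurable_EFinP; exact: measurable_indic.
pose g (i : 'I_m) (v : 'rV[R]_n) : \bar R :=
  (\prod_(j < n) (\1_(`[(- M)%R, M]%classic : set R) (v ord0 j))%:E)%E.
have -> : (leb (@cube R m n M) = \int[leb]_x \prod_(i < m) g i (row i x))%E.
  transitivity (\int[leb]_x (\1_(@cube R m n M) x)%:E)%E.
    by rewrite integral_indic// ?setIT//; exact: measurable_cube.
  apply: eq_integral => x _; rewrite indicE.
  have [xM|/negP xM] := boolP (x \in @cube R m n M).
    rewrite big1// => i _; rewrite /g big1// => j _; rewrite mxE indicE mem_set//=.
    by rewrite in_itv/= -ler_norml; move: xM; rewrite inE; exact.
  have /existsNP[i /existsNP[j /negP xij]] : ~ @cube R m n M x by move=> /mem_set.
  rewrite (bigD1 i)//= /g (bigD1 j)//= mxE indicE memNset ?mul0e//=.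
  by rewrite in_itv/= -ler_norml; exact/negP.
rewrite integral_rows_prod; last 2 first.
- move=> i; apply: emeasurable_prod => j _.
  exact: (measurableT_comp mI (measurable_coord ord0 j)).
- by move=> i v; apply: prode_ge0 => j _; rewrite lee_fin.
rewrite ltey_eq; apply/orP; left.
elim/big_ind: _ => // [x y|i _]; first exact: fin_numM.
rewrite (@integral_lebesgue_row_prod R n (fun _ t => (\1_(`[- M, M]%classic : set R) t)%:E)) => //.
elim/big_ind: _ => // [x y|j _]; first exact: fin_numM.
rewrite integral_indic//= setIT lebesgue_measure_itv/=.
by case: ifP.
Qed.

Lemma box_sub_cube (a b : T) : box a b `<=` @cube R m n (`|a| + `|b|).
Proof.
move=> x xab i j; have /andP[ax xb] := xab i j.
have := le_entry_norm a i j; have := le_entry_norm b i j.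
rewrite !ler_norml => /andP[b1 b2] /andP[a1 a2].
have := normr_ge0 a; have := normr_ge0 b.
by move=> ? ?; apply/andP; split; lra.
Qed.

Lemma bump_separates (f : T -> R) : measurable_fun setT f ->
  (forall M, leb.-integrable (cube M) (EFin \o f)) ->
  (forall a b k, \int[leb]_x (f x * box_bump a b k x) = 0) ->
  {ae leb, forall x, f x = 0}.
Proof.
move=> mf lf H.
have box_cube := box_sub_cube.
have box0 a b : (\int[leb]_(x in box a b) (f x)%:E = 0)%E.
  pose W : T -> \bar R := (EFin \o (fun x => `|f x|)) \_ (cube (`|a| + `|b|)).
  have mb k : measurable_fun setT (box_bump a b k).
    by apply: continuous_measurable_mx; apply: smooth_poly_continuous; exact: smooth_poly_box_bump.
  have iW : leb.-integrable setT W.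
    rewrite -integrable_mkcond; last exact: measurable_cube.
    exact: (@integrable_norm _ _ _ leb _ _ (lf _)).
  have [| | | | |ig _ DC] := @dominated_convergence _ _ R leb setT measurableT
    (fun k x => (f x * box_bump a b k x)%:E) (fun x => (f x * \1_(box a b) x)%:E) W.
  - by move=> k; apply/measurable_EFinP; apply: measurable_funM.
  - apply/measurable_EFinP; apply: measurable_funM => //.
    by apply: measurable_indic; exact: measurable_box.
  - apply: ae_all => x _; apply: cvg_EFin; first exact: nearW.
    by apply: cvgM; [exact: cvg_cst|exact: box_bump_cvg].
  - exact: iW.
  - apply: ae_all => x k _; rewrite /W patchE; case: ifPn => [_|/negP xc].
      by rewrite /= lee_fin normrM ler_piMr// ger0_norm ?box_bump_ge0 ?box_bump_le1.
    by rewrite box_bump_out ?mulr0 /= ?normr0 ?lexx// => /box_cube /mem_set.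
  have DC0 : (\int[leb]_x (f x * box_bump a b k x)%:E)%E @[k --> \oo] --> (0 : \bar R)%E.
    rewrite (_ : (fun k => _) = fun=> 0%E); first exact: cvg_cst.
    apply/funext => k; have := H a b k; rewrite /Rintegral => /eqP.
    rewrite fine_eq0; first by move/eqP.
    apply: integrable_fin_num => //.
    apply: (@le_integrable _ _ R leb setT _ _ W) => //.
    - by apply/measurable_EFinP; exact: measurable_funM.
    - move=> x _; rewrite /W patchE; case: ifPn => [_|/negP xc].
        by rewrite /= lee_fin normrM normr_id ler_piMr// ger0_norm ?box_bump_ge0 ?box_bump_le1.
      by rewrite box_bump_out ?mulr0 /= ?normr0 ?lexx// => /box_cube /mem_set.
  have E0 := cvg_unique (@ereal_hausdorff R) DC DC0.
  rewrite integral_mkcond -[RHS]E0; apply: eq_integral => x _.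
  by rewrite patchE indicE; case: ifP; rewrite ?mulr1 ?mulr0.
have ae_k (k : nat) : {ae leb, forall x, box (const_mx (- k%:R)) (const_mx k%:R) x -> f x = 0}.
  set D := box (const_mx (- k%:R) : T) (const_mx k%:R).
  have mD : measurable D by exact: measurable_box.
  have iD : leb.-integrable D (EFin \o f).
    apply: (integrableS _ _ _ (lf (`|const_mx (- k%:R) : T| + `|const_mx k%:R : T|))) => //.
      exact: measurable_cube.
    exact: box_cube.
  pose fD := (EFin \o f) \_ D.
  have ifD : leb.-integrable setT fD by rewrite -integrable_mkcond.
  have mfD : measurable_fun setT fD by exact: measurable_int ifD.
  have mp : measurable_fun setT (fD^\+)%E by exact: measurable_funepos.
  have mq : measurable_fun setT (fD^\-)%E by exact: measurable_funeneg.
  have ip : leb.-integrable setT (fD^\+)%E by exact: integrable_funepos.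
  have iq : leb.-integrable setT (fD^\-)%E by exact: integrable_funeneg.
  have p0 x : (0 <= fD^\+ x)%E by exact: funepos_ge0.
  have q0 x : (0 <= fD^\- x)%E by exact: funeneg_ge0.
  pose nup := density_measure leb mp p0; pose nuq := density_measure leb mq q0.
  have pq A : measurable A -> (\int[leb]_(x in A) fD x = nup A - nuq A)%E.
    by move=> mA; rewrite integralE.
  have fin_p A : measurable A -> nup A \is a fin_num.
    by move=> mA; apply: integrable_fin_num => //; exact: integrableS ip.
  have fin_q A : measurable A -> nuq A \is a fin_num.
    by move=> mA; apply: integrable_fin_num => //; exact: integrableS iq.
  have E A : measurable A -> nup A = nuq A.
    apply: (measure_unique (@boxes R m n) (fun k => box (const_mx (- k%:R)) (const_mx k%:R))).
    - exact: measurable_boxes.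
    - exact: boxesI.
    - by move=> l; exists (const_mx (- l%:R)), (const_mx l%:R).
    - exact: box_cover.
    - move=> B BB; have mB : measurable B by case: BB => a [b ->]; exact: measurable_box.
      have e0 : (nup B - nuq B = 0)%E.
        rewrite -pq// /fD -integral_mkcondr.
        have [a [b ->]] : boxes (B `&` D).
          by apply: boxesI => //; exists (const_mx (- k%:R)), (const_mx k%:R).
        by rewrite box0.
      move: e0; rewrite -(fineK (fin_p B mB)) -(fineK (fin_q B mB)) -EFinB => -[] /eqP.
      rewrite subr_eq0 => /eqP pqB; rewrite -[LHS](fineK (fin_p B mB)) -[RHS](fineK (fin_q B mB)).
      by congr EFin.
    - by move=> l; rewrite ltey_eq fin_p//; exact: measurable_box.
  have := @integral_ae_eq _ _ R leb D mD (cst 0%E) (EFin \o f) iD (measurable_cst _).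
  move=> /(_ _)/ae_imp; apply => [x H' Dx|A AD mA]; first by have [] := H' Dx.
  rewrite integral0.
  have -> : (\int[leb]_(x in A) (EFin \o f) x = \int[leb]_(x in A) fD x)%E.
    by apply: eq_integral => x; rewrite inE => Ax; rewrite /fD patchE mem_set//; exact: AD.
  by rewrite pq// E// subee// fin_q.
have := ae_foralln ae_k; apply: ae_imp => x Hx.
have : [set: T] x by [].
by rewrite -box_cover => -[k _ /Hx].
Qed.

End fundamental_lemma.

Section weak_basics.
Variables (R : realType) (m n : nat).
Local Notation T := 'M[R]_(m, n).
Local Notation leb := (lebesgue_mx R m n).
Local Notation mu := (@lebesgue_measure R).
Implicit Types (f g phi : T -> R).

Lemma loc_integrable_cube f : loc_integrable f ->
  forall M, leb.-integrable (cube M) (EFin \o f).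
Proof. by move=> lf M; apply: lf; exact: compact_cube. Qed.

Lemma cube_cover : \bigcup_k (@cube R m n k%:R) = setT.
Proof.
rewrite -subTset => x _; exists (Num.truncn `|x|).+1 => // i j.
by rewrite ltW// (le_lt_trans (le_entry_norm x i j))// truncnS_gt.
Qed.

Lemma loc_integrable_measurable f : loc_integrable f -> measurable_fun setT f.
Proof.
move=> lf; rewrite -cube_cover; apply/measurable_fun_bigcup => k.
  exact: measurable_cube.
by apply/measurable_EFinP; exact: measurable_int (loc_integrable_cube lf _).
Qed.

Lemma cube_loc_integrable f : (forall M, leb.-integrable (cube M) (EFin \o f)) ->
  loc_integrable f.
Proof.
move=> lf K cK; have [M _ KM] := compact_sub_cube cK.
apply: (integrableS _ _ KM (lf M)); first exact: measurable_cube.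
have cl : closed K by apply: compact_closed => //; exact: norm_hausdorff.
by rewrite -[K]setCK; apply: measurableC; apply: open_measurable_mx; rewrite openC.
Qed.

Lemma line_continuous (e x : T) : continuous (fun s : R => x + s *: e).
Proof.
move=> s; apply: (@cvgD _ _ _ _ _ (fun=> x) (fun s : R => s *: e)); first exact: cvg_cst.
by apply: cvgZr_tmp.
Qed.

Lemma smooth_ac phi (ij : 'I_m * 'I_n) : smooth phi ->
  ac_everywhere (delta_mx ij.1 ij.2) phi (partial ij phi).
Proof.
move=> sphi x; set e := delta_mx _ _.
have [cphi dphi] := sphi [::]; have [cpphi _] := sphi [:: ij].
apply: primitive01_FTC => [s|]; last first.
  by move=> s; apply: continuous_comp; [exact: line_continuous|exact: cpphi].
have H : (fun h : R => h^-1 *: (((fun s => phi (x + s *: e)) \o shift s) (h *: 1) - phi (x + s *: e)))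
    = (fun h : R => h^-1 *: ((phi \o shift (x + s *: e)) (h *: e) - phi (x + s *: e))).
  have h1 (h : R) : h *: (1 : R) = h by rewrite /GRing.scale/= mulr1.
  by apply/funext => h; congr (_ *: (phi _ - _)); rewrite /= h1 scalerDl addrCA.
have D := dphi ij (x + s *: e).
by split; [rewrite /derivable H; exact: D|rewrite /derive H].
Qed.

Lemma continuous_bounded_support phi M : continuous phi ->
  (forall x, phi x != 0 -> cube M x) -> exists C, forall x, `|phi x| <= C.
Proof.
move=> cphi phiM.
have : compact (phi @` cube M).
  by apply: continuous_compact; [exact: continuous_subspaceT|exact: compact_cube].
move=> /compact_bounded[C [_ HC]]; exists (`|C| + 1) => x.
have [->|/phiM xM] := eqVneq (phi x) 0; first by rewrite normr0 addr_ge0.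
by apply: HC; [rewrite ltr_pwDr// ler_norm|exists x].
Qed.

Lemma test_function_bound phi (ij : 'I_m * 'I_n) : test_function phi ->
  exists M C, [/\ forall x, phi x != 0 -> cube M x,
    forall x, partial ij phi x != 0 -> cube M x, forall x, `|phi x| <= C &
    forall x, `|partial ij phi x| <= C].
Proof.
move=> [sphi /compact_sub_cube[M _ HM]].
have [cphi _] := sphi [::]; have [cpphi _] := sphi [:: ij].
have H1 x : phi x != 0 -> cube M x by move=> x0; apply: HM; exact: subset_closure.
have H2 x : partial ij phi x != 0 -> cube M x.
  move=> p0; apply: HM; apply: contrapT => nx.
  have nc : nbhs x (~` closure [set x | phi x != 0]).
    by apply: open_nbhs_nbhs; split => //; rewrite openC; exact: closed_closure.
  move/negP: p0; apply; apply/eqP.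
  rewrite /partial (@near_eq_derive _ _ _ phi (cst 0)); first exact: derive_cst.
  apply: filterS nc => y nyc; apply/eqP; apply: contrapT => /negP y0.
  by apply: nyc; exact: subset_closure.
have [C1 HC1] := continuous_bounded_support cphi H1.
have [C2 HC2] := continuous_bounded_support cpphi H2.
exists M, (Num.max C1 C2); split => // x.
  by rewrite le_max HC1.
by rewrite le_max HC2 orbT.
Qed.

Lemma integrable_mul_support f (psi : T -> R) M C : loc_integrable f ->
  measurable_fun setT psi -> (forall x, psi x != 0 -> cube M x) ->
  (forall x, `|psi x| <= C) ->
  leb.-integrable setT (EFin \o (fun x => f x * psi x)).
Proof.
move=> lf mpsi psiM psiC.
have mf := loc_integrable_measurable lf.
pose W := (EFin \o (fun x => C * f x)) \_ (@cube R m n M).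
have iW : leb.-integrable setT W.
  rewrite -integrable_mkcond; last exact: measurable_cube.
  exact: (@integrableZl _ _ _ leb _ (@measurable_cube R m n M) C _ (loc_integrable_cube lf M)).
apply: (@le_integrable _ _ R leb setT _ _ W) => //.
  by apply/measurable_EFinP; exact: measurable_funM.
move=> x _; rewrite /W patchE.
have [px0|/psiM xM] := eqVneq (psi x) 0; first by rewrite /= px0 mulr0 normr0 abse_ge0.
rewrite mem_set//= lee_fin !normrM mulrC ler_wpM2r//.
by rewrite (le_trans (psiC _))// ler_norm.
Qed.

Lemma ac_weak f g (i : 'I_m) (j : 'I_n) : ac_lines (delta_mx i j) f g ->
  loc_integrable f -> loc_integrable g -> is_weak_partial (i, j) f g.
Proof.
move=> ac lf lg; split => // phi tphi.
have mf := loc_integrable_measurable lf.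
have mg := loc_integrable_measurable lg.
have [M [C [pM ppM pC ppC]]] := test_function_bound (i, j) tphi.
have [sphi _] := tphi.
have [cphi _] := sphi [::]; have [cpphi _] := sphi [:: (i, j)].
have mphi := continuous_measurable_mx cphi.
have mpphi : measurable_fun setT (partial (i, j) phi) := continuous_measurable_mx cpphi.
have i1 := integrable_mul_support lf mphi pM pC.
have i2 := integrable_mul_support lf mpphi ppM ppC.
have i3 := integrable_mul_support lg mphi pM pC.
have ac2 := ac_everywhere_lines (smooth_ac (i, j) sphi).
have acm := ac_linesM mf mphi mg mpphi ac ac2.
have i4 : leb.-integrable setT (EFin \o (fun x => f x * partial (i, j) phi x + phi x * g x)).
  rewrite (_ : _ \o _ = (fun x => (f x * partial (i, j) phi x)%:E + (g x * phi x)%:E)%E).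
    exact: integrableD.
  by apply/funext => x; rewrite /= EFinD [phi x * _]mulrC.
have := ac_lines_integral0 acm i1 i4.
under eq_integral do rewrite EFinD [phi _ * _]mulrC.
rewrite integralD// => /eqP H.
apply/eqP; rewrite -addr_eq0 /Rintegral -fineD; [|exact: integrable_fin_num..].
by rewrite (eqP H).
Qed.

Lemma weak_partial_unique f g g' (ij : 'I_m * 'I_n) : is_weak_partial ij f g ->
  is_weak_partial ij f g' -> {ae leb, forall x, g x = g' x}.
Proof.
move=> [_ lg H] [_ lg' H'].
have mg := loc_integrable_measurable lg; have mg' := loc_integrable_measurable lg'.
have : {ae leb, forall x, (fun x => g x - g' x) x = 0}.
  apply: bump_separates => [|M|a b k].
  - exact: measurable_funB.
  - have := @integrableB _ _ R leb _ (@measurable_cube R m n M) _ _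
      (loc_integrable_cube lg M) (loc_integrable_cube lg' M).
    by apply: eq_integrable => //; exact: measurable_cube.
  have sb := smooth_poly_box_bump a b k.
  have tb : test_function (box_bump a b k).
    apply: (test_function_cube (M := `|a| + `|b|)); first exact: smooth_poly_smooth.
    move=> x /eqP bx; apply: box_sub_cube; apply: contrapT => nb; apply: bx.
    exact: box_bump_out.
  have [M [C [pM _ pC _]]] := test_function_bound ij tb.
  have mb := continuous_measurable_mx (smooth_poly_continuous sb).
  have i1 := integrable_mul_support lg mb pM pC.
  have i2 := integrable_mul_support lg' mb pM pC.
  have -> : \int[leb]_x ((g x - g' x) * box_bump a b k x) =
      \int[leb]_x (g x * box_bump a b k x - g' x * box_bump a b k x).
    by apply: eq_Rintegral => x _; rewrite mulrBl.
  rewrite RintegralB//; apply/eqP; rewrite subr_eq0; apply/eqP.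
  by apply: oppr_inj; rewrite -H// -H'.
by apply: ae_imp => x /eqP; rewrite subr_eq0 => /eqP.
Qed.

Lemma ae_loc_integrable f f' : measurable_fun setT f' ->
  {ae leb, forall x, f x = f' x} -> loc_integrable f -> loc_integrable f'.
Proof.
move=> mf' ff lf; apply: cube_loc_integrable => M.
have mc := @measurable_cube R m n M.
have mfM : measurable_fun (cube M) (EFin \o f) := measurable_int _ (loc_integrable_cube lf M).
apply/integrableP; split; first by apply/measurable_EFinP; exact: measurable_funTS.
have /integrableP[_] := loc_integrable_cube lf M.
apply: le_lt_trans; rewrite le_eqVlt; apply/orP; left; apply/eqP.
apply: ge0_ae_eq_integral => //.
- by do 2 apply: measurableT_comp => //; apply: measurable_funTS.
- exact: measurableT_comp.
- by apply: ae_imp ff => x H _ /=; rewrite H.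
Qed.

Lemma ae_eq_Rintegral (f g : T -> R) : measurable_fun setT f -> measurable_fun setT g ->
  {ae leb, forall x, f x = g x} -> \int[leb]_x f x = \int[leb]_x g x.
Proof.
move=> mf mg fg; rewrite /Rintegral; congr fine; apply: ae_eq_integral => //.
- exact/measurable_EFinP.
- exact/measurable_EFinP.
- by apply: ae_imp fg => x ->.
Qed.

Lemma eq_weak_partial f f' g g' (ij : 'I_m * 'I_n) :
  measurable_fun setT f' -> measurable_fun setT g' ->
  {ae leb, forall x, f x = f' x} -> {ae leb, forall x, g x = g' x} ->
  is_weak_partial ij f g -> is_weak_partial ij f' g'.
Proof.
move=> mf' mg' ff gg [lf lg H].
have mf := loc_integrable_measurable lf; have mg := loc_integrable_measurable lg.
split; [exact: ae_loc_integrable lf|exact: ae_loc_integrable lg|] => phi tphi.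
have [sphi _] := tphi.
have [cphi _] := sphi [::]; have [cpphi _] := sphi [:: ij].
have mphi := continuous_measurable_mx cphi.
have mpphi : measurable_fun setT (partial ij phi) := continuous_measurable_mx cpphi.
have := H _ tphi.
rewrite (@ae_eq_Rintegral (fun x => f x * partial ij phi x) (fun x => f' x * partial ij phi x)).
- move=> ->; congr (- _); apply: ae_eq_Rintegral; [exact: measurable_funM..|].
  by apply: ae_imp gg => x ->.
- exact: measurable_funM.
- exact: measurable_funM.
- by apply: ae_imp ff => x ->.
Qed.

End weak_basics.

Section bump_primitive.
Variable R : realType.
Notation mu := (@lebesgue_measure R).

Lemma integrable_bump1 (a b : R) k : mu.-integrable setT (EFin \o bump1 a b k).
Proof.
have mb : measurable_fun setT (bump1 a b k).
  by apply: continuous_measurable_fun; apply: smooth1_continuous; exact: smooth1_bump.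
have i1 : mu.-integrable setT (EFin \o \1_(`[a, b]%classic : set R)).
  apply/integrableP; split; first by apply/measurable_EFinP; exact: measurable_indic.
  under eq_integral do rewrite gee0_abs ?lee_fin//.
  rewrite integral_indic//= setIT lebesgue_measure_itv/=.
  by case: ifP => _; rewrite ltry.
apply: (@le_integrable _ _ R mu setT _ _ (EFin \o \1_(`[a, b]%classic : set R))) => //.
  exact/measurable_EFinP.
move=> t _; rewrite /= lee_fin ger0_norm ?bump1_ge0// indicE.
have [tab|tab] := boolP (a < t < b); last by rewrite bump1_out.
rewrite mem_set ?normr1 ?bump1_le1//= in_itv/=.
by case/andP: tab => /ltW -> /ltW ->.
Qed.

Definition bump1_prim a b k (t : R) : R := \int[mu]_(s in `]-oo, t]) bump1 a b k s.

Lemma is_derive_bump1_prim a b k (t : R) :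
  is_derive t (1 : R) (bump1_prim a b k) (bump1 a b k t).
Proof.
have tt : t < t + 1 by rewrite ltrDl.
have it : mu.-integrable [set` Interval -oo%O (BRight (t + 1))] (EFin \o bump1 a b k).
  by apply: integrableS (integrable_bump1 a b k).
have := continuous_FTC1 tt it => /(_ _ (@smooth1_continuous _ _ (smooth1_bump a b k) t)).
case; first by (rewrite bnd_simp || exact: isT || rewrite /Order.lt/=).
move=> D DE.
split; [exact: D|rewrite -derive1E; exact: DE].
Qed.

Lemma integral_bump1 a b k (x h : R) : 0 <= h <= 1 ->
  \int[mu]_(s in `[0, h]) bump1 a b k (x - s) = bump1_prim a b k x - bump1_prim a b k (x - h).
Proof.
move=> h01.
have cb := smooth1_continuous (smooth1_bump a b k).
have H : primitive01 (fun s => - bump1_prim a b k (x - s)) (fun s => bump1 a b k (x - s)).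
  apply: primitive01_FTC => [s|s]; last first.
    apply: (@continuous_comp _ _ _ (fun s => x - s) (bump1 a b k)); last exact: cb.
    by apply: (@cvgB _ R); [exact: cvg_cst|exact: cvg_id].
  have D1 : is_derive s (1 : R) (fun s : R => x - s) (- 1).
    have := is_derive_affine (- 1) x s.
    by rewrite (_ : (fun t : R => _) = (fun s => x - s))//; apply/funext => t; rewrite mulN1r addrC.
  have := is_deriveN (@is_derive1_comp R (bump1_prim a b k) (fun s => x - s) s _ _ (is_derive_bump1_prim a b k _) D1).
  by move=> D; apply: is_derive_eq D _; rewrite mulrN1 opprK.
have [_ /(_ h h01)] := H; rewrite subr0 => H2; lra.
Qed.

End bump_primitive.

Section weak_ac.
Variables (R : realType) (m n : nat).
Local Notation T := 'M[R]_(m, n).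
Local Notation leb := (lebesgue_mx R m n).
Local Notation mu := (@lebesgue_measure R).
Implicit Types (f g phi : T -> R).

Section avg_bump.
Variables (i : 'I_m) (j : 'I_n) (a b : T) (k : nat) (h : R).
Hypothesis h01 : 0 <= h <= 1.
Let E : T := delta_mx i j.

(* minus the average of the bump over a segment in direction E *)
Definition avg_coord (i' : 'I_m) (j' : 'I_n) : R -> R :=
  if (i' == i) && (j' == j)
  then (fun t => bump1_prim (a i j) (b i j) k (t - h) + (- 1) * bump1_prim (a i j) (b i j) k t)
  else bump1 (a i' j') (b i' j') k.

Definition avg_bump (x : T) : R := \prod_(i' < m) \prod_(j' < n) avg_coord i' j' (x i' j').

Definition other_bump (x : T) : R :=
  \prod_(i' < m) \prod_(j' < n)
    (if (i' == i) && (j' == j) then 1 else bump1 (a i' j') (b i' j') k (x i' j')).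

Lemma smooth_poly_avg_bump : smooth_poly avg_bump.
Proof.
have sB : smooth1 (bump1_prim (a i j) (b i j) k).
  apply: smooth1_prim (smooth1_bump (a i j) (b i j) k).
  exact: is_derive_bump1_prim.
apply: smooth_poly_prod => i'; apply: smooth_poly_prod => j'.
apply: (@smooth_poly_coord _ _ _ i' j' (avg_coord i' j')).
rewrite /avg_coord; case: ifP => _; last exact: smooth1_bump.
apply: smooth1_add; first exact: (smooth1_shift (- h) sB).
by apply: smooth1_mul => //; exact: smooth1_cst.
Qed.

Lemma prod_split (F G : 'I_m -> 'I_n -> R) (c : R) :
  F i j = c * G i j -> (forall i' j', ~~ ((i' == i) && (j' == j)) -> F i' j' = G i' j') ->
  \prod_(i' < m) \prod_(j' < n) F i' j' = c * \prod_(i' < m) \prod_(j' < n) G i' j'.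
Proof.
move=> Fij FG; rewrite [LHS](bigD1 i)//= [in RHS](bigD1 i)//= (bigD1 j)//= [in RHS](bigD1 j)//= Fij.
rewrite -!mulrA; congr (_ * (_ * (_ * _))).
  by apply: eq_bigr => j' jj; rewrite FG// eqxx.
by apply: eq_bigr => i' ii; apply: eq_bigr => j' _; rewrite FG// (negbTE ii).
Qed.

Lemma avg_bumpE x : avg_bump x = other_bump x *
  (bump1_prim (a i j) (b i j) k (x i j - h) - bump1_prim (a i j) (b i j) k (x i j)).
Proof.
rewrite mulrC; apply: prod_split; first by rewrite /avg_coord !eqxx/= mulr1 mulN1r.
by move=> i' j' /negbTE ij; rewrite /avg_coord ij.
Qed.

Lemma box_bumpE x : box_bump a b k x = other_bump x * bump1 (a i j) (b i j) k (x i j).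
Proof.
rewrite mulrC; apply: prod_split; first by rewrite !eqxx/= mulr1.
by move=> i' j' /negbTE ->.
Qed.

Lemma other_bump_line x s : other_bump (x + s *: E) = other_bump x.
Proof.
apply: eq_bigr => i' _; apply: eq_bigr => j' _; case: ifP => // ij.
by rewrite !mxE ij mulr0 addr0.
Qed.

Lemma coord_line (x : T) s : (x + s *: E) i j = x i j + s.
Proof. by rewrite !mxE !eqxx mulr1. Qed.

Lemma avg_bump_integral x :
  avg_bump x = - \int[mu]_(s in `[0, h]) box_bump a b k (x - s *: E).
Proof.
have -> : \int[mu]_(s in `[0, h]) box_bump a b k (x - s *: E) =
   other_bump x * \int[mu]_(s in `[0, h]) bump1 (a i j) (b i j) k (x i j - s).
  rewrite -RintegralZl//.
    by apply: eq_Rintegral => s _; rewrite box_bumpE -scaleNr other_bump_line coord_line.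
  have cb := smooth1_continuous (smooth1_bump (a i j) (b i j) k).
  apply: continuous_compact_integrable; first exact: segment_compact.
  apply: continuous_subspaceT => s.
  apply: (@continuous_comp _ _ _ (fun s => x i j - s) (bump1 _ _ k)); last exact: cb.
  by apply: (@cvgB _ R); [exact: cvg_cst|exact: cvg_id].
by rewrite integral_bump1// avg_bumpE -mulrN opprB.
Qed.

Lemma partial_avg_bump x :
  partial (i, j) avg_bump x = box_bump a b k (x - h *: E) - box_bump a b k x.
Proof.
pose q (t : R) := bump1_prim (a i j) (b i j) k (t - h) - bump1_prim (a i j) (b i j) k t.
have dB := is_derive_bump1_prim (a i j) (b i j) k.
have dq : is_derive (x i j) (1 : R) q (bump1 (a i j) (b i j) k (x i j - h) - bump1 (a i j) (b i j) k (x i j)).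
  have D1 : is_derive (x i j) (1 : R) (fun t : R => t - h) 1.
    by have := is_derive_affine 1 (- h) (x i j); under eq_fun do rewrite mul1r.
  have D2 := @is_derive1_comp R (bump1_prim (a i j) (b i j) k) (fun t : R => t - h) (x i j) _ _ (dB _) D1.
  have := is_deriveB D2 (dB (x i j)).
  by move=> D; apply: is_derive_eq D _; rewrite mulr1.
have D : is_derive (x i j) (1 : R) (fun t => other_bump x *: q t) (other_bump x *:
    (bump1 (a i j) (b i j) k (x i j - h) - bump1 (a i j) (b i j) k (x i j))).
  exact: is_deriveZ.
have [_ DE] := D.
rewrite /partial /= /derive (_ : (fun h : R => _) =
  (fun h0 : R => h0^-1 *: (((fun t => other_bump x *: q t) \o shift (x i j)) (h0 *: 1) - other_bump x *: q (x i j)))).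
  have sc (c y : R) : c *: (y : R^o) = c * y by [].
  rewrite -/(derive _ _ _) DE sc mulrBr !box_bumpE.
  have -> : x - h *: E = x + (- h) *: E by rewrite scaleNr.
  by rewrite other_bump_line coord_line.
apply/funext => h0; congr (_ *: (_ - _)); last by rewrite avg_bumpE.
have h1 : h0 *: (1 : R) = h0 by rewrite /GRing.scale/= mulr1.
by rewrite /= h1 addrC avg_bumpE other_bump_line coord_line [h0 + _]addrC.
Qed.

Lemma test_avg_bump : test_function avg_bump.
Proof.
apply: (test_function_cube (M := `|a| + `|b| + 1)).
  exact: smooth_poly_smooth smooth_poly_avg_bump.
move=> x /eqP x0; apply: contrapT => nx; apply: x0.
rewrite avg_bump_integral (_ : \int[mu]_(s in _) _ = 0) ?oppr0//.
rewrite (_ : \int[mu]_(s in `[0, h]) box_bump a b k (x - s *: E) = \int[mu]_(s in `[0, h]) (cst 0 s)).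
  by rewrite Rintegral_cst// mul0r.
apply: eq_Rintegral => s; rewrite inE/= in_itv/= => /andP[s0 sh].
apply: box_bump_out => /box_sub_cube xs; apply: nx => i' j'.
have := xs i' j'; rewrite !mxE => H.
rewrite -[x i' j'](subrK (s * ((i' == i) && (j' == j))%:R)) (le_trans (ler_normD _ _))// lerD//.
rewrite normrM (ger0_norm s0) mulr_ile1// ?normr_ge0//.
  by case/andP: h01 => _; exact: le_trans.
by case: (_ && _); rewrite ?normr1 ?normr0.
Qed.

End avg_bump.

Lemma integrable_line_prefix e g h : 0 <= h <= 1 -> leb.-integrable setT (EFin \o g) ->
  (leb \x mu)%E.-integrable setT
    (fun z : T * R => (g (z.1 + z.2 *: e) * \1_(`[0, h]%classic : set R) z.2)%:E).
Proof.
move=> /andP[h0 h1] ig; have I1 := integrable_line e ig.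
have mg : measurable_fun setT g by apply/measurable_EFinP; exact: measurable_int ig.
apply: (le_integrable measurableT _ _ I1).
  apply/measurable_EFinP; apply: measurable_funM.
    exact: (measurableT_comp mg (measurable_line e)).
  by apply: measurableT_comp => //; exact: measurable_indic.
move=> z _; rewrite !abse_EFin lee_fin !normrM ler_wpM2l// !ger0_norm// !indicE.
have [|//] := boolP (z.2 \in `[0, h]%classic).
rewrite inE/= in_itv/= => /andP[z0 zh].
by rewrite mem_set//= in_itv/= z0 (le_trans zh).
Qed.

Lemma loc_integrable_shift_cube f (c : T) M : (forall i j, `|c i j| <= 1) -> loc_integrable f ->
  leb.-integrable (cube M) (fun x => (f (x + c))%:E).
Proof.
move=> c1 lf; have mf := loc_integrable_measurable lf.
have mfs : measurable_fun setT (fun x : T => f (x + c)).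
  exact: (measurableT_comp mf (@measurable_shift R m n c)).
pose fM := (EFin \o f) \_ (@cube R m n (M + 1)).
have ifM : leb.-integrable setT fM.
  rewrite -integrable_mkcond; last exact: measurable_cube.
  exact: loc_integrable_cube.
apply/integrableP; split; first by apply/measurable_EFinP; exact: measurable_funTS.
have /integrableP[mfM] := ifM; apply: le_lt_trans.
rewrite -(@integral_shift _ _ _ c (fun x => `|fM x|%E)); last exact: measurableT_comp.
rewrite integral_mkcond; apply: ge0_le_integral => //.
- by move=> x _; rewrite patchE; case: ifP.
- apply/(measurable_restrictT _ _).1; first exact: measurable_cube.
  by apply: measurable_funTS; do 2 apply: measurableT_comp => //.
- apply: (measurableT_comp (f := fun x => `|fM x|%E)); last exact: measurable_shift.
  exact: measurableT_comp.
- move=> x _; rewrite patchE; case: ifPn => [/set_mem xM|_]; last exact: abse_ge0.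
  rewrite /fM patchE mem_set// => i j; rewrite mxE (le_trans (ler_normD _ _))// lerD//.
Qed.

Lemma line_entry1 (i : 'I_m) (j : 'I_n) s i' j' : 0 <= s <= 1 ->
  `|(s *: (delta_mx i j : T)) i' j'| <= 1.
Proof.
move=> /andP[s0 s1]; rewrite !mxE normrM (ger0_norm s0).
by case: (_ && _); rewrite ?normr1 ?normr0 ?mulr1 ?mulr0.
Qed.

(* the integral of g over the segment from x to x + h e *)
Definition seg_int (e : T) g (h : R) (x : T) : R := \int[mu]_(s in `[0, h]) g (x + s *: e).

Lemma measurable_seg_int2 e g : measurable_fun setT g ->
  measurable_fun setT (fun z : T * R => seg_int e g z.2 z.1).
Proof.
move=> mg.
have -> : (fun z : T * R => seg_int e g z.2 z.1) =
    (fun z => \int[mu]_r (g (z.1 + r *: e) * ((0 <= r) && (r <= z.2))%:R)).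
  apply/funext => z; rewrite /seg_int Rintegral_mkcond; apply: eq_Rintegral => r _.
  have E0 : (r \in (`[0, z.2]%classic : set R)) = (0 <= r) && (r <= z.2).
    by apply/idP/idP; rewrite inE/= in_itv.
  by rewrite patchE E0; case: (_ && _); rewrite ?mulr1 ?mulr0.
apply: (@measurable_param_Rintegral _ _ _ _ R mu
  (fun y : (T * R) * R => g (y.1.1 + y.2 *: e) * ((0 <= y.2) && (y.2 <= y.1.2))%:R)).
apply: measurable_funM.
  have ms : measurable_fun setT (fun y : (T * R) * R => (y.1.1, y.2)).
    by apply: measurable_fun_pair => //; exact: measurableT_comp.
  exact: (measurableT_comp mg (measurableT_comp (measurable_line e) ms)).
rewrite (_ : (fun y : T * R * R => _) = (fun b : bool => b%:R) \o
  (fun y : (T * R) * R => (0 <= y.2) && (y.2 <= y.1.2)))//.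
apply: measurableT_comp => //.
apply: measurable_and.
  by apply: measurable_fun_ler.
by apply: measurable_fun_ler => //; exact: measurableT_comp.
Qed.

Lemma measurable_seg_int e g h : measurable_fun setT g -> measurable_fun setT (seg_int e g h).
Proof.
move=> mg; have := measurable_seg_int2 e mg => H.
have mp : measurable_fun setT (fun x : T => (x, h)) by exact: measurable_fun_pair.
exact: (measurableT_comp H mp).
Qed.

End weak_ac.

Lemma integral_fine d (T : measurableType d) (R : realType) (mu : {measure set T -> \bar R})
  (F : T -> \bar R) : mu.-integrable setT F ->
  (\int[mu]_x (fine (F x))%:E = \int[mu]_x F x)%E.
Proof.
move=> iF; have mF := measurable_int _ iF.
apply: ae_eq_integral => //.
- by apply/measurable_EFinP; exact: measurableT_comp.
- by apply: ae_imp (integrable_ae measurableT iF) => x H _; rewrite fineK// H.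
Qed.

Section weak_ac.
Variables (R : realType) (m n : nat).
Local Notation T := 'M[R]_(m, n).
Local Notation leb := (lebesgue_mx R m n).
Local Notation mu := (@lebesgue_measure R).
Implicit Types (f g phi : T -> R).

Definition cut (M : R) g (x : T) : R := g x * \1_(@cube R m n M) x.

Lemma measurable_cut M g : measurable_fun setT g -> measurable_fun setT (cut M g).
Proof.
move=> mg; apply: measurable_funM => //.
by apply: measurable_indic; exact: measurable_cube.
Qed.

Lemma integrable_cut M g : loc_integrable g -> leb.-integrable setT (EFin \o cut M g).
Proof.
move=> lg; have := loc_integrable_cube lg M.
rewrite integrable_mkcond; last exact: measurable_cube.
apply: eq_integrable => // x _; rewrite patchE /cut/= indicE.
by case: ifP => _; rewrite ?mulr1 ?mulr0.
Qed.

Lemma cut_line (i : 'I_m) (j : 'I_n) M g x s : cube M x -> 0 <= s <= 1 ->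
  cut (M + 1) g (x + s *: delta_mx i j) = g (x + s *: delta_mx i j).
Proof.
move=> xM s01; rewrite /cut indicE mem_set ?mulr1// => i' j'.
by rewrite mxE (le_trans (ler_normD _ _))// lerD//; exact: line_entry1.
Qed.

Lemma integrable_seg_int (i : 'I_m) (j : 'I_n) g h M : 0 <= h <= 1 -> loc_integrable g ->
  leb.-integrable (cube M) (EFin \o seg_int (delta_mx i j) g h).
Proof.
move=> h01 lg; have mg := loc_integrable_measurable lg.
have I1 := integrable_line_prefix (delta_mx i j) h01 (integrable_cut (M + 1) lg).
have IF := integrable_fubini_F I1.
have mM : measurable (@cube R m n M) by exact: measurable_cube.
apply: (le_integrable mM _ _ (integrableS measurableT mM (@subsetT _ _) IF)).
  by apply/measurable_EFinP; apply: measurable_funTS; exact: measurable_seg_int.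
move=> x xM; rewrite /fubini_F /=.
have -> : (\int[mu]_y (cut (M + 1) g (x + y *: delta_mx i j) * \1_(`[0%R, h]%classic : set R) y)%:E =
    \int[mu]_(s in `[0%R, h]) (g (x + s *: delta_mx i j))%:E)%E.
  rewrite [RHS]integral_mkcond; apply: eq_integral => s _; rewrite patchE indicE.
  case: ifPn => [/set_mem/=|]; rewrite ?mulr0//.
  rewrite in_itv/= => /andP[s0 sh]; rewrite mulr1 cut_line// s0/= (le_trans sh)//.
  by case/andP: h01.
rewrite /seg_int /Rintegral.
by case: (\int[mu]_(s in _) _)%E => [r| |]//=; rewrite normr0 leey.
Qed.

Lemma weak_increment (i : 'I_m) (j : 'I_n) f g h : 0 <= h <= 1 ->
  is_weak_partial (i, j) f g ->
  {ae leb, forall x, f (x + h *: delta_mx i j) - f x - seg_int (delta_mx i j) g h x = 0}.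
Proof.
move=> h01 [lf lg H]; set E := delta_mx i j.
have mf := loc_integrable_measurable lf; have mg := loc_integrable_measurable lg.
have mfs : measurable_fun setT (fun x : T => f (x + h *: E)).
  exact: (measurableT_comp mf (@measurable_shift R m n _)).
have mseg := @measurable_seg_int R m n E g h mg.
have i1 M : leb.-integrable (cube M) (EFin \o (fun x => f (x + h *: E))).
  by apply: loc_integrable_shift_cube => // i' j'; exact: line_entry1.
have i3 M := @integrable_seg_int i j g h M h01 lg.
have i12 M : leb.-integrable (cube M) (EFin \o (fun x => f (x + h *: E) - f x)).
  have := @integrableB _ _ R leb _ (@measurable_cube R m n M) _ _ (i1 M) (loc_integrable_cube lf M).
  by apply: eq_integrable => //; exact: measurable_cube.
apply: bump_separates => [|M|a b k].
- by apply: measurable_funB => //; exact: measurable_funB.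
- have := @integrableB _ _ R leb _ (@measurable_cube R m n M) _ _ (i12 M) (i3 M).
  by apply: eq_integrable => //; exact: measurable_cube.
set beta := box_bump a b k.
have cb : continuous beta by apply: smooth_poly_continuous; exact: smooth_poly_box_bump.
have mb : measurable_fun setT beta by exact: continuous_measurable_mx.
pose M := `|a| + `|b|.
have bM x : beta x != 0 -> cube M x.
  by move=> /eqP bx; apply: box_sub_cube; apply: contrapT => nb; apply: bx; exact: box_bump_out.
have b1 x : `|beta x| <= 1 by rewrite ger0_norm ?box_bump_ge0 ?box_bump_le1.
have msub s : measurable_fun setT (fun x : T => x - s *: E) by exact: measurable_shift.
have tPhi := @test_avg_bump R m n i j a b k h h01.
have HPhi := H _ tPhi.
have loc_shift : loc_integrable (fun x => f (x + h *: E)) by exact: cube_loc_integrable.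
have loc_seg : loc_integrable (seg_int E g h) by exact: cube_loc_integrable.
have j1 := integrable_mul_support loc_shift mb bM b1.
have j2 := integrable_mul_support lf mb bM b1.
have j3 := integrable_mul_support loc_seg mb bM b1.
have -> : \int[leb]_x ((f (x + h *: E) - f x - seg_int E g h x) * beta x) =
    \int[leb]_x (f (x + h *: E) * beta x) - \int[leb]_x (f x * beta x) -
    \int[leb]_x (seg_int E g h x * beta x).
  rewrite -!RintegralB//; first by apply: eq_Rintegral => x _; rewrite !mulrBl.
  exact: (@integrableB _ _ R leb _ measurableT _ _ j1 j2).
have bhM x : beta (x - h *: E) != 0 -> cube (M + 1) x.
  move=> /bM xM i' j'; rewrite -[x](subrK (h *: E)) mxE (le_trans (ler_normD _ _))// lerD//.
  exact: line_entry1.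
have j1' := integrable_mul_support lf (measurableT_comp mb (msub h)) bhM (fun x => b1 _).
have s1 : \int[leb]_x (f (x + h *: E) * beta x) = \int[leb]_x (f x * beta (x - h *: E)).
  rewrite /Rintegral; congr fine.
  rewrite -[RHS](@integral_shift _ _ _ (h *: E)); last exact: measurable_int j1'.
  by apply: eq_integral => x _; rewrite /= addrK.
have s2 : \int[leb]_x (f x * partial (i, j) (avg_bump i j a b k h) x) =
   \int[leb]_x (f (x + h *: E) * beta x) - \int[leb]_x (f x * beta x).
  rewrite s1 -RintegralB//; apply: eq_Rintegral => x _.
  by rewrite partial_avg_bump mulrBr.
have s3 : \int[leb]_x (g x * avg_bump i j a b k h x) = - \int[leb]_x (seg_int E g h x * beta x).
  pose gM := cut (M + 1) g.
  have igM := integrable_cut (M + 1) lg.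
  have I1 := integrable_line_prefix E h01 igM.
  pose kk (z : T * R) : \bar R := (g (z.1 + z.2 *: E) * beta z.1 * \1_(`[0, h]%classic : set R) z.2)%:E.
  pose kk' (z : T * R) : \bar R := (g z.1 * beta (z.1 - z.2 *: E) * \1_(`[0, h]%classic : set R) z.2)%:E.
  have m1 : measurable_fun setT (fun z : T * R => \1_(`[0, h]%classic : set R) z.2 : R).
    by apply: measurableT_comp => //; exact: measurable_indic.
  have mkk : measurable_fun setT kk.
    apply/measurable_EFinP; apply: measurable_funM => //; apply: measurable_funM.
      exact: (measurableT_comp mg (measurable_line E)).
    exact: (measurableT_comp mb measurable_fst).
  have mkk' : measurable_fun setT kk'.
    apply/measurable_EFinP; apply: measurable_funM => //; apply: measurable_funM.
      exact: (measurableT_comp mg measurable_fst).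
    have -> : (fun z : T * R => beta (z.1 - z.2 *: E)) = (fun z : T * R => beta (z.1 + z.2 *: (- E))).
      by apply/funext => z; rewrite scalerN.
    exact: (measurableT_comp mb (measurable_line (- E))).
  have h1 : h <= 1 by case/andP: h01.
  have ikk : (leb \x mu)%E.-integrable setT kk.
    apply: (le_integrable measurableT _ _ I1); first exact: mkk.
    move=> z _.
    rewrite /kk !abse_EFin lee_fin.
    have [bz|/bM zM] := eqVneq (beta z.1) 0; first by rewrite bz mulr0 mul0r normr0.
    rewrite !normrM indicE; have [zh|_] := boolP (z.2 \in _); last by rewrite normr0 !mulr0.
    have z01 : 0 <= z.2 <= 1.
      by move: zh; rewrite inE/= in_itv/= => /andP[-> /le_trans]; apply.
    have zE : cut (M + 1) g (z.1 + z.2 *: E) = g (z.1 + z.2 *: E) by exact: cut_line.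
    rewrite normr1 !mulr1 -[leRHS]normrM [X in _ <= `|X|](_ : _ = g (z.1 + z.2 *: E)); last exact: zE.
    by rewrite ler_piMr.
  have kshift s : (\int[leb]_x `|kk (x, s)| = \int[leb]_x `|kk' (x, s)|)%E.
    rewrite -[RHS](@integral_shift _ _ _ (s *: E) (fun x => `|kk' (x, s)|%E)).
      by apply: eq_integral => x _; rewrite /kk /kk'/= addrK.
    apply: measurableT_comp => //; apply: (measurableT_comp mkk'); exact: measurable_fun_pair.
  have kshift' s : (\int[leb]_x kk (x, s) = \int[leb]_x kk' (x, s))%E.
    rewrite -[RHS](@integral_shift _ _ _ (s *: E) (fun x => kk' (x, s))).
      by apply: eq_integral => x _; rewrite /kk /kk'/= addrK.
    by apply: (measurableT_comp mkk'); exact: measurable_fun_pair.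
  have ikk' : (leb \x mu)%E.-integrable setT kk'.
    apply/(integrable21ltyP leb mu mkk').
    under eq_integral do rewrite -kshift.
    exact: (integrable21ltyP leb mu mkk).1 ikk.
  rewrite -[LHS]opprK; congr (- _); rewrite -[LHS]mulN1r -RintegralZl//; last first.
    have [M' [C' [pM _ pC _]]] := test_function_bound (i, j) tPhi.
    apply: integrable_mul_support pM pC => //.
    by apply: continuous_measurable_mx; apply: smooth_poly_continuous; exact: smooth_poly_avg_bump.
  have e1 x : -1 * (g x * avg_bump i j a b k h x) = fine (\int[mu]_s kk' (x, s))%E.
    rewrite avg_bump_integral// mulrCA mulN1r opprK.
    have ib : mu.-integrable `[0, h] (EFin \o (fun s => box_bump a b k (x - s *: E))).
      apply: continuous_compact_integrable; first exact: segment_compact.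
      apply: continuous_subspaceT => s.
      have -> : (fun s : R => beta (x - s *: E)) = beta \o (fun s : R => x + s *: (- E)).
        by apply/funext => s'; rewrite /= scalerN.
      by apply: continuous_comp; [exact: line_continuous|exact: cb].
    rewrite -RintegralZl// /Rintegral integral_mkcond; congr fine; apply: eq_integral => s _.
    by rewrite patchE /kk'/= indicE; case: ifP => _; rewrite ?mulr1 ?mulr0.
  have e2 : {ae leb, forall x, seg_int E g h x * beta x = fine (\int[mu]_s kk (x, s))%E}.
    apply: ae_imp (ae_integrable_line E igM) => x ix.
    have [bx|/bM xM] := eqVneq (beta x) 0.
      rewrite bx mulr0 (eq_integral (cst 0%E)) ?integral0// => s _.
      by rewrite /kk/= bx mulr0 mul0r.
    have ig : mu.-integrable `[0, h] (EFin \o (fun s => g (x + s *: E))).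
      have ig1 : mu.-integrable `[0, 1] (EFin \o (fun s => g (x + s *: E))).
        apply: eq_integrable ix => // s; rewrite inE/= in_itv/= => s01.
        by congr EFin; exact: cut_line.
      exact: (integrable01_sub (g := fun s => g (x + s *: E)) ig1 (lexx 0) h1).
    rewrite /seg_int -RintegralZr// /Rintegral integral_mkcond; congr fine.
    apply: eq_integral => s _; rewrite patchE /kk/= indicE.
    by case: ifP => _; rewrite ?mulr1 ?mulr0.
  have -> : \int[leb]_x (-1 * (g x * avg_bump i j a b k h x)) = fine (\int[leb]_x \int[mu]_s kk' (x, s))%E.
    rewrite -(integral_fine (integrable_fubini_F ikk')); congr fine.
    by apply: eq_integral => x _; rewrite e1.
  have -> : \int[leb]_x (seg_int E g h x * beta x) = fine (\int[leb]_x \int[mu]_s kk (x, s))%E.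
    rewrite -(integral_fine (integrable_fubini_F ikk)); congr fine.
    apply: ae_eq_integral => //.
    - exact: measurable_int j3.
    - apply/measurable_EFinP; apply: measurableT_comp => //.
      exact: measurable_fubini_F ikk.
    - by apply: ae_imp e2 => x ->.
  have -> // : (\int[leb]_x \int[mu]_s kk' (x, s) = \int[leb]_x \int[mu]_s kk (x, s))%E.
  have F1 := Fubini ikk; have F2 := Fubini ikk'.
  apply: (etrans F2); apply: esym; apply: (etrans F1).
  by apply: eq_integral => s _; exact: kshift'.
rewrite -s2 HPhi s3; ring.
Qed.

Theorem weak_ac (i : 'I_m) (j : 'I_n) f g : is_weak_partial (i, j) f g ->
  ac_lines (delta_mx i j) f g.
Proof.
move=> wp; have [lf lg _] := wp; set E := delta_mx i j.
have mf := loc_integrable_measurable lf; have mg := loc_integrable_measurable lg.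
have inc h : 0 <= h <= 1 -> {ae leb, forall x, f (x + h *: E) - f x - seg_int E g h x = 0}.
  by move=> h01; exact: weak_increment.
pose F (z : T * R) := f (z.1 + z.2 *: E) - f z.1 - seg_int E g z.2 z.1.
have mF : measurable_fun setT F.
  apply: measurable_funB; last exact: measurable_seg_int2.
  apply: measurable_funB.
    exact: (measurableT_comp mf (measurable_line E)).
  exact: (measurableT_comp mf measurable_fst).
pose A := (snd @^-1` (`[0, 1]%classic : set R)) `&` (F @^-1` [set~ 0]) : set (T * R).
have mA : measurable A.
  apply: measurableI.
    by rewrite -[X in measurable X]setTI; exact: measurable_snd.
  rewrite -[X in measurable X]setTI; apply: mF => //.
  by apply: measurableC; exact: measurable_set1.
have A0 s : leb [set x | A (x, s)] = 0%E.
  have mAs : measurable [set x | A (x, s)].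
    have := @measurable_ysection _ _ _ _ A s mA.
    by congr measurable; apply/seteqP; split => x; rewrite /ysection/= inE.
  have [s01|s01] := boolP (s \in `[0, 1]); last first.
    rewrite (_ : [set x | A (x, s)] = set0) ?measure0//.
    by apply/seteqP; split => // x [/=]; rewrite (negbTE s01).
  apply: measure_negligible => //.
  have : {ae leb, forall x, F (x, s) = 0} by apply: inc; rewrite in_itv in s01.
  by apply: negligibleS => x [_ /= Fx] /Fx.
have ae_int : {ae leb, forall x, forall k : nat,
    mu.-integrable `[0, 1] (EFin \o (fun s => cut (k%:R + 1) g (x + s *: E)))}.
  by apply: ae_foralln => k; apply: ae_integrable_line; exact: integrable_cut.
have inc1 := inc 1 (@andb_true_intro _ _ (conj ler01 (lexx 1))).
apply: ae_imp2 (ae_and ae_int inc1) (@ae_sections _ _ _ _ R leb mu _ mA A0).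
move=> x [int inc1x] ae_s.
exists (fun t => f x + seg_int E g t x).
have ig : mu.-integrable `[0, 1] (EFin \o (fun s => g (x + s *: E))).
  have : [set: T] x by [].
  rewrite -cube_cover => -[k _ xk].
  apply: eq_integrable (int k) => // s; rewrite inE/= in_itv/= => s01.
  by congr EFin; exact: cut_line.
split.
- by split => // t t01; rewrite /seg_int set_itv1 Rintegral_set1 addr0.
- by rewrite /seg_int set_itv1 Rintegral_set1 addr0.
- by move: inc1x; rewrite scale1r => H1; lra.
- apply: ae_imp ae_s => s nA s01.
  have : F (x, s) = 0 by apply: contrapT => F0; apply: nA.
  by rewrite /F/= => H1; lra.
Qed.

End weak_ac.

Section scalar_inequalities.
Variable R : realType.
Implicit Types (a b t x y m p : R).

Lemma gt0_powRD x r s : 0 < x -> x `^ (r + s) = x `^ r * x `^ s.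
Proof. by move=> x0; rewrite powRD//; apply/implyP => _; rewrite gt_eqF. Qed.

Lemma powR_inv_base x r : 0 <= x -> (x^-1) `^ r = x `^ (- r).
Proof. by move=> x0; rewrite -powR_inv1// -powRrM mulN1r. Qed.

(* derivative of |x|^p, divided by p *)
Definition dpow p m : R := Num.sg m * `|m| `^ (p - 1).

Lemma powR_tangent_ge0 p t m : 1 <= p -> 0 <= t -> 0 <= m ->
  m `^ p + p * m `^ (p - 1) * (t - m) <= t `^ p.
Proof.
move=> p1 t0 m0; have p0 : 0 < p by exact: lt_le_trans p1.
have mono : {in Num.nneg &, {homo (fun x => x `^ (p - 1)) : x y / x <= y}}.
  by apply: ge0_ler_powR; rewrite subr_ge0.
have [mt|tm] := leP m t.
  have [z /andP[mz zt] H] := powR_MVT (or_intror (conj m0 p0)) mt.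
  rewrite addrC -lerBrDr H ler_wpM2r ?subr_ge0// ler_wpM2l ?(ltW p0)//.
  by apply: mono => //; rewrite nnegrE// (le_trans m0).
have [z /andP[tz zm] H] := powR_MVT (or_intror (conj t0 p0)) (ltW tm).
have L : p * z `^ (p - 1) * (m - t) <= p * m `^ (p - 1) * (m - t).
  rewrite ler_wpM2r ?subr_ge0 ?(ltW tm)// ler_wpM2l ?(ltW p0)//.
  by apply: mono => //; rewrite nnegrE// (le_trans t0).
by move: L; rewrite -H; lra.
Qed.

Lemma powR_tangent p t m : 1 <= p ->
  `|m| `^ p + p * dpow p m * (t - m) <= `|t| `^ p.
Proof.
move=> p1; have p0 : 0 <= p by exact: le_trans p1.
apply: le_trans (powR_tangent_ge0 p1 (normr_ge0 t) (normr_ge0 m)).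
rewrite lerD2l /dpow.
rewrite [leLHS](_ : _ = p * `|m| `^ (p - 1) * (Num.sg m * (t - m))); last by ring.
apply: ler_wpM2l; first by rewrite mulr_ge0// powR_ge0.
rewrite mulrBr -normrEsg lerD2r.
have [->|m0] := eqVneq m 0; first by rewrite sgr0 mul0r.
by rewrite (le_trans (ler_norm _))// normrM normr_sg m0 mul1r.
Qed.

Lemma powR_convex p x y l : 1 <= p -> 0 <= l <= 1 ->
  `|l * x + (1 - l) * y| `^ p <= l * `|x| `^ p + (1 - l) * `|y| `^ p.
Proof.
move=> p1 /andP[l0 l1]; set m := l * x + _.
have H1 := powR_tangent x m p1; have H2 := powR_tangent y m p1.
have := ler_wpM2l l0 H1; have l1' : 0 <= 1 - l by rewrite subr_ge0.
have := ler_wpM2l l1' H2.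
have E : l * (p * dpow p m * (x - m)) + (1 - l) * (p * dpow p m * (y - m)) = 0.
  by rewrite [X in dpow _ X]lock /m; ring.
by move: E; rewrite !mulrDr; lra.
Qed.

Lemma powR_split p a b l : 1 <= p -> 0 < l < 1 ->
  `|a + b| `^ p <= l `^ (1 - p) * `|a| `^ p + (1 - l) `^ (1 - p) * `|b| `^ p.
Proof.
move=> p1 /andP[l0 l1]; have l1' : 0 < 1 - l by rewrite subr_gt0.
have E c x : 0 < c -> c * `|x / c| `^ p = c `^ (1 - p) * `|x| `^ p.
  move=> c0; rewrite normrM normfV (gtr0_norm c0) powRM ?normr_ge0 ?invr_ge0 ?(ltW c0)//.
  rewrite powR_inv_base ?(ltW c0)// gt0_powRD// powRr1 ?(ltW c0)//; ring.
have := @powR_convex p (a / l) (b / (1 - l)) l p1; rewrite (ltW l0) (ltW l1) => /(_ isT).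
rewrite !E// [l * _]mulrC divfK ?gt_eqF// [(1 - l) * _]mulrC divfK ?gt_eqF//.
Qed.

Lemma powR_half_sub p a b : 1 <= p ->
  `|a - b| `^ p <= 2 `^ (p - 1) * (`|a| `^ p + `|b| `^ p).
Proof.
move=> p1; have := @powR_split p a (- b) 2^-1 p1; rewrite invr_gt0 ltr0n invf_lt1 ?ltr0n// ltr1n => /(_ isT).
have -> : 1 - 2^-1 = 2^-1 :> R by field.
rewrite normrN -mulrDr; congr (_ <= _ * _).
by rewrite powR_inv_base// opprB.
Qed.

Lemma powR_add_le q x y : 1 <= q -> 0 <= x -> 0 <= y -> x `^ q + y `^ q <= (x + y) `^ q.
Proof.
move=> q1 x0 y0; have q0 : q != 0 by rewrite gt_eqF// (lt_le_trans _ q1).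
have [S0|S0] := eqVneq (x + y) 0.
  move/eqP: S0; rewrite paddr_eq0// => /andP[/eqP -> /eqP ->].
  by rewrite addr0 powR0// addr0.
have S : 0 < x + y by rewrite lt0r S0 addr_ge0.
have H z : 0 <= z -> z <= x + y -> z `^ q <= (z / (x + y)) * (x + y) `^ q.
  move=> z0 zS; rewrite -{1}[z](divfK S0) powRM ?divr_ge0 ?(ltW S)// ler_wpM2r ?powR_ge0//.
  have [->|z0'] := eqVneq z 0; first by rewrite mul0r powR0.
  apply: ge1r_powR => //; apply/andP; split; last by rewrite ler_pdivrMr// mul1r.
  by rewrite divr_gt0// lt0r z0'.
rewrite (le_trans (lerD (H x x0 _) (H y y0 _))) ?lerDl ?lerDr//.
by rewrite -mulrDl -mulrDl divff// mul1r.
Qed.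

Lemma normr_powR_sqr p a : `|a| `^ p = (a ^+ 2) `^ (p / 2).
Proof.
rewrite -real_normK ?num_real// -powR_mulrn ?normr_ge0// -powRrM.
by congr powR; field.
Qed.

Lemma clarkson p a b : 2 <= p ->
  `|(a + b) / 2| `^ p + `|(a - b) / 2| `^ p <= (`|a| `^ p + `|b| `^ p) / 2.
Proof.
move=> p2; have q1 : 1 <= p / 2 by rewrite ler_pdivlMr// mul1r.
rewrite !normr_powR_sqr (le_trans (powR_add_le q1 (sqr_ge0 _) (sqr_ge0 _)))//.
have -> : ((a + b) / 2) ^+ 2 + ((a - b) / 2) ^+ 2 = 2^-1 * a ^+ 2 + (1 - 2^-1) * b ^+ 2 by field.
have h : 0 <= (2^-1 : R) <= 1 by rewrite invr_ge0 ler0n invf_le1 ?ltr0n// ler1n.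
have := @powR_convex (p / 2) (a ^+ 2) (b ^+ 2) 2^-1 q1 h.
have s0 : 0 <= 2^-1 * a ^+ 2 + (1 - 2^-1) * b ^+ 2.
  have := sqr_ge0 a; have := sqr_ge0 b; lra.
rewrite (ger0_norm (sqr_ge0 a)) (ger0_norm (sqr_ge0 b)) (ger0_norm s0).
by move=> /le_trans; apply; lra.
Qed.

Lemma powR_tangent_strong p t m : 2 <= p ->
  `|m| `^ p + p * dpow p m * (t - m) + 2 `^ (1 - p) * `|t - m| `^ p <= `|t| `^ p.
Proof.
move=> p2; have p1 : 1 <= p by rewrite (le_trans _ p2)// ler1n.
have H1 := powR_tangent ((t + m) / 2) m p1.
have H2 := clarkson t m p2.
have E : `|(t - m) / 2| `^ p = 2 `^ (1 - p) / 2 * `|t - m| `^ p.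
  rewrite normrM powRM ?normr_ge0// mulrC; congr (_ * _).
  rewrite ger0_norm ?invr_ge0// powR_inv_base//.
  by rewrite gt0_powRD// powRr1//; field.
have E2 : p * dpow p m * ((t + m) / 2 - m) = p * dpow p m * (t - m) / 2 by field.
by move: H1 H2; rewrite E E2; lra.
Qed.

Lemma le_norm_powR p a : 1 <= p -> `|a| <= 1 + `|a| `^ p.
Proof.
move=> p1; have [a1|a1] := leP `|a| 1; first by rewrite (le_trans a1)// lerDl powR_ge0.
by rewrite (le_trans (le1r_powR (ltW a1) p1))// lerDr.
Qed.

Lemma young_le p x a : 1 <= p -> 0 <= x -> x `^ (p - 1) * `|a| <= x `^ p + `|a| `^ p.
Proof.
move=> p1 x0; have p0 : 0 < p by exact: lt_le_trans p1.
have [ax|xa] := leP `|a| x.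
  rewrite (@le_trans _ _ (x `^ p))//; last by rewrite lerDl powR_ge0.
  by rewrite -[leRHS](mulr_powRB1 x0 p0) mulrC ler_wpM2r ?powR_ge0.
rewrite (@le_trans _ _ (`|a| `^ p))//; last by rewrite lerDr powR_ge0.
rewrite -[leRHS](mulr_powRB1 (normr_ge0 a) p0) mulrC ler_wpM2l//.
by apply: ge0_ler_powR; rewrite ?subr_ge0// ?nnegrE// ltW.
Qed.

Lemma le_root_add p x e : 0 < p -> 0 <= x -> 0 < e -> x <= (x `^ p^-1 + e) `^ p.
Proof.
move=> p0 x0 e0; rewrite -{1}[x](powRr1 x0) -(@mulVf _ p) ?gt_eqF// powRrM.
apply: ge0_ler_powR; rewrite ?nnegrE ?powR_ge0 ?(ltW p0)//.
  by rewrite addr_ge0 ?powR_ge0// ltW.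
by rewrite lerDl ltW.
Qed.

Lemma minkowski_optimize p (S A B : R) : 1 <= p -> 0 <= S -> 0 <= A -> 0 <= B ->
  (forall l, 0 < l < 1 -> S <= l `^ (1 - p) * A + (1 - l) `^ (1 - p) * B) ->
  S <= (A `^ p^-1 + B `^ p^-1) `^ p.
Proof.
move=> p1 S0 A0 B0 H; have p0 : 0 < p by exact: lt_le_trans p1.
have pV0 : 0 <= p^-1 by rewrite invr_ge0 ltW.
have rootK x : 0 <= x -> (x `^ p^-1) `^ p = x.
  by move=> x0; rewrite -powRrM mulVf ?gt_eqF// powRr1.
have powK x : 0 <= x -> (x `^ p) `^ p^-1 = x.
  by move=> x0; rewrite -powRrM divff ?gt_eqF// powRr1.
rewrite -[leLHS](rootK S)//; apply: ge0_ler_powR; rewrite ?nnegrE ?addr_ge0 ?powR_ge0 ?(ltW p0)//.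
apply/ler_addgt0Pl => e e0.
set a := A `^ p^-1 + e / 2; set b := B `^ p^-1 + e / 2.
have e20 : 0 < e / 2 by rewrite divr_gt0.
have a0 : 0 < a by rewrite ltr_wpDl ?powR_ge0.
have b0 : 0 < b by rewrite ltr_wpDl ?powR_ge0.
have ab0 : 0 < a + b by rewrite addr_gt0.
have Aa : A <= a `^ p by exact: le_root_add.
have Bb : B <= b `^ p by exact: le_root_add.
have abE : e + (A `^ p^-1 + B `^ p^-1) = a + b by rewrite /a /b; field.
clearbody a b.
have key c : 0 < c -> (c / (a + b)) `^ (1 - p) * c `^ p = c * (a + b) `^ (p - 1).
  move=> c0; rewrite powRM ?(ltW c0) ?invr_ge0 ?(ltW ab0)// mulrAC -gt0_powRD//.
  rewrite subrK powRr1 ?(ltW c0)//; congr (_ * _).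
  by rewrite powR_inv_base ?(ltW ab0)// opprB.
have l01 : 0 < a / (a + b) < 1 by rewrite divr_gt0//= ltr_pdivrMr// mul1r ltrDl.
have E1 : 1 - a / (a + b) = b / (a + b) by field; rewrite gt_eqF.
have Sab : S <= (a + b) `^ p.
  rewrite (le_trans (H _ l01))// E1.
  rewrite (le_trans (lerD (ler_wpM2l (powR_ge0 _ _) Aa) (ler_wpM2l (powR_ge0 _ _) Bb)))//.
  have ka := key a a0; have kb := key b b0.
  have kab := mulr_powRB1 (ltW ab0) p0.
  by rewrite ka kb -mulrDl kab lexx.
rewrite abE.
rewrite -[leRHS]powK ?(ltW ab0)//; apply: ge0_ler_powR; rewrite ?nnegrE ?powR_ge0//.
Qed.

Lemma delta_lower (s E F : R) : 1 <= s -> 0 <= F -> F <= E ->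
  (1 - 2 `^ (1 - s)) * (E + F) `^ s <= (E + F) `^ s - 2 * F `^ s.
Proof.
move=> s1 F0 FE; have s0 : 0 <= s by exact: le_trans s1.
rewrite mulrBl mul1r lerD2l lerN2.
have H : F `^ s <= ((E + F) / 2) `^ s.
  by apply: ge0_ler_powR => //; rewrite ?nnegrE//; lra.
rewrite (le_trans (ler_wpM2l _ H))// powRM ?invr_ge0//; last by lra.
rewrite mulrCA mulrC ler_wpM2r ?powR_ge0//.
by rewrite powR_inv_base// gt0_powRD// powRr1.
Qed.

Definition moment_cst p : R := let n := (Num.truncn (p / 2)).+1 in
  4 `^ (p / 2) * (1 + n.+1%:R ^+ n).

Lemma moment_cst_ge0 p : 0 <= moment_cst p.
Proof. by rewrite mulr_ge0 ?powR_ge0// addr_ge0// exprn_ge0. Qed.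

Lemma moment_bound p eps t : 0 <= p -> 0 < eps ->
  `|t| `^ p <= moment_cst p * eps `^ (p / 2) * expR (t ^+ 2 / (4 * eps)).
Proof.
move=> p0 e0; set y := t ^+ 2 / (4 * eps).
have p20 : 0 <= p / 2 by rewrite divr_ge0.
have e40 : 0 < 4 * eps by rewrite mulr_gt0.
have y0 : 0 <= y by rewrite divr_ge0 ?sqr_ge0// ltW.
have -> : `|t| `^ p = 4 `^ (p / 2) * eps `^ (p / 2) * y `^ (p / 2).
  have -> : 4 `^ (p / 2) * eps `^ (p / 2) = (4 * eps) `^ (p / 2) by rewrite powRM// ltW.
  rewrite normr_powR_sqr -powRM ?(ltW e40)//.
  by rewrite /y [4 * eps * _]mulrC divfK// gt_eqF.
rewrite /moment_cst; set n := (Num.truncn (p / 2)).+1.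
rewrite -!mulrA ler_wpM2l ?powR_ge0// mulrCA ler_wpM2l ?powR_ge0//.
have yn : y `^ (p / 2) <= 1 + y ^+ n.
  have [y1|y1] := leP y 1.
    rewrite (@le_trans _ _ 1)//; last by rewrite lerDl exprn_ge0.
    have : y `^ (p / 2) <= 1 `^ (p / 2) by apply: ge0_ler_powR; rewrite ?nnegrE.
    by rewrite powR1.
  rewrite (@le_trans _ _ (y ^+ n))//; last by rewrite lerDr.
  rewrite -powR_mulrn//; apply: ler_powR; rewrite ?(ltW y1)//.
  by rewrite /n ltW// truncnS_gt.
rewrite (le_trans yn)// mulrDl mul1r lerD//.
  by rewrite -[leLHS]expR0 ler_expR.
have [->|y0'] := eqVneq y 0; first by rewrite expr0n mulr_ge0 ?exprn_ge0 ?expR_ge0.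
have := @expRN_le R n y; rewrite lt0r y0' y0 => /(_ isT).
by rewrite expRN ler_pdivrMr ?expR_gt0.
Qed.

End scalar_inequalities.

Section jensen.
Local Open Scope ring_scope.
Context d (T : measurableType d) (R : realType) (mu : {measure set T -> \bar R}).

Lemma weighted_integrable (p : R) (a k : T -> R) : 1 <= p ->
  measurable_fun setT a -> measurable_fun setT k -> (forall x, 0 <= k x) ->
  (\int[mu]_x (k x)%:E < +oo)%E -> (\int[mu]_x (`|a x| `^ p * k x)%:E < +oo)%E ->
  mu.-integrable setT (EFin \o (fun x => a x * k x)).
Proof.
move=> p1 ma mk k0 Ik Iak.
have map : measurable_fun setT (fun x => `|a x| `^ p * k x).
  apply: measurable_funM => //.
  by apply: (measurableT_comp (measurable_powR _)); exact: measurableT_comp.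
apply/integrableP; split; first by apply/measurable_EFinP; exact: measurable_funM.
apply: (@le_lt_trans _ _ (\int[mu]_x ((k x)%:E + (`|a x| `^ p * k x)%:E))%E).
  apply: ge0_le_integral => //.
  - by do 2 apply: measurableT_comp => //; exact: measurable_funM.
  - by apply: emeasurable_funD; exact/measurable_EFinP.
  move=> x _; rewrite /= -EFinD lee_fin normrM (ger0_norm (k0 x)).
  rewrite -[X in _ <= X + _]mul1r -mulrDl ler_wpM2r//.
  exact: le_norm_powR.
rewrite ge0_integralD//; first exact: lte_add_pinfty.
- by move=> x _; rewrite lee_fin.
- exact/measurable_EFinP.
- by move=> x _; rewrite lee_fin mulr_ge0// powR_ge0.
- exact/measurable_EFinP.
Qed.

Lemma jensen_powR (p K : R) (a k : T -> R) : 1 <= p ->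
  measurable_fun setT a -> measurable_fun setT k -> (forall x, 0 <= k x) ->
  0 < K -> (\int[mu]_x (k x)%:E = K%:E)%E ->
  ((`|\int[mu]_x (a x * k x)| `^ p * K `^ (1 - p))%:E <= \int[mu]_x (`|a x| `^ p * k x)%:E)%E.
Proof.
move=> p1 ma mk k0 K0 IK; have p0 : 0 < p by exact: lt_le_trans p1.
have [Ioo|] := eqVneq (\int[mu]_x (`|a x| `^ p * k x)%:E)%E +oo%E.
  by rewrite Ioo leey.
rewrite -ltey => Ip.
have map : measurable_fun setT (fun x => `|a x| `^ p * k x).
  apply: measurable_funM => //.
  by apply: (measurableT_comp (measurable_powR _)); exact: measurableT_comp.
have iak : mu.-integrable setT (EFin \o (fun x => a x * k x)).
  by apply: (weighted_integrable p1) => //; rewrite IK ltry.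
have ik : mu.-integrable setT (EFin \o k).
  apply/integrableP; split; first exact/measurable_EFinP.
  by under eq_integral do rewrite /= ger0_norm//; rewrite IK ltry.
have iap : mu.-integrable setT (EFin \o (fun x => `|a x| `^ p * k x)).
  apply/integrableP; split; first exact/measurable_EFinP.
  by under eq_integral do rewrite /= ger0_norm ?mulr_ge0 ?powR_ge0//.
set I := \int[mu]_x (a x * k x).
pose m := I / K.
have E : `|I| `^ p * K `^ (1 - p) = `|m| `^ p * K.
  have -> : I = m * K by rewrite /m divfK// gt_eqF.
  rewrite normrM (gtr0_norm K0) powRM ?normr_ge0 ?(ltW K0)// -mulrA -gt0_powRD//.
  by rewrite addrC subrK powRr1 ?(ltW K0).
rewrite E.
pose g x := (`|m| `^ p - p * dpow p m * m) * k x + p * dpow p m * (a x * k x).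
have ig1 : mu.-integrable setT (EFin \o (fun x => (`|m| `^ p - p * dpow p m * m) * k x)).
  exact: (@integrableZl _ _ _ mu _ measurableT _ _ ik).
have ig2 : mu.-integrable setT (EFin \o (fun x => p * dpow p m * (a x * k x))).
  exact: (@integrableZl _ _ _ mu _ measurableT _ _ iak).
have ig : mu.-integrable setT (EFin \o g) by exact: (@integrableD _ _ _ mu _ measurableT _ _ ig1 ig2).
have IKr : \int[mu]_x k x = K by rewrite /Rintegral IK.
have <- : \int[mu]_x g x = `|m| `^ p * K.
  rewrite RintegralD// !RintegralZl// IKr -/I.
  have -> : I = m * K by rewrite /m divfK// gt_eqF.
  ring.
rewrite /Rintegral fineK; last exact: integrable_fin_num.
apply: le_integral => // x _; rewrite lee_fin /g.
have := ler_wpM2r (k0 x) (powR_tangent (a x) m p1); lra.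
Qed.

End jensen.

Section gaussian.
Variables (R : realType) (eps : R).
Hypothesis eps0 : 0 < eps.
Notation mu := (@lebesgue_measure R).

Let sd := Num.sqrt eps.
Let sd0 : sd != 0. Proof. by rewrite gt_eqF// sqrtr_gt0. Qed.
Let sd2 : sd ^+ 2 = eps. Proof. by rewrite sqr_sqrtr// ltW. Qed.

Definition gauss1 (y x : R) : R := normal_pdf y sd x.

Lemma gauss1E y x : gauss1 y x = (2 * pi * eps) `^ (- 2^-1) * expR (- (x - y) ^+ 2 / (2 * eps)).
Proof.
rewrite /gauss1 normal_pdfE// /normal_peak /normal_fun sd2; congr (_ * expR (_ / _)); last by ring.
rewrite -powR12_sqrt; last by rewrite mulrn_wge0// mulr_ge0 ?pi_ge0// ltW.
by rewrite powRN; congr (_ `^ _)^-1; ring.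
Qed.

Lemma gauss1_ge0 y x : 0 <= gauss1 y x. Proof. exact: normal_pdf_ge0. Qed.

Lemma measurable_gauss1 y : measurable_fun setT (gauss1 y).
Proof. exact: measurable_normal_pdf. Qed.

Lemma integral_gauss1 y : (\int[mu]_x (gauss1 y x)%:E = 1)%E.
Proof. exact: integral_normal_pdf. Qed.

Lemma moment_gauss1 p y : 1 <= p ->
  (\int[mu]_x (`|y - x| `^ p * gauss1 y x)%:E <= (moment_cst p * eps `^ (p / 2) * 2 `^ (2^-1))%:E)%E.
Proof.
move=> p1; have p0 : 0 <= p by exact: le_trans p1.
pose s2 := Num.sqrt (2 * eps).
have e20 : 0 < 2 * eps by rewrite mulr_gt0.
have s20 : s2 != 0 by rewrite gt_eqF// sqrtr_gt0.
have s22 : s2 ^+ 2 = 2 * eps by rewrite sqr_sqrtr// ltW.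
have c0 : 0 <= moment_cst p * eps `^ (p / 2) * 2 `^ (2^-1) :> R.
  by rewrite !mulr_ge0 ?moment_cst_ge0 ?powR_ge0.
have pe0 : 0 < 2 * pi * eps by rewrite !mulr_gt0 ?pi_gt0.
apply: (@le_trans _ _ (\int[mu]_x ((moment_cst p * eps `^ (p / 2) * 2 `^ (2^-1))%:E * (normal_pdf y s2 x)%:E))%E).
  apply: ge0_le_integral => //.
  - by move=> x _; rewrite lee_fin mulr_ge0 ?powR_ge0 ?gauss1_ge0.
  - apply/measurable_EFinP; apply: measurable_funM; last exact: measurable_gauss1.
    apply: (measurableT_comp (measurable_powR p)); apply: measurableT_comp => //.
    exact: measurable_funB.
  - by apply: emeasurable_funM => //; apply/measurable_EFinP; exact: measurable_normal_pdf.
  move=> x _; rewrite -EFinM lee_fin.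
  rewrite normal_pdfE// /normal_peak /normal_fun s22 gauss1E.
  rewrite -powR12_sqrt; last by rewrite mulrn_wge0// mulr_ge0 ?pi_ge0// ltW.
  have -> : (2 * eps * pi *+ 2) `^ 2^-1 = 2 `^ 2^-1 * (2 * pi * eps) `^ (2^-1).
    by rewrite -powRM ?(ltW pe0)//; congr powR; ring.
  rewrite powRN (invfM (2 `^ 2^-1)).
  have q0 : 0 <= ((2 * pi * eps) `^ 2^-1)^-1 by rewrite invr_ge0 powR_ge0.
  move: (((2 * pi * eps) `^ 2^-1)^-1) q0 => q q0.
  rewrite (le_trans (ler_wpM2r _ (moment_bound (y - x) p0 eps0)))//.
    by rewrite mulr_ge0 ?expR_ge0.
  move: (moment_cst p) (moment_cst_ge0 p) => C C0.
  rewrite -!mulrA; apply: ler_wpM2l => //.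
  apply: ler_wpM2l; first exact: powR_ge0.
  rewrite [leRHS]mulrA divff ?gt_eqF ?powR_gt0// mul1r.
  rewrite mulrCA ler_wpM2l//.
  rewrite -expRD ler_expR le_eqVlt; apply/orP; left; apply/eqP.
  by field; rewrite gt_eqF.
rewrite ge0_integralZl//.
- by rewrite integral_normal_pdf mule1.
- by apply/measurable_EFinP; exact: measurable_normal_pdf.
- by move=> x _; rewrite lee_fin normal_pdf_ge0.
Qed.

Section rows.
Variable d : nat.
Local Notation V := 'rV[R]_d.

Lemma eta_prod (y x : V) : eta eps (y - x) = \prod_(i < d) gauss1 (y ord0 i) (x ord0 i).
Proof.
have pe0 : 0 <= 2 * pi * eps by rewrite !mulr_ge0 ?pi_ge0// ltW.
under eq_bigr do rewrite gauss1E.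
rewrite big_split/= prodr_const card_ord -powR_mulrn ?powR_ge0// -powRrM.
rewrite /eta; congr (_ * _); first by congr powR; rewrite mulNr mulrC.
rewrite -(big_morph _ (@expRD R) (expR0 R)); congr expR.
rewrite mulNr mulr_suml -sumrN; apply: eq_bigr => i _; rewrite !mxE.
by rewrite -mulNr; congr (_ / _); ring.
Qed.

Lemma etaN (z : V) : eta eps (- z) = eta eps z.
Proof.
by rewrite /eta; under eq_bigr do rewrite mxE sqrrN.
Qed.

Lemma eta_sym (x y : V) : eta eps (y - x) = eta eps (x - y).
Proof. by rewrite -etaN opprB. Qed.

Lemma eta_gt0 (z : V) : 0 < eta eps z.
Proof. by rewrite mulr_gt0 ?expR_gt0// powR_gt0// !mulr_gt0 ?pi_gt0. Qed.

Definition eta_max : R := (2 * pi * eps) `^ (- (d%:R / 2)).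

Lemma eta_le (z : V) : eta eps z <= eta_max.
Proof.
rewrite /eta ler_piMr ?powR_ge0// -[leRHS]expR0 ler_expR mulNr oppr_le0.
by rewrite divr_ge0 ?sumr_ge0// ?mulr_ge0 ?(ltW eps0)// => i _; exact: sqr_ge0.
Qed.

Lemma measurable_eta : measurable_fun setT (@eta R d eps).
Proof.
apply: measurable_funM => //; apply: measurableT_comp => //.
apply: measurable_funM => //; apply: measurableT_comp => //.
apply: measurable_sum => i; apply: measurable_funX; exact: measurable_coord.
Qed.

Lemma integral_eta_mul (y : V) (i : 'I_d) (g : R -> R) : measurable_fun setT g -> (forall t, 0 <= g t) ->
  (\int[lebesgue_row R d]_x (g (x ord0 i) * eta eps (y - x))%:E =
   \int[mu]_t (g t * gauss1 (y ord0 i) t)%:E)%E.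
Proof.
move=> mg g0.
pose h (l : 'I_d) (t : R) : \bar R := ((if l == i then g t else 1) * gauss1 (y ord0 l) t)%:E.
have mh l : measurable_fun setT (h l).
  apply/measurable_EFinP; apply: measurable_funM; last exact: measurable_gauss1.
  by case: (l == i).
have h0 l t : (0 <= h l t)%E.
  by rewrite lee_fin mulr_ge0 ?gauss1_ge0//; case: ifP.
transitivity (\int[lebesgue_row R d]_x \prod_(l < d) h l (x ord0 l))%E.
  apply: eq_integral => x _; rewrite prodEFin big_split/= -eta_prod; congr (_ * _)%:E.
  by rewrite (bigD1 i)//= eqxx big1 ?mulr1// => l /negbTE ->.
rewrite (integral_lebesgue_row_prod mh h0) (bigD1 i)//= big1 ?mule1.
  by rewrite /h eqxx.
by move=> l /negbTE li; rewrite /h li; under eq_integral do rewrite mul1r; exact: integral_gauss1.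
Qed.

Lemma integral_eta (y : V) : (\int[lebesgue_row R d]_x (eta eps (y - x))%:E = 1)%E.
Proof.
transitivity (\int[lebesgue_row R d]_x \prod_(l < d) (gauss1 (y ord0 l) (x ord0 l))%:E)%E.
  by apply: eq_integral => x _; rewrite prodEFin eta_prod.
rewrite (@integral_lebesgue_row_prod R d (fun l t => (gauss1 (y ord0 l) t)%:E)).
- by rewrite big1// => l _; exact: integral_gauss1.
- by move=> l; apply/measurable_EFinP; exact: measurable_gauss1.
- by move=> l t; rewrite lee_fin gauss1_ge0.
Qed.

End rows.

Section matrices.
Variables N d : nat.
Local Notation T := 'M[R]_(N, d).
Local Notation leb := (lebesgue_mx R N d).

Definition gaussian (Z : T) : R := \prod_(k < N) eta eps (row k Z).
Local Notation gk := gaussian.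

Lemma gk_gt0 Z : 0 < gk Z.
Proof. by apply: prodr_gt0 => k _; exact: eta_gt0. Qed.

Lemma gk_ge0 Z : 0 <= gk Z. Proof. exact: ltW (gk_gt0 Z). Qed.

Lemma gkN Z : gk (- Z) = gk Z.
Proof. by apply: eq_bigr => k _; rewrite linearN etaN. Qed.

Lemma gk_sym X Y : gk (Y - X) = gk (X - Y).
Proof. by rewrite -gkN opprB. Qed.

Lemma gkB X Y : gk (Y - X) = \prod_(k < N) eta eps (row k Y - row k X).
Proof. by apply: eq_bigr => k _; rewrite linearB. Qed.

Definition gk_max : R := (eta_max d) ^+ N.

Lemma gk_le Z : gk Z <= gk_max.
Proof.
rewrite /gk /gk_max -[X in _ ^+ X](card_ord N) -prodr_const; apply: ler_prod => k _.
by rewrite (ltW (eta_gt0 _)) eta_le.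
Qed.

Lemma measurable_gk : measurable_fun setT gk.
Proof.
apply: measurable_prod => k _.
apply: (measurableT_comp (f := @eta R d eps)); first exact: measurable_eta.
exact: measurable_row.
Qed.

Lemma measurable_sub : measurable_fun setT (fun z : T * T => z.1 - z.2).
Proof.
apply: measurable_fun_mx => i j; under eq_fun do rewrite !mxE.
apply: measurable_funB.
  exact: (measurableT_comp (measurable_coord i j) measurable_fst).
exact: (measurableT_comp (measurable_coord i j) measurable_snd).
Qed.

Lemma measurable_gk2 : measurable_fun setT (fun z : T * T => gk (z.1 - z.2)).
Proof. exact: (measurableT_comp measurable_gk measurable_sub). Qed.

Lemma integral_gk (Y : T) : (\int[leb]_X (gk (Y - X))%:E = 1)%E.
Proof.
under eq_integral do rewrite gkB -prodEFin.
have me (k : 'I_N) : measurable_fun setT (fun x : 'rV[R]_d => (eta eps (row k Y - x))%:E).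
  apply/measurable_EFinP; under eq_fun do rewrite eta_sym.
  apply: (measurableT_comp (f := @eta R d eps)); first exact: measurable_eta.
  exact: measurable_shift.
rewrite (@integral_rows_prod R N d _ (fun k x => (eta eps (row k Y - x))%:E))//.
  by rewrite big1// => k _; exact: integral_eta.
by move=> k x; rewrite lee_fin ltW// eta_gt0.
Qed.

Lemma gkE Z : gk Z = gk_max * expR (- (\sum_(k < N) \sum_(l < d) Z k l ^+ 2) / (2 * eps)).
Proof.
rewrite /gk /eta big_split/= prodr_const card_ord; congr (_ * _).
rewrite -(big_morph _ (@expRD R) (expR0 R)); congr expR.
rewrite -mulr_suml sumrN; congr (- _ / _); apply: eq_bigr => k _; apply: eq_bigr => l _.
by rewrite mxE.
Qed.

Lemma sum_sqr_line (j : 'I_N) (i : 'I_d) (Z : T) (s : R) :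
  \sum_(k < N) \sum_(l < d) (Z + s *: delta_mx j i) k l ^+ 2 =
  \sum_(k < N) \sum_(l < d) Z k l ^+ 2 + (2 * s * Z j i + s ^+ 2).
Proof.
have E k l : (Z + s *: delta_mx j i) k l ^+ 2 = Z k l ^+ 2 +
    (if (k == j) && (l == i) then 2 * s * Z j i + s ^+ 2 else 0).
  rewrite !mxE; case: ifP => [/andP[/eqP -> /eqP ->]|_]; last by rewrite mulr0 !addr0.
  by rewrite mulr1; ring.
under eq_bigr do under eq_bigr do rewrite E.
under eq_bigr do rewrite big_split/=.
rewrite big_split/=; congr (_ + _).
rewrite (bigD1 j)//= (bigD1 i)//= !eqxx/= big1 ?addr0; last by move=> l /negbTE ->.
rewrite big1 ?addr0// => k /negbTE ->; by rewrite big1.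
Qed.

Lemma ac_gk (j : 'I_N) (i : 'I_d) :
  ac_everywhere (delta_mx j i) gk (fun Z => - (Z j i / eps) * gk Z).
Proof.
move=> Z; pose A := \sum_(k < N) \sum_(l < d) Z k l ^+ 2.
have E s : gk (Z + s *: delta_mx j i) = gk_max * expR ((- (2 * eps)^-1) * (s ^+ 2) + (- (Z j i / eps)) * s + (- A / (2 * eps))).
  by rewrite gkE sum_sqr_line -/A; congr (_ * expR _); field; rewrite gt_eqF.
have E2 s : (Z + s *: delta_mx j i) j i = Z j i + s by rewrite !mxE !eqxx mulr1.
have D s : is_derive s (1 : R) (fun s => gk (Z + s *: delta_mx j i))
   (- ((Z + s *: delta_mx j i) j i / eps) * gk (Z + s *: delta_mx j i)).
  have d1 : is_derive s (1 : R) (fun s : R => - (2 * eps)^-1 * (s ^+ 2)) (- (2 * eps)^-1 * (2 * s)).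
    have d0 := is_derive_affine (- (2 * eps)^-1) 0 s.
    have := is_deriveM d0 (is_derive_id s (1 : R)).
    rewrite (_ : (_ * _)%R = (fun s : R => - (2 * eps)^-1 * s ^+ 2)).
      move=> H; apply: is_derive_eq H _.
      by rewrite /GRing.scale/=; ring.
    apply/funext => r; rewrite (_ : (_ * _)%R r = (- (2 * eps)^-1 * r + 0) * r)//.
    by ring.
  have d2 := is_derive_affine (- (Z j i / eps)) (- A / (2 * eps)) s.
  have d3 := is_deriveD d1 d2.
  have d4 := @is_derive1_comp R expR _ s _ _ (is_derive_expR _) d3.
  have d5 := is_deriveZ gk_max d4.
  have fE : (fun s => gk (Z + s *: delta_mx j i)) = gk_max \*: (expR \o
     ((fun s : R => - (2 * eps)^-1 * (s ^+ 2)) + (fun s : R => - (Z j i / eps) * s + (- A / (2 * eps))))).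
    by apply/funext => r; rewrite E /= addrA.
  rewrite fE; apply: is_derive_eq d5 _.
  rewrite E2 E /GRing.scale/= addrA; field; rewrite gt_eqF//.
apply: primitive01_FTC => //.
have c1 : continuous (fun s : R => gk (Z + s *: delta_mx j i)).
  by move=> s; apply: differentiable_continuous; apply/derivable1_diffP; case: (D s).
have c2 : continuous (fun s : R => - eps^-1 * s + (- (Z j i / eps))).
  move=> s; apply: differentiable_continuous; apply/derivable1_diffP.
  by case: (is_derive_affine (- eps^-1) (- (Z j i / eps)) s).
rewrite [X in continuous X](_ : _ = fun s : R =>
    (- eps^-1 * s + (- (Z j i / eps))) * gk (Z + s *: delta_mx j i)).
  by move=> s; apply: cvgM; [exact: c2|exact: c1].
by apply/funext => s; rewrite E2; congr (_ * _); ring.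
Qed.

End matrices.
End gaussian.

Section densities.
Variables (R : realType) (m n : nat).
Local Notation T := 'M[R]_(m, n).
Local Notation leb := (lebesgue_mx R m n).

Definition has_density (P : probability T R) (f : T -> R) :=
  [/\ measurable_fun setT f, forall x, 0 <= f x &
    forall A, measurable A -> P A = (\int[leb]_(x in A) (f x)%:E)%E].

Lemma has_density_ac P f : has_density P f -> P `<< leb.
Proof.
move=> [mf f0 Pf]; apply/null_content_dominatesP => A mA A0.
rewrite Pf//; apply: null_set_integral => //.
  exact/measurable_EFinP/measurable_funTS.
Qed.

Lemma has_density_sigma_finite P f : has_density P f ->
  {ae leb, forall x, (f x)%:E = Radon_Nikodym_SigmaFinite.f P leb x}.
Proof.
move=> Pf; have ac := has_density_ac Pf; case: Pf => mf f0 Pf.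
have H := @integral_ae_eq _ _ _ leb setT measurableT (EFin \o f)
   (Radon_Nikodym_SigmaFinite.f P leb).
apply: ae_imp (H _ _ _).
- by move=> x /(_ I) ->.
- exact: Radon_Nikodym_SigmaFinite.f_integrable.
- exact/measurable_EFinP.
- by move=> A _ mA; rewrite -Radon_Nikodym_SigmaFinite.f_integral//; exact: Pf.
Qed.

Lemma has_density_integral P f (g : T -> \bar R) : has_density P f ->
  measurable_fun setT g -> (forall x, 0 <= g x)%E ->
  (\int[P]_x g x = \int[leb]_x (g x * (f x)%:E))%E.
Proof.
move=> Pf mg g0; have ac := has_density_ac Pf.
rewrite -(Radon_Nikodym_SigmaFinite.change_of_variables ac)//.
have mR : measurable_fun setT (Radon_Nikodym_SigmaFinite.f P leb).
  apply: (measurable_int leb); exact: Radon_Nikodym_SigmaFinite.f_integrable.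
have [mf f0 _] := Pf.
apply: ge0_ae_eq_integral => //.
- exact: emeasurable_funM.
- by apply: emeasurable_funM => //; exact/measurable_EFinP.
- by move=> x _; rewrite mule_ge0//; exact: Radon_Nikodym_SigmaFinite.f_ge0.
- by move=> x _; rewrite mule_ge0// lee_fin.
by apply: ae_imp (has_density_sigma_finite Pf) => x -> _.
Qed.

Lemma has_density_unique P f : has_density P f -> {ae leb, forall x, density P x = f x}.
Proof.
move=> Pf; have ac := has_density_ac Pf.
have H := @ae_eq_Radon_Nikodym_SigmaFinite _ _ _ P leb ac setT measurableT.
by apply: ae_imp2 H (has_density_sigma_finite Pf) => x /(_ I) e1 e2; rewrite /density -e1 -e2.
Qed.

Lemma has_density_root p P f : has_density P f ->
  {ae leb, forall x, root_density p P x = f x `^ p^-1}.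
Proof.
by move=> /has_density_unique; apply: ae_imp => x e; rewrite /root_density e.
Qed.

Lemma has_density_mass P f : has_density P f -> (\int[leb]_x (f x)%:E = 1)%E.
Proof. by move=> [_ _ Pf]; rewrite -Pf// probability_setT. Qed.

Lemma has_density_exists (f : T -> R) : measurable_fun setT f -> (forall x, 0 <= f x) ->
  (\int[leb]_x (f x)%:E = 1)%E -> exists P, has_density P f.
Proof.
move=> mf f0 f1.
have mf' : measurable_fun setT (EFin \o f) by exact/measurable_EFinP.
have f0' x : (0 <= (EFin \o f) x)%E by rewrite lee_fin.
pose D := density_measure leb mf' f0'.
have D1 : D setT = 1%E by [].
pose P : probability T R := HB.pack D (Measure_isProbability.Build _ _ _ D D1).
by exists P; split.
Qed.

Lemma prob_of_densityP (f : T -> R) : measurable_fun setT f -> (forall x, 0 <= f x) ->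
  (\int[leb]_x (f x)%:E = 1)%E -> has_density (prob_of_density f) f.
Proof.
move=> mf f0 f1; split => //.
have [P [_ _ PP]] := has_density_exists mf f0 f1.
by apply: (@getPex _ [set P : probability T R |
    forall A, measurable A -> P A = (\int[leb]_(x in A) (f x)%:E)%E]); exists P.
Qed.

Lemma P1p_has_density p (P : probability T R) : 0 < p -> P `<< leb -> measurable_fun setT (root_density p P) ->
  has_density P (fun x => root_density p P x `^ p).
Proof.
move=> p0 ac mu; split=> [|x|A mA].
- exact: (measurableT_comp (measurable_powR p)).
- exact: powR_ge0.
have H := @ae_eq_Radon_Nikodym_SigmaFinite _ _ _ P leb ac setT measurableT.
rewrite (Radon_Nikodym_SigmaFinite.f_integral ac mA).
apply: ge0_ae_eq_integral => //.
- apply: measurable_funTS; apply: (measurable_int leb); exact: Radon_Nikodym_SigmaFinite.f_integrable.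
- apply/measurable_EFinP/measurable_funTS; exact: (measurableT_comp (measurable_powR p)).
- by move=> x _; exact: Radon_Nikodym_SigmaFinite.f_ge0.
- by move=> x _; rewrite lee_fin powR_ge0.
apply: ae_imp H => x /(_ I) e _; rewrite /root_density /density -e.
rewrite -powRrM mulVf ?gt_eqF// powRr1 ?fine_ge0 ?fineK ?Radon_Nikodym_SigmaFinite.f_ge0//.
exact: Radon_Nikodym_SigmaFinite.f_fin_num.
Qed.

Lemma Lfun_powR p (f : T -> R) : 0 < p -> f \in Lfun leb p%:E <->
  measurable_fun setT f /\ (\int[leb]_x (`|f x| `^ p)%:E < +oo)%E.
Proof.
move=> p0; have pV : p^-1 != 0 by rewrite invr_neq0// gt_eqF.
have E : ('N[leb]_(p%:E)[EFin \o f])%E = ((\int[leb]_x (`|f x| `^ p)%:E) `^ p^-1)%E.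
  by rewrite unlock /Lnorm.
have I0 : (0 <= \int[leb]_x (`|f x| `^ p)%:E)%E.
  by apply: integral_ge0 => x _; rewrite lee_fin powR_ge0.
split.
- rewrite /Lfun inE/= => /andP[/set_mem mf /set_mem]; rewrite /= /finite_norm E => fin.
  split => //; rewrite ltey; apply/eqP => Ioo; move: fin; rewrite Ioo.
  by rewrite poweRyr.
- move=> [mf fin]; rewrite /Lfun inE/=; apply/andP; split; rewrite inE//=.
  by rewrite /finite_norm E poweR_lty.
Qed.

Lemma Lp_loc_integrable p (f : T -> R) : 1 <= p -> measurable_fun setT f ->
  (\int[leb]_x (`|f x| `^ p)%:E < +oo)%E -> loc_integrable f.
Proof.
move=> p1 mf fin; apply: cube_loc_integrable => M.
have ip : leb.-integrable setT (fun x => (`|f x| `^ p)%:E).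
  apply/integrableP; split.
    apply/measurable_EFinP; apply: (measurableT_comp (measurable_powR p)).
    exact: measurableT_comp.
  by under eq_integral do rewrite gee0_abs ?lee_fin ?powR_ge0//.
have mc := @measurable_cube R m n M.
have i1 : leb.-integrable (cube M) (fun _ : T => 1%:E).
  apply/integrableP; split => //.
  under eq_integral do rewrite gee0_abs ?lee_fin//.
  by rewrite integral_cst// mul1e leb_cube_lty.
have i2 := integrableS measurableT mc (@subsetT _ _) ip.
apply: (le_integrable mc) (integrableD mc i1 i2).
  exact/measurable_EFinP/measurable_funTS.
move=> x _; rewrite /= lee_fin [leRHS]ger0_norm ?addr_ge0 ?powR_ge0//.
exact: le_norm_powR.
Qed.

End densities.

Section energies.
Variables (R : realType) (m n : nat) (p : R).
Hypothesis p1 : 1 <= p.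
Local Notation T := 'M[R]_(m, n).
Local Notation leb := (lebesgue_mx R m n).

Let p0 : 0 < p. Proof. exact: lt_le_trans p1. Qed.

Lemma weak_partialP ij (f g : T -> R) : is_weak_partial ij f g ->
  is_weak_partial ij f (weak_partial ij f).
Proof. by move=> H; apply: (@xgetPex _ (cst 0) [set g | is_weak_partial ij f g]); exists g. Qed.

Lemma weak_partial_ae ij (f g : T -> R) : is_weak_partial ij f g ->
  {ae leb, forall x, weak_partial ij f x = g x}.
Proof. by move=> H; exact: weak_partial_unique (weak_partialP H) H. Qed.

Lemma measurable_weak_partial ij (f g : T -> R) : is_weak_partial ij f g ->
  measurable_fun setT g.
Proof. by case=> _ /loc_integrable_measurable. Qed.

Lemma measurable_abs_powR d (S : measurableType d) (f : S -> R) (q : R) :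
  measurable_fun setT f -> measurable_fun setT (fun x => `|f x| `^ q).
Proof. by move=> mf; apply: (measurableT_comp (measurable_powR q)); exact: measurableT_comp. Qed.

Lemma ae_eq_powR_integral (f g : T -> R) : measurable_fun setT f -> measurable_fun setT g ->
  {ae leb, forall x, f x = g x} ->
  (\int[leb]_x (`|f x| `^ p)%:E = \int[leb]_x (`|g x| `^ p)%:E)%E.
Proof.
move=> mf mg fg; apply: ge0_ae_eq_integral => //.
- by apply/measurable_EFinP; exact: measurable_abs_powR.
- by apply/measurable_EFinP; exact: measurable_abs_powR.
by apply: (ae_imp _ fg) => x ->.
Qed.

Lemma P1pP (P : probability T R) : P1p p P -> let u := root_density p P in
  [/\ measurable_fun setT u, has_density P (fun x => u x `^ p),
      forall ij, is_weak_partial ij u (weak_partial ij u) &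
      forall ij, (\int[leb]_x (`|weak_partial ij u x| `^ p)%:E < +oo)%E].
Proof.
move=> [ac [uL wp]] u; have /(Lfun_powR _ p0)[mu _] := uL.
split => // [|ij|ij]; first exact: P1p_has_density.
- by have [g /weak_partialP] := wp ij.
have [g wg /(Lfun_powR _ p0)[mg fin]] := wp ij.
rewrite (@ae_eq_powR_integral _ g)//; last exact: weak_partial_ae.
exact: measurable_weak_partial (weak_partialP wg).
Qed.

Lemma P1p_intro (P : probability T R) (w : T -> R) (g : 'I_m * 'I_n -> T -> R) :
  (forall x, 0 <= w x) -> has_density P (fun x => w x `^ p) -> measurable_fun setT w ->
  (forall ij, is_weak_partial ij w (g ij)) ->
  (forall ij, (\int[leb]_x (`|g ij x| `^ p)%:E < +oo)%E) ->
  P1p p P /\ (forall ij, {ae leb, forall x, weak_partial ij (root_density p P) x = g ij x}).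
Proof.
move=> w0 Pw mw wg fin; have ac := has_density_ac Pw.
have mu : measurable_fun setT (root_density p P).
  apply: (measurableT_comp (measurable_powR _)).
  have H := @ae_eq_Radon_Nikodym_SigmaFinite _ _ _ P leb ac setT measurableT.
  apply: (measurableT_comp (fine_measurable measurableT)); apply: (measurable_int leb).
  exact: Radon_Nikodym_integrable.
have uw : {ae leb, forall x, w x = root_density p P x}.
  apply: ae_imp (has_density_root p Pw) => x ->.
  by rewrite -powRrM divff ?gt_eqF// powRr1.
have wp ij : is_weak_partial ij (root_density p P) (g ij).
  apply: eq_weak_partial (wg ij) => //; last exact: ae_all.
  exact: measurable_weak_partial (wg ij).
split; last by move=> ij; exact: weak_partial_ae.
split => //; split.
  apply/Lfun_powR => //; split => //.
  rewrite (@ae_eq_powR_integral _ w)//; last by apply: (ae_imp _ uw) => x ->.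
  under eq_integral do rewrite ger0_norm//.
  by rewrite (has_density_mass Pw) ltry.
move=> ij; exists (g ij) => //; apply/Lfun_powR => //; split => //.
exact: measurable_weak_partial (wg ij).
Qed.

Lemma row_grad_norm_integral (u : T -> R) (g : 'I_m * 'I_n -> T -> R) i :
  (forall ij, is_weak_partial ij u (g ij)) ->
  (\int[leb]_x (row_grad_norm p i u x `^ p)%:E = \sum_(j < n) \int[leb]_x (`|g (i, j) x| `^ p)%:E)%E.
Proof.
move=> wg; have mwp ij := measurable_weak_partial (weak_partialP (wg ij)).
have mg ij := measurable_weak_partial (wg ij).
transitivity (\int[leb]_x \sum_(j < n) (`|weak_partial (i, j) u x| `^ p)%:E)%E.
  apply: eq_integral => x _; rewrite /row_grad_norm -powRrM mulVf ?gt_eqF//.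
  by rewrite powRr1 ?sumr_ge0// -?sumEFin// => j _; exact: powR_ge0.
rewrite ge0_integral_sum//.
- apply: eq_bigr => j _; apply: ae_eq_powR_integral => //; exact: weak_partial_ae.
- by move=> j; apply/measurable_EFinP; exact: measurable_abs_powR.
Qed.

Lemma energyE (P : probability T R) (g : 'I_m * 'I_n -> T -> R) : P1p p P ->
  (forall ij, {ae leb, forall x, weak_partial ij (root_density p P) x = g ij x}) ->
  (forall ij, measurable_fun setT (g ij)) ->
  energy p P = (\sum_(i < m) \sum_(j < n) \int[leb]_x (`|g (i, j) x| `^ p)%:E)%E.
Proof.
move=> H ae_g mg; rewrite /energy; case: asboolP => // _.
have [mu _ wp _] := P1pP H.
transitivity (\int[leb]_x \sum_(i < m) (row_grad_norm p i (root_density p P) x `^ p)%:E)%E.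
  apply: eq_integral => x _; rewrite /grad_norm -powRrM mulVf ?gt_eqF// powRr1; last first.
    by apply: sumr_ge0 => i _; apply: sumr_ge0 => j _; exact: powR_ge0.
  rewrite sumEFin; congr EFin; apply: eq_bigr => i _.
  by rewrite /row_grad_norm -powRrM mulVf ?gt_eqF// powRr1// sumr_ge0// => j _; exact: powR_ge0.
have mr i : measurable_fun setT (row_grad_norm p i (root_density p P)).
  apply: (measurableT_comp (measurable_powR _)); apply: measurable_sum => j.
  by apply: measurable_abs_powR; exact: measurable_weak_partial (wp _).
rewrite ge0_integral_sum//; last 2 first.
- move=> i; apply/measurable_EFinP; exact: (measurableT_comp (measurable_powR _)).
- by move=> i x _; rewrite lee_fin powR_ge0.
apply: eq_bigr => i _; rewrite (row_grad_norm_integral i wp).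
apply: eq_bigr => j _; apply: ae_eq_powR_integral => //; exact: measurable_weak_partial (wp _).
Qed.

End energies.

Lemma ac_everywhere_shift (R : realType) (m n : nat) (e c : 'M[R]_(m, n)) f g :
  ac_everywhere e f g ->
  ac_everywhere e (fun x => f (x + c)) (fun x => g (x + c)).
Proof.
move=> H x; have := H (x + c); congr primitive01; apply/funext => s;
by rewrite addrAC.
Qed.

Section gaussian_derivative.
Variables (R : realType) (eps : R) (N d : nat).
Hypothesis eps0 : 0 < eps.
Local Notation T := 'M[R]_(N, d).
Local Notation V := 'rV[R]_d.
Local Notation leb := (lebesgue_mx R N d).
Local Notation lebV := (lebesgue_mx R 1 d).
Local Notation mu := (@lebesgue_measure R).

Definition gaussian_partial (j : 'I_N) (i : 'I_d) (Z : T) : R := - (Z j i / eps) * gaussian eps Z.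

Definition dgk_max : R := eps^-1 * (gk_max eps N d * (moment_cst 1 * eps `^ (1 / 2))).

Lemma gk_max_ge0 : 0 <= gk_max eps N d.
Proof. by rewrite /gk_max exprn_ge0// powR_ge0. Qed.

Lemma le_dgk j i Z : `|gaussian_partial j i Z| <= dgk_max.
Proof.
rewrite /gaussian_partial normrM normrN normrM (ger0_norm (gk_ge0 eps0 _)).
rewrite (gtr0_norm (_ : 0 < eps^-1)) ?invr_gt0// mulrAC mulrC ler_pM2l ?invr_gt0//.
have := moment_bound (Z j i) ler01 eps0; rewrite powRr1// => H.
apply: (le_trans (ler_wpM2r (gk_ge0 eps0 Z) H)).
rewrite gkE [leLHS]mulrCA ler_wpM2l ?gk_max_ge0//.
rewrite -[leLHS]mulrA ler_piMr ?mulr_ge0 ?moment_cst_ge0 ?powR_ge0//.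
rewrite -expRD -[leRHS]expR0 ler_expR.
have e2 : 0 < 2 * eps by rewrite mulr_gt0.
have e4 : 0 < 4 * eps by rewrite mulr_gt0.
have : Z j i ^+ 2 <= \sum_(k < N) \sum_(l < d) Z k l ^+ 2.
  rewrite (bigD1 j)//= (bigD1 i)//= -addrA lerDl addr_ge0// ?sumr_ge0// => k _.
    exact: sqr_ge0.
  by apply: sumr_ge0 => l _; exact: sqr_ge0.
move=> Hs; rewrite mulNr subr_le0.
have S0 := le_trans (sqr_ge0 _) Hs.
apply: (@le_trans _ _ ((\sum_(k < N) \sum_(l < d) Z k l ^+ 2) / (4 * eps))).
  by rewrite ler_wpM2r// invr_ge0 ltW.
by rewrite ler_wpM2l// lef_pV2 ?posrE// ler_pM2r// ler_nat.
Qed.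

Lemma measurable_dgk j i : measurable_fun setT (gaussian_partial j i).
Proof.
apply: measurable_funM; last exact: measurable_gk.
apply: measurableT_comp => //; apply: measurable_funM => //; exact: measurable_coord.
Qed.

Lemma ac_gk_shift j i (X : T) :
  ac_everywhere (delta_mx j i) (fun Y => gaussian eps (Y - X)) (fun Y => gaussian_partial j i (Y - X)).
Proof. exact: (ac_everywhere_shift (- X) (ac_gk eps0 j i)). Qed.

Lemma integral_gk_row (j : 'I_N) (Y : T) (h : V -> \bar R) : measurable_fun setT h ->
  (forall x, 0 <= h x)%E ->
  (\int[leb]_X (h (row j X) * (gaussian eps (Y - X))%:E) =
   \int[lebV]_x (h x * (eta eps (row j Y - x))%:E))%E.
Proof.
move=> mh h0; have me (k : 'I_N) : measurable_fun setT (fun x : V => (eta eps (row k Y - x))%:E).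
  apply/measurable_EFinP; under eq_fun do rewrite eta_sym.
  apply: (measurableT_comp (f := @eta R d eps)); first exact: measurable_eta.
  exact: measurable_shift.
pose H (k : 'I_N) x := ((if k == j then h x else 1) * (eta eps (row k Y - x))%:E)%E.
have mH k : measurable_fun setT (H k) by apply: emeasurable_funM => //; case: (k == j).
have H0 k x : (0 <= H k x)%E.
  by rewrite mule_ge0// ?lee_fin ?(ltW (eta_gt0 eps0 _))//; case: (k == j).
transitivity (\int[leb]_X \prod_(k < N) H k (row k X))%E.
  apply: eq_integral => X _; rewrite big_split/= prodEFin -gkB; congr (_ * _)%E.
  rewrite (bigD1 j)//= eqxx big1 ?mule1// => k /negbTE -> //.
rewrite (integral_rows_prod _ mH H0) (bigD1 j)//= big1 ?mule1.
  have := @integral_lebesgue_mx1 R d (H j) (mH j) (H0 j).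
  by rewrite /H eqxx => ->.
by move=> k /negbTE kj; rewrite /H kj; under eq_integral do rewrite mul1e; exact: integral_eta.
Qed.

End gaussian_derivative.

Section gk1.
Variables (R : realType) (eps : R) (d : nat).

Lemma gk1 (Z : 'rV[R]_d) : gaussian eps Z = eta eps Z.
Proof. by rewrite /gaussian big_ord1; congr Defs.eta; apply/rowP => i; rewrite !mxE. Qed.

Lemma moment_eta q (i : 'I_d) (y : 'rV[R]_d) : 0 < eps -> 1 <= q ->
  (\int[lebesgue_mx R 1 d]_x (`|(y - x) ord0 i| `^ q * eta eps (y - x))%:E
    <= (moment_cst q * eps `^ (q / 2) * 2 `^ (2^-1))%:E)%E.
Proof.
move=> eps0 q1; rewrite integral_lebesgue_mx1.
- under eq_integral do rewrite !mxE.
  rewrite (@integral_eta_mul R eps eps0 d y i (fun t => `|y ord0 i - t| `^ q)).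
  + exact: moment_gauss1.
  + by apply: measurable_abs_powR; exact: measurable_funB.
  + by move=> t; rewrite powR_ge0.
- apply/measurable_EFinP; apply: measurable_funM.
    apply: measurable_abs_powR; under eq_fun do rewrite !mxE.
    by apply: measurable_funB => //; exact: measurable_coord.
  under eq_fun do rewrite eta_sym.
  apply: (measurableT_comp (f := @eta R d eps)); first exact: measurable_eta.
  exact: measurable_shift.
- by move=> x; rewrite lee_fin mulr_ge0 ?powR_ge0// ltW// eta_gt0.
Qed.

End gk1.

Section param_bounded.
Variables (R : realType) (m n : nat).
Local Notation T := 'M[R]_(m, n).
Local Notation mu := (@lebesgue_measure R).

Lemma ac_everywhere_param_bounded (e : T) d (S : measurableType d)
    (mm : {sigma_finite_measure set S -> \bar R}) (k k' : S -> T -> R) (C : R) :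
  measurable_fun setT (fun z : S * T => k' z.1 z.2) ->
  (forall a, ac_everywhere e (k a) (k' a)) ->
  (forall x, mm.-integrable setT (fun a => (k a x)%:E)) ->
  (forall x, (\int[mm]_a `|(k' a x)%:E| <= C%:E)%E) ->
  ac_everywhere e (fun x => \int[mm]_a k a x) (fun x => \int[mm]_a k' a x).
Proof.
move=> mk' ack ik bk'; apply: ac_everywhere_param => // x.
pose I : set R := `[0%R, 1%R]%classic.
pose F (z : S * R) := (`|(k' z.1 (x + z.2 *: e))%:E| * (\1_I z.2)%:E)%E.
have mI : measurable I by exact: measurable_itv.
have mF : measurable_fun setT F.
  apply: emeasurable_funM.
    apply: measurableT_comp => //; apply/measurable_EFinP.
    have ms : measurable_fun setT (fun z : S * R => (z.1, x + z.2 *: e)).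
      by apply: measurable_fun_pair => //; exact: (measurableT_comp (measurable_line1 e x)).
    exact: (measurableT_comp mk' ms).
  by apply/measurable_EFinP; apply: (measurableT_comp _ measurable_snd); exact: measurable_indic.
have F0 z : (0 <= F z)%E by rewrite mule_ge0// lee_fin indicE.
have -> : (\int[mm]_a \int[mu]_(s in `[0%R, 1%R]) `|(k' a (x + s *: e))%:E| =
           \int[mu]_s \int[mm]_a F (a, s))%E.
  have FT := @fubini_tonelli _ _ _ _ R mm mu F mF F0.
  apply: (etrans _ FT).
  apply: eq_integral => a _; rewrite [LHS]integral_mkcond; apply: eq_integral => s _.
  by rewrite /F /patch /= indicE /I; case: (s \in _); rewrite ?mule1 ?mule0.
apply: (@le_lt_trans _ _ (\int[mu]_s (C%:E * (\1_I s)%:E))%E).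
  have C0 : (0 <= C%:E)%E by apply: le_trans (bk' 0); exact: integral_ge0.
  apply: ge0_le_integral => //.
  - by move=> s _; exact: integral_ge0.
  - apply: (@measurable_param_integral _ _ _ _ R mm (fun z => F (z.2, z.1))) => //.
    by apply: (measurableT_comp mF); exact: measurable_swap.
  - by apply: emeasurable_funM => //; apply/measurable_EFinP; exact: measurable_indic.
  move=> s _; rewrite /F /= indicE; case: (s \in I); rewrite ?mule1 ?mule0.
    apply: le_trans (bk' (x + s *: e)).
    by rewrite le_eqVlt; apply/orP; left; apply/eqP; apply: eq_integral => a _; rewrite mule1.
  by rewrite integral0_eq// => a _; rewrite mule0.
rewrite ge0_integralZl//.
- by rewrite integral_indic01 mule1 ltry.
- by apply/measurable_EFinP; exact: measurable_indic.
- by apply: le_trans (bk' 0); exact: integral_ge0.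
Qed.

End param_bounded.

Section lambda.
Variables (R : realType) (eps : R) (N d : nat).
Hypothesis eps0 : 0 < eps.
Local Notation T := 'M[R]_(N, d).
Local Notation leb := (lebesgue_mx R N d).
Variable mu : probability T R.
Local Notation gk := (gaussian eps).
Local Notation Lam := (Lambda_density eps mu).

Lemma measurable_gkB (X : T) : measurable_fun setT (fun Y : T => gk (Y - X)).
Proof.
exact: (measurableT_comp (@measurable_gk R eps N d) (measurable_shift (- X))).
Qed.

Lemma measurable_gkB2 (Y : T) : measurable_fun setT (fun X : T => gk (Y - X)).
Proof. by under eq_fun do rewrite gk_sym; exact: measurable_gkB. Qed.

Lemma integral_prob_cst (c : \bar R) : (\int[mu]_X c = c)%E.
Proof.
apply: (etrans (integral_cst mu measurableT c)).
by apply: (etrans (congr1 (mule c) (probability_setT mu))); exact: mule1.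
Qed.

Lemma prob_bounded_integrable (f : T -> R) (C : R) : measurable_fun setT f ->
  (forall x, `|f x| <= C) -> mu.-integrable setT (EFin \o f).
Proof.
move=> mf fC; have C0 : 0 <= C by exact: le_trans (fC 0).
apply: (@le_integrable _ _ _ mu setT measurableT _ (EFin \o cst C)).
- exact/measurable_EFinP.
- by move=> x _ /=; rewrite lee_fin (ger0_norm C0).
- apply/integrableP; split; first exact/measurable_EFinP.
  under eq_integral do rewrite /= ger0_norm//.
  by rewrite integral_prob_cst ltry.
Qed.

Lemma prob_gk_integrable (Y : T) : mu.-integrable setT (fun X : T => (gk (Y - X))%:E).
Proof.
apply: (@prob_bounded_integrable _ (gk_max eps N d)); first exact: measurable_gkB2.
by move=> X; rewrite ger0_norm ?gk_ge0// gk_le.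
Qed.

Lemma LamE Y : Lam Y = \int[mu]_X gk (Y - X).
Proof. by apply: eq_Rintegral => X _; rewrite gkB. Qed.

Lemma EFin_Lam Y : ((Lam Y)%:E = \int[mu]_X (gk (Y - X))%:E)%E.
Proof. by rewrite LamE /Rintegral fineK//; exact: integrable_fin_num (prob_gk_integrable Y). Qed.

Lemma Lam_le Y : Lam Y <= gk_max eps N d.
Proof.
rewrite -lee_fin EFin_Lam.
apply: (@le_trans _ _ (\int[mu]_X (gk_max eps N d)%:E)%E).
  apply: ge0_le_integral => //.
  - by move=> X _; rewrite lee_fin gk_ge0.
  - by apply/measurable_EFinP; exact: measurable_gkB2.
  - by move=> X _; rewrite lee_fin gk_le.
by rewrite integral_prob_cst.
Qed.

Lemma Lam_gt0 Y : 0 < Lam Y.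
Proof.
have mg : measurable_fun setT (fun X : T => (gk (Y - X))%:E).
  by apply/measurable_EFinP; exact: measurable_gkB2.
rewrite -lte_fin EFin_Lam lt_neqAle integral_ge0 ?andbT; last first.
  by move=> X _; rewrite lee_fin gk_ge0.
apply/eqP => I0.
have : (\int[mu]_X `|(gk (Y - X))%:E| = 0)%E.
  by under eq_integral do rewrite gee0_abs ?lee_fin ?gk_ge0//.
move=> /(ae_eq_integral_abs mu measurableT mg)[A [mA A0 sA]].
have AT : A = setT.
  by apply/seteqP; split=> // X _; apply: sA => /= /(_ I)[] /eqP; rewrite gt_eqF// gk_gt0.
by have := probability_setT mu; rewrite -AT A0 => /eqP; rewrite eqe eq_sym oner_eq0.
Qed.

Lemma measurable_Lam : measurable_fun setT Lam.
Proof.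
rewrite (_ : Lam = fun Y => \int[mu]_X gk (Y - X)); last by apply/funext => Y; exact: LamE.
apply: (@measurable_param_Rintegral _ _ _ _ R mu (fun z : T * T => gk (z.1 - z.2))).
exact: measurable_gk2.
Qed.

Lemma integral_Lam (g : T -> \bar R) : measurable_fun setT g -> (forall x, 0 <= g x)%E ->
  (\int[leb]_Y (g Y * (Lam Y)%:E) = \int[mu]_X \int[leb]_Y (g Y * (gk (Y - X))%:E))%E.
Proof.
move=> mg g0.
pose F (z : T * T) := (g z.1 * (gk (z.1 - z.2))%:E)%E.
have mF : measurable_fun setT F.
  apply: emeasurable_funM; first exact: (measurableT_comp mg).
  by apply/measurable_EFinP; exact: measurable_gk2.
have F0 z : (0 <= F z)%E by rewrite mule_ge0// lee_fin gk_ge0.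
have FT := @fubini_tonelli _ _ _ _ R leb mu F mF F0.
apply: (etrans _ FT).
apply: eq_integral => Y _; rewrite EFin_Lam -ge0_integralZl//.
  by apply/measurable_EFinP; exact: measurable_gkB2.
- by move=> X _; rewrite lee_fin gk_ge0.
Qed.

Lemma Lam_mass : (\int[leb]_Y (Lam Y)%:E = 1)%E.
Proof.
have := @integral_Lam (cst 1%E); under eq_integral do rewrite mul1e.
move=> ->//; transitivity (\int[mu]_X 1)%E.
  apply: eq_integral => X _; under eq_integral do rewrite mul1e gk_sym.
  exact: integral_gk.
by rewrite integral_prob_cst.
Qed.

Lemma Lam_has_density : has_density (Lambda eps mu) Lam.
Proof.
apply: prob_of_densityP; [exact: measurable_Lam|by move=> x; exact/ltW/Lam_gt0|exact: Lam_mass].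
Qed.

Definition Lambda_partial (j : 'I_N) (i : 'I_d) (Y : T) : R := \int[mu]_X gaussian_partial eps j i (Y - X).

Lemma measurable_dgk2 j i : measurable_fun setT (fun z : T * T => gaussian_partial eps j i (z.1 - z.2)).
Proof.
apply: (measurableT_comp (f := gaussian_partial eps j i)); first exact: measurable_dgk.
exact: measurable_sub.
Qed.

Lemma measurable_dLam j i : measurable_fun setT (Lambda_partial j i).
Proof.
apply: (@measurable_param_Rintegral _ _ _ _ R mu (fun z : T * T => gaussian_partial eps j i (z.1 - z.2))).
exact: measurable_dgk2.
Qed.

Lemma ac_Lam j i : ac_everywhere (delta_mx j i) Lam (Lambda_partial j i).
Proof.
rewrite (_ : Lam = fun Y => \int[mu]_X gk (Y - X)); last by apply/funext => Y; exact: LamE.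
apply: (@ac_everywhere_param_bounded _ _ _ _ _ _ mu (fun X Y : T => gk (Y - X))
  (fun X Y : T => gaussian_partial eps j i (Y - X)) (dgk_max eps N d)).
- have H : measurable_fun setT (fun z : T * T => (z.2, z.1)) by exact: measurable_swap.
  exact: (measurableT_comp (measurable_dgk2 j i) H).
- by move=> X; exact: ac_gk_shift.
- by move=> Y; exact: prob_gk_integrable.
move=> Y; apply: (@le_trans _ _ (\int[mu]_X (dgk_max eps N d)%:E)%E); last first.
  by rewrite integral_prob_cst.
apply: ge0_le_integral => //.
- apply: measurableT_comp => //; apply/measurable_EFinP.
  have H : measurable_fun setT (fun X : T => (Y, X)) by exact: measurable_fun_pair.
  exact: (measurableT_comp (measurable_dgk2 j i) H).
- by move=> X _; rewrite lee_fin le_dgk.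
Qed.

End lambda.

Lemma le_integrable_real d (S : measurableType d) (R : realType) (mu : {measure set S -> \bar R})
    (f g : S -> R) : measurable_fun setT f -> mu.-integrable setT (EFin \o g) ->
  (forall x, `|f x| <= g x) -> mu.-integrable setT (EFin \o f).
Proof.
move=> mf ig fg; apply: (@le_integrable _ _ _ mu setT measurableT _ (EFin \o g)) => //.
  exact/measurable_EFinP.
by move=> x _ /=; rewrite lee_fin (le_trans (fg x))// ler_norm.
Qed.

Lemma ge0_integrable_real d (S : measurableType d) (R : realType) (mu : {measure set S -> \bar R})
    (f : S -> R) : measurable_fun setT f -> (forall x, 0 <= f x) ->
  (\int[mu]_x (f x)%:E < +oo)%E -> mu.-integrable setT (EFin \o f).
Proof.
move=> mf f0 fin; apply/integrableP; split; first exact/measurable_EFinP.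
by under eq_integral do rewrite /= ger0_norm//.
Qed.

Lemma has_density_integral_signed (R : realType) m n (P : probability 'M[R]_(m, n) R) f
    (g : 'M[R]_(m, n) -> \bar R) : has_density P f -> measurable_fun setT g ->
  (\int[P]_x g x = \int[lebesgue_mx R m n]_x (g x * (f x)%:E))%E.
Proof.
move=> Pf mg; have [_ f0 _] := Pf.
rewrite [LHS]integralE [RHS]integralE; congr (_ - _)%E.
  rewrite (has_density_integral Pf)//; last exact: measurable_funepos.
  by apply: eq_integral => x _; rewrite !funeposE maxe_pMl ?mul0e// lee_fin.
rewrite (has_density_integral Pf)//; last exact: measurable_funeneg.
by apply: eq_integral => x _; rewrite !funenegE -mulNe maxe_pMl ?mul0e// lee_fin.
Qed.

Section smoothing_energy.
Variables (R : realType) (eps p : R) (N d : nat).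
Hypotheses (eps0 : 0 < eps) (p1 : 1 < p).
Local Notation T := 'M[R]_(N, d).
Local Notation leb := (lebesgue_mx R N d).
Variable nu : probability T R.
Hypothesis nuP : P1p p nu.
Local Notation gk := (gaussian eps).
Local Notation Lam := (Lambda_density eps nu).
Local Notation u := (root_density p nu).
Local Notation Du ij := (weak_partial ij (root_density p nu)).

Let p0 : 0 < p. Proof. exact: lt_trans p1. Qed.
Let p1' : 1 <= p. Proof. exact: ltW. Qed.
Let u0 x : 0 <= u x. Proof. exact: powR_ge0. Qed.
Let mu : measurable_fun setT u. Proof. by have [] := P1pP p1' nuP. Qed.
Let nud : has_density nu (fun x => u x `^ p). Proof. by have [] := P1pP p1' nuP. Qed.
Let wpu ij : is_weak_partial ij u (Du ij). Proof. by have [] := P1pP p1' nuP. Qed.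
Let fDu ij : (\int[leb]_x (`|Du ij x| `^ p)%:E < +oo)%E. Proof. by have [] := P1pP p1' nuP. Qed.
Let mDu ij : measurable_fun setT (Du ij). Proof. exact: measurable_weak_partial (wpu ij). Qed.

Let iup : leb.-integrable setT (EFin \o (fun x => u x `^ p)).
Proof.
apply: ge0_integrable_real => [|x|].
- exact: (measurableT_comp (measurable_powR p)).
- exact: powR_ge0.
- by rewrite (has_density_mass nud) ltry.
Qed.

Let iDup ij : leb.-integrable setT (EFin \o (fun x => `|Du ij x| `^ p)).
Proof.
apply: ge0_integrable_real => [|x|//]; last exact: powR_ge0.
exact: measurable_abs_powR.
Qed.

Let integrable_gk (f : T -> R) Y : leb.-integrable setT (EFin \o f) ->
  leb.-integrable setT (EFin \o (fun X => f X * gk (Y - X))).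
Proof.
move=> fi; have mf : measurable_fun setT f by move/integrableP: fi => [/measurable_EFinP].
have fi' : leb.-integrable setT (fun X => ((gk_max eps N d)%:E * `|(f X)%:E|)%E).
  apply: (@integrableZl _ _ _ leb setT measurableT _ (fun X => `|(f X)%:E|%E)).
  exact: integrable_abse.
apply: (le_integrable_real _ (g := fun X => gk_max eps N d * `|f X|)) => //.
  apply: measurable_funM => //; exact: measurable_gkB2.
move=> X; rewrite normrM mulrC ler_wpM2r// (ger0_norm (gk_ge0 eps0 _)).
exact: gk_le.
Qed.

Let iuDu ij : leb.-integrable setT (EFin \o (fun x => u x `^ (p - 1) * Du ij x)).
Proof.
apply: (le_integrable_real _ (integrableD measurableT iup (iDup ij) : leb.-integrable setT (EFin \o (fun x => u x `^ p + `|Du ij x| `^ p)))).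
  by apply: measurable_funM => //; exact: (measurableT_comp (measurable_powR _)).
move=> x; rewrite normrM (ger0_norm (powR_ge0 _ _)).
exact: young_le.
Qed.

Lemma Lam_density Y : (Lam Y)%:E = (\int[leb]_X (u X `^ p * gk (Y - X))%:E)%E.
Proof.
rewrite EFin_Lam// (has_density_integral nud).
- by apply: eq_integral => X _; rewrite -EFinM mulrC.
- by apply/measurable_EFinP; exact: measurable_gkB2.
- by move=> X; rewrite lee_fin gk_ge0.
Qed.

Lemma dLam_density j i Y :
  Lambda_partial eps nu j i Y = \int[leb]_X (p * u X `^ (p - 1) * Du (j, i) X * gk (Y - X)).
Proof.
have mdg (Z : T) : measurable_fun setT (fun X : T => gaussian_partial eps j i (X - Z)).
  exact: (measurableT_comp (@measurable_dgk R eps N d j i) (measurable_shift (- Z))).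
have dgN (X : T) : gaussian_partial eps j i (Y - X) = - gaussian_partial eps j i (X - Y).
  by rewrite /gaussian_partial gk_sym// !mxE; ring.
have H1 : ac_lines (delta_mx j i) (fun X => u X `^ p) (fun X => p * u X `^ (p - 1) * Du (j, i) X).
  by apply: ac_lines_powR => //; exact: weak_ac.
have H2 := ac_everywhere_lines (ac_gk_shift eps0 j i Y).
have m1 : measurable_fun setT (fun X => u X `^ p) by exact: (measurableT_comp (measurable_powR p)).
have m2 : measurable_fun setT (fun X => p * u X `^ (p - 1) * Du (j, i) X).
  apply: measurable_funM => //; apply: measurable_funM => //.
  exact: (measurableT_comp (measurable_powR _)).
have H := ac_linesM m1 (measurable_gkB eps Y) m2 (mdg Y) H1 H2.
have i1 : leb.-integrable setT (EFin \o (fun X => u X `^ p * gk (X - Y))).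
  have := integrable_gk Y iup; congr (integrable _ _ (EFin \o _)).
  by apply/funext => X; rewrite gk_sym.
have i2 : leb.-integrable setT (EFin \o (fun X => u X `^ p * gaussian_partial eps j i (X - Y))).
  apply: (le_integrable_real _ (@integrableZl _ _ _ leb setT measurableT (dgk_max eps N d) _ iup :
    leb.-integrable setT (EFin \o (fun x => dgk_max eps N d * u x `^ p)))); first exact: measurable_funM.
  move=> X; rewrite normrM (ger0_norm (powR_ge0 _ _)) [leRHS]mulrC ler_wpM2l ?powR_ge0//.
  exact: le_dgk.
have i3 : leb.-integrable setT (EFin \o (fun X => gk (X - Y) * (p * u X `^ (p - 1) * Du (j, i) X))).
  have := integrable_gk Y (@integrableZl _ _ _ leb setT measurableT p _ (iuDu (j, i))).
  congr (integrable _ _ _); apply/funext => X; rewrite /= gk_sym//; congr (_%:E); ring.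
have := ac_lines_integral0 H i1 (integrableD measurableT i2 i3).
rewrite (@integralD _ _ _ leb setT measurableT _ _ i2 i3) => /eqP.
have f2 := integrable_fin_num measurableT i2; have f3 := integrable_fin_num measurableT i3.
rewrite -(fineK f2) -(fineK f3) -EFinD eqe addrC addr_eq0 => /eqP E3.
rewrite [RHS](_ : _ = fine (\int[leb]_x (EFin \o (fun X => (gk (X - Y) * (p * u X `^ (p - 1) * Du (j, i) X))%R)) x)%E); last first.
  by rewrite /Rintegral; congr fine; apply: eq_integral => X _; rewrite /= gk_sym// mulrC.
rewrite E3 /Lambda_partial /Rintegral (has_density_integral_signed nud); last first.
  by apply/measurable_EFinP; under eq_fun do rewrite dgN; exact: measurableT_comp.
rewrite -fineN; congr fine; rewrite -integralN//; last exact: integrable_add_def.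
by apply: eq_integral => X _; rewrite /= -EFinM dgN mulNr mulrC.
Qed.

Definition logder j i Y : R := p^-1 * (Lambda_partial eps nu j i Y / Lam Y).
Definition root_Lambda_partial (ij : 'I_N * 'I_d) Y : R := logder ij.1 ij.2 Y * Lam Y `^ p^-1.

Lemma measurable_qL j i : measurable_fun setT (logder j i).
Proof.
apply: measurable_funM => //; apply: measurable_funM; first exact: measurable_dLam.
have -> : (fun Y => (Lam Y)^-1) = (fun Y => Lam Y `^ (-1)).
  by apply/funext => Y; rewrite powRN powRr1// ltW// Lam_gt0.
apply: (measurableT_comp (measurable_powR (-1))); exact: measurable_Lam.
Qed.

Lemma measurable_aL ij : measurable_fun setT (root_Lambda_partial ij).
Proof.
apply: measurable_funM; first exact: measurable_qL.
apply: (measurableT_comp (measurable_powR _)); exact: measurable_Lam.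
Qed.

Lemma aL_powR j i Y : `|root_Lambda_partial (j, i) Y| `^ p = `|logder j i Y| `^ p * Lam Y.
Proof.
have L0 := Lam_gt0 eps0 nu Y.
rewrite /root_Lambda_partial/= normrM powRM ?normr_ge0// (ger0_norm (powR_ge0 _ _)).
by rewrite -powRrM mulVf ?gt_eqF// powRr1// ltW.
Qed.

Lemma ac_root_Lam j i : ac_everywhere (delta_mx j i) (fun Y => Lam Y `^ p^-1) (root_Lambda_partial (j, i)).
Proof.
have := ac_everywhere_powR p^-1 (Lam_gt0 eps0 nu) (ac_Lam eps0 nu j i).
apply: eq_ac_everywhere => // Y; rewrite /root_Lambda_partial /logder/=.
have L0 := Lam_gt0 eps0 nu Y.
rewrite gt0_powRD// powRN powRr1 ?ltW//.
by field; rewrite !gt_eqF.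
Qed.

Lemma tangent_at (c : R) j i Y : 0 <= c ->
  (forall t m, `|m| `^ p + p * dpow p m * (t - m) + c * `|t - m| `^ p <= `|t| `^ p) ->
  ((`|root_Lambda_partial (j, i) Y| `^ p)%:E
    + c%:E * \int[leb]_X (`|Du (j, i) X - u X * logder j i Y| `^ p * gk (Y - X))%:E
   <= \int[leb]_X (`|Du (j, i) X| `^ p * gk (Y - X))%:E)%E.
Proof.
move=> c0 Hc; set q := logder j i Y.
have L0 := Lam_gt0 eps0 nu Y.
have mg : measurable_fun setT (fun X : T => gk (Y - X)) by exact: measurable_gkB2.
have mD : measurable_fun setT (fun X => `|Du (j, i) X - u X * q| `^ p * gk (Y - X)).
  apply: measurable_funM => //; apply: measurable_abs_powR.
  by apply: measurable_funB => //; exact: measurable_funM.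
have mup : measurable_fun setT (fun X => u X `^ p * gk (Y - X)).
  by apply: measurable_funM => //; exact: (measurableT_comp (measurable_powR p)).
have i1 := integrable_gk Y (iDup (j, i)).
have i2 := integrable_gk Y (iuDu (j, i)).
have i3 := integrable_gk Y iup.
pose h X := p * dpow p q * (u X `^ (p - 1) * Du (j, i) X * gk (Y - X) - q * (u X `^ p * gk (Y - X))).
have ih : leb.-integrable setT (EFin \o h).
  apply: (@integrableZl _ _ _ leb setT measurableT (p * dpow p q) (fun X =>
   (u X `^ (p - 1) * Du (j, i) X * gk (Y - X) - q * (u X `^ p * gk (Y - X)))%:E)).
  exact: (integrableB measurableT i2 (@integrableZl _ _ _ leb setT measurableT q _ i3)).
have Ih : (\int[leb]_X (h X)%:E = 0)%E.
  under eq_integral do rewrite /h EFinM EFinB.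
  rewrite integralZl//; last first.
    exact: (integrableB measurableT i2 (@integrableZl _ _ _ leb setT measurableT q _ i3)).
  rewrite integralB//; last exact: (@integrableZl _ _ _ leb setT measurableT q _ i3).
  rewrite (@integralZl _ _ _ leb setT measurableT _ i3 q) -Lam_density.
  have -> : (\int[leb]_X (u X `^ (p - 1) * Du (j, i) X * gk (Y - X))%:E = (p^-1 * Lambda_partial eps nu j i Y)%:E)%E.
    rewrite dLam_density -[LHS]fineK; last exact: (integrable_fin_num measurableT i2).
    congr EFin; rewrite -RintegralZl//; last first.
      have := @integrableZl _ _ _ leb setT measurableT p _ i2.
      by congr (integrable _ _ _); apply/funext => X /=; congr EFin; ring.
    by congr fine; apply: eq_integral => X _; congr EFin; rewrite !mulrA mulVf ?gt_eqF// mul1r.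
  transitivity (p * dpow p q * (p^-1 * Lambda_partial eps nu j i Y - q * Lam Y))%:E => //.
  by congr EFin; rewrite /q /logder; field; rewrite !gt_eqF.
have dpowM X : dpow p (u X * q) = u X `^ (p - 1) * dpow p q.
  rewrite /dpow sgrM normrM (ger0_norm (u0 X)) powRM//.
  have := u0 X; rewrite le_eqVlt => /predU1P[<-|ux].
    by rewrite powR0 ?gt_eqF ?subr_gt0// sgr0 !mul0r.
  by rewrite gtr0_sg// mul1r mulrCA.
have uX X : u X * u X `^ (p - 1) = u X `^ p.
  by rewrite -{1}[u X]powRr1// -powRD ?subrKC// (gt_eqF p0).
have -> : ((`|root_Lambda_partial (j, i) Y| `^ p)%:E = \int[leb]_X (`|u X * q| `^ p * gk (Y - X))%:E)%E.
  rewrite aL_powR EFinM Lam_density -ge0_integralZl//.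
  - by apply: eq_integral => X _; rewrite -EFinM (normrM (u X)) (ger0_norm (u0 X)) powRM// mulrA [X in (X * _)%:E]mulrC.
  - by apply/measurable_EFinP.
  - by move=> X _; rewrite lee_fin mulr_ge0 ?powR_ge0// gk_ge0.
rewrite -ge0_integralZl//; last 2 first.
- exact/measurable_EFinP.
- by move=> X _; rewrite lee_fin mulr_ge0 ?powR_ge0// gk_ge0.
rewrite -ge0_integralD//; last 4 first.
- by move=> X _; rewrite lee_fin mulr_ge0 ?powR_ge0// gk_ge0.
- apply/measurable_EFinP; apply: measurable_funM => //; apply: measurable_abs_powR; exact: measurable_funM.
- by move=> X _; rewrite -EFinM lee_fin mulr_ge0// mulr_ge0 ?powR_ge0// gk_ge0.
- by apply: emeasurable_funM => //; exact/measurable_EFinP.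
rewrite -[leRHS]sube0 -Ih -(@integralB _ _ _ leb setT measurableT _ _ i1 ih).
apply: ge0_le_integral => //.
- by move=> X _; rewrite adde_ge0// ?mule_ge0// lee_fin ?mulr_ge0 ?powR_ge0// gk_ge0.
- apply: emeasurable_funD; last by apply: emeasurable_funM => //; exact/measurable_EFinP.
  apply/measurable_EFinP; apply: measurable_funM => //; apply: measurable_abs_powR; exact: measurable_funM.
- have /integrableP[] := integrableB measurableT i1 ih; exact.
move=> X _; rewrite /= -EFinM -EFinD -EFinB lee_fin lerBrDr.
have := ler_wpM2r (gk_ge0 eps0 (Y - X)) (Hc (Du (j, i) X) (u X * q)).
apply: le_trans; rewrite le_eqVlt; apply/orP; left; apply/eqP.
by rewrite /h dpowM -uX; ring.
Qed.

Definition smoothing_defect j i : \bar R :=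
  (\int[leb]_Y \int[leb]_X (`|Du (j, i) X - u X * logder j i Y| `^ p * gk (Y - X))%:E)%E.

Lemma integral_gk_out (f : T -> R) : measurable_fun setT f -> (forall x, 0 <= f x) ->
  (\int[leb]_Y \int[leb]_X (f X * gk (Y - X))%:E = \int[leb]_X (f X)%:E)%E.
Proof.
move=> mf f0; pose F (z : T * T) := (f z.2 * gk (z.1 - z.2))%:E.
have mF : measurable_fun setT F.
  apply/measurable_EFinP; apply: measurable_funM; last exact: measurable_gk2.
  exact: (measurableT_comp mf).
have F0 z : (0 <= F z)%E by rewrite lee_fin mulr_ge0// gk_ge0.
have FT := @fubini_tonelli _ _ _ _ R leb leb F mF F0.
apply: (etrans FT); apply: eq_integral => X _.
have mgX : measurable_fun setT (fun Y : T => (gk (Y - X))%:E).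
  by apply/measurable_EFinP; exact: measurable_gkB.
have gX0 (Y : T) : setT Y -> (0 <= (gk (Y - X))%:E)%E by rewrite lee_fin gk_ge0.
have fX0 : (0 <= (f X)%:E)%E by rewrite lee_fin.
have Z := @ge0_integralZl _ _ _ leb setT measurableT _ mgX (f X)%:E gX0 fX0.
have I1 : (\int[leb]_Y (gk (Y - X))%:E = 1)%E.
  apply: (etrans _ (integral_gk eps0 X)).
  by apply: eq_integral => Y _; congr EFin; exact: gk_sym.
rewrite I1 mule1 in Z; apply: (etrans _ Z).
by apply: eq_integral => Y _; exact: EFinM.
Qed.

Let mDD j i : measurable_fun setT (fun z : T * T =>
  (`|Du (j, i) z.2 - u z.2 * logder j i z.1| `^ p * gk (z.1 - z.2))%:E).
Proof.
apply/measurable_EFinP; apply: measurable_funM; last exact: measurable_gk2.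
apply: measurable_abs_powR; apply: measurable_funB; first exact: (measurableT_comp (mDu _)).
apply: measurable_funM; first exact: (measurableT_comp mu).
by apply: (measurableT_comp (measurable_qL j i)).
Qed.

Let mDDY j i : measurable_fun setT (fun Y : T =>
  (\int[leb]_X (`|Du (j, i) X - u X * logder j i Y| `^ p * gk (Y - X))%:E)%E).
Proof.
apply: (@measurable_param_integral _ _ _ _ R leb (fun z : T * T =>
  (`|Du (j, i) z.2 - u z.2 * logder j i z.1| `^ p * gk (z.1 - z.2))%:E)); first exact: mDD.
by move=> z; rewrite lee_fin mulr_ge0 ?powR_ge0// gk_ge0.
Qed.

Let mDuY j i : measurable_fun setT (fun Y : T =>
  (\int[leb]_X (`|Du (j, i) X| `^ p * gk (Y - X))%:E)%E).
Proof.
apply: (@measurable_param_integral _ _ _ _ R leb (fun z : T * T => (`|Du (j, i) z.2| `^ p * gk (z.1 - z.2))%:E)).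
  apply/measurable_EFinP; apply: measurable_funM; last exact: measurable_gk2.
  by apply: measurable_abs_powR; exact: (measurableT_comp (mDu _)).
by move=> z; rewrite lee_fin mulr_ge0 ?powR_ge0// gk_ge0.
Qed.

Lemma smoothing_energy_le (c : R) j i : 0 <= c ->
  (forall t m, `|m| `^ p + p * dpow p m * (t - m) + c * `|t - m| `^ p <= `|t| `^ p) ->
  (\int[leb]_Y (`|root_Lambda_partial (j, i) Y| `^ p)%:E + c%:E * smoothing_defect j i <= \int[leb]_X (`|Du (j, i) X| `^ p)%:E)%E.
Proof.
move=> c0 Hc.
have ma : measurable_fun setT (fun Y => (`|root_Lambda_partial (j, i) Y| `^ p)%:E).
  by apply/measurable_EFinP; apply: measurable_abs_powR; exact: measurable_aL.
rewrite -(integral_gk_out (measurable_abs_powR p (mDu (j, i)))); last by move=> x; exact: powR_ge0.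
rewrite /smoothing_defect -ge0_integralZl//; last first.
  by move=> Y _; apply: integral_ge0 => X _; rewrite lee_fin mulr_ge0 ?powR_ge0// gk_ge0.
have g0 Y : (0 <= \int[leb]_X (`|Du (j, i) X - u X * logder j i Y| `^ p * gk (Y - X))%:E)%E.
  by apply: integral_ge0 => X _; rewrite lee_fin mulr_ge0 ?powR_ge0// gk_ge0.
rewrite -ge0_integralD//; last 2 first.
- by move=> Y _; rewrite mule_ge0.
- exact: emeasurable_funM.
apply: ge0_le_integral => //.
- by move=> Y _; rewrite adde_ge0// mule_ge0.
- by apply: emeasurable_funD => //; exact: emeasurable_funM.
by move=> Y _; exact: tangent_at.
Qed.

Lemma DD_le j i : (smoothing_defect j i <= (2 `^ (p - 1))%:E *
  (\int[leb]_X (`|Du (j, i) X| `^ p)%:E + \int[leb]_Y (`|root_Lambda_partial (j, i) Y| `^ p)%:E))%E.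
Proof.
rewrite -(integral_gk_out (measurable_abs_powR p (mDu (j, i)))); last by move=> x; exact: powR_ge0.
have ma : measurable_fun setT (fun Y => (`|root_Lambda_partial (j, i) Y| `^ p)%:E).
  by apply/measurable_EFinP; apply: measurable_abs_powR; exact: measurable_aL.
have D0 Y : (0 <= \int[leb]_X (`|Du (j, i) X| `^ p * gk (Y - X))%:E)%E.
  by apply: integral_ge0 => X _; rewrite lee_fin mulr_ge0 ?powR_ge0// gk_ge0.
rewrite -ge0_integralD// -ge0_integralZl//; last 2 first.
- exact: emeasurable_funD.
- by move=> Y _; rewrite adde_ge0.
apply: ge0_le_integral => //.
- by move=> Y _; apply: integral_ge0 => X _; rewrite lee_fin mulr_ge0 ?powR_ge0// gk_ge0.
- by apply: emeasurable_funM => //; exact: emeasurable_funD.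
move=> Y _; rewrite aL_powR EFinM Lam_density.
have mg : measurable_fun setT (fun X : T => gk (Y - X)) by exact: measurable_gkB2.
have mup : measurable_fun setT (fun X => u X `^ p * gk (Y - X)).
  by apply: measurable_funM => //; exact: (measurableT_comp (measurable_powR p)).
have mDg : measurable_fun setT (fun X => `|Du (j, i) X| `^ p * gk (Y - X)).
  by apply: measurable_funM => //; exact: measurable_abs_powR.
have mq : measurable_fun setT (fun X => (`|logder j i Y| `^ p)%:E * (u X `^ p * gk (Y - X))%:E)%E.
  by apply: emeasurable_funM => //; exact/measurable_EFinP.
have up0 X : 0 <= u X `^ p * gk (Y - X) by rewrite mulr_ge0 ?powR_ge0// gk_ge0.
have Dg0 X : 0 <= `|Du (j, i) X| `^ p * gk (Y - X) by rewrite mulr_ge0 ?powR_ge0// gk_ge0.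
rewrite -ge0_integralZl//; last 2 first.
- exact/measurable_EFinP.
- by move=> X _; rewrite lee_fin.
rewrite -ge0_integralD//; last 2 first.
- exact/measurable_EFinP.
- by move=> X _; rewrite -EFinM lee_fin mulr_ge0 ?powR_ge0.
rewrite -ge0_integralZl//; last 2 first.
- by apply: emeasurable_funD => //; exact/measurable_EFinP.
- by move=> X _; rewrite -EFinM -EFinD lee_fin addr_ge0// mulr_ge0 ?powR_ge0.
apply: ge0_le_integral => //.
- by move=> X _; rewrite lee_fin mulr_ge0 ?powR_ge0// gk_ge0.
- apply/measurable_EFinP; apply: measurable_funM => //; apply: measurable_abs_powR.
  by apply: measurable_funB => //; exact: measurable_funM.
- by apply: emeasurable_funM => //; apply: emeasurable_funD => //; exact/measurable_EFinP.
  move=> X _; have H : `|Du (j, i) X - u X * logder j i Y| `^ p * gk (Y - X) <=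
      2 `^ (p - 1) * (`|Du (j, i) X| `^ p * gk (Y - X) + `|logder j i Y| `^ p * (u X `^ p * gk (Y - X))).
    rewrite [X in _ * (_ + X)]mulrA -mulrDl mulrA ler_wpM2r ?gk_ge0//.
    rewrite (le_trans (powR_half_sub _ _ p1'))// (normrM (u X)) powRM// (ger0_norm (u0 X)).
    by rewrite [X in _ * (_ + X)]mulrC.
  by rewrite -lee_fin in H.
by move=> X _; rewrite lee_fin.
Qed.

Lemma aL_fin ij : (\int[leb]_Y (`|root_Lambda_partial ij Y| `^ p)%:E <= \int[leb]_X (`|Du ij X| `^ p)%:E)%E.
Proof.
case: ij => j i; have := @smoothing_energy_le 0 j i (lexx _); rewrite mul0e adde0; apply.
by move=> t m; rewrite mul0r addr0; exact: powR_tangent.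
Qed.

Lemma is_weak_partial_root_Lam ij : is_weak_partial ij (fun Y => Lam Y `^ p^-1) (root_Lambda_partial ij).
Proof.
have mL : measurable_fun setT (fun Y => Lam Y `^ p^-1).
  by apply: (measurableT_comp (measurable_powR _)); exact: measurable_Lam.
case: ij => j i; apply: ac_weak.
- exact/ac_everywhere_lines/ac_root_Lam.
- apply: (Lp_loc_integrable p1') => //.
  under eq_integral do rewrite ger0_norm ?powR_ge0// -powRrM mulVf ?gt_eqF// powRr1 ?(ltW (Lam_gt0 eps0 _ _))//.
  by rewrite Lam_mass// ltry.
- apply: (Lp_loc_integrable p1'); first exact: measurable_aL.
  exact: le_lt_trans (aL_fin _) (fDu _).
Qed.

Lemma P1p_Lambda : P1p p (Lambda eps nu) /\
  (forall ij, {ae leb, forall Y, weak_partial ij (root_density p (Lambda eps nu)) Y = root_Lambda_partial ij Y}).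
Proof.
apply: (@P1p_intro _ _ _ _ p1' _ (fun Y => Lam Y `^ p^-1)).
- by move=> Y; exact: powR_ge0.
- have := Lam_has_density eps0 nu; congr has_density; apply/funext => Y.
  by rewrite -powRrM mulVf ?gt_eqF// powRr1// ltW// Lam_gt0.
- by apply: (measurableT_comp (measurable_powR _)); exact: measurable_Lam.
- exact: is_weak_partial_root_Lam.
- by move=> ij; exact: le_lt_trans (aL_fin _) (fDu _).
Qed.

End smoothing_energy.

Lemma weighted_tonelli d1 d2 (S1 : measurableType d1) (S2 : measurableType d2) (R : realType)
    (m1 : {sigma_finite_measure set S1 -> \bar R}) (m2 : {sigma_finite_measure set S2 -> \bar R})
    (r : S1 -> R) (Phi : S1 * S2 -> \bar R) :
  measurable_fun setT r -> (forall x, 0 <= r x) ->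
  measurable_fun setT Phi -> (forall z, 0 <= Phi z)%E ->
  (\int[m1]_x ((r x)%:E * \int[m2]_y Phi (x, y)) =
   \int[m2]_y \int[m1]_x ((r x)%:E * Phi (x, y)))%E.
Proof.
move=> mr r0 mP P0; pose Psi (z : S1 * S2) := ((r z.1)%:E * Phi z)%E.
have mPsi : measurable_fun setT Psi.
  apply: emeasurable_funM => //; apply/measurable_EFinP.
  exact: (measurableT_comp mr measurable_fst).
have Psi0 z : (0 <= Psi z)%E by rewrite mule_ge0// lee_fin.
apply: (etrans _ (@fubini_tonelli _ _ _ _ R m1 m2 Psi mPsi Psi0)).
apply: eq_integral => x _; apply/esym.
transitivity (\int[m2]_y ((r x)%:E * Phi (x, y)))%E => //.
apply: (@ge0_integralZl _ _ _ m2 setT measurableT (fun y => Phi (x, y))) => //.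
- apply: (measurableT_comp mP); exact: measurable_fun_pair.
- by rewrite lee_fin.
Qed.

Section theta.
Variables (R : realType) (eps p : R) (N d : nat).
Hypotheses (eps0 : 0 < eps) (p1 : 1 <= p).
Local Notation T := 'M[R]_(N, d).
Local Notation V := 'rV[R]_d.
Local Notation leb := (lebesgue_mx R N d).
Local Notation lebV := (lebesgue_mx R 1 d).
Variable mu : probability T R.
Hypothesis muP : forall j, P1p p (marginal mu j).
Local Notation gk := (gaussian eps).
Local Notation Lam := (Lambda_density eps mu).
Local Notation u k := (root_density p (marginal mu k)).
Local Notation re k := (Lambda_density eps (marginal mu k : probability 'M[R]_(1, d) R)).

Let p0 : 0 < p. Proof. exact: lt_le_trans p1. Qed.

Lemma convE (nu : probability 'M[R]_(1, d) R) : conv_density eps nu =1 Lambda_density eps nu.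
Proof. by move=> y; rewrite LamE; apply: eq_Rintegral => x _; rewrite gk1. Qed.

Lemma gauss_convE (nu : probability 'M[R]_(1, d) R) : gauss_conv eps nu = Lambda eps nu.
Proof. by rewrite /gauss_conv /Lambda; congr prob_of_density; apply/funext; exact: convE. Qed.

Definition rho k (x : V) : R := u k x `^ p.

Lemma rho_ge0 k x : 0 <= rho k x. Proof. exact: powR_ge0. Qed.

Lemma measurable_u k : measurable_fun setT (u k).
Proof. by have [] := P1pP p1 (muP k). Qed.

Lemma measurable_rho k : measurable_fun setT (rho k).
Proof. exact: (measurableT_comp (measurable_powR p) (measurable_u k)). Qed.

Lemma marginal_density k : has_density (marginal mu k) (rho k).
Proof. by have [] := P1pP p1 (muP k). Qed.

Lemma measurable_etaB (y : V) : measurable_fun setT (fun x : V => eta eps (y - x)).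
Proof.
under eq_fun do rewrite -gk1.
exact: (@measurable_gkB2 R eps 1 d y).
Qed.

Lemma measurable_eta2 : measurable_fun setT (fun z : V * V => eta eps (z.2 - z.1)).
Proof.
under eq_fun do rewrite -gk1 gk_sym.
exact: (@measurable_gk2 R eps 1 d).
Qed.

Lemma re_gt0 k y : 0 < re k y. Proof. exact: Lam_gt0. Qed.

Lemma measurable_re k : measurable_fun setT (re k). Proof. exact: measurable_Lam. Qed.

Lemma re_density k y : ((re k y)%:E = \int[lebV]_x (rho k x * eta eps (y - x))%:E)%E.
Proof.
rewrite EFin_Lam// (has_density_integral (marginal_density k)).
- by apply: eq_integral => x _; rewrite gk1 -EFinM mulrC.
- by apply/measurable_EFinP; exact: measurable_gkB2.
- by move=> x; rewrite lee_fin gk_ge0.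
Qed.

Lemma marginal_integral j (g : V -> \bar R) : measurable_fun setT g -> (forall x, 0 <= g x)%E ->
  (\int[mu]_X g (row j X) = \int[marginal mu j]_x g x)%E.
Proof.
move=> mg g0; apply/esym.
apply: (@ge0_integral_pushforward _ _ _ _ R (row j) (measurable_row j) mu setT g) => //.
Qed.

Definition reP (Y : T) : R := \prod_(k < N) re k (row k Y).
Definition rhoP (X : T) : R := \prod_(k < N) rho k (row k X).
Definition rhoN (j : 'I_N) (X : T) : R := \prod_(k < N | k != j) rho k (row k X).
Definition coupling_ratio (Y : T) : R := Lam Y / reP Y.
Local Notation G := coupling_ratio.
Definition coupling_kernel (X Y : T) : R := gk (Y - X) * G Y.
Local Notation K := coupling_kernel.

Lemma reP_gt0 Y : 0 < reP Y. Proof. by apply: prodr_gt0 => k _; exact: re_gt0. Qed.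
Lemma rhoP_ge0 X : 0 <= rhoP X. Proof. by apply: prodr_ge0 => k _; exact: rho_ge0. Qed.
Lemma rhoN_ge0 j X : 0 <= rhoN j X. Proof. by apply: prodr_ge0 => k _; exact: rho_ge0. Qed.
Lemma rhoPE j X : rhoP X = rho j (row j X) * rhoN j X. Proof. by rewrite /rhoP (bigD1 j). Qed.
Lemma G_gt0 Y : 0 < G Y. Proof. by rewrite divr_gt0 ?reP_gt0// Lam_gt0. Qed.
Lemma K_gt0 X Y : 0 < K X Y. Proof. by rewrite mulr_gt0 ?G_gt0// gk_gt0. Qed.
Lemma K_ge0 X Y : 0 <= K X Y. Proof. exact/ltW/K_gt0. Qed.

Lemma measurable_row_comp (f : V -> R) k : measurable_fun setT f ->
  measurable_fun setT (fun X : T => f (row k X)).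
Proof. by move=> mf; apply: (measurableT_comp mf); exact: measurable_row. Qed.

Lemma measurable_pos_inv d' (S : measurableType d') (f : S -> R) : (forall x, 0 < f x) ->
  measurable_fun setT f -> measurable_fun setT (fun x => (f x)^-1).
Proof.
move=> f0 mf; have -> : (fun x => (f x)^-1) = (fun x => f x `^ (-1)).
  by apply/funext => x; rewrite powRN powRr1// ltW.
exact: (measurableT_comp (measurable_powR (-1))).
Qed.

Lemma measurable_reP : measurable_fun setT reP.
Proof. by apply: measurable_prod => k _; apply: measurable_row_comp; exact: measurable_re. Qed.

Lemma measurable_rhoP : measurable_fun setT rhoP.
Proof. by apply: measurable_prod => k _; apply: measurable_row_comp; exact: measurable_rho. Qed.

Lemma measurable_rhoN j : measurable_fun setT (rhoN j).
Proof.
rewrite (_ : rhoN j = fun X => \prod_(k <- [seq k <- index_enum 'I_N | k != j]) rho k (row k X)).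
  by apply: measurable_prod => k _; apply: measurable_row_comp; exact: measurable_rho.
by apply/funext => X; rewrite big_filter.
Qed.

Lemma measurable_G : measurable_fun setT G.
Proof.
apply: measurable_funM; first exact: measurable_Lam.
by apply: measurable_pos_inv; [exact: reP_gt0|exact: measurable_reP].
Qed.

Lemma measurable_gk2r : measurable_fun setT (fun z : T * T => gk (z.2 - z.1)).
Proof.
by under eq_fun do rewrite gk_sym; exact: measurable_gk2.
Qed.

Lemma measurable_K2 : measurable_fun setT (fun z : T * T => K z.1 z.2).
Proof.
apply: measurable_funM; first exact: measurable_gk2r.
exact: (measurableT_comp measurable_G measurable_snd).
Qed.

Lemma measurable_KY X : measurable_fun setT (K X).
Proof.
apply: measurable_funM; last exact: measurable_G.
exact: measurable_gkB.
Qed.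

Lemma measurable_KX Y : measurable_fun setT (fun X => K X Y).
Proof.
apply: measurable_funM => //; exact: measurable_gkB2.
Qed.

Lemma theta_row j (h : V * V -> \bar R) : measurable_fun setT h -> (forall z, 0 <= h z)%E ->
  (\int[leb]_X ((rhoN j X)%:E * \int[leb]_Y (h (row j X, row j Y) * (K X Y)%:E)) =
   \int[lebV]_y \int[lebV]_x (h (x, y) * (eta eps (y - x))%:E))%E.
Proof.
move=> mh h0.
pose H (y : V) := (\int[lebV]_x (h (x, y) * (eta eps (y - x))%:E))%E.
have H0 y : (0 <= H y)%E.
  by apply: integral_ge0 => x _; rewrite mule_ge0// lee_fin ltW// eta_gt0.
have mH : measurable_fun setT H.
  apply: (@measurable_param_integral _ _ _ _ R lebV (fun z : V * V => (h (z.2, z.1) * (eta eps (z.1 - z.2))%:E)%E)).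
    apply: emeasurable_funM; first by apply: (measurableT_comp mh); exact: measurable_swap.
    apply/measurable_EFinP; have := measurableT_comp measurable_eta2 (@measurable_swap _ _ V V).
    exact.
  by move=> z; rewrite mule_ge0// lee_fin ltW// eta_gt0.
have mrows : measurable_fun setT (fun z : T * T => (row j z.1, row j z.2)).
  by apply: measurable_fun_pair; apply: (measurableT_comp (measurable_row j)).
rewrite (weighted_tonelli leb leb (Phi := fun z : T * T => (h (row j z.1, row j z.2) * (K z.1 z.2)%:E)%E)
  (measurable_rhoN j) (rhoN_ge0 j)); last 2 first.
- apply: emeasurable_funM; first exact: (measurableT_comp mh mrows).
  by apply/measurable_EFinP; exact: measurable_K2.
- by move=> z; rewrite mule_ge0// lee_fin K_ge0.
pose gg (y : V) := (H y * ((re j y)^-1)%:E)%E.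
have gg0 y : (0 <= gg y)%E by rewrite mule_ge0// lee_fin invr_ge0 ltW// re_gt0.
have mgg : measurable_fun setT gg.
  apply: emeasurable_funM => //; apply/measurable_EFinP; apply: measurable_pos_inv.
    exact: re_gt0.
  exact: measurable_re.
transitivity (\int[leb]_Y (gg (row j Y) * (Lam Y)%:E))%E.
  apply: eq_integral => Y _.
  pose g k (x : V) := ((if k == j then h (x, row k Y) else (rho k x)%:E) * (eta eps (row k Y - x))%:E)%E.
  have mg k : measurable_fun setT (g k).
    apply: emeasurable_funM; last by apply/measurable_EFinP; exact: measurable_etaB.
    case: (k == j); last by apply/measurable_EFinP; exact: measurable_rho.
    apply: (measurableT_comp mh); exact: measurable_fun_pair.
  have g0 k x : (0 <= g k x)%E.
    rewrite mule_ge0// ?lee_fin ?(ltW (eta_gt0 eps0 _))//.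
    by case: (k == j) => //; rewrite lee_fin rho_ge0.
  transitivity (\int[leb]_X ((G Y)%:E * \prod_(k < N) g k (row k X)))%E.
    apply: eq_integral => X _.
    have E1 : gk (Y - X) = eta eps (row j Y - row j X) * \prod_(k < N | k != j) eta eps (row k Y - row k X).
      by rewrite gkB (bigD1 j).
    have E2 : (\prod_(k < N) g k (row k X) = h (row j X, row j Y) * (eta eps (row j Y - row j X))%:E *
        (rhoN j X * \prod_(k < N | k != j) eta eps (row k Y - row k X))%:E)%E.
      rewrite (bigD1 j)//= {1}/g eqxx; congr (_ * _)%E.
      rewrite /rhoN -big_split -prodEFin; apply: eq_bigr => k kj.
      by rewrite /g (negbTE kj).
    rewrite E2 /K E1 /= muleCA [RHS]muleCA -[in RHS]muleA; congr (_ * _)%E.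
    by rewrite -!EFinM; congr EFin; ring.
  rewrite ge0_integralZl//; last 3 first.
  - exact: measurable_rows_prod.
  - by move=> X _; exact: prode_ge0.
  - by rewrite lee_fin ltW// G_gt0.
  rewrite (integral_rows_prod _ mg g0).
  have Ek k : k != j -> (\int[lebesgue_row R d]_x g k x = (re k (row k Y))%:E)%E.
    move=> kj; rewrite re_density integral_lebesgue_mx1.
    + by apply: eq_integral => x _; rewrite /g (negbTE kj) EFinM.
    + apply/measurable_EFinP; apply: measurable_funM; [exact: measurable_rho|exact: measurable_etaB].
    + by move=> x; rewrite lee_fin mulr_ge0 ?rho_ge0// ltW// eta_gt0.
  rewrite (bigD1 j)//= (eq_bigr _ Ek) prodEFin.
  have -> : (\int[lebesgue_row R d]_x g j x = H (row j Y))%E.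
    rewrite /H integral_lebesgue_mx1.
    + by apply: eq_integral => x _; rewrite /g eqxx.
    + by have := mg j; rewrite /g eqxx.
    + by have := g0 j; rewrite /g eqxx.
  rewrite /gg muleCA -!muleA -!EFinM; congr (_ * _%:E)%E.
  rewrite /G /reP [in LHS](bigD1 j)//=.
  have r0 : \prod_(k < N | k != j) re k (row k Y) != 0.
    by rewrite gt_eqF//; apply: prodr_gt0 => k _; exact: re_gt0.
  by field; rewrite r0 gt_eqF// re_gt0.
have mggr : measurable_fun setT (fun Y : T => gg (row j Y)).
  by apply: (measurableT_comp mgg); exact: measurable_row.
rewrite integral_Lam//.
pose f (x : V) := (\int[lebV]_y (gg y * (eta eps (x - y))%:E))%E.
transitivity (\int[mu]_X f (row j X))%E.
  apply: eq_integral => X _; rewrite /f -(integral_gk_row eps0 j X mgg gg0).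
  by apply: eq_integral => Y _; rewrite gk_sym.
have f0 x : (0 <= f x)%E.
  by apply: integral_ge0 => y _; rewrite mule_ge0// lee_fin ltW// eta_gt0.
have mf : measurable_fun setT f.
  apply: (@measurable_param_integral _ _ _ _ R lebV (fun z : V * V => (gg z.2 * (eta eps (z.1 - z.2))%:E)%E)).
    apply: emeasurable_funM; first exact: (measurableT_comp mgg).
    by apply/measurable_EFinP; have := measurableT_comp measurable_eta2 (@measurable_swap _ _ V V); exact.
  by move=> z; rewrite mule_ge0// lee_fin ltW// eta_gt0.
rewrite marginal_integral//.
have := @integral_Lam R eps 1 d eps0 (marginal mu j) gg mgg gg0.
move=> E; transitivity (\int[lebV]_y (gg y * (re j y)%:E))%E.
  rewrite E; apply: eq_integral => x _; apply: eq_integral => y _.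
  by rewrite gk1 eta_sym.
apply: eq_integral => y _; rewrite /gg -muleA -EFinM mulVf ?mule1//.
by rewrite gt_eqF// re_gt0.
Qed.

Lemma integral_rhoP_gk Y : (\int[leb]_X ((rhoP X)%:E * (gk (Y - X))%:E) = (reP Y)%:E)%E.
Proof.
pose g k (x : V) := (rho k x * eta eps (row k Y - x))%:E.
have mg k : measurable_fun setT (g k).
  by apply/measurable_EFinP; apply: measurable_funM; [exact: measurable_rho|exact: measurable_etaB].
have g0 k x : (0 <= g k x)%E by rewrite lee_fin mulr_ge0 ?rho_ge0// ltW// eta_gt0.
transitivity (\int[leb]_X \prod_(k < N) g k (row k X))%E.
  by apply: eq_integral => X _; rewrite prodEFin big_split/= -gkB EFinM.
rewrite (integral_rows_prod _ mg g0) /reP -prodEFin; apply: eq_bigr => k _.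
by rewrite re_density; exact: (esym (@integral_lebesgue_mx1 R d (g k) (mg k) (g0 k))).
Qed.

Lemma theta_Y (g : T -> \bar R) : measurable_fun setT g -> (forall Y, 0 <= g Y)%E ->
  (\int[leb]_X ((rhoP X)%:E * \int[leb]_Y (g Y * (K X Y)%:E)) =
   \int[leb]_Y (g Y * (Lam Y)%:E))%E.
Proof.
move=> mg g0.
rewrite (weighted_tonelli leb leb (Phi := fun z : T * T => (g z.2 * (K z.1 z.2)%:E)%E)
  measurable_rhoP rhoP_ge0); last 2 first.
- apply: emeasurable_funM; first exact: (measurableT_comp mg).
  by apply/measurable_EFinP; exact: measurable_K2.
- by move=> z; rewrite mule_ge0// lee_fin K_ge0.
apply: eq_integral => Y _.
transitivity (\int[leb]_X ((g Y * (G Y)%:E) * ((rhoP X)%:E * (gk (Y - X))%:E)))%E.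
  apply: eq_integral => X _; rewrite /K /= muleCA -muleA; congr (_ * _)%E.
  by rewrite -!EFinM; congr EFin; ring.
rewrite ge0_integralZl//; last 3 first.
- apply: emeasurable_funM; apply/measurable_EFinP; first exact: measurable_rhoP.
  exact: measurable_gkB2.
- by move=> X _; rewrite mule_ge0// lee_fin ?rhoP_ge0// gk_ge0.
- by rewrite mule_ge0// lee_fin ltW// G_gt0.
by rewrite integral_rhoP_gk -muleA -EFinM /G divfK// gt_eqF// reP_gt0.
Qed.

Definition coupling_mass (X : T) : \bar R := (\int[leb]_Y (K X Y)%:E)%E.
Local Notation F := coupling_mass.

Lemma measurable_F : measurable_fun setT F.
Proof.
apply: (@measurable_param_integral _ _ _ _ R leb (fun z : T * T => (K z.1 z.2)%:E)).
  by apply/measurable_EFinP; exact: measurable_K2.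
by move=> z; rewrite lee_fin K_ge0.
Qed.

Lemma F_ge0 X : (0 <= F X)%E.
Proof. by apply: integral_ge0 => Y _; rewrite lee_fin K_ge0. Qed.

Lemma integral_rhoPF : (\int[leb]_X ((rhoP X)%:E * F X) = 1)%E.
Proof.
rewrite -(@Lam_mass R eps N d eps0 mu).
have := theta_Y (g := cst 1%E) (measurable_cst _) (fun=> lee01).
under [in X in _ = X]eq_integral do rewrite mul1e.
move=> <-; apply: eq_integral => X _; congr (_ * _)%E.
by apply: eq_integral => Y _; rewrite mul1e.
Qed.

Lemma ae_F_fin : {ae leb, forall X, (F X < +oo)%E \/ rhoP X = 0}.
Proof.
have mr : measurable_fun setT (fun X => (rhoP X)%:E * F X)%E.
  by apply: emeasurable_funM; [apply/measurable_EFinP; exact: measurable_rhoP|exact: measurable_F].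
have i1 : leb.-integrable setT (fun X => (rhoP X)%:E * F X)%E.
  apply/integrableP; split => //.
  under eq_integral do rewrite gee0_abs ?mule_ge0 ?lee_fin ?rhoP_ge0 ?F_ge0//.
  by rewrite integral_rhoPF ltry.
have := @integrable_ae _ _ _ leb setT measurableT _ i1.
apply: ae_imp => X /(_ I) Xfin.
have [|rn0] := eqVneq (rhoP X) 0; first by right.
left; rewrite ltey; apply/eqP => Foo; move: Xfin; rewrite Foo gt0_muley//.
by rewrite lte_fin lt_neqAle eq_sym rn0 rhoP_ge0.
Qed.

End theta.

Section determined_by_bumps.
Variables (R : realType) (m n : nat).
Local Notation T := 'M[R]_(m, n).

Lemma continuous_box_bump (a b : T) k : continuous (box_bump a b k).
Proof. by apply: smooth_poly_continuous; exact: smooth_poly_box_bump. Qed.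

Lemma measurable_box_bump (a b : T) k : measurable_fun setT (box_bump a b k).
Proof. by apply: continuous_measurable_mx; exact: continuous_box_bump. Qed.

Lemma prob_box_cvg (P : probability T R) (a b : T) :
  (\int[P]_x (box_bump a b k x)%:E)%E @[k --> \oo] --> P (box a b).
Proof.
have i1 : P.-integrable setT (cst (1%:E : \bar R)).
  exact: (@prob_bounded_integrable R m n P (cst 1) 1 (measurable_cst _) (fun x => ltac:(by rewrite normr1))).
have [| | | | |ig _ DC] := @dominated_convergence _ _ R P setT measurableT
    (fun k x => (box_bump a b k x)%:E) (fun x => (\1_(box a b) x)%:E) (cst 1%:E).
- by move=> k; apply/measurable_EFinP; exact: measurable_box_bump.
- by apply/measurable_EFinP; apply: measurable_indic; exact: measurable_box.
- apply: ae_all => x _; apply: cvg_EFin; first exact: nearW.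
  exact: box_bump_cvg.
- exact: i1.
- by apply: ae_all => x k _; rewrite /= lee_fin ger0_norm ?box_bump_ge0 ?box_bump_le1.
rewrite (_ : P (box a b) = \int[P]_x (\1_(box a b) x)%:E)%E//.
by rewrite integral_indic ?setIT//; exact: measurable_box.
Qed.

Lemma prob_eq_bumps (P Q : probability T R) :
  (forall a b k, \int[P]_x box_bump a b k x = \int[Q]_x box_bump a b k x) ->
  forall A, measurable A -> P A = Q A.
Proof.
move=> H A; apply: (measure_unique (@boxes R m n) (fun k => box (const_mx (- k%:R)) (const_mx k%:R))).
- exact: measurable_boxes.
- exact: boxesI.
- by move=> l; exists (const_mx (- l%:R)), (const_mx l%:R).
- exact: box_cover.
- move=> B [a [b ->]]; have C1 := @prob_box_cvg P a b.
  have fin (Pr : probability T R) k : (\int[Pr]_x (box_bump a b k x)%:E)%E \is a fin_num.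
    apply: (integrable_fin_num measurableT).
    apply: (@prob_bounded_integrable R m n Pr _ 1 (measurable_box_bump a b k)) => x.
    by rewrite ger0_norm ?box_bump_ge0 ?box_bump_le1.
  have C2 : (\int[P]_x (box_bump a b k x)%:E)%E @[k --> \oo] --> Q (box a b).
    rewrite (_ : (fun k => _) = (fun k => \int[Q]_x (box_bump a b k x)%:E)%E); first exact: prob_box_cvg.
    by apply/funext => k; have := H a b k; rewrite /Rintegral => E; rewrite -[LHS](fineK (fin P k)) E (fineK (fin Q k)).
  exact: (cvg_unique (@ereal_hausdorff R) C1 C2).
- move=> l; apply: (le_lt_trans (probability_le1 _ _)); last exact: ltry.
  exact: measurable_box.
Qed.

End determined_by_bumps.

Section theta_density.
Variables (R : realType) (eps p : R) (N d : nat).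
Hypotheses (eps0 : 0 < eps) (p1 : 1 <= p).
Local Notation T := 'M[R]_(N, d).
Local Notation V := 'rV[R]_d.
Local Notation leb := (lebesgue_mx R N d).
Local Notation lebV := (lebesgue_mx R 1 d).
Variable mu : probability T R.
Hypothesis muP : forall j, P1p p (marginal mu j).
Local Notation gk := (gaussian eps).
Local Notation Lam := (Lambda_density eps mu).
Local Notation rhoP := (rhoP p mu).
Local Notation reP := (reP eps mu).
Local Notation F := (coupling_mass eps mu).
Local Notation K := (coupling_kernel eps mu).

Definition Theta_fun (X : T) : R := rhoP X * fine (F X).

Lemma thd_ge0 X : 0 <= Theta_fun X.
Proof. by rewrite mulr_ge0 ?rhoP_ge0 ?fine_ge0 ?F_ge0. Qed.

Lemma measurable_thd : measurable_fun setT Theta_fun.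
Proof.
apply: measurable_funM; first exact: measurable_rhoP.
by apply: (measurableT_comp (fine_measurable measurableT)); exact: measurable_F.
Qed.

Lemma ae_thd : {ae leb, forall X, ((Theta_fun X)%:E = (rhoP X)%:E * F X)%E}.
Proof.
apply: ae_imp (ae_F_fin eps0 p1 muP) => X [Foo|r0]; last first.
  by rewrite /Theta_fun r0 mul0r mul0e.
by rewrite /Theta_fun EFinM fineK// ge0_fin_numE// F_ge0.
Qed.

Lemma integral_thd (g : T -> \bar R) : measurable_fun setT g -> (forall X, 0 <= g X)%E ->
  (\int[leb]_X (g X * (Theta_fun X)%:E) = \int[leb]_X (g X * ((rhoP X)%:E * F X)))%E.
Proof.
move=> mg g0; apply: ge0_ae_eq_integral => //.
- by apply: emeasurable_funM => //; apply/measurable_EFinP; exact: measurable_thd.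
- apply: emeasurable_funM => //; apply: emeasurable_funM; last exact: measurable_F.
  by apply/measurable_EFinP; exact: measurable_rhoP.
- by move=> X _; rewrite mule_ge0// lee_fin thd_ge0.
- by move=> X _; rewrite mule_ge0// mule_ge0 ?F_ge0// lee_fin rhoP_ge0.
by apply: ae_imp ae_thd => X ->.
Qed.

Lemma thd_mass : (\int[leb]_X (Theta_fun X)%:E = 1)%E.
Proof.
rewrite -(integral_rhoPF eps0 p1 muP).
have := @integral_thd (cst 1%E) (measurable_cst _) (fun=> lee01).
under eq_integral do rewrite mul1e.
by move=> ->; apply: eq_integral => X _; rewrite mul1e.
Qed.

Local Notation rows := (rows_measure (marginal mu)).

Lemma integral_rows (f : T -> \bar R) : measurable_fun setT f -> (forall X, 0 <= f X)%E ->
  (\int[rows]_X f X = \int[leb]_X (f X * (rhoP X)%:E))%E.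
Proof.
move=> mf f0.
rewrite (@integral_rows_density R N d _ (fun=> lebesgue_row R d) (fun k x => (rho p mu k x)%:E))//.
- by apply: eq_integral => X _; rewrite prodEFin.
- by move=> k; apply/measurable_EFinP; exact: measurable_rho.
- by move=> k x; rewrite lee_fin rho_ge0.
move=> k g mg g0; rewrite (has_density_integral (marginal_density p1 muP k))//.
rewrite integral_lebesgue_mx1//.
- by apply: emeasurable_funM => //; apply/measurable_EFinP; exact: measurable_rho.
- by move=> x; rewrite mule_ge0// lee_fin rho_ge0.
Qed.

Definition plan_kernel (Y X : T) : R := gk (Y - X) / reP Y.

Lemma W_ge0 Y X : 0 <= plan_kernel Y X.
Proof. by rewrite divr_ge0 ?gk_ge0// ltW// reP_gt0. Qed.

Lemma measurable_W Y : measurable_fun setT (plan_kernel Y).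
Proof. by apply: measurable_funM => //; exact: measurable_gkB2. Qed.

Lemma WE Y X : plan_kernel Y X = \prod_(k < N) (eta eps (row k Y - row k X) /
                              conv_density eps (marginal mu k) (row k Y)).
Proof.
rewrite prodf_div /plan_kernel gkB; congr (_ / _).
by apply: eq_bigr => k _; rewrite convE.
Qed.

Lemma W_mass Y : (\int[rows]_X (plan_kernel Y X)%:E = 1)%E.
Proof.
rewrite integral_rows; last 2 first.
- by apply/measurable_EFinP; exact: measurable_W.
- by move=> X; rewrite lee_fin W_ge0.
transitivity (\int[leb]_X (((reP Y)^-1)%:E * ((rhoP X)%:E * (gk (Y - X))%:E)))%E.
  by apply: eq_integral => X _; rewrite /plan_kernel -!EFinM; congr EFin; ring.
rewrite ge0_integralZl//.
- by rewrite (integral_rhoP_gk eps0 p1 muP) -EFinM mulVf// gt_eqF// reP_gt0.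
- apply: emeasurable_funM; apply/measurable_EFinP; first exact: measurable_rhoP.
  exact: measurable_gkB2.
- by move=> X _; rewrite mule_ge0// lee_fin ?rhoP_ge0// gk_ge0.
- by rewrite lee_fin invr_ge0 ltW// reP_gt0.
Qed.

Definition plan_mean (f : T -> R) (Y : T) : R := \int[rows]_X (f X * plan_kernel Y X).

Lemma integrable_W (f : T -> R) C Y : measurable_fun setT f -> (forall X, `|f X| <= C) ->
  rows.-integrable setT (EFin \o (fun X => f X * plan_kernel Y X)).
Proof.
move=> mf fC.
have iW : rows.-integrable setT (EFin \o plan_kernel Y).
  by apply: ge0_integrable_real; [exact: measurable_W|exact: W_ge0|rewrite W_mass ltry].
apply: (le_integrable_real (g := fun X => C * plan_kernel Y X)).
- by apply: measurable_funM => //; exact: measurable_W.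
- exact: (@integrableZl _ _ _ rows setT measurableT C _ iW).
- by move=> X; rewrite normrM (ger0_norm (W_ge0 _ _)) ler_wpM2r ?W_ge0.
Qed.

Lemma EFin_S (f : T -> R) C Y : measurable_fun setT f -> (forall X, `|f X| <= C) ->
  ((plan_mean f Y)%:E = \int[rows]_X (f X * plan_kernel Y X)%:E)%E.
Proof.
move=> mf fC; rewrite /plan_mean /Rintegral fineK//.
exact: (integrable_fin_num measurableT (integrable_W Y mf fC)).
Qed.

Lemma measurable_S (f : T -> R) : measurable_fun setT f -> measurable_fun setT (plan_mean f).
Proof.
move=> mf; apply: (@measurable_param_Rintegral _ _ _ _ R rows (fun z : T * T => f z.2 * plan_kernel z.1 z.2)).
apply: measurable_funM; first exact: (measurableT_comp mf).
apply: measurable_funM; first exact: measurable_gk2.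
apply: (measurable_pos_inv (f := fun z : T * T => reP z.1)); first by move=> z; exact: reP_gt0.
exact: (measurableT_comp (@measurable_reP R eps N d mu) measurable_fst).
Qed.

Lemma S_cst C Y : plan_mean (cst C) Y = C.
Proof.
apply: EFin_inj; rewrite (@EFin_S _ `|C|)//.
have iW : rows.-integrable setT (EFin \o plan_kernel Y).
  by apply: ge0_integrable_real; [exact: measurable_W|exact: W_ge0|rewrite W_mass ltry].
have := @integralZl _ _ _ rows setT measurableT _ iW C.
by rewrite W_mass mule1 => <-.
Qed.

Lemma S_bound (f : T -> R) C Y : measurable_fun setT f -> (forall X, `|f X| <= C) -> `|plan_mean f Y| <= C.
Proof.
move=> mf fC; rewrite -lee_fin.
apply: (le_trans (le_abse_fine_integral rows _)); last first.
  rewrite -[C in leRHS](S_cst C Y) (@EFin_S (cst C) `|C|)//.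
  apply: ge0_le_integral => //.
  - by apply/measurable_EFinP; apply: measurableT_comp => //; apply: measurable_funM => //; exact: measurable_W.
  - by apply/measurable_EFinP; apply: measurable_funM => //; exact: measurable_W.
  by move=> X _; rewrite /= lee_fin normrM (ger0_norm (W_ge0 _ _)) ler_wpM2r ?W_ge0.
by apply/measurable_EFinP; apply: measurable_funM => //; exact: measurable_W.
Qed.

Lemma theta_nonneg (f : T -> R) C P : has_density P Theta_fun -> measurable_fun setT f ->
  (forall X, 0 <= f X) -> (forall X, `|f X| <= C) ->
  \int[P]_X f X = \int[Lambda eps mu]_Y plan_mean f Y.
Proof.
move=> Pd mf f0 fC; rewrite /Rintegral; congr fine.
have S0 Y : (0 <= (plan_mean f Y)%:E)%E.
  by rewrite (EFin_S Y mf fC); apply: integral_ge0 => X _; rewrite lee_fin mulr_ge0 ?W_ge0.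
rewrite (has_density_integral Pd)//; [|exact/measurable_EFinP].
rewrite (has_density_integral (Lam_has_density eps0 mu))//; last first.
  by apply/measurable_EFinP; exact: measurable_S.
rewrite integral_thd//; [|exact/measurable_EFinP].
pose r X := f X * rhoP X.
have mr : measurable_fun setT r by apply: measurable_funM => //; exact: measurable_rhoP.
have r0 X : 0 <= r X by rewrite mulr_ge0// rhoP_ge0.
transitivity (\int[leb]_X ((r X)%:E * \int[leb]_Y (K X Y)%:E))%E.
  by apply: eq_integral => X _; rewrite muleA -EFinM.
rewrite (weighted_tonelli leb leb (Phi := fun z : T * T => (K z.1 z.2)%:E) mr r0); last 2 first.
- by apply/measurable_EFinP; exact: measurable_K2.
- by move=> z; rewrite lee_fin K_ge0.
apply: eq_integral => Y _; rewrite (EFin_S Y mf fC) integral_rows; last 2 first.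
- by apply/measurable_EFinP; apply: measurable_funM => //; exact: measurable_W.
- by move=> X; rewrite lee_fin mulr_ge0 ?W_ge0.
rewrite muleC -ge0_integralZl//.
- apply: eq_integral => X _; rewrite -!EFinM; congr EFin.
  by rewrite /r /coupling_kernel /coupling_ratio /plan_kernel; ring.
- apply/measurable_EFinP; apply: measurable_funM; last exact: measurable_rhoP.
  by apply: measurable_funM => //; exact: measurable_W.
- by move=> X _; rewrite lee_fin mulr_ge0 ?rhoP_ge0// mulr_ge0 ?W_ge0.
- by rewrite lee_fin ltW// Lam_gt0.
Qed.

Lemma is_Theta_density P : has_density P Theta_fun -> is_Theta eps mu P.
Proof.
move=> Pd psi cpsi [M psiM].
have mpsi := continuous_measurable_mx cpsi.
have M0 : 0 <= M by exact: le_trans (psiM 0).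
pose f X := psi X + M.
have mf : measurable_fun setT f by exact: measurable_funD.
have f0 X : 0 <= f X by have := psiM X; rewrite /f ler_norml => /andP[]; rewrite -lerBlDr sub0r.
have fC X : `|f X| <= M + M.
  by rewrite (le_trans (ler_normD _ _))// (ger0_norm M0) lerD2r.
have H := theta_nonneg Pd mf f0 fC.
have E (Q : probability T R) (g : T -> R) : measurable_fun setT g -> (forall X, `|g X| <= M) ->
    \int[Q]_X (g X + M) = \int[Q]_X g X + M.
  move=> mg gM; rewrite RintegralD//.
  - by congr (_ + _); rewrite /Rintegral integral_prob_cst.
  - exact: (@prob_bounded_integrable R N d Q g M mg gM).
  - apply: (@prob_bounded_integrable R N d Q (cst M) M) => // X.
    by rewrite /= ger0_norm.
have SE Y : plan_mean f Y = plan_mean psi Y + M.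
  rewrite -[M in RHS](S_cst M Y) /plan_mean -RintegralD//.
  - by apply: eq_Rintegral => X _; rewrite /f mulrDl.
  - exact: (integrable_W Y mpsi psiM).
  - by apply: (@integrable_W (cst M) M) => // X; rewrite /= ger0_norm.
move: H; rewrite /f E//.
under [RHS]eq_Rintegral do rewrite SE.
rewrite E//; last 2 first.
- exact: measurable_S.
- by move=> X; exact: S_bound.
move=> /addIr ->; apply: eq_Rintegral => Y _; apply: eq_Rintegral => X _.
by rewrite WE.
Qed.

Lemma Theta_has_density : has_density (Theta eps mu) Theta_fun.
Proof.
have [P Pd] := has_density_exists measurable_thd thd_ge0 thd_mass.
have PT := is_Theta_density Pd.
have QT : is_Theta eps mu (Theta eps mu) by apply: (@getPex _ [set P | is_Theta eps mu P]); exists P.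
have [mt t0 PA] := Pd; split => // A mA; rewrite -PA//.
apply: prob_eq_bumps => // a b k.
have bd : exists M, forall X, `|box_bump a b k X| <= M :> R.
  by exists 1 => X; rewrite ger0_norm ?box_bump_ge0 ?box_bump_le1.
have c := @continuous_box_bump R N d a b k.
by rewrite (QT _ c bd) (PT _ c bd).
Qed.

End theta_density.

Section theta_ac.
Variables (R : realType) (eps p : R) (N d : nat).
Hypotheses (eps0 : 0 < eps) (p1 : 1 <= p).
Local Notation T := 'M[R]_(N, d).
Local Notation V := 'rV[R]_d.
Local Notation leb := (lebesgue_mx R N d).
Local Notation lebV := (lebesgue_mx R 1 d).
Variable mu : probability T R.
Hypothesis muP : forall j, P1p p (marginal mu j).
Local Notation gk := (gaussian eps).
Local Notation rhoP := (rhoP p mu).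
Local Notation rhoN := (rhoN p mu).
Local Notation F := (coupling_mass eps mu).
Local Notation K := (coupling_kernel eps mu).
Local Notation G := (coupling_ratio eps mu).
Local Notation u k := (root_density p (marginal mu k)).
Local Notation Du k i := (weak_partial (ord0, i) (root_density p (marginal mu k))).

Let p0 : 0 < p. Proof. exact: lt_le_trans p1. Qed.
Let pn0 : p != 0. Proof. by rewrite gt_eqF. Qed.
Let en0 : eps != 0. Proof. by rewrite gt_eqF. Qed.
Let u0 k x : 0 <= u k x. Proof. exact: powR_ge0. Qed.
Let mu_ k : measurable_fun setT (u k). Proof. exact: measurable_u. Qed.
Let wpu k i : is_weak_partial (ord0, i) (u k) (Du k i).
Proof. by have [_ _ H _] := P1pP p1 (muP k). Qed.
Let mDu k i : measurable_fun setT (Du k i). Proof. exact: measurable_weak_partial (wpu k i). Qed.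
Let fDu k i : (\int[lebV]_x (`|Du k i x| `^ p)%:E < +oo)%E.
Proof. by have [_ _ _ H] := P1pP p1 (muP k). Qed.

Definition uP (X : T) : R := \prod_(k < N) u k (row k X).
Definition uN (j : 'I_N) (X : T) : R := \prod_(k < N | k != j) u k (row k X).

Lemma uP_ge0 X : 0 <= uP X. Proof. by apply: prodr_ge0 => k _; exact: u0. Qed.
Lemma uN_ge0 j X : 0 <= uN j X. Proof. by apply: prodr_ge0 => k _; exact: u0. Qed.
Lemma uPE j X : uP X = u j (row j X) * uN j X. Proof. by rewrite /uP (bigD1 j). Qed.

Lemma prod_powR (I : Type) (r : seq I) (Q : pred I) (f : I -> R) (q : R) :
  (forall i, 0 <= f i) -> (\prod_(i <- r | Q i) f i) `^ q = \prod_(i <- r | Q i) f i `^ q.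
Proof.
move=> f0; elim: r => [|i r IH]; first by rewrite !big_nil powR1.
by rewrite !big_cons; case: ifP => // _; rewrite powRM ?IH// prodr_ge0.
Qed.

Lemma uP_powR X : uP X `^ p = rhoP X. Proof. exact: prod_powR. Qed.
Lemma uN_powR j X : uN j X `^ p = rhoN j X. Proof. exact: prod_powR. Qed.

Lemma measurable_uN j : measurable_fun setT (uN j).
Proof.
rewrite (_ : uN j = fun X => \prod_(k <- [seq k <- index_enum 'I_N | k != j]) u k (row k X)).
  by apply: measurable_prod => k _; apply: measurable_row_comp.
by apply/funext => X; rewrite big_filter.
Qed.

Definition Gn (n : nat) (Y : T) : R := Num.min (G Y) n.+1%:R.

Lemma Gn_gt0 n Y : 0 < Gn n Y. Proof. by rewrite /Gn lt_min G_gt0//= ltr0n. Qed.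
Lemma Gn_ge0 n Y : 0 <= Gn n Y. Proof. exact/ltW/Gn_gt0. Qed.
Lemma Gn_le n Y : Gn n Y <= n.+1%:R. Proof. by rewrite /Gn ge_min lexx orbT. Qed.
Lemma Gn_leG n Y : Gn n Y <= G Y. Proof. by rewrite /Gn ge_min lexx. Qed.
Lemma measurable_Gn n : measurable_fun setT (Gn n).
Proof. by apply: measurable_minr => //; exact: measurable_G. Qed.

Lemma Gn_cvg Y : Gn n Y @[n --> \oo] --> G Y.
Proof.
apply: cvg_near_cst; near=> n; rewrite /Gn; apply/min_idPl.
apply: (le_trans (ltW (truncnS_gt (G Y)))); rewrite ler_nat ltnS.
by near: n; exact: nbhs_infty_ge.
Unshelve. all: by end_near. Qed.

Definition cut_kernel n (X Y : T) : R := gk (Y - X) * Gn n Y.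
Local Notation kn := cut_kernel.

Lemma kn_gt0 n X Y : 0 < kn n X Y. Proof. by rewrite mulr_gt0 ?Gn_gt0// gk_gt0. Qed.
Lemma kn_ge0 n X Y : 0 <= kn n X Y. Proof. exact/ltW/kn_gt0. Qed.
Lemma kn_le n X Y : kn n X Y <= n.+1%:R * gk (Y - X).
Proof. by rewrite /kn mulrC ler_wpM2r ?gk_ge0// Gn_le. Qed.
Lemma kn_leK n X Y : kn n X Y <= K X Y.
Proof. by rewrite /kn ler_wpM2l ?gk_ge0// Gn_leG. Qed.
Lemma kn_cvg X Y : kn n X Y @[n --> \oo] --> K X Y.
Proof. by apply: cvgM; [exact: cvg_cst|exact: Gn_cvg]. Qed.

Lemma measurable_kn n X : measurable_fun setT (kn n X).
Proof. by apply: measurable_funM; [exact: measurable_gkB|exact: measurable_Gn]. Qed.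

Lemma measurable_kn2 n : measurable_fun setT (fun z : T * T => kn n z.1 z.2).
Proof.
apply: measurable_funM; first exact: measurable_gk2r.
exact: (measurableT_comp (measurable_Gn n) measurable_snd).
Qed.

Lemma gk_mass X : (\int[leb]_Y (gk (Y - X))%:E = 1)%E.
Proof.
apply: (etrans _ (integral_gk eps0 X)).
by apply: eq_integral => Y _; congr EFin; exact: gk_sym.
Qed.

Lemma integrable_gkY X : leb.-integrable setT (EFin \o (fun Y => gk (Y - X))).
Proof.
apply: ge0_integrable_real; [exact: measurable_gkB|by move=> Y; exact: gk_ge0|].
by rewrite gk_mass ltry.
Qed.

Lemma integrable_kn n X : leb.-integrable setT (EFin \o kn n X).
Proof.
apply: (@le_integrable_real _ _ R leb (kn n X) (fun Y => n.+1%:R * gk (Y - X))).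
- exact: measurable_kn.
- exact: (@integrableZl _ _ _ leb setT measurableT n.+1%:R _ (integrable_gkY X)).
- by move=> Y; rewrite ger0_norm ?kn_ge0// kn_le.
Qed.

Definition cut_mass n (X : T) : R := \int[leb]_Y kn n X Y.
Local Notation Fn := cut_mass.

Lemma EFin_Fn n X : ((Fn n X)%:E = \int[leb]_Y (kn n X Y)%:E)%E.
Proof. by rewrite /Fn /Rintegral fineK//; exact: (integrable_fin_num measurableT (integrable_kn n X)). Qed.

Lemma measurable_Fn n : measurable_fun setT (Fn n).
Proof. exact: (@measurable_param_Rintegral _ _ _ _ R leb (fun z => kn n z.1 z.2) (measurable_kn2 n)). Qed.

Lemma Fn_gt0 n X : 0 < Fn n X.
Proof.
have mk : measurable_fun setT (EFin \o kn n X) by apply/measurable_EFinP; exact: measurable_kn.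
rewrite -lte_fin EFin_Fn lt_neqAle integral_ge0 ?andbT; last first.
  by move=> Y _; rewrite lee_fin kn_ge0.
apply/eqP => I0.
have I1 : (\int[leb]_Y `|(EFin \o kn n X) Y| = 0)%E.
  by rewrite [RHS]I0; apply: eq_integral => Y _; rewrite /= ger0_norm ?kn_ge0.
have [A [mA A0 sA]] := proj1 (ae_eq_integral_abs leb measurableT mk) I1.
have AT : A = setT.
  apply/seteqP; split=> // Y _; apply: sA => /= /(_ I)[] /eqP.
  by rewrite gt_eqF// kn_gt0.
have := gk_mass X; rewrite (null_set_integral measurableT).
- by move=> /eqP; rewrite eqe eq_sym oner_eq0.
- by apply/measurable_EFinP; exact: measurable_gkB.
- by rewrite -AT.
Qed.

Lemma Fn_leF n X : ((Fn n X)%:E <= F X)%E.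
Proof.
rewrite EFin_Fn; apply: ge0_le_integral => //.
- by move=> Y _; rewrite lee_fin kn_ge0.
- by apply/measurable_EFinP; exact: measurable_kn.
- by apply/measurable_EFinP; exact: measurable_KY.
- by move=> Y _; rewrite lee_fin kn_leK.
Qed.

Lemma F_gt0 X : (0 < F X)%E.
Proof. by apply: lt_le_trans (Fn_leF 0 X); rewrite lte_fin Fn_gt0. Qed.

Variables (j : 'I_N) (i : 'I_d).
Local Notation e := (delta_mx j i : T).

Definition score (X Y : T) : R := (Y j i - X j i) / (p * eps).
Local Notation drift := score.
Definition plan_slope (X Y : T) : R := Du j i (row j X) + u j (row j X) * drift X Y.
Local Notation slope := plan_slope.

Lemma dgk_drift X Y : gaussian_partial eps j i (X - Y) = p * drift X Y * gk (Y - X).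
Proof. by rewrite /gaussian_partial gk_sym !mxE /drift; field; rewrite pn0 en0. Qed.

Lemma measurable_entry2 : measurable_fun setT (fun z : T * T => z.2 j i - z.1 j i).
Proof.
apply: measurable_funB.
  exact: (measurableT_comp (measurable_coord j i) measurable_snd).
exact: (measurableT_comp (measurable_coord j i) measurable_fst).
Qed.

Lemma measurable_drift2 : measurable_fun setT (fun z : T * T => drift z.1 z.2).
Proof. by apply: measurable_funM => //; exact: measurable_entry2. Qed.

Lemma measurable_drift X : measurable_fun setT (drift X).
Proof.
apply: measurable_funM => //; apply: measurable_funB => //; exact: measurable_coord.
Qed.

Lemma measurable_slope X : measurable_fun setT (slope X).
Proof.
apply: measurable_funD => //; apply: measurable_funM => //; exact: measurable_drift.
Qed.

Lemma measurable_slope2 : measurable_fun setT (fun z : T * T => slope z.1 z.2).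
Proof.
have m1 : measurable_fun setT (fun z : T * T => Du j i (row j z.1)).
  exact: (measurableT_comp (measurable_row_comp j (mDu j i)) measurable_fst).
have m2 : measurable_fun setT (fun z : T * T => u j (row j z.1)).
  exact: (measurableT_comp (measurable_row_comp j (mu_ j)) measurable_fst).
apply: measurable_funD => //; apply: measurable_funM => //; exact: measurable_drift2.
Qed.

Lemma measurable_dgkX X : measurable_fun setT (fun Y : T => gaussian_partial eps j i (X - Y)).
Proof.
have H : measurable_fun setT (fun Y : T => (X, Y)) by exact: measurable_fun_pair.
exact: (measurableT_comp (@measurable_dgk2 R eps N d j i) H).
Qed.

Lemma integral_dgk_bound : exists C, forall X,
  (\int[leb]_Y `|(gaussian_partial eps j i (X - Y))%:E| <= C%:E)%E.
Proof.
exists (eps^-1 * (moment_cst 1 * eps `^ (1 / 2) * 2 `^ (2^-1))) => X.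
pose h (x : V) := (`|(row j X - x) ord0 i| `^ 1)%:E.
have mh : measurable_fun setT h.
  apply/measurable_EFinP; apply: measurable_abs_powR; under eq_fun do rewrite !mxE.
  by apply: measurable_funB => //; exact: measurable_coord.
have h0 x : (0 <= h x)%E by rewrite lee_fin powR_ge0.
apply: (@le_trans _ _ (eps^-1%:E * \int[leb]_Y (h (row j Y) * (gk (X - Y))%:E))%E).
  rewrite le_eqVlt; apply/orP; left; apply/eqP.
  rewrite -ge0_integralZl//.
  - apply: eq_integral => Y _; rewrite /h powRr1// -!EFinM /gaussian_partial /= normrM (ger0_norm (gk_ge0 eps0 _)).
    by rewrite normrN normrM !mxE (gtr0_norm (_ : 0 < eps^-1)) ?invr_gt0//; congr EFin; ring.
  - apply: emeasurable_funM; first exact: (measurableT_comp mh (measurable_row j)).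
    by apply/measurable_EFinP; exact: measurable_gkB2.
  - by move=> Y _; rewrite mule_ge0// lee_fin gk_ge0.
  - by rewrite lee_fin invr_ge0 ltW.
rewrite EFinM lee_pmul2l// ?lte_fin ?invr_gt0//.
rewrite (integral_gk_row eps0 j X mh h0).
apply: le_trans (moment_eta i (row j X) eps0 (lexx 1)).
by rewrite le_eqVlt; apply/orP; left; apply/eqP; apply: eq_integral => x _.
Qed.

Lemma integrable_drift_kn n X : leb.-integrable setT (EFin \o (fun Y => drift X Y * kn n X Y)).
Proof.
have [C HC] := integral_dgk_bound.
have id : leb.-integrable setT (EFin \o (fun Y => gaussian_partial eps j i (X - Y))).
  apply/integrableP; split; last exact: le_lt_trans (HC X) (ltry _).
  by apply/measurable_EFinP; exact: measurable_dgkX.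
have id' := @integrableZl _ _ _ leb setT measurableT (p^-1 * n.+1%:R) _ (integrable_norm id).
apply: (@le_integrable_real _ _ R leb _ (fun Y => p^-1 * n.+1%:R * `|gaussian_partial eps j i (X - Y)|)) => //.
  by apply: measurable_funM; [exact: measurable_drift|exact: measurable_kn].
move=> Y; have E : `|gaussian_partial eps j i (X - Y)| = p * `|drift X Y| * gk (Y - X).
  by rewrite dgk_drift normrM (normrM p) (gtr0_norm p0) (ger0_norm (gk_ge0 eps0 _)).
rewrite (normrM (drift X Y)) (ger0_norm (kn_ge0 _ _ _)) E.
move: (normr_ge0 (drift X Y)); move: (`|drift X Y|) => D D0.
rewrite [leRHS](_ : _ = D * (n.+1%:R * gk (Y - X))); last by field; rewrite pn0.
by rewrite ler_wpM2l// kn_le.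
Qed.

Lemma ac_Fn n : ac_everywhere e (Fn n) (fun X => p * \int[leb]_Y (drift X Y * kn n X Y)).
Proof.
have [C HC] := integral_dgk_bound.
have EA : Fn n = fun X => \int[leb]_Y (gk (X - Y) * Gn n Y).
  by apply/funext => X; apply: eq_Rintegral => Y _; rewrite /kn gk_sym.
have EB : (fun X => p * \int[leb]_Y (drift X Y * kn n X Y)) =
    fun X => \int[leb]_Y (gaussian_partial eps j i (X - Y) * Gn n Y).
  apply/funext => X; have Z := @RintegralZl _ _ _ leb setT _ p measurableT (integrable_drift_kn n X).
  apply: (etrans (esym Z)).
  by apply: eq_Rintegral => Y _; rewrite dgk_drift /kn; ring.
rewrite EA EB.
apply: (@ac_everywhere_param_bounded _ _ _ _ _ _ leb (fun Y X : T => gk (X - Y) * Gn n Y)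
  (fun Y X : T => gaussian_partial eps j i (X - Y) * Gn n Y) (n.+1%:R * C)).
- apply: measurable_funM; last exact: (measurableT_comp (measurable_Gn n) measurable_fst).
  have H : measurable_fun setT (fun z : T * T => (z.2, z.1)) by exact: measurable_swap.
  exact: (measurableT_comp (@measurable_dgk2 R eps N d j i) H).
- move=> Y; have H := ac_everywhereM (@ac_everywhere_invariant _ _ _ e (fun _ : T => Gn n Y) (fun _ _ => erefl))
    (ac_gk_shift eps0 j i Y).
  apply: eq_ac_everywhere H => X; first by rewrite mulrC.
  by rewrite mulr0 addr0 mulrC.
- move=> X; have := integrable_kn n X; congr (integrable _ _ _).
  by apply/funext => Y; rewrite /= /kn gk_sym.
move=> X; have mdX : measurable_fun setT (fun Y : T => `|(gaussian_partial eps j i (X - Y))%:E|%E).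
  have m1 : measurable_fun setT (fun Y : T => `|gaussian_partial eps j i (X - Y)|).
    exact: (measurableT_comp (@normr_measurable R setT) (measurable_dgkX X)).
  by move/measurable_EFinP : m1.
apply: (@le_trans _ _ (\int[leb]_Y (n.+1%:R%:E * `|(gaussian_partial eps j i (X - Y))%:E|))%E).
  apply: ge0_le_integral.
  - exact: measurableT.
  - by move=> Y _; exact: abse_ge0.
  - have m1 : measurable_fun setT (fun Y : T => `|gaussian_partial eps j i (X - Y) * Gn n Y|).
      apply: (measurableT_comp (@normr_measurable R setT)).
      by apply: measurable_funM; [exact: measurable_dgkX|exact: measurable_Gn].
    by move/measurable_EFinP : m1.
  - by apply: emeasurable_funM; [exact: measurable_cst|exact: mdX].
  move=> Y _; have H : `|gaussian_partial eps j i (X - Y) * Gn n Y| <= n.+1%:R * `|gaussian_partial eps j i (X - Y)|.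
    rewrite normrM mulrC (ger0_norm (Gn_ge0 n Y)).
    by apply: ler_wpM2r; [exact: normr_ge0|exact: Gn_le].
  by move: H; rewrite -lee_fin EFinM.
have n0 : (0 <= n.+1%:R%:E :> \bar R)%E by rewrite lee_fin.
rewrite (@ge0_integralZl _ _ _ leb setT measurableT _ mdX n.+1%:R%:E (fun _ _ => abse_ge0 _) n0).
by rewrite EFinM lee_pmul2l.
Qed.

Definition cut_root n (X : T) : R := u j (row j X) * (uN j X * Fn n X `^ p^-1).
Local Notation wn := cut_root.
Definition cut_moment n (X : T) : R := \int[leb]_Y (slope X Y * kn n X Y).
Local Notation An := cut_moment.
Definition cut_root_partial n (X : T) : R := uN j X * Fn n X `^ (p^-1 - 1) * An n X.
Local Notation gn := cut_root_partial.

Lemma AnE n X : An n X = Du j i (row j X) * Fn n X +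
  u j (row j X) * \int[leb]_Y (drift X Y * kn n X Y).
Proof.
have i1 := integrable_kn n X; have i2 := integrable_drift_kn n X.
have i1' := @integrableZl _ _ _ leb setT measurableT (Du j i (row j X)) _ i1.
have i2' := @integrableZl _ _ _ leb setT measurableT (u j (row j X)) _ i2.
rewrite -RintegralZl// -RintegralZl// -RintegralD//.
by apply: eq_Rintegral => Y _; rewrite /slope; ring.
Qed.

Lemma ac_wn n : ac_lines e (wn n) (gn n).
Proof.
have Iinv : ac_everywhere e (uN j) (fun=> 0).
  apply: ac_everywhere_invariant => X s; apply: eq_bigr => k kj.
  by rewrite row_shift (negbTE kj) scaler0 addr0.
have aF := ac_everywhere_powR p^-1 (Fn_gt0 n) (ac_Fn n).
have H2 := ac_everywhere_lines (ac_everywhereM Iinv aF).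
have H1 := ac_lines_row j (weak_ac (wpu j i)).
have mF' : measurable_fun setT (fun X => \int[leb]_Y (drift X Y * kn n X Y)).
  apply: (@measurable_param_Rintegral _ _ _ _ R leb (fun z => drift z.1 z.2 * kn n z.1 z.2)).
  by apply: measurable_funM; [exact: measurable_drift2|exact: measurable_kn2].
have mFp q : measurable_fun setT (fun X => Fn n X `^ q).
  exact: (measurableT_comp (measurable_powR q) (measurable_Fn n)).
have H := ac_linesM (measurable_row_comp j (mu_ j)) _ (measurable_row_comp j (mDu j i)) _ H1 H2.
have gE : gn n = fun X => u j (row j X) * (uN j X * (p^-1 * Fn n X `^ (p^-1 - 1) *
     (p * \int[leb]_Y (drift X Y * kn n X Y))) + Fn n X `^ p^-1 * 0) +
     uN j X * Fn n X `^ p^-1 * Du j i (row j X).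
  apply/funext => X; rewrite /gn AnE.
  have -> : Fn n X `^ p^-1 = Fn n X `^ (p^-1 - 1) * Fn n X.
    by rewrite gt0_powRD ?Fn_gt0// powRN powRr1 ?(ltW (Fn_gt0 _ _))// mulfVK// gt_eqF ?Fn_gt0.
  by field; rewrite pn0.
rewrite gE; apply: H.
- by apply: measurable_funM => //; exact: measurable_uN.
- apply: measurable_funD; last by apply: measurable_funM.
  apply: measurable_funM; first exact: measurable_uN.
  by apply: measurable_funM; apply: measurable_funM.
Qed.

(* bound *)
Definition slope_energy (X : T) : \bar R :=
  ((rhoN j X)%:E * \int[leb]_Y (`|slope X Y| `^ p * K X Y)%:E)%E.
Local Notation VV := slope_energy.

Lemma gn_bound n X : ((`|gn n X| `^ p)%:E <= VV X)%E.
Proof.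
have J := jensen_powR p1 (measurable_slope X) (measurable_kn n X) (kn_ge0 n X) (Fn_gt0 n X)
  (esym (EFin_Fn n X)).
have E : `|gn n X| `^ p = rhoN j X * (`|An n X| `^ p * Fn n X `^ (1 - p)).
  rewrite /gn !normrM (ger0_norm (uN_ge0 _ _)) (ger0_norm (powR_ge0 _ _)).
  rewrite !powRM ?mulr_ge0 ?uN_ge0 ?powR_ge0// uN_powR -powRrM mulrBl mulVf// mul1r.
  by ring.
rewrite E EFinM; apply: lee_wpmul2l; first by rewrite lee_fin rhoN_ge0.
apply: (le_trans J); apply: ge0_le_integral => //.
- by move=> Y _; rewrite lee_fin mulr_ge0 ?powR_ge0 ?kn_ge0.
- apply/measurable_EFinP; apply: measurable_funM; last exact: measurable_kn.
  by apply: measurable_abs_powR; exact: measurable_slope.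
- apply/measurable_EFinP; apply: measurable_funM; last exact: measurable_KY.
  by apply: measurable_abs_powR; exact: measurable_slope.
- by move=> Y _; rewrite lee_fin ler_wpM2l ?powR_ge0// kn_leK.
Qed.

End theta_ac.

Lemma powR_cvg (R : realType) (f : nat -> R) (l r : R) : 0 < l -> f @ \oo --> l ->
  f n `^ r @[n --> \oo] --> l `^ r.
Proof.
move=> l0 fl.
have /derivable1_diffP/differentiable_continuous C : derivable (fun x : R => x `^ r) l 1.
  by apply: derivable_powR; rewrite in_itv/= l0.
exact: (cvg_comp _ _ fl C).
Qed.

Lemma Rintegral_dct d (S : measurableType d) (R : realType) (mm : {measure set S -> \bar R})
    (f_ : nat -> S -> R) (f h : S -> R) :
  (forall n, measurable_fun setT (f_ n)) -> measurable_fun setT f ->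
  (forall x, f_ n x @[n --> \oo] --> f x) -> (forall n x, `|f_ n x| <= h x) ->
  mm.-integrable setT (EFin \o h) ->
  \int[mm]_x f_ n x @[n --> \oo] --> \int[mm]_x f x.
Proof.
move=> mf_ mf ff fh ih.
have [| | | | |ig _ H] := @dominated_convergence _ _ R mm setT measurableT
   (fun n x => (f_ n x)%:E) (fun x => (f x)%:E) (EFin \o h).
- by move=> n; apply/measurable_EFinP.
- exact/measurable_EFinP.
- by apply: ae_all => x _; apply: cvg_EFin; [exact: nearW|exact: ff].
- exact: ih.
- by apply: ae_all => x n _; rewrite /= lee_fin.
apply: fine_cvg; rewrite fineK//; exact: (integrable_fin_num measurableT ig).
Qed.

Lemma split_double_integral d1 d2 (S1 : measurableType d1) (S2 : measurableType d2) (R : realType)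
    (m1 : {sigma_finite_measure set S1 -> \bar R}) (m2 : {sigma_finite_measure set S2 -> \bar R})
    (p l : R) (a b k : S1 * S2 -> R) : 1 <= p -> 0 < l < 1 ->
  measurable_fun setT a -> measurable_fun setT b -> measurable_fun setT k -> (forall z, 0 <= k z) ->
  (\int[m1]_x \int[m2]_y (`|a (x, y) + b (x, y)| `^ p * k (x, y))%:E <=
   (l `^ (1 - p))%:E * \int[m1]_x \int[m2]_y (`|a (x, y)| `^ p * k (x, y))%:E +
   ((1 - l) `^ (1 - p))%:E * \int[m1]_x \int[m2]_y (`|b (x, y)| `^ p * k (x, y))%:E)%E.
Proof.
move=> p1 l01 ma mb mk k0.
pose I (f : S1 * S2 -> R) z := (`|f z| `^ p * k z)%:E.
have mI f : measurable_fun setT f -> measurable_fun setT (I f).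
  by move=> mf; apply/measurable_EFinP; apply: measurable_funM => //; exact: measurable_abs_powR.
have I0 f z : (0 <= I f z)%E by rewrite lee_fin mulr_ge0 ?powR_ge0.
have FT f : measurable_fun setT f -> (\int[m1]_x \int[m2]_y I f (x, y) = \int[m1 \x m2]_z I f z)%E.
  by move=> mf; apply/esym; exact: (fubini_tonelli1 (I f) (mI f mf) (I0 f)).
have mab : measurable_fun setT (fun z => a z + b z) by exact: measurable_funD.
have := FT _ mab; rewrite /I => ->; have := FT _ ma; rewrite /I => ->; have := FT _ mb; rewrite /I => ->.
have A0 : (0 <= (l `^ (1 - p))%:E)%E by rewrite lee_fin powR_ge0.
have B0 : (0 <= ((1 - l) `^ (1 - p))%:E)%E by rewrite lee_fin powR_ge0.
rewrite -(@ge0_integralZl _ _ _ _ setT measurableT _ (mI a ma) _ (fun z _ => I0 a z) A0).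
rewrite -(@ge0_integralZl _ _ _ _ setT measurableT _ (mI b mb) _ (fun z _ => I0 b z) B0).
rewrite -ge0_integralD; first last.
- by apply: emeasurable_funM; [exact: measurable_cst|exact: mI].
- by move=> z _; exact: mule_ge0.
- by apply: emeasurable_funM; [exact: measurable_cst|exact: mI].
- by move=> z _; exact: mule_ge0.
- exact: measurableT.
apply: ge0_le_integral.
- exact: measurableT.
- by move=> z _; exact: (I0 (fun z => a z + b z)).
- exact: (mI _ mab).
- by apply: emeasurable_funD; apply: emeasurable_funM; [exact: measurable_cst|exact: mI|exact: measurable_cst|exact: mI].
move=> z _; have H := ler_wpM2r (k0 z) (powR_split (a z) (b z) p1 l01).
by rewrite mulrDl -!mulrA -lee_fin in H.
Qed.

Section theta_limit.
Variables (R : realType) (eps p : R) (N d : nat).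
Hypotheses (eps0 : 0 < eps) (p1 : 1 <= p).
Local Notation T := 'M[R]_(N, d).
Local Notation V := 'rV[R]_d.
Local Notation leb := (lebesgue_mx R N d).
Local Notation lebV := (lebesgue_mx R 1 d).
Variable mu : probability T R.
Hypothesis muP : forall j, P1p p (marginal mu j).
Local Notation gk := (gaussian eps).
Local Notation rhoP := (rhoP p mu).
Local Notation rhoN := (rhoN p mu).
Local Notation F := (coupling_mass eps mu).
Local Notation K := (coupling_kernel eps mu).
Local Notation u k := (root_density p (marginal mu k)).
Local Notation Du k i := (weak_partial (ord0, i) (root_density p (marginal mu k))).
Local Notation uP := (uP p mu).
Local Notation uN := (uN p mu).
Local Notation slope := (plan_slope eps p mu).
Local Notation Fn := (cut_mass eps mu).
Local Notation kn := (cut_kernel eps mu).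
Local Notation VV := (slope_energy eps p mu).

Let p0 : 0 < p. Proof. exact: lt_le_trans p1. Qed.
Let u0 k x : 0 <= u k x. Proof. exact: powR_ge0. Qed.
Let mu_ k : measurable_fun setT (u k). Proof. exact: measurable_u. Qed.
Let wpu k i : is_weak_partial (ord0, i) (u k) (Du k i).
Proof. by have [_ _ H _] := P1pP p1 (muP k). Qed.
Let mDu k i : measurable_fun setT (Du k i). Proof. exact: measurable_weak_partial (wpu k i). Qed.
Let fDu k i : (\int[lebV]_x (`|Du k i x| `^ p)%:E < +oo)%E.
Proof. by have [_ _ _ H] := P1pP p1 (muP k). Qed.

Definition slope_moment j i (X : T) : R := \int[leb]_Y (slope j i X Y * K X Y).
Definition Theta_root_partial (ji : 'I_N * 'I_d) (X : T) : R :=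
  uN ji.1 X * fine (F X) `^ (p^-1 - 1) * slope_moment ji.1 ji.2 X.
Definition Theta_root (X : T) : R := uP X * fine (F X) `^ p^-1.

Lemma wtheta_ge0 X : 0 <= Theta_root X.
Proof. by rewrite mulr_ge0 ?powR_ge0 ?uP_ge0. Qed.

Lemma wtheta_powR X : Theta_root X `^ p = Theta_fun eps p mu X.
Proof.
rewrite /Theta_root powRM ?powR_ge0 ?uP_ge0// uP_powR -powRrM mulVf ?gt_eqF//.
by rewrite powRr1// fine_ge0// F_ge0.
Qed.

Lemma measurable_fineF q : measurable_fun setT (fun X => fine (F X) `^ q).
Proof.
apply: (measurableT_comp (measurable_powR q)).
by apply: (measurableT_comp (fine_measurable measurableT)); exact: measurable_F.
Qed.

Lemma measurable_uP : measurable_fun setT uP.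
Proof. by apply: measurable_prod => k _; apply: measurable_row_comp. Qed.

Lemma measurable_wtheta : measurable_fun setT Theta_root.
Proof. by apply: measurable_funM; [exact: measurable_uP|exact: measurable_fineF]. Qed.

Lemma measurable_gtheta ji : measurable_fun setT (Theta_root_partial ji).
Proof.
apply: measurable_funM.
  by apply: measurable_funM; [exact: measurable_uN|exact: measurable_fineF].
apply: (@measurable_param_Rintegral _ _ _ _ R leb (fun z => slope ji.1 ji.2 z.1 z.2 * K z.1 z.2)).
by apply: measurable_funM; [exact: measurable_slope2|exact: measurable_K2].
Qed.

Lemma integrable_KY X : (F X < +oo)%E -> leb.-integrable setT (EFin \o K X).
Proof.
move=> Foo; apply: ge0_integrable_real => //; first exact: measurable_KY.
by move=> Y; exact: K_ge0.
Qed.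

Lemma EFin_F X : (F X < +oo)%E -> ((fine (F X))%:E = F X)%E.
Proof. by move=> Foo; rewrite fineK// ge0_fin_numE// F_ge0. Qed.

Lemma fineF_gt0 X : (F X < +oo)%E -> 0 < fine (F X).
Proof. by move=> Foo; rewrite -lte_fin EFin_F// F_gt0. Qed.

Lemma Fn_cvg X : (F X < +oo)%E -> Fn n X @[n --> \oo] --> fine (F X).
Proof.
move=> Foo; apply: (@Rintegral_dct _ _ R leb (fun n => kn n X) (K X) (K X)).
- by move=> n; exact: measurable_kn.
- exact: measurable_KY.
- by move=> Y; exact: kn_cvg.
- by move=> n Y; rewrite ger0_norm ?kn_ge0// kn_leK.
- exact: integrable_KY.
Qed.

Section fixed_direction.
Variables (j : 'I_N) (i : 'I_d).
Local Notation An := (cut_moment eps p mu j i).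
Local Notation gn := (cut_root_partial eps p mu j i).
Local Notation wn := (cut_root eps p mu j).

Lemma integrable_slopeK X : (F X < +oo)%E -> (VV j i X < +oo)%E -> uN j X != 0 ->
  leb.-integrable setT (EFin \o (fun Y => slope j i X Y * K X Y)).
Proof.
move=> Foo Voo uN0; apply: (weighted_integrable p1).
- exact: measurable_slope.
- exact: measurable_KY.
- by move=> Y; exact: K_ge0.
- exact: Foo.
move: Voo; rewrite /slope_energy -(uN_powR) ltey => /eqP H; rewrite ltey; apply/eqP => E; apply: H.
by rewrite E gt0_muley// lte_fin powR_gt0// lt_neqAle eq_sym uN0 uN_ge0.
Qed.

Lemma An_cvg X : (F X < +oo)%E -> (VV j i X < +oo)%E -> uN j X != 0 ->
  An n X @[n --> \oo] --> slope_moment j i X.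
Proof.
move=> Foo Voo uN0; have ii := integrable_norm (integrable_slopeK Foo Voo uN0).
apply: (@Rintegral_dct _ _ R leb (fun n Y => slope j i X Y * kn n X Y)
  (fun Y => slope j i X Y * K X Y) (fun Y => `|slope j i X Y * K X Y|)) => //.
- by move=> n; apply: measurable_funM; [exact: measurable_slope|exact: measurable_kn].
- by apply: measurable_funM; [exact: measurable_slope|exact: measurable_KY].
- by move=> Y; apply: cvgM; [exact: cvg_cst|exact: kn_cvg].
- move=> n Y; rewrite (normrM _ (kn n X Y)) (normrM _ (K X Y)).
  by rewrite ler_wpM2l// !ger0_norm ?kn_ge0 ?K_ge0// kn_leK.
Qed.

(* where F is infinite the density vanishes, and so does the candidate derivative *)
Lemma degenerate X : ~ (F X < +oo)%E -> rhoP X = 0 -> (VV j i X < +oo)%E -> uN j X != 0 ->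
  forall Y, slope j i X Y = 0.
Proof.
move=> Foo r0 Voo uN0.
have u00 : u j (row j X) = 0.
  have := uP_powR p mu X; rewrite r0 => /eqP; rewrite powR_eq0 (uPE p mu j) mulf_eq0 (negbTE uN0) orbF.
  by case/andP => /eqP.
have sE Y : slope j i X Y = Du j i (row j X) by rewrite /plan_slope u00 mul0r addr0.
have [D0 Y|Dn0] := eqVneq (Du j i (row j X)) 0; first by rewrite sE.
have F_oo : F X = +oo%E by apply/eqP; rewrite -leye_eq leNgt; apply/negP.
move: Voo; rewrite /slope_energy.
under eq_integral do rewrite sE EFinM.
rewrite ge0_integralZl//.
- rewrite -/(coupling_mass eps mu X) F_oo gt0_muley ?gt0_muley ?ltxx// lte_fin ?powR_gt0 ?normr_gt0//.
  by rewrite -uN_powR powR_gt0// lt_neqAle eq_sym uN0 uN_ge0.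
- by apply/measurable_EFinP; exact: measurable_KY.
- by move=> Y _; rewrite lee_fin K_ge0.
Qed.

Lemma wn_cvg X : (F X < +oo)%E \/ rhoP X = 0 -> wn n X @[n --> \oo] --> Theta_root X.
Proof.
have wE n : wn n X = uP X * Fn n X `^ p^-1 by rewrite /cut_root mulrA -uPE.
move=> H; have [r0|rn0] := eqVneq (rhoP X) 0.
  have uP0 : uP X = 0.
    by have := uP_powR p mu X; rewrite r0 => /eqP; rewrite powR_eq0 => /andP[/eqP].
  apply: cvg_near_cst; apply: nearW => n.
  by rewrite wE uP0 mul0r; apply/esym; rewrite /Theta_root uP0; exact: mul0r.
case: H => [Foo|r0]; last by rewrite r0 eqxx in rn0.
rewrite (_ : (fun n => wn n X) = (fun n => uP X * Fn n X `^ p^-1)); last by apply/funext.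
apply: cvgM; first exact: cvg_cst.
by apply: powR_cvg; [exact: fineF_gt0|exact: Fn_cvg].
Qed.

Lemma gn_cvg X : (F X < +oo)%E \/ rhoP X = 0 -> (VV j i X < +oo)%E ->
  gn n X @[n --> \oo] --> Theta_root_partial (j, i) X.
Proof.
move=> H Voo; rewrite /Theta_root_partial/=.
have [uN0|uNn0] := eqVneq (uN j X) 0.
  rewrite uN0 !mul0r; under eq_cvg do rewrite /cut_root_partial uN0 !mul0r.
  exact: cvg_cst.
have [Foo|Foo] := pselect (F X < +oo)%E.
  apply: cvgM; last exact: An_cvg.
  apply: cvgM; first exact: cvg_cst.
  by apply: powR_cvg; [exact: fineF_gt0|exact: Fn_cvg].
case: H => // r0; have s0 := degenerate Foo r0 Voo uNn0.
have -> : slope_moment j i X = 0.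
  rewrite /slope_moment; under eq_Rintegral do rewrite s0 mul0r.
  by rewrite /Rintegral integral0.
under eq_cvg => n.
  have -> : gn n X = 0.
    rewrite /cut_root_partial (_ : An n X = 0) ?mulr0// /cut_moment.
    under eq_Rintegral do rewrite s0 mul0r.
    by rewrite /Rintegral integral0.
  over.
by rewrite mulr0; exact: cvg_cst.
Qed.

Lemma gtheta_neq0 X : (F X < +oo)%E \/ rhoP X = 0 -> (VV j i X < +oo)%E ->
  Theta_root_partial (j, i) X != 0 -> (F X < +oo)%E /\ uN j X != 0.
Proof.
move=> H Voo; rewrite /Theta_root_partial/= !mulf_eq0 !negb_or => /andP[/andP[uNn0 _] An0].
split => //; have [//|Foo] := pselect (F X < +oo)%E.
case: H => // r0; have s0 := degenerate Foo r0 Voo uNn0.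
move: An0; rewrite /slope_moment; under eq_Rintegral do rewrite s0 mul0r.
by rewrite /Rintegral integral0 eqxx.
Qed.

Lemma gtheta_le X (a : T -> R) : measurable_fun setT a ->
  (F X < +oo)%E \/ rhoP X = 0 -> (VV j i X < +oo)%E ->
  (Theta_root_partial (j, i) X != 0 -> \int[leb]_Y (a Y * K X Y) = slope_moment j i X) ->
  ((`|Theta_root_partial (j, i) X| `^ p)%:E <= (rhoN j X)%:E * \int[leb]_Y (`|a Y| `^ p * K X Y)%:E)%E.
Proof.
move=> ma H Voo E; have [g0|gn0] := eqVneq (Theta_root_partial (j, i) X) 0.
  rewrite g0 normr0 powR0 ?gt_eqF// mule_ge0// ?lee_fin ?rhoN_ge0// integral_ge0// => Y _.
  by rewrite lee_fin mulr_ge0 ?powR_ge0 ?K_ge0.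
have [Foo uNn0] := gtheta_neq0 H Voo gn0.
have J := jensen_powR p1 ma (measurable_KY eps0 mu X) (K_ge0 eps0 mu X) (fineF_gt0 Foo)
  (esym (EFin_F Foo)).
rewrite E// in J.
have -> : `|Theta_root_partial (j, i) X| `^ p = rhoN j X * (`|slope_moment j i X| `^ p * fine (F X) `^ (1 - p)).
  rewrite /Theta_root_partial/= !normrM (ger0_norm (uN_ge0 _ _ _ _)) (ger0_norm (powR_ge0 _ _)).
  rewrite !powRM ?mulr_ge0 ?uN_ge0 ?powR_ge0// uN_powR -powRrM mulrBl mulVf ?gt_eqF// mul1r.
  by ring.
by rewrite EFinM; apply: lee_wpmul2l => //; rewrite lee_fin rhoN_ge0.
Qed.

Definition bV (x y : V) : R := (y ord0 i - x ord0 i) / (p * eps).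
Definition slopeV (x y : V) : R := Du j i x + u j x * bV x y.

Lemma slopeE X Y : slope j i X Y = slopeV (row j X) (row j Y).
Proof. by rewrite /plan_slope /slopeV /bV /score !mxE. Qed.

Lemma measurable_slopeV : measurable_fun setT (fun z : V * V => slopeV z.1 z.2).
Proof.
apply: measurable_funD; first exact: (measurableT_comp (mDu j i) measurable_fst).
apply: measurable_funM; first exact: (measurableT_comp (mu_ j) measurable_fst).
apply: measurable_funM => //; apply: measurable_funB.
  exact: (measurableT_comp (measurable_coord ord0 i) measurable_snd).
exact: (measurableT_comp (measurable_coord ord0 i) measurable_fst).
Qed.

Lemma integral_VV : (\int[leb]_X VV j i X =
  \int[lebV]_y \int[lebV]_x (`|slopeV x y| `^ p * eta eps (y - x))%:E)%E.
Proof.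
have := @theta_row R eps p N d eps0 p1 mu muP j (fun z => (`|slopeV z.1 z.2| `^ p)%:E).
have mh : measurable_fun setT (fun z : V * V => (`|slopeV z.1 z.2| `^ p)%:E).
  by apply/measurable_EFinP; apply: measurable_abs_powR; exact: measurable_slopeV.
move=> /(_ mh (fun z => ltac:(by rewrite lee_fin powR_ge0))) H.
apply: (etrans _ (etrans H _)).
- by apply: eq_integral => X _; rewrite /slope_energy; under eq_integral do rewrite slopeE EFinM.
- by apply: eq_integral => y _; apply: eq_integral => x _; rewrite EFinM.
Qed.

Definition kappa : R := (p * eps) `^ (- p) * (moment_cst p * eps `^ (p / 2) * 2 `^ (2^-1)).

Lemma kappa_ge0 : 0 <= kappa.
Proof. by rewrite !mulr_ge0 ?powR_ge0 ?moment_cst_ge0. Qed.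

Lemma bV_moment (x : V) : (\int[lebV]_y (`|bV x y| `^ p * eta eps (y - x))%:E <= kappa%:E)%E.
Proof.
have pe0 : 0 < p * eps by rewrite mulr_gt0.
have mF : measurable_fun setT (fun y : V => (`|(x - y) ord0 i| `^ p * eta eps (x - y))%:E).
  apply/measurable_EFinP; apply: measurable_funM; last exact: measurable_etaB.
  apply: measurable_abs_powR; under eq_fun do rewrite !mxE.
  by apply: measurable_funB => //; exact: measurable_coord.
have F0 (y : V) : setT y -> (0 <= (`|(x - y) ord0 i| `^ p * eta eps (x - y))%:E)%E.
  by move=> _; rewrite lee_fin mulr_ge0 ?powR_ge0// ltW// eta_gt0.
have k0 : (0 <= ((p * eps) `^ (- p))%:E)%E by rewrite lee_fin powR_ge0.
have Z := @ge0_integralZl _ _ _ lebV setT measurableT _ mF ((p * eps) `^ (- p))%:E F0 k0.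
rewrite /kappa EFinM; apply: (@le_trans _ _ (((p * eps) `^ (- p))%:E *
  \int[lebV]_y (`|(x - y) ord0 i| `^ p * eta eps (x - y))%:E)%E); last first.
  by apply: lee_wpmul2l => //; exact: moment_eta.
rewrite -Z le_eqVlt; apply/orP; left; apply/eqP; apply: eq_integral => y _.
have E1 : `|bV x y| `^ p = (p * eps) `^ (- p) * `|(x - y) ord0 i| `^ p.
  rewrite /bV (normrM (y ord0 i - x ord0 i)) (powRM _ (normr_ge0 _) (normr_ge0 _)) normfV (gtr0_norm pe0) powR_inv_base ?(ltW pe0)// mulrC.
  by rewrite distrC !mxE.
by rewrite -EFinM; congr EFin; rewrite E1 (eta_sym eps x y); exact: esym (mulrA _ _ _).
Qed.

Lemma measurable_bV : measurable_fun setT (fun z : V * V => bV z.1 z.2).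
Proof.
apply: measurable_funM => //; apply: measurable_funB.
  exact: (measurableT_comp (measurable_coord ord0 i) measurable_snd).
exact: (measurableT_comp (measurable_coord ord0 i) measurable_fst).
Qed.

Lemma ubV_moment : (\int[lebV]_y \int[lebV]_x (`|u j x * bV x y| `^ p * eta eps (y - x))%:E
   <= kappa%:E)%E.
Proof.
pose Phi (z : V * V) := (`|bV z.1 z.2| `^ p * eta eps (z.2 - z.1))%:E.
have mPhi : measurable_fun setT Phi.
  apply/measurable_EFinP; apply: measurable_funM; last exact: measurable_eta2.
  by apply: measurable_abs_powR; exact: measurable_bV.
have Phi0 z : (0 <= Phi z)%E by rewrite lee_fin mulr_ge0 ?powR_ge0// ltW// eta_gt0.
have WT := weighted_tonelli lebV lebV (measurable_rho p1 muP j) (rho_ge0 p mu j) mPhi Phi0.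
apply: (@le_trans _ _ (\int[lebV]_x ((rho p mu j x)%:E * \int[lebV]_y Phi (x, y)))%E).
  rewrite le_eqVlt; apply/orP; left; apply/eqP; apply/esym; apply: (etrans WT).
  apply: eq_integral => y _; apply: eq_integral => x _.
  rewrite /Phi -EFinM; congr EFin.
  by rewrite (normrM (u j x)) (ger0_norm (u0 j x)) powRM// mulrA.
apply: (@le_trans _ _ (\int[lebV]_x ((rho p mu j x)%:E * kappa%:E))%E).
  have mr : measurable_fun setT (fun x => (rho p mu j x)%:E).
    by apply/measurable_EFinP; exact: measurable_rho.
  apply: ge0_le_integral.
  - exact: measurableT.
  - move=> x _; apply: mule_ge0; first by rewrite lee_fin rho_ge0.
    by apply: integral_ge0 => y _; exact: Phi0.
  - apply: emeasurable_funM => //.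
    exact: (@measurable_param_integral _ _ _ _ R lebV Phi).
  - by apply: emeasurable_funM.
  move=> x _; apply: lee_wpmul2l; first by rewrite lee_fin rho_ge0.
  exact: bV_moment.
under eq_integral do rewrite muleC.
rewrite ge0_integralZl//.
- by rewrite (has_density_mass (marginal_density p1 muP j)) mule1.
- by apply/measurable_EFinP; exact: measurable_rho.
- by move=> x _; rewrite lee_fin rho_ge0.
- by rewrite lee_fin kappa_ge0.
Qed.

Lemma split_integral (a b : V -> V -> R) (l : R) : 0 < l < 1 ->
  measurable_fun setT (fun z : V * V => a z.1 z.2) ->
  measurable_fun setT (fun z : V * V => b z.1 z.2) ->
  (\int[lebV]_y \int[lebV]_x (`|a x y + b x y| `^ p * eta eps (y - x))%:E <=
   (l `^ (1 - p))%:E * \int[lebV]_y \int[lebV]_x (`|a x y| `^ p * eta eps (y - x))%:E +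
   ((1 - l) `^ (1 - p))%:E * \int[lebV]_y \int[lebV]_x (`|b x y| `^ p * eta eps (y - x))%:E)%E.
Proof.
move=> l01 ma mb.
have sw (f : V -> V -> R) : measurable_fun setT (fun z : V * V => f z.1 z.2) ->
    measurable_fun setT (fun z : V * V => f z.2 z.1).
  by move=> mf; exact: (measurableT_comp mf (@measurable_swap _ _ V V)).
have me : measurable_fun setT (fun z : V * V => eta eps (z.1 - z.2)).
  have H : measurable_fun setT (fun z : V * V => (z.2, z.1)) by exact: measurable_swap.
  exact: (measurableT_comp (@measurable_eta2 R eps d) H).
exact: (@split_double_integral _ _ _ _ R lebV lebV p l _ _ _ p1 l01 (sw _ ma) (sw _ mb) me
  (fun z => ltW (eta_gt0 eps0 _))).
Qed.

Lemma integral_eta_out (f : V -> R) : measurable_fun setT f -> (forall x, 0 <= f x) ->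
  (\int[lebV]_y \int[lebV]_x (f x * eta eps (y - x))%:E = \int[lebV]_x (f x)%:E)%E.
Proof.
move=> mf f0; rewrite -(@integral_gk_out R eps 1 d eps0 f mf f0).
by apply: eq_integral => y _; apply: eq_integral => x _; rewrite gk1.
Qed.

Lemma VV_le (l : R) : 0 < l < 1 -> (\int[leb]_X VV j i X <=
  (l `^ (1 - p))%:E * \int[lebV]_x (`|Du j i x| `^ p)%:E + ((1 - l) `^ (1 - p) * kappa)%:E)%E.
Proof.
move=> l01; rewrite integral_VV.
have H := @split_integral (fun x _ => Du j i x) (fun x y => u j x * bV x y) l l01
  (measurableT_comp (mDu j i) measurable_fst)
  (measurable_funM (measurableT_comp (mu_ j) measurable_fst) measurable_bV).
apply: (le_trans H); rewrite integral_eta_out.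
- apply: leeD2l; rewrite EFinM; apply: lee_wpmul2l; first by rewrite lee_fin powR_ge0.
  exact: ubV_moment.
- exact: measurable_abs_powR.
- by move=> x; exact: powR_ge0.
Qed.

Lemma VV_fin : (\int[leb]_X VV j i X < +oo)%E.
Proof.
have h : (0 < (2^-1 : R) < 1) by rewrite invr_gt0 ltr0n/= invf_lt1 ?ltr1n.
apply: (le_lt_trans (VV_le h)).
by rewrite lte_add_pinfty ?ltry// lte_mul_pinfty// lee_fin powR_ge0.
Qed.

Lemma VV_ge0 X : (0 <= VV j i X)%E.
Proof.
rewrite mule_ge0 ?lee_fin ?rhoN_ge0// integral_ge0// => Y _.
by rewrite lee_fin mulr_ge0 ?powR_ge0 ?K_ge0.
Qed.

Lemma measurable_VV : measurable_fun setT (VV j i).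
Proof.
apply: emeasurable_funM; first by apply/measurable_EFinP; exact: measurable_rhoN.
apply: (@measurable_param_integral _ _ _ _ R leb (fun z => (`|slope j i z.1 z.2| `^ p * K z.1 z.2)%:E)).
  apply/measurable_EFinP; apply: measurable_funM; last exact: measurable_K2.
  by apply: measurable_abs_powR; exact: measurable_slope2.
by move=> z; rewrite lee_fin mulr_ge0 ?powR_ge0 ?K_ge0.
Qed.

Lemma integrable_VV : leb.-integrable setT (VV j i).
Proof.
apply/integrableP; split; first exact: measurable_VV.
by under eq_integral do rewrite gee0_abs ?VV_ge0//; exact: VV_fin.
Qed.

Lemma ae_VV_fin : {ae leb, forall X, (VV j i X < +oo)%E}.
Proof.
have := @integrable_ae _ _ _ leb setT measurableT _ integrable_VV.
by apply: ae_imp => X /(_ I); rewrite ge0_fin_numE// VV_ge0.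
Qed.

Lemma ae_good : {ae leb, forall X, ((F X < +oo)%E \/ rhoP X = 0) /\ (VV j i X < +oo)%E}.
Proof. exact: ae_and (ae_F_fin eps0 p1 muP) ae_VV_fin. Qed.

Lemma ac_wtheta : ac_lines (delta_mx j i) Theta_root (Theta_root_partial (j, i)).
Proof.
apply: (@ac_lines_lim _ _ _ _ wn gn _ _ (fun X => fine (VV j i X))).
- by move=> n; exact: ac_wn.
- exact: measurable_gtheta.
- by apply: ae_imp ae_good => X [H _]; exact: wn_cvg.
- by apply: ae_imp ae_good => X [H H']; exact: gn_cvg.
- apply: ae_imp ae_VV_fin => X Voo k.
  apply: (le_trans (le_norm_powR _ p1)); rewrite lerD2l -lee_fin fineK.
    exact: gn_bound.
  by rewrite ge0_fin_numE// VV_ge0.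
apply: ge0_integrable_real.
- by apply: (measurableT_comp (fine_measurable measurableT)); exact: measurable_VV.
- by move=> X; apply: fine_ge0; exact: VV_ge0.
apply: le_lt_trans VV_fin; rewrite le_eqVlt; apply/orP; left; apply/eqP.
apply: ge0_ae_eq_integral => //.
- by apply/measurable_EFinP; apply: (measurableT_comp (fine_measurable measurableT)); exact: measurable_VV.
- exact: measurable_VV.
- by move=> X _; rewrite lee_fin fine_ge0// VV_ge0.
- by move=> X _; exact: VV_ge0.
by apply: ae_imp ae_VV_fin => X Voo _; rewrite fineK// ge0_fin_numE// VV_ge0.
Qed.

Lemma gtheta_energy_le :
  (\int[leb]_X (`|Theta_root_partial (j, i) X| `^ p)%:E <= \int[leb]_X VV j i X)%E.
Proof.
apply: ae_ge0_le_integral => //.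
- by apply/measurable_EFinP; apply: measurable_abs_powR; exact: measurable_gtheta.
- by move=> X _; exact: VV_ge0.
- exact: measurable_VV.
apply: ae_imp ae_good => X [H Voo] _.
have H2 := @gtheta_le X (slope j i X) _ H Voo (fun _ => erefl).
by apply: H2; exact: measurable_slope.
Qed.

End fixed_direction.

Lemma is_weak_partial_wtheta ji : is_weak_partial ji Theta_root (Theta_root_partial ji).
Proof.
case: ji => j i; apply: ac_weak; first exact: ac_wtheta.
- apply: (Lp_loc_integrable p1); first exact: measurable_wtheta.
  under eq_integral do rewrite (ger0_norm (wtheta_ge0 _)) wtheta_powR.
  by rewrite (thd_mass eps0 p1 muP) ltry.
- apply: (Lp_loc_integrable p1); first exact: measurable_gtheta.
  exact: le_lt_trans (gtheta_energy_le j i) (VV_fin j i).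
Qed.

Lemma P1p_Theta : P1p p (Theta eps mu) /\
  (forall ji, {ae leb, forall X, weak_partial ji (root_density p (Theta eps mu)) X = Theta_root_partial ji X}).
Proof.
apply: (@P1p_intro _ _ _ _ p1 _ Theta_root).
- exact: wtheta_ge0.
- have := Theta_has_density eps0 p1 muP; congr has_density.
  by apply/funext => X; rewrite wtheta_powR.
- exact: measurable_wtheta.
- exact: is_weak_partial_wtheta.
- by case=> j i; exact: le_lt_trans (gtheta_energy_le j i) (VV_fin j i).
Qed.

Lemma energy_Theta : energy p (Theta eps mu) =
  (\sum_(j < N) \sum_(i < d) \int[leb]_X (`|Theta_root_partial (j, i) X| `^ p)%:E)%E.
Proof.
have [H H'] := P1p_Theta.
by apply: energyE => //; exact: measurable_gtheta.
Qed.

End theta_limit.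

Section theta_ibp.
Variables (R : realType) (eps p : R) (N d : nat).
Hypotheses (eps0 : 0 < eps) (p1 : 1 < p).
Local Notation T := 'M[R]_(N, d).
Local Notation V := 'rV[R]_d.
Local Notation leb := (lebesgue_mx R N d).
Local Notation lebV := (lebesgue_mx R 1 d).
Variable mu : probability T R.
Hypotheses (muP : forall j, P1p p (marginal mu j)) (muPP : P1p p mu).
Local Notation gk := (gaussian eps).
Local Notation rhoP := (rhoP p mu).
Local Notation rhoN := (rhoN p mu).
Local Notation F := (coupling_mass eps mu).
Local Notation K := (coupling_kernel eps mu).
Local Notation Lam := (Lambda_density eps mu).
Local Notation re k := (Lambda_density eps (marginal mu k : probability 'M[R]_(1, d) R)).
Local Notation u k := (root_density p (marginal mu k)).
Local Notation Du k i := (weak_partial (ord0, i) (root_density p (marginal mu k))).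
Local Notation slope := (plan_slope eps p mu).
Local Notation drift := (score eps p).
Local Notation VV := (slope_energy eps p mu).
Local Notation qT j i := (logder eps p mu j i).
Local Notation qV j i := (logder eps p (marginal mu j : probability 'M[R]_(1, d) R) ord0 i).

Let p0 : 0 < p. Proof. exact: lt_trans p1. Qed.
Let p1' : 1 <= p. Proof. exact: ltW. Qed.
Let pn0 : p != 0. Proof. by rewrite gt_eqF. Qed.
Let en0 : eps != 0. Proof. by rewrite gt_eqF. Qed.
Let u0 k x : 0 <= u k x. Proof. exact: powR_ge0. Qed.
Let mu_ k : measurable_fun setT (u k). Proof. exact: measurable_u. Qed.
Let mDu k i : measurable_fun setT (Du k i).
Proof. by have [_ _ H _] := P1pP p1' (muP k); exact: measurable_weak_partial (H _). Qed.
Let fDu k i : (\int[lebV]_x (`|Du k i x| `^ p)%:E < +oo)%E.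
Proof. by have [_ _ _ H] := P1pP p1' (muP k). Qed.

Section fixed_direction.
Variables (j : 'I_N) (i : 'I_d).
Local Notation e := (delta_mx j i : T).

Definition bias (Y : T) : R := qT j i Y - qV j i (row j Y).

Lemma measurable_bias : measurable_fun setT bias.
Proof.
apply: measurable_funB; first exact: measurable_qL.
by apply: measurable_row_comp; exact: measurable_qL.
Qed.

Lemma ac_K X : ac_everywhere e (K X) (fun Y => p * (bias Y - drift j i X Y) * K X Y).
Proof.
pose rN (Y : T) := (\prod_(k < N | k != j) re k (row k Y))^-1.
have H1 := ac_everywhere_row j (ac_everywhere_powR (-1) (re_gt0 eps0 mu j) (ac_Lam eps0 (marginal mu j) ord0 i)).
have H2 : ac_everywhere e rN (fun=> 0).
  apply: ac_everywhere_invariant => Y s.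
  have E : \prod_(k < N | k != j) re k (row k (Y + s *: e)) = \prod_(k < N | k != j) re k (row k Y).
    apply: eq_bigr => k kj.
    have Er : row k (Y + s *: e) = row k Y by rewrite row_shift (negbTE kj) scaler0 addr0.
    exact: (congr1 (fun y => re k y) Er).
  exact: (congr1 (fun x : R => x^-1) E).
have H3 := ac_everywhereM (ac_gk_shift eps0 j i X) (ac_everywhereM (ac_Lam eps0 mu j i) (ac_everywhereM H1 H2)).
have r0 Y : \prod_(k < N | k != j) re k (row k Y) != 0.
  by rewrite gt_eqF//; apply: prodr_gt0 => k _; exact: re_gt0.
have m1E Y : re j (row j Y) `^ (-1) = (re j (row j Y))^-1.
  by rewrite powRN powRr1// ltW// re_gt0.
have KE Y : K X Y = gk (Y - X) * (Lam Y * (re j (row j Y) `^ (-1) * rN Y)).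
  rewrite m1E /coupling_kernel /coupling_ratio /reP (bigD1 j)//= /rN; congr (_ * (_ * _)).
  by rewrite invfM.
apply: eq_ac_everywhere H3 => Y; first by rewrite KE.
rewrite KE /bias /logder m1E.
have -> : re j (row j Y) `^ (-1 - 1) = (re j (row j Y))^-1 * (re j (row j Y))^-1.
  by rewrite gt0_powRD ?re_gt0// m1E.
have -> : gaussian_partial eps j i (Y - X) = - (p * drift j i X Y) * gk (Y - X).
  by rewrite /gaussian_partial /score !mxE; field; rewrite pn0 en0.
have L0 : Lam Y != 0 by rewrite gt_eqF// Lam_gt0.
have R0 : re j (row j Y) != 0 by rewrite gt_eqF// re_gt0.
move: (Lambda_partial _ _ _ _ _) (Lambda_partial _ _ _ _ _) (Lam Y) (re j (row j Y)) (rN Y) (gk _) (score _ _ _ _ _ _) L0 R0.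
move=> a b c f g h dr c0 f0; field.
by rewrite pn0 c0 f0.
Qed.

Lemma integral_bias X (c : R) : (F X < +oo)%E ->
  leb.-integrable setT (EFin \o (fun Y => c * bias Y * K X Y)) ->
  leb.-integrable setT (EFin \o (fun Y => c * drift j i X Y * K X Y)) ->
  \int[leb]_Y (c * (bias Y - drift j i X Y) * K X Y) = 0.
Proof.
move=> Foo i1 i2.
have cI : ac_everywhere e (fun _ : T => c) (fun=> 0) by exact: ac_everywhere_invariant.
have H := ac_everywhereM cI (ac_K X).
have iK : leb.-integrable setT (EFin \o (fun Y => c * K X Y)).
  exact: (@integrableZl _ _ _ leb setT measurableT c _ (integrable_KY eps0 Foo)).
have iB := @integrableZl _ _ _ leb setT measurableT p _ (integrableB measurableT i1 i2).
have iD : leb.-integrable setT (EFin \o (fun Y => c * (p * (bias Y - drift j i X Y) * K X Y) + K X Y * 0)).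
  move: iB; congr (integrable _ _ _); apply/funext => Y.
  have E : p * (c * bias Y * K X Y - c * drift j i X Y * K X Y) = c * (p * (bias Y - drift j i X Y) * K X Y) + K X Y * 0.
    by ring.
  exact: (congr1 EFin E).
have Z := ac_lines_integral0 (ac_everywhere_lines H) iK iD.
have iS : leb.-integrable setT (EFin \o (fun Y => c * (bias Y - drift j i X Y) * K X Y)).
  move: (integrableB measurableT i1 i2); congr (integrable _ _ _); apply/funext => Y.
  have E : c * bias Y * K X Y - c * drift j i X Y * K X Y = c * (bias Y - drift j i X Y) * K X Y by ring.
  exact: (congr1 EFin E).
have Z2 := @RintegralZl _ _ _ leb setT _ p measurableT iS.
have Z3 : \int[leb]_Y (p * (c * (bias Y - drift j i X Y) * K X Y)) = 0.
  rewrite /Rintegral -[RHS](congr1 fine Z); congr fine; apply: eq_integral => Y _.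
  by congr EFin; ring.
by move: Z3; rewrite Z2 => /eqP; rewrite mulf_eq0 (negbTE pn0) => /eqP.
Qed.

Definition rowpart (x y : V) : R := Du j i x - u j x * qV j i y.
Definition slope2 (X Y : T) : R := u j (row j X) * qT j i Y + rowpart (row j X) (row j Y).

Lemma slope2E X Y : slope2 X Y = slope j i X Y + u j (row j X) * (bias Y - drift j i X Y).
Proof. by rewrite /slope2 /rowpart /plan_slope /bias; ring. Qed.

Lemma measurable_slope2X X : measurable_fun setT (slope2 X).
Proof.
apply: measurable_funD; first by apply: measurable_funM => //; exact: measurable_qL.
apply: measurable_funB => //; apply: measurable_funM => //.
by apply: measurable_row_comp; exact: measurable_qL.
Qed.

Definition weighted_energy (a : T -> T -> R) (X : T) : \bar R :=
  ((rhoN j X)%:E * \int[leb]_Y (`|a X Y| `^ p * K X Y)%:E)%E.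

Lemma wint_ge0 a X : (0 <= weighted_energy a X)%E.
Proof.
rewrite mule_ge0 ?lee_fin ?rhoN_ge0// integral_ge0// => Y _.
by rewrite lee_fin mulr_ge0 ?powR_ge0 ?K_ge0.
Qed.

Lemma measurable_wint a : measurable_fun setT (fun z : T * T => a z.1 z.2) ->
  measurable_fun setT (weighted_energy a).
Proof.
move=> ma; apply: emeasurable_funM; first by apply/measurable_EFinP; exact: measurable_rhoN.
apply: (@measurable_param_integral _ _ _ _ R leb (fun z => (`|a z.1 z.2| `^ p * K z.1 z.2)%:E)).
  apply/measurable_EFinP; apply: measurable_funM; last exact: measurable_K2.
  exact: measurable_abs_powR.
by move=> z; rewrite lee_fin mulr_ge0 ?powR_ge0 ?K_ge0.
Qed.

Lemma ae_wint_fin a : measurable_fun setT (fun z : T * T => a z.1 z.2) ->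
  (\int[leb]_X weighted_energy a X < +oo)%E -> {ae leb, forall X, (weighted_energy a X < +oo)%E}.
Proof.
move=> ma fin; have ii : leb.-integrable setT (weighted_energy a).
  apply/integrableP; split; first exact: measurable_wint.
  by under eq_integral do rewrite gee0_abs ?wint_ge0//.
have := @integrable_ae _ _ _ leb setT measurableT _ ii.
by apply: ae_imp => X /(_ I); rewrite ge0_fin_numE// wint_ge0.
Qed.

Lemma wint_integrable a X : measurable_fun setT (a X) -> (F X < +oo)%E ->
  uN p mu j X != 0 -> (weighted_energy a X < +oo)%E ->
  leb.-integrable setT (EFin \o (fun Y => a X Y * K X Y)).
Proof.
move=> ma Foo uN0 Woo; apply: (weighted_integrable p1') => //.
- exact: measurable_KY.
- by move=> Y; exact: K_ge0.
move: Woo; rewrite /weighted_energy -(uN_powR) ltey => /eqP H; rewrite ltey; apply/eqP => E; apply: H.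
by rewrite E gt0_muley// lte_fin powR_gt0// lt_neqAle eq_sym uN0 uN_ge0.
Qed.

Lemma wint_row (h : V -> V -> R) : measurable_fun setT (fun z : V * V => h z.1 z.2) ->
  (\int[leb]_X weighted_energy (fun X Y => h (row j X) (row j Y)) X =
   \int[lebV]_y \int[lebV]_x (`|h x y| `^ p * eta eps (y - x))%:E)%E.
Proof.
move=> mh.
have := @theta_row R eps p N d eps0 p1' mu muP j (fun z => (`|h z.1 z.2| `^ p)%:E).
have mh' : measurable_fun setT (fun z : V * V => (`|h z.1 z.2| `^ p)%:E).
  by apply/measurable_EFinP; exact: measurable_abs_powR.
move=> /(_ mh' (fun z => ltac:(by rewrite lee_fin powR_ge0))) H.
apply: (etrans _ (etrans H _)).
- by apply: eq_integral => X _; rewrite /weighted_energy; under eq_integral do rewrite EFinM.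
- by apply: eq_integral => y _; apply: eq_integral => x _; rewrite EFinM.
Qed.

Lemma wint_drift : (\int[leb]_X weighted_energy (fun X Y => (u j (row j X) * drift j i X Y)%R) X < +oo)%E.
Proof.
have mh : measurable_fun setT (fun z : V * V => u j z.1 * bV eps p i z.1 z.2).
  by apply: measurable_funM; [exact: (measurableT_comp (mu_ j) measurable_fst)|exact: measurable_bV].
have E := @wint_row (fun x y => u j x * bV eps p i x y) mh.
have dE : (fun X Y : T => u j (row j X) * drift j i X Y) =
    (fun X Y : T => u j (row j X) * bV eps p i (row j X) (row j Y)).
  by apply/funext => X; apply/funext => Y; rewrite /bV /score !mxE.
rewrite dE E; exact: le_lt_trans (ubV_moment eps0 p1' muP j i) (ltry _).
Qed.

Lemma measurable_uqV : measurable_fun setT (fun z : V * V => u j z.1 * qV j i z.2).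
Proof.
apply: measurable_funM; first exact: (measurableT_comp (mu_ j) measurable_fst).
exact: (measurableT_comp (@measurable_qL R eps p 1 d eps0 (marginal mu j) ord0 i) measurable_snd).
Qed.

Lemma wint_qV :
  (\int[leb]_X weighted_energy (fun X Y => (u j (row j X) * qV j i (row j Y))%R) X < +oo)%E.
Proof.
rewrite (@wint_row (fun x y => u j x * qV j i y) measurable_uqV).
apply: (@le_lt_trans _ _ (\int[lebV]_y (`|root_Lambda_partial eps p (marginal mu j : probability 'M[R]_(1, d) R) (ord0, i) y| `^ p)%:E)%E).
  rewrite le_eqVlt; apply/orP; left; apply/eqP; apply: eq_integral => y _.
  rewrite (aL_powR eps0 p1) EFinM (re_density eps0 p1' muP).
  have mF : measurable_fun setT (fun x : V => (rho p mu j x * eta eps (y - x))%:E).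
    apply/measurable_EFinP; apply: measurable_funM; [exact: measurable_rho|exact: measurable_etaB].
  have F0 (x : V) : setT x -> (0 <= (rho p mu j x * eta eps (y - x))%:E)%E.
    by move=> _; rewrite lee_fin mulr_ge0 ?rho_ge0// ltW// eta_gt0.
  have k0 : (0 <= (`|qV j i y| `^ p)%:E)%E by rewrite lee_fin powR_ge0.
  rewrite -(@ge0_integralZl _ _ _ lebV setT measurableT _ mF _ F0 k0).
  apply: eq_integral => x _; rewrite -EFinM; congr EFin.
  rewrite (normrM (u j x)) (ger0_norm (u0 j x)) (powRM _ (u0 j x) (normr_ge0 _)) -/(rho p mu j x).
  by move: (eta _ _) => E; ring.
exact: le_lt_trans (aL_fin eps0 p1 (muP j) (ord0, i)) (fDu j i).
Qed.

Lemma wint_qT :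
  (\int[leb]_X weighted_energy (fun X Y => (u j (row j X) * qT j i Y)%R) X =
   \int[leb]_Y (`|root_Lambda_partial eps p mu (j, i) Y| `^ p)%:E)%E.
Proof.
have mq : measurable_fun setT (fun Y => (`|qT j i Y| `^ p)%:E).
  by apply/measurable_EFinP; apply: measurable_abs_powR; exact: measurable_qL.
have H := theta_Y eps0 p1' muP mq (fun Y => ltac:(by rewrite lee_fin powR_ge0)).
apply: (etrans _ (etrans H _)); last first.
  by apply: eq_integral => Y _; rewrite (aL_powR eps0 p1) EFinM.
apply: eq_integral => X _; rewrite /weighted_energy (rhoPE p mu j) mulrC EFinM -muleA; congr (_ * _)%E.
have mF : measurable_fun setT (fun Y => (`|qT j i Y| `^ p)%:E * (K X Y)%:E)%E.
  by apply: emeasurable_funM => //; apply/measurable_EFinP; exact: measurable_KY.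
have F0 (Y : T) : setT Y -> (0 <= (`|qT j i Y| `^ p)%:E * (K X Y)%:E)%E.
  by move=> _; rewrite mule_ge0// lee_fin ?powR_ge0 ?K_ge0.
have k0 : (0 <= (rho p mu j (row j X))%:E)%E by rewrite lee_fin rho_ge0.
rewrite -(@ge0_integralZl _ _ _ leb setT measurableT _ mF _ F0 k0).
apply: eq_integral => Y _; rewrite -!EFinM; congr EFin.
by rewrite (normrM (u j _)) (ger0_norm (u0 j _)) (powRM _ (u0 j _) (normr_ge0 _)) mulrA.
Qed.

Lemma measurable_uqT2 : measurable_fun setT (fun z : T * T => u j (row j z.1) * qT j i z.2).
Proof.
apply: measurable_funM; first exact: (measurableT_comp (measurable_row_comp j (mu_ j)) measurable_fst).
exact: (measurableT_comp (@measurable_qL R eps p N d eps0 mu j i) measurable_snd).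
Qed.

Lemma gtheta_energy_le2 (l : R) : 0 < l < 1 ->
  (\int[leb]_X (`|Theta_root_partial eps p mu (j, i) X| `^ p)%:E <=
   (l `^ (1 - p))%:E * \int[leb]_Y (`|root_Lambda_partial eps p mu (j, i) Y| `^ p)%:E +
   ((1 - l) `^ (1 - p))%:E * smoothing_defect eps p (marginal mu j : probability 'M[R]_(1, d) R) ord0 i)%E.
Proof.
move=> l01.
have mr : measurable_fun setT (fun z : V * V => rowpart z.1 z.2).
  apply: measurable_funB; first exact: (measurableT_comp (mDu j i) measurable_fst).
  exact: measurable_uqV.
have mrow2 : measurable_fun setT (fun z : T * T => (row j z.1, row j z.2)).
  by apply: measurable_fun_pair; apply: (measurableT_comp (measurable_row j)).
have mrT := measurableT_comp mr mrow2.
have muqT := measurable_uqT2.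
have ms2 : measurable_fun setT (fun z : T * T => slope2 z.1 z.2) by exact: measurable_funD.
have muqV2 := measurableT_comp measurable_uqV mrow2.
have mud : measurable_fun setT (fun z : T * T => u j (row j z.1) * drift j i z.1 z.2).
  apply: measurable_funM; last exact: measurable_drift2.
  exact: (measurableT_comp (measurable_row_comp j (mu_ j)) measurable_fst).
have w1 := ae_wint_fin mud wint_drift.
have w2 := ae_wint_fin (a := fun X Y => u j (row j X) * qV j i (row j Y)) muqV2 wint_qV.
have w3 : {ae leb, forall X, (weighted_energy (fun X Y => (u j (row j X) * qT j i Y)%R) X < +oo)%E}.
  apply: (ae_wint_fin muqT); rewrite wint_qT.
  apply: le_lt_trans (aL_fin eps0 p1 muPP (j, i)) _.
  by have [_ _ _ H] := P1pP p1' muPP.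
have good := ae_good eps0 p1' muP j i.
apply: (@le_trans _ _ (\int[leb]_X weighted_energy slope2 X)%E).
  apply: ae_ge0_le_integral => //.
  - by apply/measurable_EFinP; apply: measurable_abs_powR; exact: measurable_gtheta.
  - by move=> X _; exact: wint_ge0.
  - exact: measurable_wint.
  apply: ae_imp (ae_and good (ae_and w1 (ae_and w2 w3))) => X [[H Voo] [W1 [W2 W3]]] _.
  apply: (gtheta_le eps0 p1' (measurable_slope2X X) H Voo) => gn0.
  have [Foo uN0] := gtheta_neq0 eps0 H Voo gn0.
  have mqT : measurable_fun setT (qT j i) by exact: measurable_qL.
  have mqV : measurable_fun setT (fun Y : T => qV j i (row j Y)).
    by apply: measurable_row_comp; exact: measurable_qL.
  have i1 := wint_integrable (a := fun X Y => u j (row j X) * drift j i X Y)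
    (measurable_funM (measurable_cst _) (measurable_drift eps p j i X)) Foo uN0 W1.
  have i2 := wint_integrable (a := fun X Y => u j (row j X) * qV j i (row j Y))
    (measurable_funM (measurable_cst _) mqV) Foo uN0 W2.
  have i3 := wint_integrable (a := fun X Y => u j (row j X) * qT j i Y)
    (measurable_funM (measurable_cst _) mqT) Foo uN0 W3.
  have i4 : leb.-integrable setT (EFin \o (fun Y => u j (row j X) * bias Y * K X Y)).
    move: (integrableB measurableT i3 i2); congr (integrable _ _ _); apply/funext => Y.
    have E : u j (row j X) * qT j i Y * K X Y - u j (row j X) * qV j i (row j Y) * K X Y =
      u j (row j X) * bias Y * K X Y by rewrite /bias; ring.
    exact: (congr1 EFin E).
  have Z := integral_bias Foo i4 i1.
  have i5 : leb.-integrable setT (EFin \o (fun Y => u j (row j X) * (bias Y - drift j i X Y) * K X Y)).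
    move: (integrableB measurableT i4 i1); congr (integrable _ _ _); apply/funext => Y.
    have E : u j (row j X) * bias Y * K X Y - u j (row j X) * drift j i X Y * K X Y =
      u j (row j X) * (bias Y - drift j i X Y) * K X Y by ring.
    exact: (congr1 EFin E).
  have i6 := integrable_slopeK eps0 p1' Foo Voo uN0.
  rewrite /slope_moment -[RHS]addr0 -[X in _ + X]Z -RintegralD//.
  by apply: eq_Rintegral => Y _; rewrite slope2E mulrDl.
have -> : smoothing_defect eps p (marginal mu j : probability 'M[R]_(1, d) R) ord0 i =
    (\int[leb]_X weighted_energy (fun X Y => rowpart (row j X) (row j Y)) X)%E.
  rewrite (wint_row mr); apply: eq_integral => y _; apply: eq_integral => x _.
  by rewrite gk1.
rewrite -wint_qT.
pose k (z : T * T) := rhoN j z.1 * K z.1 z.2.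
have mk : measurable_fun setT k.
  apply: measurable_funM; last exact: measurable_K2.
  exact: (measurableT_comp (measurable_rhoN p1' muP j) measurable_fst).
have k0 z : 0 <= k z by rewrite mulr_ge0 ?rhoN_ge0 ?K_ge0.
have wE (a : T -> T -> R) : measurable_fun setT (fun z : T * T => a z.1 z.2) ->
    (\int[leb]_X weighted_energy a X = \int[leb]_X \int[leb]_Y (`|a X Y| `^ p * k (X, Y))%:E)%E.
  move=> ma; apply: eq_integral => X _.
  have mX : measurable_fun setT (fun Y => (`|a X Y| `^ p * K X Y)%:E).
    apply/measurable_EFinP; apply: measurable_funM; last exact: measurable_KY.
    apply: measurable_abs_powR; have H : measurable_fun setT (fun Y : T => (X, Y)) by exact: measurable_fun_pair.
    exact: (measurableT_comp ma H).
  have a0 (Y : T) : setT Y -> (0 <= (`|a X Y| `^ p * K X Y)%:E)%E.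
    by move=> _; rewrite lee_fin mulr_ge0 ?powR_ge0 ?K_ge0.
  have r0 : (0 <= (rhoN j X)%:E)%E by rewrite lee_fin rhoN_ge0.
  rewrite /weighted_energy -(@ge0_integralZl _ _ _ leb setT measurableT _ mX _ a0 r0).
  by apply: eq_integral => Y _; rewrite -EFinM /k /= mulrCA.
rewrite (wE _ ms2) (wE _ muqT) (wE _ mrT).
exact: (@split_double_integral _ _ _ _ R leb leb p l (fun z => u j (row j z.1) * qT j i z.2)
  (fun z => rowpart (row j z.1) (row j z.2)) k p1' l01 muqT mrT mk k0).
Qed.

End fixed_direction.
End theta_ibp.

Lemma minkowski_optimize_ereal (R : realType) (p : R) (S : \bar R) (A B : R) : 1 <= p ->
  (0 <= S)%E -> 0 <= A -> 0 <= B ->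
  (forall l, 0 < l < 1 -> (S <= (l `^ (1 - p))%:E * A%:E + ((1 - l) `^ (1 - p))%:E * B%:E)%E) ->
  (S <= ((A `^ p^-1 + B `^ p^-1) `^ p)%:E)%E.
Proof.
move=> p1 S0 A0 B0 H.
have h : (0 < (2^-1 : R) < 1) by rewrite invr_gt0 ltr0n/= invf_lt1 ?ltr1n.
have Soo : (S < +oo)%E by apply: le_lt_trans (H _ h) _; exact: ltry.
case: S S0 Soo H {h} => [s| |]//; rewrite lee_fin => S0 _ H.
by rewrite lee_fin; apply: minkowski_optimize.
Qed.

Definition first_constant (R : realType) (d : nat) (p : R) : R :=
  p^-1 * (d%:R * moment_cst p * 2 `^ (2^-1)) `^ p^-1.

Definition second_constant (R : realType) (p : R) : R :=
  if p < 2 then (2 `^ (p - 1) / (1 - 2 `^ (1 - (p - 1)^-1)) `^ (p - 1)) `^ p^-1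
  else (2 `^ (p - 1)) `^ p^-1.

Section marginal_energy.
Variables (R : realType) (p : R) (d : nat).
Hypothesis p1 : 1 <= p.
Local Notation leb := (lebesgue_mx R 1 d).
Variable nu : probability 'rV[R]_d R.
Hypothesis nuP : P1p p nu.
Local Notation Du i := (weak_partial (ord0, i) (root_density p nu)).

Lemma energy_marginal : energy p nu = (\sum_(i < d) \int[leb]_x (`|Du i x| `^ p)%:E)%E.
Proof.
have [_ _ wp _] := P1pP p1 nuP.
rewrite (energyE p1 nuP (g := fun ij => weak_partial ij (root_density p nu))) ?big_ord1//.
- by move=> ij; apply: ae_all.
- by move=> ij; exact: measurable_weak_partial (wp ij).
Qed.

Lemma energy_marginal_fin : energy p nu \is a fin_num.
Proof.
have [_ _ _ fin] := P1pP p1 nuP.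
rewrite energy_marginal; apply/sum_fin_numP => i _ _.
by rewrite ge0_fin_numE ?fin// integral_ge0// => x _; rewrite lee_fin powR_ge0.
Qed.

Lemma energy_ge0 : (0 <= energy p nu)%E.
Proof.
rewrite energy_marginal sume_ge0// => i _; apply: integral_ge0 => x _.
by rewrite lee_fin powR_ge0.
Qed.

End marginal_energy.

Section smoothed_marginal_energy.
Variables (R : realType) (eps p : R) (d : nat).
Hypotheses (eps0 : 0 < eps) (p1 : 1 < p).
Local Notation leb := (lebesgue_mx R 1 d).
Variable nu : probability 'M[R]_(1, d) R.
Hypothesis nuP : P1p p nu.

Let p1' : 1 <= p. Proof. exact: ltW. Qed.

Lemma energy_smoothed : energy p (gauss_conv eps nu) =
  (\sum_(i < d) \int[leb]_x (`|root_Lambda_partial eps p nu (ord0, i) x| `^ p)%:E)%E.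
Proof.
rewrite gauss_convE; have [H H'] := P1p_Lambda eps0 p1 nuP.
rewrite (energyE p1' H H') ?big_ord1// => ij; exact: measurable_aL.
Qed.

Definition defect : \bar R := (\sum_(i < d) smoothing_defect eps p nu ord0 i)%E.

Lemma defect_ge0 : (0 <= defect)%E.
Proof.
apply: sume_ge0 => i _; apply: integral_ge0 => y _; apply: integral_ge0 => x _.
by rewrite lee_fin mulr_ge0 ?powR_ge0// gk_ge0.
Qed.

Lemma energy_smoothed_le (c : R) : 0 <= c ->
  (forall t m, `|m| `^ p + p * dpow p m * (t - m) + c * `|t - m| `^ p <= `|t| `^ p) ->
  (energy p (gauss_conv eps nu) + c%:E * defect <= energy p nu)%E.
Proof.
move=> c0 Hc; rewrite energy_smoothed (energy_marginal p1' nuP) /defect.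
rewrite ge0_sume_distrr; last first.
  move=> i _; apply: integral_ge0 => y _; apply: integral_ge0 => x _.
  by rewrite lee_fin mulr_ge0 ?powR_ge0// gk_ge0.
rewrite -big_split/=; apply: lee_sum => i _.
exact: smoothing_energy_le.
Qed.

Lemma defect_le : (defect <= (2 `^ (p - 1))%:E * (energy p nu + energy p (gauss_conv eps nu)))%E.
Proof.
rewrite energy_smoothed (energy_marginal p1' nuP) /defect -big_split/=.
rewrite ge0_sume_distrr; last first.
  by move=> i _; rewrite adde_ge0// integral_ge0// => x _; rewrite lee_fin powR_ge0.
by apply: lee_sum => i _; exact: DD_le.
Qed.

Lemma energy_smoothed_le0 : (energy p (gauss_conv eps nu) <= energy p nu)%E.
Proof.
have := @energy_smoothed_le 0 (lexx 0); rewrite mul0e adde0; apply.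
by move=> t m; rewrite mul0r addr0; exact: powR_tangent.
Qed.

Lemma energy_smoothed_ge0 : (0 <= energy p (gauss_conv eps nu))%E.
Proof.
rewrite energy_smoothed sume_ge0// => i _; apply: integral_ge0 => x _.
by rewrite lee_fin powR_ge0.
Qed.

End smoothed_marginal_energy.

Lemma conj_exponent_base_gt0 (R : realType) (p : R) : 1 < p -> p < 2 ->
  0 < 1 - 2 `^ (1 - (p - 1)^-1) :> R.
Proof.
move=> p1 p2; rewrite subr_gt0 /powR pnatr_eq0/= -[ltRHS]expR0 ltr_expR.
rewrite pmulr_llt0 ?ln_gt0 ?ltr1n// subr_lt0.
by rewrite invf_gt1 ?subr_gt0//; lra.
Qed.

Lemma cst2_ge0 (R : realType) (p : R) : 0 <= second_constant p.
Proof. by rewrite /second_constant; case: ifP => _; exact: powR_ge0. Qed.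

Lemma defect_le_Delta (R : realType) (eps p E Ee D : R) : 1 < p -> 0 <= D -> 0 <= Ee -> Ee <= E ->
  D <= 2 `^ (p - 1) * (E + Ee) -> (2 <= p -> 2 `^ (1 - p) * D <= E - Ee) ->
  D `^ p^-1 <= second_constant p * (if p < 2
    then ((E + Ee) `^ (p - 1)^-1 - 2 * Ee `^ (p - 1)^-1) `^ ((p - 1) / p)
    else (E - Ee) `^ p^-1).
Proof.
move=> p1 D0 Ee0 EeE Dle Dle2; have p0 : 0 < p by exact: lt_trans p1.
have pV0 : 0 <= p^-1 by rewrite invr_ge0 ltW.
rewrite /second_constant; case: ifPn => [p2|]; last first.
  rewrite -leNgt => p2; rewrite -powRM ?powR_ge0 ?subr_ge0//.
  apply: ge0_ler_powR => //; rewrite ?nnegrE//; first by rewrite mulr_ge0 ?powR_ge0 ?subr_ge0.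
  have := Dle2 p2; rewrite -(ler_pM2l (powR_gt0 (p - 1) (ltr0n R 2))) mulrA.
  by rewrite -gt0_powRD ?ltr0n// (_ : p - 1 + (1 - p) = 0) ?powRr0 ?mul1r//; ring.
have q0 : 0 < p - 1 by rewrite subr_gt0.
have s1 : 1 <= (p - 1)^-1 by rewrite invf_ge1//; lra.
have k0 := conj_exponent_base_gt0 p1 p2.
set k := 1 - _ in k0 *; set s := (p - 1)^-1.
have S0 : 0 <= E + Ee by rewrite addr_ge0// (le_trans Ee0).
have H := delta_lower s1 Ee0 EeE; rewrite -/k -/s in H.
have L0 : 0 <= k * (E + Ee) `^ s by rewrite mulr_ge0 ?powR_ge0 ?(ltW k0).
set X := _ - 2 * _ in H *.
have X0 : 0 <= X by exact: le_trans H.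
have -> : X `^ ((p - 1) / p) = (X `^ (p - 1)) `^ p^-1 by rewrite powRrM.
rewrite -powRM ?powR_ge0 ?divr_ge0 ?powR_ge0//.
apply: ge0_ler_powR => //; rewrite ?nnegrE//.
  by rewrite mulr_ge0 ?powR_ge0// divr_ge0 ?powR_ge0.
apply: (le_trans Dle); rewrite -mulrA ler_wpM2l ?powR_ge0//.
have kq0 : 0 < k `^ (p - 1) by exact: powR_gt0.
rewrite -(ler_pM2l kq0) mulrA divff ?gt_eqF// mul1r.
have -> : k `^ (p - 1) * (E + Ee) = (k * (E + Ee) `^ s) `^ (p - 1).
  by rewrite powRM ?powR_ge0 ?(ltW k0)// -powRrM /s mulVf ?gt_eqF// powRr1.
by apply: ge0_ler_powR => //; rewrite ?nnegrE// ltW.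
Qed.

Lemma kappa_root (R : realType) (d : nat) (p eps : R) : 0 < eps -> 1 <= p ->
  (d%:R * kappa eps p) `^ p^-1 = first_constant d p / Num.sqrt eps.
Proof.
move=> e0 p1; have p0 : 0 < p by exact: lt_le_trans p1.
have pn0 : p != 0 by rewrite gt_eqF.
have pe0 : 0 < p * eps by rewrite mulr_gt0.
set Q := d%:R * moment_cst p * 2 `^ 2^-1 : R.
have Q0 : 0 <= Q by rewrite !mulr_ge0 ?powR_ge0 ?moment_cst_ge0 ?ler0n.
have -> : d%:R * kappa eps p = Q * ((p * eps) `^ (- p) * eps `^ (p / 2)).
  by rewrite /kappa /Q; move: (moment_cst p) => M; ring.
rewrite powRM ?mulr_ge0 ?powR_ge0// powRM ?powR_ge0// -!powRrM /first_constant -/Q.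
have -> : - p * p^-1 = -1 by field.
have -> : p / 2 * p^-1 = 2^-1 by field.
rewrite powRN powRr1 ?(ltW pe0)// powR12_sqrt ?(ltW e0)//.
have s0 : Num.sqrt eps != 0 by rewrite gt_eqF// sqrtr_gt0.
have -> : p * eps = p * (Num.sqrt eps * Num.sqrt eps) by rewrite -expr2 sqr_sqrtr// ltW.
by field; rewrite s0 pn0.
Qed.

Section main.
Variables (R : realType) (eps p : R) (N d : nat).
Hypotheses (eps0 : 0 < eps) (p1 : 1 <= p).
Local Notation T := 'M[R]_(N, d).
Local Notation leb := (lebesgue_mx R N d).
Variable mu : probability T R.
Hypothesis muP : forall j, P1p p (marginal mu j).

Let p0 : 0 < p. Proof. exact: lt_le_trans p1. Qed.

Definition row_energy (j : 'I_N) : \bar R :=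
  (\sum_(i < d) \int[leb]_X (`|Theta_root_partial eps p mu (j, i) X| `^ p)%:E)%E.

Lemma row_energy_ge0 j : (0 <= row_energy j)%E.
Proof. by apply: sume_ge0 => i _; apply: integral_ge0 => X _; rewrite lee_fin powR_ge0. Qed.

Lemma row_energy_le1 j : (row_energy j <=
  (energy p (marginal mu j) `^ p^-1 + (first_constant d p / Num.sqrt eps)%:E) `^ p)%E.
Proof.
have fE := energy_marginal_fin p1 (muP j).
have PE (x : \bar R) c : x \is a fin_num ->
  ((x `^ p^-1 + c%:E) `^ p = ((fine x `^ p^-1 + c) `^ p)%:E)%E by case: x.
rewrite (PE _ _ fE) -(kappa_root d eps0 p1).
apply: minkowski_optimize_ereal => //.
- exact: row_energy_ge0.
- by apply: fine_ge0; exact: energy_ge0.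
- by rewrite mulr_ge0 ?ler0n// kappa_ge0.
move=> l l01; rewrite (fineK fE) (energy_marginal p1 (muP j)).
apply: (@le_trans _ _ (\sum_(i < d) ((l `^ (1 - p))%:E *
   \int[lebesgue_mx R 1 d]_x (`|weak_partial (ord0, i) (root_density p (marginal mu j)) x| `^ p)%:E +
   ((1 - l) `^ (1 - p) * kappa eps p)%:E))%E).
  apply: lee_sum => i _; apply: le_trans (VV_le eps0 p1 muP j i l01).
  exact: gtheta_energy_le.
rewrite big_split/= -ge0_sume_distrr; last first.
  by move=> i _; apply: integral_ge0 => x _; rewrite lee_fin powR_ge0.
rewrite leeD2l// sumEFin big_const_ord iter_addr_0 -EFinM lee_fin.
move: (kappa eps p) ((1 - l) `^ (1 - p)) => k a.
by rewrite le_eqVlt -mulr_natl; apply/orP; left; apply/eqP; ring.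
Qed.

Lemma first_estimate : (energy p (Theta eps mu) <=
   \sum_(j < N) (energy p (marginal mu j) `^ p^-1 + (first_constant d p / Num.sqrt eps)%:E) `^ p)%E.
Proof.
rewrite energy_Theta//; apply: lee_sum => j _; exact: row_energy_le1.
Qed.

Lemma second_estimate : P1p p mu -> 1 < p -> (energy p (Theta eps mu) <=
      \sum_(j < N) ('N[lebesgue_mx R N d]_(p%:E)
                      [EFin \o row_grad_norm p j (root_density p (Lambda eps mu))]
                    + (second_constant p)%:E * Delta eps p mu j) `^ p)%E.
Proof.
move=> muPP p1'.
rewrite energy_Theta//; apply: lee_sum => j _; rewrite -/(row_energy j).
pose A := (\sum_(i < d) \int[leb]_Y (`|root_Lambda_partial eps p mu (j, i) Y| `^ p)%:E)%E.
have A0 : (0 <= A)%E by apply: sume_ge0 => i _; apply: integral_ge0 => X _; rewrite lee_fin powR_ge0.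
have fA : A \is a fin_num.
  apply/sum_fin_numP => i _ _; rewrite ge0_fin_numE; last first.
    by apply: integral_ge0 => X _; rewrite lee_fin powR_ge0.
  apply: le_lt_trans (aL_fin eps0 p1' muPP (j, i)) _.
  by have [_ _ _ H] := P1pP p1 muPP.
have [LP Lae] := P1p_Lambda eps0 p1' muPP.
have [_ _ Lwp _] := P1pP p1 LP.
have NE : ('N[lebesgue_mx R N d]_(p%:E)[EFin \o row_grad_norm p j (root_density p (Lambda eps mu))] =
    A `^ p^-1)%E.
  rewrite unlock /Lnorm; congr (_ `^ _)%E.
  transitivity (\int[leb]_x (row_grad_norm p j (root_density p (Lambda eps mu)) x `^ p)%:E)%E.
    by apply: eq_integral => x _; rewrite /= ger0_norm// powR_ge0.
  rewrite (row_grad_norm_integral p1 j Lwp); apply: eq_bigr => i _.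
  apply: ae_eq_powR_integral.
  - exact: measurable_weak_partial (Lwp _).
  - exact: measurable_aL.
  - exact: Lae.
pose nu : probability 'M[R]_(1, d) R := marginal mu j.
have nuP : P1p p nu := muP j.
have fE := energy_marginal_fin p1 nuP.
have E0 := energy_ge0 p1 nuP.
have Ee0 := energy_smoothed_ge0 eps0 p1' nuP.
have EeE := energy_smoothed_le0 eps0 p1' nuP.
have fEe : energy p (gauss_conv eps nu) \is a fin_num.
  rewrite (ge0_fin_numE Ee0); apply: le_lt_trans EeE _; rewrite -(fineK fE); exact: ltry.
have D0 := @defect_ge0 R eps p d eps0 nu.
have Dle := defect_le eps0 p1' nuP.
have fD : defect eps p nu \is a fin_num.
  rewrite (ge0_fin_numE D0); apply: le_lt_trans Dle _.
  by rewrite -(fineK fE) -(fineK fEe) -EFinD -EFinM ltry.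
have Dle2 : 2 <= p -> (energy p (gauss_conv eps nu) + (2 `^ (1 - p))%:E * defect eps p nu <= energy p nu)%E.
  move=> p2; apply: (energy_smoothed_le eps0 p1' nuP); first exact: powR_ge0.
  by move=> t m; exact: powR_tangent_strong.
have S : (row_energy j <= ((fine A `^ p^-1 + fine (defect eps p nu) `^ p^-1) `^ p)%:E)%E.
  apply: (minkowski_optimize_ereal p1 (row_energy_ge0 j) (fine_ge0 A0) (fine_ge0 D0)).
  move=> l l01; rewrite (fineK fA) (fineK fD) /A /defect.
  rewrite ge0_sume_distrr; last by move=> i _; apply: integral_ge0 => X _; rewrite lee_fin powR_ge0.
  rewrite ge0_sume_distrr; last first.
    move=> i _; apply: integral_ge0 => y _; apply: integral_ge0 => x _.
    by rewrite lee_fin mulr_ge0 ?powR_ge0// gk_ge0.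
  rewrite -big_split/=; apply: lee_sum => i _; exact: gtheta_energy_le2.
apply: (le_trans S); rewrite NE /Delta -/nu.
move: fA fD fE fEe Dle Dle2 D0 Ee0 EeE E0 A0 {S NE}.
move: A (defect eps p nu) (energy p nu) (energy p (gauss_conv eps nu)).
move=> [a| |] [D| |] [E| |] [Ee| |]// _ _ _ _; rewrite !lee_fin => Dle Dle2 D0 Ee0 EeE E0 A0.
have H := @defect_le_Delta R eps p E Ee D p1' D0 Ee0 EeE Dle.
have {}H : D `^ p^-1 <= second_constant p * (if p < 2
    then ((E + Ee) `^ (p - 1)^-1 - 2 * Ee `^ (p - 1)^-1) `^ ((p - 1) / p)
    else (E - Ee) `^ p^-1).
  apply: H => p2; rewrite lerBrDl.
  exact: (Dle2 p2).
have -> : (if (p < 2)%R then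
     ((E%:E + Ee%:E) `^ (p - 1)^-1 - 2%:E * Ee%:E `^ (p - 1)^-1) `^ ((p - 1) / p)
   else (E%:E - Ee%:E) `^ p^-1)%E =
  (if p < 2 then ((E + Ee) `^ (p - 1)^-1 - 2 * Ee `^ (p - 1)^-1) `^ ((p - 1) / p)
    else (E - Ee) `^ p^-1)%:E.
  by case: (p < 2); rewrite -?EFinD -?EFinB ?poweR_EFin.
set X := (if _ then _ else _) in H *; clearbody X.
suff H2 : (a `^ p^-1 + D `^ p^-1) `^ p <= (a `^ p^-1 + second_constant p * X) `^ p by rewrite -lee_fin in H2.
apply: ge0_ler_powR; rewrite ?nnegrE ?(ltW p0)//.
- by rewrite addr_ge0 ?powR_ge0.
- by rewrite addr_ge0 ?powR_ge0//; apply: le_trans H; exact: powR_ge0.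
- by rewrite lerD2l.
Qed.

End main.

Theorem theorem6p4 (R : realType) :
  exists (c : nat -> R -> R) (cp : R -> R),
  forall (d N : nat) (p : R), (0 < d)%N -> (0 < N)%N -> (1 <= p)%R ->
  [/\ (0 <= c d p)%R, ((1 < p)%R -> (0 <= cp p)%R) &
  forall eps : R, (0 < eps)%R ->
  forall mu : probability 'M[R]_(N, d) R,
  (forall j : 'I_N, P1p p (marginal mu j)) ->
  (energy p (Theta eps mu) <=
     \sum_(j < N) (energy p (marginal mu j) `^ p^-1
                   + (c d p / Num.sqrt eps)%:E) `^ p)%E
  /\
  (P1p p mu -> (1 < p)%R ->
   (energy p (Theta eps mu) <=
      \sum_(j < N) ('N[lebesgue_mx R N d]_(p%:E)
                      [EFin \o row_grad_norm p j (root_density p (Lambda eps mu))]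
                    + (cp p)%:E * Delta eps p mu j) `^ p)%E)].
Proof.
exists (@first_constant R), (@second_constant R) => d N p _ _ p1; split.
- by rewrite mulr_ge0 ?powR_ge0// invr_ge0 (le_trans _ p1).
- by move=> _; exact: cst2_ge0.
move=> eps eps0 mu muP; split; first exact: first_estimate.
exact: second_estimate.
Qed.
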